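(* Consider, for each $N\in\mathbb{N}$, the $N$-server load-balancing network with the $SQ(2)$ routing algorithm described in the context, satisfying the arrival, service and initial-condition assumptions described there (including exchangeability of the initial conditions), and let $Z^0_\ell(r)=\lim_{N\to\infty}\overline Z^{(N)}_\ell(0,r)$, $\ell\ge1$, $r\ge0$. Let $(Z_\ell;\ell\ge1)$ be the unique solution to the hydrodynamic PDE associated to $(\lambda,Z^0_\ell;\ell\ge1)$. Then for every $\ell\ge1$ and $t\ge0$, $$\lim_{N\to\infty}\mathbb{P}(X^{(N),1}(t)\ge\ell)=Z_\ell(t,0),$$ and for every $t\ge0$, $K\ge1$ and $\ell_1,\dots,\ell_K\ge1$, $$\lim_{N\to\infty}\mathbb{P}(X^{(N),1}(t)\ge\ell_1,\dots,X^{(N),K}(t)\ge\ell_K)=\prod_{k=1}^K Z_{\ell_k}(t,0).$$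
   Context: Network: for each $N$, there are $N$ servers indexed $i=1,\dots,N$, each with its own infinite-capacity queue, serving jobs first-in-first-out and non-idling (a server is never idle while jobs wait in its queue). Jobs arrive according to a counting process $E^{(N)}$; job $j$ has service requirement $v_j$, the $v_j$ being i.i.d. with distribution function $G$ and independent of the arrival process; $\overline G=1-G$. Routing ($SQ(2)$): on arrival of a job, two servers are sampled independently and uniformly at random from $\{1,\dots,N\}$ and the job is routed to the one with the smaller queue length, ties broken uniformly at random. $X^{(N),i}(t)$ is the number of jobs at server $i$ at time $t$ (in service plus waiting), $X^{(N)}(t)=\sum_iX^{(N),i}(t)$ and $\overline X^{(N)}=X^{(N)}/N$. For a server with $X^{(N),i}(t)\ge1$, the age $a^{(N),i}(t)$ is the time the job currently in service there has spent in service. Define $Z^{(N)}_\ell(t,r)=\sum_{i:\,X^{(N),i}(t)\ge\ell}\overline G(a^{(N),i}(t)+r)/\overline G(a^{(N),i}(t))$ for $r\ge0$, and $\overline Z^{(N)}_\ell=Z^{(N)}_\ell/N$. Assumptions: (Arrivals) $E^{(N)}$ is a time-inhomogeneous Poisson process with rate $a^{(N)}\lambda(\cdot)$, where $\lambda\ge0$ satisfies $\int_0^T\lambda(t)dt<\infty$ for all $T<\infty$ and $a^{(N)}>0$ with $a^{(N)}/N\to1$. (Service) $G$ has mean $1$ and density $g$, and the hazard rate $h=g/(1-G)$ is bounded on $[0,\infty)$ by a constant $H$. (Initial condition) (a) almost surely, for every $\ell\ge1$ and every bounded continuous $f$ on $[0,\infty)$, the limit $\lim_{N\to\infty}\frac1N\sum_{i:\,X^{(N),i}(0)\ge\ell}f(a^{(N),i}(0))$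 exists, and $\limsup_N\mathbb{E}[\overline X^{(N)}(0)]<\infty$; (b) for every $N$ the vector $(X^{(N),i}(0),\mathbf{1}\{X^{(N),i}(0)>0\}a^{(N),i}(0);\,i=1,\dots,N)$ has a distribution invariant under permutations of the server indices. Hydrodynamic PDE: $\mathbb{C}^1_{\le1}[0,\infty)$ is the set of continuously differentiable $f$ on $[0,\infty)$ with bounded derivative and $|f|\le1$; $\mathbb{X}$ is the set of $\varphi$ on $[0,\infty)^2$ with $\varphi(t,\cdot)\in\mathbb{C}^1_{\le1}[0,\infty)$ for all $t$ and $t\mapsto\varphi(t,r)$ measurable for all $r$; $\partial_r$ is the derivative in the second variable. $(Z_\ell;\ell\ge1)\subset\mathbb{X}$ solves the hydrodynamic PDE associated to $(\lambda,Z^0_\ell;\ell\ge1)$ if for all $t,r\ge0$: $Z_1(t,r)=Z_1^0(t+r)-\int_0^t\overline G(t+r-u)\partial_rZ_2(u,0)du+\int_0^t\lambda(u)\overline G(t+r-u)(1-Z_1(u,0)^2)du$, $Z_1(t,0)=Z_1^0(0)+\int_0^t(\partial_rZ_1(u,0)-\partial_rZ_2(u,0))du+\int_0^t\lambda(u)(1-Z_1(u,0)^2)du$, and for $\ell\ge2$: $Z_\ell(t,r)=Z_\ell^0(t+r)-\int_0^t\overline G(t+r-u)\partial_rZ_{\ell+1}(u,0)du+\int_0^t\lambda(u)(Z_{\ell-1}(u,0)+Z_\ell(u,0))(Z_{\ell-1}(u,t+r-u)-Z_\ell(u,t+r-u))du$, $Z_\ell(t,0)=Z_\ell^0(0)+\int_0^t(\partial_rZ_\ell(u,0)-\partial_rZ_{\ell+1}(u,0))du+\int_0^t\lambda(u)(Z_{\ell-1}(u,0)^2-Z_\ell(u,0)^2)du$.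 *)

(* Defs.v *)
From HB Require Import structures.
From mathcomp Require Import all_boot all_order all_algebra.
From mathcomp Require Import all_classical all_reals all_analysis.
Set Implicit Arguments.
Unset Strict Implicit.
Unset Printing Implicit Defensive.
Import Order.TTheory GRing.Theory Num.Theory.
Import numFieldNormedType.Exports.
Local Open Scope classical_set_scope.
Local Open Scope ring_scope.

Section Analytic.
Variable R : realType.

Definition intR (D : set R) (f : R -> R) : R :=
  Rintegral (@lebesgue_measure R) D f.

Definition integrable0 (t : R) (f : R -> R) : Prop :=
  (@lebesgue_measure R).-integrable `[0, t] (fun u => (f u)%:E).

(* Derivative of f at r as a function on [0,oo): at r = 0 this is the
   right derivative. *)
Definition dr_dom (r : R) : set R := fun h => h != 0 /\ 0 <= r + h.
Definition dr (f : R -> R) (r : R) : R :=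
  lim ((fun h => h^-1 * (f (r + h) - f r)) @ within (dr_dom r) (nbhs (0:R))).

Definition C1le1 (f : R -> R) : Prop :=
  [/\ (forall r, 0 <= r -> `|f r| <= 1),
      (forall r, 0 <= r ->
         (fun h => h^-1 * (f (r + h) - f r)) @ within (dr_dom r) (nbhs (0:R))
           --> dr f r),
      {within `[0, +oo[, continuous (dr f)} &
      (exists M, forall r, 0 <= r -> `|dr f r| <= M)].

Definition inX (phi : R -> R -> R) : Prop :=
  (forall t, 0 <= t -> C1le1 (phi t)) /\
  (forall r, 0 <= r -> measurable_fun (`[0%R, +oo[ : set R) (fun t => phi t r)).

(* The hydrodynamic PDE associated to (lam, Z0_l; l >= 1), with complementary
   distribution function Gb = 1 - G.  Z l t r stands for Z_l(t,r); index l >= 1.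
   The integrals are required to exist (integrability on [0,t]). *)
Definition hydro_sol (lam Gb : R -> R) (Z0 : nat -> R -> R)
    (Z : nat -> R -> R -> R) : Prop :=
  [/\ forall l, (1 <= l)%N -> inX (Z l),
      (forall t r, 0 <= t -> 0 <= r ->
        [/\ integrable0 t (fun u => Gb (t + r - u) * dr (Z 2%N u) 0),
            integrable0 t (fun u => lam u * Gb (t + r - u) * (1 - Z 1%N u 0 ^+ 2)) &
        Z 1%N t r = Z0 1%N (t + r)
          - intR `[0, t] (fun u => Gb (t + r - u) * dr (Z 2%N u) 0)
          + intR `[0, t] (fun u => lam u * Gb (t + r - u) * (1 - Z 1%N u 0 ^+ 2))]),
      (forall t, 0 <= t ->
        [/\ integrable0 t (fun u => dr (Z 1%N u) 0 - dr (Z 2%N u) 0),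
            integrable0 t (fun u => lam u * (1 - Z 1%N u 0 ^+ 2)) &
        Z 1%N t 0 = Z0 1%N 0
          + intR `[0, t] (fun u => dr (Z 1%N u) 0 - dr (Z 2%N u) 0)
          + intR `[0, t] (fun u => lam u * (1 - Z 1%N u 0 ^+ 2))]),
      (forall l t r, (2 <= l)%N -> 0 <= t -> 0 <= r ->
        [/\ integrable0 t (fun u => Gb (t + r - u) * dr (Z l.+1 u) 0),
            integrable0 t (fun u => lam u * (Z l.-1 u 0 + Z l u 0)
                                  * (Z l.-1 u (t + r - u) - Z l u (t + r - u))) &
        Z l t r = Z0 l (t + r)
          - intR `[0, t] (fun u => Gb (t + r - u) * dr (Z l.+1 u) 0)
          + intR `[0, t] (fun u => lam u * (Z l.-1 u 0 + Z l u 0)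
                                  * (Z l.-1 u (t + r - u) - Z l u (t + r - u)))]) &
      (forall l t, (2 <= l)%N -> 0 <= t ->
        [/\ integrable0 t (fun u => dr (Z l u) 0 - dr (Z l.+1 u) 0),
            integrable0 t (fun u => lam u * (Z l.-1 u 0 ^+ 2 - Z l u 0 ^+ 2)) &
        Z l t 0 = Z0 l 0
          + intR `[0, t] (fun u => dr (Z l u) 0 - dr (Z l.+1 u) 0)
          + intR `[0, t] (fun u => lam u * (Z l.-1 u 0 ^+ 2 - Z l u 0 ^+ 2))])].

Definition service_assumption (G g : R -> R) (H : R) : Prop :=
  (forall x, 0 <= g x) /\ measurable_fun [set: R] g /\
  (forall x, (G x)%:E = (\int[@lebesgue_measure R]_(y in `]-oo, x]) (g y)%:E)%E) /\
  G 0 = 0 /\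
  (\int[@lebesgue_measure R]_(y in [set: R]) (g y)%:E = 1)%E /\
  (\int[@lebesgue_measure R]_(y in `[0%R, +oo[) (y * g y)%:E = 1)%E /\
  (forall x, 0 <= x -> G x < 1 /\ g x / (1 - G x) <= H).

Definition arrival_assumption (lam : R -> R) (aN : nat -> R) : Prop :=
  [/\ (forall t, 0 <= t -> 0 <= lam t),
      (forall T, 0 <= T -> integrable0 T lam),
      (forall N, 0 < aN N) &
      (fun N => aN N / N%:R) @ \oo --> (1 : R)].

Definition poisson_pmf (m : R) (n : nat) : R := expR (- m) * m ^+ n / (n`!)%:R.

End Analytic.

(* Pathwise dynamics of the N-server network (servers indexed 0..N-1, server *)
(* k+1 of the paper is index k).  The state of a server is the FIFO list of  *)
(* total service requirements of the jobs present, head = job in service,    *)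
(* together with the elapsed service time (age) of the head job.             *)
Section Dynamics.
Variable R : realType.

(* Let a non-idling FIFO server work for dt time units. *)
Fixpoint adv (dt : R) (q : seq R) (e : R) : seq R * R :=
  match q with
  | [::] => ([::], 0)
  | h :: q' => if dt < h - e then (q, e + dt) else adv (dt - (h - e)) q' 0
  end.

Definition sstate := nat -> seq R * R.

Definition adv_all (dt : R) (s : sstate) : sstate := fun i => adv dt (s i).1 (s i).2.

Definition sq2_pick (s : sstate) (c1 c2 : nat) (b : bool) : nat :=
  let n1 := size (s c1).1 in let n2 := size (s c2).1 in
  if (n1 < n2)%N then c1 else if (n2 < n1)%N then c2 else if b then c1 else c2.

Definition add_job (s : sstate) (k : nat) (x : R) : sstate :=
  fun i => if i == k then (rcons (s i).1 x, (s i).2) else s i.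

(* Initial state: x0 i jobs at server i; the job in service has age a0 i and
   residual service requirement res i; the k-th waiting job has requirement w i k. *)
Definition init_state (x0 : nat -> nat) (a0 res : nat -> R) (w : nat -> nat -> R)
  : sstate := fun i =>
  if x0 i is 0 then ([::], 0)
  else ((a0 i + res i) :: mkseq (w i) (x0 i).-1, a0 i).

Definition arr_time (Ec : R -> nat) (j : nat) : R :=
  inf [set s | 0 <= s /\ (j < Ec s)%N].

Section Run.
Variables (s0 : sstate) (Ec : R -> nat) (v : nat -> R) (c1 c2 : nat -> nat)
  (b : nat -> bool).

Fixpoint after (n : nat) : sstate * R :=
  match n with
  | 0 => (s0, 0)
  | n'.+1 =>
    let: (s, tl) := after n' in
    let s' := adv_all (arr_time Ec n' - tl) s in
    (add_job s' (sq2_pick s' (c1 n') (c2 n') (b n')) (v n'), arr_time Ec n')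
  end.

Definition state_at (t : R) : sstate :=
  let: (s, tl) := after (Ec t) in adv_all (t - tl) s.

End Run.

Definition qlen (s0 : sstate) (Ec : R -> nat) (v : nat -> R) (c1 c2 : nat -> nat)
  (b : nat -> bool) (i : nat) (t : R) : nat :=
  size (state_at s0 Ec v c1 c2 b t i).1.

End Dynamics.

(* Primitives, for each N (on a common probability space):                   *)
(*  X0 N i, A0 N i : initial queue length and age at server i                *)
(*  Res N i        : residual service requirement of the initial job in      *)
(*                   service at server i                                     *)
(*  W N i k        : service requirement of the k-th initially waiting job   *)
(*  E N t          : arrival counting process                                *)
(*  V N j          : service requirement of the j-th arriving job            *)
(*  C1 N j, C2 N j : the two sampled servers for the j-th arrival           *)
(*  Bt N j         : the fair coin breaking ties for the j-th arrival        *)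
Section Model.
Variables (R : realType) (d : measure_display) (T : measurableType d)
  (P : probability T R).
Variables (X0 : nat -> nat -> T -> nat) (A0 Res : nat -> nat -> T -> R)
  (W : nat -> nat -> nat -> T -> R) (E : nat -> R -> T -> nat)
  (V : nat -> nat -> T -> R) (C1 C2 : nat -> nat -> T -> nat)
  (Bt : nat -> nat -> T -> bool).

Definition Xq (N i : nat) (t : R) (w : T) : nat :=
  qlen (init_state (X0 N ^~ w) (A0 N ^~ w) (Res N ^~ w) (fun i k => W N i k w))
       (E N ^~ w) (V N ^~ w) (C1 N ^~ w) (C2 N ^~ w) (Bt N ^~ w) i t.

Definition Zbar0 (G : R -> R) (N l : nat) (r : R) (w : T) : R :=
  N%:R^-1 * \sum_(i < N | (l <= X0 N i w)%N)
     ((1 - G (A0 N i w + r)) / (1 - G (A0 N i w))).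

Inductive prim := PInit | PArr | PW of nat & nat | PV of nat
  | PC1 of nat | PC2 of nat | PB of nat.

Definition init_cyl (N : nat) (S : nat -> set nat) (B : nat -> set R)
  (J : nat -> bool) (r : nat -> R) : set T :=
  [set w | forall i, (i < N)%N ->
     [/\ S i (X0 N i w), B i (A0 N i w) & (J i -> (0 < X0 N i w)%N -> r i < Res N i w)]].

(* pi-systems generating the sigma-algebras of the primitive random elements *)
Definition prim_events (N : nat) (p : prim) : set (set T) :=
  match p with
  | PInit => [set A | exists S B J r, (forall i, measurable (B i)) /\ A = init_cyl N S B J r]
  | PArr => [set A | exists (k : nat) (t : nat -> R) (S : nat -> set nat),
               A = [set w | forall i, (i < k)%N -> S i (E N (t i) w)]]
  | PW i k => [set A | exists B, measurable B /\ A = W N i k @^-1` B]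
  | PV j => [set A | exists B, measurable B /\ A = V N j @^-1` B]
  | PC1 j => [set A | exists S, A = C1 N j @^-1` S]
  | PC2 j => [set A | exists S, A = C2 N j @^-1` S]
  | PB j => [set A | exists S, A = Bt N j @^-1` S]
  end.

Definition prims_independent (N : nat) : Prop :=
  forall (n : nat) (idx : nat -> prim) (A : nat -> set T),
    (forall k k', (k < n)%N -> (k' < n)%N -> idx k = idx k' -> k = k') ->
    (forall k, (k < n)%N -> prim_events N (idx k) (A k)) ->
    P (\bigcap_(k in `I_n) A k) = (\prod_(k < n) P (A k))%E.

Definition prims_measurable (N : nat) : Prop :=
  (forall i m, measurable [set w | X0 N i w = m]) /\
  (forall i, measurable_fun [set: T] (A0 N i)) /\
  (forall i, measurable_fun [set: T] (Res N i)) /\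
  (forall i k, measurable_fun [set: T] (W N i k)) /\
  (forall t m, measurable [set w | E N t w = m]) /\
  (forall j, measurable_fun [set: T] (V N j)) /\
  (forall j m, measurable [set w | C1 N j w = m] /\ measurable [set w | C2 N j w = m]) /\
  (forall j, measurable [set w | Bt N j w]).

Definition counting_paths (N : nat) : Prop :=
  forall w, [/\ E N 0 w = 0%N,
    (forall s t, 0 <= s -> s <= t -> (E N s w <= E N t w)%N) &
    (forall t, 0 <= t -> exists2 del, 0 < del &
        forall s, t <= s -> s < t + del -> E N s w = E N t w)].

Definition poisson_law (lam : R -> R) (aN : nat -> R) (N : nat) : Prop :=
  forall (k : nat) (t : nat -> R) (n : nat -> nat),
    t 0%N = 0 -> (forall i, t i <= t i.+1) ->
    P [set w | forall i, (i < k)%N -> (E N (t i.+1) w - E N (t i) w)%N = n i]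
    = (\prod_(i < k) (poisson_pmf (aN N * intR `[t i, t i.+1] lam) (n i))%:E)%E.

Definition prim_laws (G : R -> R) (N : nat) : Prop :=
  [/\ (forall i k x, P [set w | W N i k w <= x] = (G x)%:E),
      (forall j x, P [set w | V N j w <= x] = (G x)%:E),
      (forall j i, (i < N)%N -> P [set w | C1 N j w = i] = (N%:R^-1)%:E
                           /\ P [set w | C2 N j w = i] = (N%:R^-1)%:E) &
      (forall j, P [set w | Bt N j w] = (2^-1)%:E)].

(* Conditionally on the initial configuration, the residual service times of
   the jobs in service are independent with
   P(res_i > r | age_i = a) = (1 - G(a + r)) / (1 - G(a)). *)
Definition residual_law (G : R -> R) (N : nat) : Prop :=
  forall S B J r, (forall i, measurable (B i)) -> (forall i, 0 <= r i) ->
    P (init_cyl N S B J r) =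
    (\int[P]_w ((\1_(init_cyl N S B (fun=> false) r) w : R) *
       \prod_(i < N | J i && (0 < X0 N i w)%N)
          ((1 - G (A0 N i w + r i)) / (1 - G (A0 N i w))))%:E)%E.

Definition init_exchangeable (N : nat) : Prop :=
  forall (s : nat -> nat), (forall i, (i < N)%N -> (s i < N)%N) ->
    (forall i j, (i < N)%N -> (j < N)%N -> s i = s j -> i = j) ->
    forall (S : nat -> set nat) (B : nat -> set R), (forall i, measurable (B i)) ->
    P [set w | forall i, (i < N)%N -> S i (X0 N (s i) w) /\
               B i (if (0 < X0 N (s i) w)%N then A0 N (s i) w else 0)]
    = P [set w | forall i, (i < N)%N -> S i (X0 N i w) /\
               B i (if (0 < X0 N i w)%N then A0 N i w else 0)].

Definition init_assumption_a : Prop :=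
  {ae P, forall w, forall l, (1 <= l)%N -> forall f : R -> R,
      (exists M, forall x, 0 <= x -> `|f x| <= M) ->
      {within `[0, +oo[, continuous f} ->
      cvgn (fun N => N%:R^-1 * \sum_(i < N | (l <= X0 N i w)%N) f (A0 N i w))}
  /\ (limn_esup (fun N => \int[P]_w (N%:R^-1 * \sum_(i < N) (X0 N i w)%:R)%:E)
       < +oo)%E.

Definition sq2_network (G lam : R -> R) (aN : nat -> R) (N : nat) : Prop :=
  prims_measurable N /\ counting_paths N /\ prims_independent N /\
  poisson_law lam aN N /\ prim_laws G N /\ residual_law G N /\
  init_exchangeable N.

End Model.

(* Main.v *)
(* Write x = s + r for the time up to which the job in service at time s has to
   last. A pathwise identity expresses the empirical version of Z_l(s, x - s)
   through the initial data, the starts of waiting jobs and the arrivals. Its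
   noise, coming from the services and from the routing, is a sum of terms that
   are uncorrelated, since resampling the service of a job does not affect what
   happens before its start; so it is of order 1/sqrt N. In the same coordinates
   the boundary derivatives of the hydrodynamic PDE enter only through their
   time integrals, which correspond to the scaled numbers of starts, and the mean
   errors of both quantities satisfy linear inequalities that contract in the
   weight 2^l e^(kappa s) (1 + c/N)^k after k jobs. So the fraction of queues of
   length at least l converges in mean to Z_l(t, 0). Relabelling the servers does
   not change the law of the primitives; hence, up to O(K^2/N), the probability
   for K given servers is the mean of a product of K such fractions. *)
Require Import Defs.
From HB Require Import structures.
From mathcomp Require Import all_boot all_order all_algebra.
From mathcomp Require Import all_classical all_reals all_analysis.
From mathcomp Require Import measurable_realfun ring lra zify.
Set Implicit Arguments.
Unset Strict Implicit.
Unset Printing Implicit Defensive.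
Import Order.TTheory GRing.Theory Num.Theory.
Import numFieldNormedType.Exports.
Local Open Scope classical_set_scope.
Local Open Scope ring_scope.

(** * Pathwise identities *)

(** The boundary slopes of the PDE are not controlled by the sup norm of its solution, so they
    cannot be compared directly with departure rates of the network. Integrated by parts they act
    through their primitives against the kernel [g], and the hazard bound gives [g <= H]; this is
    what produces Gronwall-type terms. The hierarchy is not closed: the number of starts at one
    level is governed by that at the next level. It is not truncated. A crude bound growing like
    2^l, for the network and for the limit alike, starts an iteration that halves the error
    constant, and the price of a factor 2 per level is paid by taking kappa and c large. The initial
    configuration and the arrival times are frozen during this estimate, and are only required to
    satisfy finitely many deterministic approximations, which hold with high probability; services,
    sampled servers and coins are averaged. No filtration is used: one primitive is replaced by an
    independent copy and Fubini is applied. As the order of starts is itself random, a pair of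
    service terms is split according to which of the two jobs starts first. *)

Section System.
Variable R : realType.

(* Jobs are numbered in order of arrival; the initially waiting jobs are the
   jobs [k < on0], which arrive at time 0 at the prescribed server [ofs k].
   The initial jobs in service are described by [ohb] (server busy) and [ohr]
   (residual service time). *)
Record outer := Outer {
  oN : nat; on0 : nat; ofs : nat -> nat; ohb : nat -> bool; ohr : nat -> R;
  ot : nat -> R }.

Record inner := Inner {
  iy : nat -> R; ic1 : nat -> nat; ic2 : nat -> nat; ib : nat -> bool }.

Record wf_outer (o : outer) : Prop := WfOuter {
  wf_N : (0 < oN o)%N;
  wf_fs : forall k, (k < on0 o)%N -> (ofs o k < oN o)%N /\ ohb o (ofs o k);
  wf_t0 : forall k, (k < on0 o)%N -> ot o k = 0;
  wf_tge0 : forall k, 0 <= ot o k;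
  wf_tle : forall j k, (j <= k)%N -> ot o j <= ot o k;
  wf_hr : forall i, ohb o i -> 0 < ohr o i }.

Record wf_inner (o : outer) (w : inner) : Prop := WfInner {
  wf_y : forall k, 0 < iy w k;
  wf_c1 : forall k, (ic1 w k < oN o)%N;
  wf_c2 : forall k, (ic2 w k < oN o)%N }.

Definition pick2 (q : nat -> nat) (c1 c2 : nat) (b : bool) : nat :=
  if (q c1 < q c2)%N then c1 else if (q c2 < q c1)%N then c2
  else if b then c1 else c2.

Section Recursion.
Variables (o : outer) (w : inner).

(** A listed job counts at every time before its completion, even before its arrival, so this is a
    queue length only for [s] not before the listed arrivals. Under FIFO, later jobs do not change
    the completion times in the list. *)
Definition hq (h : seq (nat * R)) (i : nat) (s : R) : nat :=
  ((ohb o i && (s < ohr o i)%R) + count (fun p => (p.1 == i) && (s < p.2)%R) h)%N.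

(** The value 0 for a server without any job is harmless, since all times considered are
    nonnegative. *)
Definition hl (h : seq (nat * R)) (i : nat) : R :=
  foldl (fun a p => if p.1 == i then p.2 else a)
    (if ohb o i then ohr o i else 0) h.

Definition hsv (h : seq (nat * R)) (k : nat) : nat :=
  if (k < on0 o)%N then ofs o k
  else pick2 (fun i => hq h i (ot o k)) (ic1 w k) (ic2 w k) (ib w k).

(* [hist k] lists the servers and completion times of the first [k] jobs. In
   the system with these jobs only, [Q k i s] is the length of queue [i] at time
   [s], and [L k i] the time at which server [i] becomes idle for good. Job [k] is
   routed to server [sv k], is taken up at time [st k] and completed at [dp k]. *)
Fixpoint hist (k : nat) : seq (nat * R) :=
  if k is k'.+1 then
    let h := hist k' in
    let i := hsv h k' in
    rcons h (i, Num.max (ot o k') (hl h i) + iy w k')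
  else [::].

Definition Q k i (s : R) : nat := hq (hist k) i s.
Definition L k i : R := hl (hist k) i.
Definition sv k := hsv (hist k) k.
Definition st k : R := Num.max (ot o k) (L k (sv k)).
Definition dp k : R := st k + iy w k.

Lemma svE k : sv k = if (k < on0 o)%N then ofs o k
  else pick2 (fun i => Q k i (ot o k)) (ic1 w k) (ic2 w k) (ib w k).
Proof. by []. Qed.

Lemma Q0 i s : Q 0 i s = (ohb o i && (s < ohr o i)%R) :> nat.
Proof. by rewrite /Q /hq /= addn0. Qed.

Lemma QS k i s : Q k.+1 i s = (Q k i s + ((sv k == i) && (s < dp k)%R))%N.
Proof. by rewrite /Q /hq /= -cats1 count_cat /= addn0 addnA. Qed.

Lemma L0 i : L 0 i = if ohb o i then ohr o i else 0.
Proof. by []. Qed.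

Lemma LS k i : L k.+1 i = if sv k == i then dp k else L k i.
Proof. by rewrite /L /hl /= -cats1 foldl_cat. Qed.

Definition wait k := ot o k < L k (sv k).

(* Once job [kk] starts service, [rk k kk] is the length of its queue, provided
   the arrivals up to its start are among the first [k]. [Jf k s l] selects the
   jobs that waited, started by time [s] and then had a queue of length at least
   [l]; they correspond to the departures from queues longer than [l]. [zi]: queue
   [i] has length at least [l] at time [s] and no departure in (s, x]. [arr]: the
   arrival [j] makes a queue of length [l] without departure up to time [x]. *)
Definition rk k kk : nat :=
  (\sum_(kk <= j < k) ((sv j == sv kk) && (ot o j < st kk)%R))%N.

Definition Jf k (s : R) l kk : bool := [&& wait kk, st kk <= s & (l <= rk k kk)%N].

Definition zi k (s x : R) l i : bool := (l <= Q k i s)%N && (Q k i x == Q k i s).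

Definition arr l (x : R) j : bool :=
  if (l == 1)%N then (Q j (sv j) (ot o j) == 0)%N && (x < dp j)
  else (Q j (sv j) (ot o j) == l.-1) && (Q j (sv j) x == Q j (sv j) (ot o j)).

(** Both inequalities are weak, so that at the arrival time of job [k] the index [k], the state seen
    by the arrival, is admissible as well as [k.+1]. *)
Definition valid k (s : R) : Prop :=
  (forall j, (j < k)%N -> ot o j <= s) /\ (forall j, (k <= j)%N -> s <= ot o j).

Hypotheses (wo : wf_outer o) (wi : wf_inner o w).

Lemma sv_lt k : (sv k < oN o)%N.
Proof.
rewrite svE; case: ifP => [/(wf_fs wo)[]//|_].
by rewrite /pick2; do 3?case: ifP => _; rewrite ?(wf_c1 wi) ?(wf_c2 wi).
Qed.

Lemma st_ge k : ot o k <= st k.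
Proof. by rewrite /st le_max lexx. Qed.

Lemma st_geL k : L k (sv k) <= st k.
Proof. by rewrite /st le_max lexx orbT. Qed.

Lemma st_ge0 k : 0 <= st k.
Proof. exact: le_trans (wf_tge0 wo k) (st_ge k). Qed.

Lemma st_dp k : st k < dp k.
Proof. by rewrite /dp ltrDl (wf_y wi). Qed.

Lemma t_dp k : ot o k < dp k.
Proof. exact: le_lt_trans (st_ge k) (st_dp k). Qed.

Lemma L_dp k : L k (sv k) < dp k.
Proof. exact: le_lt_trans (st_geL k) (st_dp k). Qed.

Lemma waitE k : wait k -> st k = L k (sv k).
Proof. by rewrite /wait /st => h; apply/max_idPr/ltW. Qed.

Lemma wait_st k : wait k = (ot o k < st k).
Proof. by rewrite /wait /st lt_max ltxx. Qed.

Lemma Q_mono k i (s x : R) : s <= x -> (Q k i x <= Q k i s)%N.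
Proof.
move=> sx; elim: k => [|k IH]; rewrite ?Q0 ?QS.
  by case: (ohb o i) => //=; case: (ltP x) => // xh; rewrite (le_lt_trans sx xh).
apply: leq_add => //; case: (sv k == i) => //=.
by case: (ltP x) => // xh; rewrite (le_lt_trans sx xh).
Qed.

(* The completion times at a server increase, so [L] is the largest. *)
Lemma Q_gt0 k i (x : R) : 0 <= x -> (0 < Q k i x)%N = (x < L k i).
Proof.
move=> x0; elim: k => [|k IH]; rewrite ?Q0 ?L0 ?QS ?LS.
  by case: (ohb o i) => /=; [case: ltP|rewrite ltNge x0].
case: eqP => [e|_] /=; last by rewrite addn0.
rewrite addn_gt0 IH -e; case: (ltP x (dp k)) => //= [|h]; first by rewrite orbT.
by rewrite orbF; apply/negbTE; rewrite -leNgt (le_trans _ h) // ltW ?L_dp.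
Qed.

Lemma Q_eq0 k i (x : R) : 0 <= x -> (Q k i x == 0)%N = (L k i <= x).
Proof. by move=> x0; rewrite -leqn0 leqNgt Q_gt0 // leNgt. Qed.

Lemma dp_le_L k kk i : (kk < k)%N -> sv kk = i -> dp kk <= L k i.
Proof.
move=> + e; elim: k => // k IH; rewrite ltnS leq_eqVlt LS => /orP[/eqP <-|h].
  by rewrite e eqxx.
case: eqP => [e'|_]; last exact: IH.
by apply: le_trans (IH h) _; rewrite -e' ltW ?L_dp.
Qed.

(** At its start a job finds itself and the jobs behind it. If the first [k] jobs have all arrived
    before the start of [kk], this number is the length of its queue at that moment, and it agrees
    with [rk]. *)
Definition rb k kk : nat := (\sum_(kk <= j < k) (sv j == sv kk))%N.

Lemma rbS k kk : (kk < k)%N -> sv kk = sv k -> rb k.+1 kk = (rb k kk).+1.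
Proof. by move=> h e; rewrite /rb big_nat_recr 1?ltnW //= e eqxx addn1. Qed.

Lemma rbN k kk : (kk < k)%N -> sv kk != sv k -> rb k.+1 kk = rb k kk.
Proof.
move=> h e; rewrite /rb big_nat_recr 1?ltnW //=.
by rewrite eq_sym (negbTE e) addn0.
Qed.

Lemma rb_gt0 k kk : (kk < k)%N -> (0 < rb k kk)%N.
Proof. by move=> h; rewrite /rb big_ltn // eqxx. Qed.

Lemma rbSk k : rb k.+1 k = 1%N.
Proof. by rewrite /rb big_nat1 eqxx. Qed.

Section OneServer.
Variables (s s' x : R) (i : nat).
Hypotheses (s0 : 0 <= s) (ss' : s <= s') (s'x : s' <= x).

Definition inn k l kk : bool :=
  [&& s < st kk, st kk <= s', (l < rb k kk)%N & x < dp kk].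
Definition innf k l kk : bool := [&& s < st kk, st kk <= s' & l == rb k kk].

(** Without arrivals in between, either nothing departs in [(s, x]], or the last departure up to
    [s'] starts a job that outlasts [x]; there is at most one such job. The induction removes the
    job at the back of the queue, not the one in service, which is why it runs over all [l]. *)
Lemma zi_advance_server k l : (forall j, (j < k)%N -> ot o j <= s) ->
  (zi k s' x l.+1 i = zi k s x l.+1 i +
    \sum_(kk < k | sv kk == i)
      inn k l kk :> nat)%N.
Proof.
have sx := le_trans ss' s'x.
have s'0 := le_trans s0 ss'; have x0 := le_trans s0 sx.
elim: k l => [|k IH] l ht.
  rewrite big_ord0 addn0 /zi !Q0; case: (ohb o i) => //=.
  case: (ltP s (ohr o i)) => h1; case: (ltP s' (ohr o i)) => h2 //=.
  - by case: (ltP x (ohr o i)) => h3; rewrite /= ?andbF //; have := le_lt_trans (le_trans h2 s'x) h3; rewrite ltxx.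
  - by have := le_lt_trans (le_trans h1 ss') h2; rewrite ltxx.
have htk : forall j, (j < k)%N -> ot o j <= s.
  by move=> j h; apply: ht; rewrite ltnS ltnW.
rewrite big_mkcond big_ord_recr -big_mkcond /=.
case: (eqVneq (sv k) i) => [ei|ni]; last first.
  rewrite addn0 /zi !QS (negbTE ni) !addn0 -/(zi k s' x l.+1 i) -/(zi k s x l.+1 i) IH //.
  congr addn; apply: eq_bigr => kk /eqP e.
  by rewrite /inn rbN ?e 1?eq_sym.
have tk : ot o k <= s by exact: ht.
have innk : inn k.+1 l k = [&& s < st k, st k <= s', (l < 1)%N & x < dp k].
  by rewrite /inn rbSk.
rewrite {}innk.
(* Job [k] stands behind the older jobs of its server and raises the rank of each by one. *)
have olds : (\sum_(kk < k | sv kk == i) inn k.+1 l kk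
  = \sum_(kk < k | sv kk == i) inn k l.-1 kk)%N.
  apply: eq_bigr => kk /eqP e; rewrite /inn rbS ?e ?ei //.
  by case: (l) => [|l'] //=; rewrite rb_gt0.
rewrite olds; clear olds.
have Qk : forall u, Q k.+1 i u = (Q k i u + (u < dp k)%R)%N.
  by move=> u; rewrite QS ei eqxx.
(* If the older work is finished by [s], job [k] is alone and has already started; otherwise it
   starts exactly when that work ends. *)
case: (leP (L k i) s) => hL.
  have q0 : Q k i s = 0%N by apply/eqP; rewrite Q_eq0.
  have q'0 : Q k i s' = 0%N by apply/eqP; rewrite Q_eq0 // (le_trans hL).
  have qx0 : Q k i x = 0%N by apply/eqP; rewrite Q_eq0 // (le_trans hL).
  have -> : (s < st k) = false by apply/le_gtF; rewrite /st ge_max tk ei hL.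
  rewrite big1 ?addn0; last first.
    move=> kk /eqP e; rewrite /inn; suff -> : (x < dp kk) = false by rewrite !andbF.
    by apply/le_gtF; apply: le_trans (le_trans hL sx); exact: dp_le_L.
  rewrite /zi !Qk q0 q'0 qx0 !add0n.
  case: (ltP x (dp k)) => h3.
    by rewrite (le_lt_trans s'x h3) (le_lt_trans sx h3).
  by case: (s' < dp k); case: (s < dp k); rewrite /= ?andbF.
have stk : st k = L k i by rewrite -ei waitE // /wait ei (le_lt_trans tk hL).
have dpL : L k i < dp k by rewrite -ei L_dp.
have q1 : (0 < Q k i s)%N by rewrite Q_gt0.
have IHl := IH l.-1 htk.
have eqz u : 0 <= u -> u <= x -> u < L k i -> 
    (zi k.+1 u x l.+1 i = zi k u x (l.-1).+1 i :> bool).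
  move=> u0 ux uL; rewrite /zi !Qk (lt_trans uL dpL).
  have qu : (0 < Q k i u)%N by rewrite Q_gt0.
  have qxu : (Q k i x <= Q k i u)%N by apply: Q_mono.
  have -> : (Q k i x + (x < dp k)%R == Q k i u + true)%N = (Q k i x == Q k i u).
    case: (ltP x (dp k)) => hx /=; first by rewrite eqn_add2r.
    have : Q k i x = 0%N by apply/eqP; rewrite Q_eq0 // (le_trans _ hx) // ltW.
    by move=> ->; rewrite addn0 addn1 !(ltn_eqF (n := (_ i u).+1)) // ltn_eqF.
  by rewrite addn1 ltnS; case: (l) => //; rewrite qu.
rewrite stk (eqz s) //.
case: (leP (L k i) s') => hL'; last first.
  by rewrite andbF addn0 eqz.
have q'0 : Q k i s' = 0%N by apply/eqP; rewrite Q_eq0.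
have qx0 : Q k i x = 0%N by apply/eqP; rewrite Q_eq0 // (le_trans hL').
move: IHl; rewrite addnA => <-.
rewrite {2}/zi q'0 /= add0n /zi !Qk q'0 qx0 !add0n hL /=.
case: (l) => [|l'] /=; last by rewrite ?andbF //; case: (s' < dp k).
case: (ltP x (dp k)) => h3; first by rewrite (le_lt_trans s'x h3).
by case: (s' < dp k).
Qed.

(** Lengths fall by one at a time, so a queue that ceases to be longer than [l.+1] does so at
    exactly one departure, the one that leaves [l.+1] jobs and starts the first of them. *)
Lemma flow_advance_server k l : (forall j, (j < k)%N -> ot o j <= s) ->
  ((l.+1 < Q k i s') + \sum_(kk < k | sv kk == i)
      innf k l.+1 kk = (l.+1 < Q k i s)%N :> nat)%N.
Proof.
have s'0 := le_trans s0 ss'.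
elim: k l => [|k IH] l ht.
  by rewrite big_ord0 addn0 !Q0; do 2 case: (_ && _).
have htk : forall j, (j < k)%N -> ot o j <= s.
  by move=> j h; apply: ht; rewrite ltnS ltnW.
rewrite big_mkcond big_ord_recr -big_mkcond /=.
case: (eqVneq (sv k) i) => [ei|ni]; last first.
  rewrite addn0 !QS (negbTE ni) !addn0 -IH //; congr addn.
  apply: eq_bigr => kk /eqP e.
  by rewrite /innf rbN ?e 1?eq_sym.
have tk : ot o k <= s by exact: ht.
have infk : innf k.+1 l.+1 k = [&& s < st k, st k <= s' & l == 0%N].
  by rewrite /innf rbSk eqSS.
rewrite {}infk.
have -> : (\sum_(kk < k | sv kk == i) innf k.+1 l.+1 kk
  = \sum_(kk < k | sv kk == i) innf k l kk)%N.
  by apply: eq_bigr => kk /eqP e; rewrite /innf rbS ?e ?ei.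
have Qk : forall u, Q k.+1 i u = (Q k i u + (u < dp k)%R)%N.
  by move=> u; rewrite QS ei eqxx.
case: (leP (L k i) s) => hL.
  have q0 : Q k i s = 0%N by apply/eqP; rewrite Q_eq0.
  have q'0 : Q k i s' = 0%N by apply/eqP; rewrite Q_eq0 // (le_trans hL).
  have -> : (s < st k) = false by apply/le_gtF; rewrite /st ge_max tk ei hL.
  rewrite big1 ?addn0; last first.
    move=> kk /eqP e; rewrite /innf; suff -> : (s < st kk) = false by [].
    apply/le_gtF; apply: le_trans hL; apply: le_trans (ltW (st_dp kk)) _.
    exact: dp_le_L.
  by rewrite !Qk q0 q'0 !add0n; do 2 case: (_ < _).
have stk : st k = L k i by rewrite -ei waitE // /wait ei (le_lt_trans tk hL).
have dpL : L k i < dp k by rewrite -ei L_dp.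
have q1 : (0 < Q k i s)%N by rewrite Q_gt0.
rewrite stk hL !Qk (lt_trans hL dpL) addn1 ltnS /=.
case: l => [|l].
  rewrite big1 ?add0n; last first.
    by move=> kk /eqP e; rewrite /innf (ltn_eqF (rb_gt0 _)) // !andbF.
  rewrite q1 eqxx andbT; case: (leP (L k i) s') => hL' /=.
    have -> : Q k i s' = 0%N by apply/eqP; rewrite Q_eq0.
    by rewrite add0n; case: (_ < _).
  by rewrite (lt_trans hL' dpL) addn1 ltnS Q_gt0 // hL'.
rewrite -(IH l) // andbF addn0; congr addn.
case: (leP (L k i) s') => hL' /=.
  have -> : Q k i s' = 0%N by apply/eqP; rewrite Q_eq0.
  by rewrite add0n; case: (_ < _).
by rewrite (lt_trans hL' dpL) addn1 ltnS.
Qed.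

End OneServer.

Lemma sum_server k (F : nat -> nat) :
  (\sum_(i < oN o) \sum_(kk < k | sv kk == i) F kk = \sum_(kk < k) F kk)%N.
Proof.
rewrite (exchange_big_dep xpredT) //=; apply: eq_bigr => kk _.
rewrite (eq_bigl (fun i : 'I_(oN o) => i == Ordinal (sv_lt kk))) ?big_pred1_eq //.
by move=> i; rewrite -val_eqE /= eq_sym.
Qed.

Lemma Jf_advance k (s s' : R) l kk : s <= s' -> (forall j, (j < k)%N -> ot o j <= s) ->
  (kk < k)%N ->
  Jf k s' l kk = (Jf k s l kk + [&& (s < st kk)%R, (st kk <= s')%R & (l <= rb k kk)%N])%N
    :> nat.
Proof.
move=> ss' ht kkk; rewrite /Jf; case: (leP (st kk) s) => h /=.
  by rewrite (le_trans h ss') addn0.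
rewrite andbF add0n wait_st (le_lt_trans (ht _ kkk) h) /=.
suff -> : rk k kk = rb k kk by [].
rewrite /rk /rb big_nat [RHS]big_nat; apply: eq_bigr => j /andP[_ jk].
by rewrite (le_lt_trans (ht _ jk) h) andbT.
Qed.

Lemma Jf_arrival k l kk : (kk < k)%N -> Jf k.+1 (ot o k) l kk = Jf k (ot o k) l kk.
Proof.
move=> kkk; rewrite /Jf; case: (leP (st kk) (ot o k)) => h; rewrite ?andbF //.
by rewrite /rk big_nat_recr ?(ltnW kkk) //= (le_gtF h) andbF addn0.
Qed.

Lemma Jf_arrival_last k l : Jf k.+1 (ot o k) l k = false.
Proof. by rewrite /Jf wait_st; case: ltP. Qed.

Lemma Jf_start l kk : (kk < on0 o)%N -> Jf (on0 o) 0 l kk = false.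
Proof. by move=> h; rewrite /Jf wait_st (wf_t0 wo h); case: ltP. Qed.

(** At a nonempty queue the newcomer leaves after all jobs ahead of it, so it cannot be the first to
    depart; at an empty queue it is the only candidate. This is the origin of the two cases of
    [arr]. *)
Lemma zi_arrival k (x : R) l i : ot o k <= x ->
  zi k.+1 (ot o k) x l.+1 i =
  (zi k (ot o k) x l.+1 i + (sv k == i) * arr l.+1 x k)%N :> nat.
Proof.
move=> tx; have t0 := wf_tge0 wo k.
rewrite /zi /arr !QS; case: eqP => [<-|_] /=; last by rewrite !addn0.
rewrite mul1n t_dp /= addn1 ltnS.
have xle := Q_mono k (sv k) tx.
have [q0|q1] := posnP (Q k (sv k) (ot o k)).
  have x0 : Q k (sv k) x = 0%N by apply/eqP; rewrite -leqn0 -q0.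
  by rewrite q0 x0 eqxx !ltn0 /= add0n; case: l => [|l] //=; case: (x < dp k).
have -> : (Q k (sv k) x + (x < dp k)%R == (Q k (sv k) (ot o k)).+1)%N
   = (Q k (sv k) x == Q k (sv k) (ot o k)).
  case: (ltP x (dp k)) => hx /=; first by rewrite addn1 eqSS.
  have x0 : Q k (sv k) x = 0%N.
    apply/eqP; rewrite Q_eq0 ?(le_trans t0) //; apply: le_trans hx.
    by rewrite ltW ?L_dp.
  by rewrite x0 /= addn0 (ltn_eqF q1).
case: l => [|l] /=; first by rewrite q1 addn0.
case: (Q k (sv k) x == _); rewrite ?andbF ?andbT //.
by case: (ltngtP (Q k (sv k) (ot o k)) l.+1).
Qed.

Lemma sum_zi_arrival k (x : R) l : ot o k <= x ->
  (\sum_(i < oN o) zi k.+1 (ot o k) x l.+1 i =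
   \sum_(i < oN o) zi k (ot o k) x l.+1 i + arr l.+1 x k)%N.
Proof.
move=> tx; under eq_bigr do rewrite zi_arrival //.
rewrite big_split /=; congr addn.
rewrite (bigD1 (Ordinal (sv_lt k))) //= eqxx mul1n big1 ?addn0 // => i.
by rewrite -val_eqE /= eq_sym => /negbTE ->.
Qed.

Lemma sum_zi_advance k (s s' x : R) l : 0 <= s -> s <= s' -> s' <= x ->
  (forall j, (j < k)%N -> ot o j <= s) ->
  (\sum_(i < oN o) zi k s' x l.+1 i + \sum_(kk < k) (Jf k s l.+1 kk && (x < dp kk)%R)
   = \sum_(i < oN o) zi k s x l.+1 i
     + \sum_(kk < k) (Jf k s' l.+1 kk && (x < dp kk)%R))%N.
Proof.
move=> s0 ss' s'x ht.
under eq_bigr do rewrite (zi_advance_server _ s0 ss' s'x _ ht).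
rewrite big_split /= (sum_server k (fun kk => inn s s' x k l kk)) -addnA; congr addn.
rewrite addnC -big_split /=; apply: eq_bigr => kk _.
have := Jf_advance l.+1 ss' ht (ltn_ord kk); rewrite /inn.
case: (x < dp kk); last by rewrite !andbF.
by rewrite !andbT => ->.
Qed.

(** Once a queue counts it keeps counting, as its head stays until [x]. So each queue is charged to
    the event that made it count: its initial state, the start of the job now in service, or the
    arrival that brought it to length [l.+1]. The induction alternates between an arrival and an
    advance of time. *)
Lemma sum_zi k (s x : R) l : (on0 o <= k)%N -> 0 <= s -> s <= x ->
  (forall j, (j < k)%N -> ot o j <= s) ->
  (\sum_(i < oN o) zi k s x l.+1 i =
   \sum_(i < oN o) zi (on0 o) 0 x l.+1 i
   + \sum_(kk < k) (Jf k s l.+1 kk && (x < dp kk)%R)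
   + \sum_(on0 o <= j < k) arr l.+1 x j)%N.
Proof.
move=> n0k; rewrite -(subnKC n0k); move: (k - on0 o)%N => m {k n0k}.
elim: m s => [|m IH] s s0 sx ht.
  rewrite addn0 in ht *; rewrite big_geq // addn0.
  have h0 j : (j < on0 o)%N -> ot o j <= 0 by move=> /(wf_t0 wo) ->.
  rewrite -(sum_zi_advance l (lexx 0) s0 sx h0).
  by rewrite [X in (_ = _ + X)%N]big1 ?addn0 // => kk _; rewrite Jf_start.
rewrite addnS in ht *; set k := (on0 o + m)%N in ht *.
have tk : ot o k <= s by apply: ht.
have tk0 := wf_tge0 wo k.
have htk j : (j < k.+1)%N -> ot o j <= ot o k by rewrite ltnS => /(wf_tle wo).
have := sum_zi_advance l tk0 tk sx htk.
rewrite sum_zi_arrival ?(le_trans tk) // IH ?(le_trans tk) //; last first.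
  by move=> j jk; apply: htk; rewrite ltnS ltnW.
rewrite [X in (_ + X = _)%N]big_ord_recr /= Jf_arrival_last addn0.
rewrite big_nat_recr ?leq_addr //=.
under [X in (_ + X = _)%N]eq_bigr do rewrite Jf_arrival //.
rewrite -/k; lia.
Qed.

Lemma sum_flow_advance k (s s' : R) l : 0 <= s -> s <= s' ->
  (forall j, (j < k)%N -> ot o j <= s) ->
  (\sum_(i < oN o) (l.+1 < Q k i s')%N
     + (\sum_(kk < k) Jf k s' l.+1 kk + \sum_(kk < k) Jf k s l.+2 kk)
   = \sum_(i < oN o) (l.+1 < Q k i s)%N
     + (\sum_(kk < k) Jf k s l.+1 kk + \sum_(kk < k) Jf k s' l.+2 kk))%N.
Proof.
move=> s0 ss' ht.
under [in RHS]eq_bigr do rewrite -(flow_advance_server _ s0 ss' _ ht).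
rewrite [in RHS]big_split /= (sum_server k (fun kk => innf s s' k l.+1 kk)) -addnA; congr addn.
rewrite -!big_split /=; apply: eq_bigr => kk _.
rewrite !(Jf_advance _ ss' ht (ltn_ord kk)) /innf.
case: (s < st kk) => /=; last by rewrite !addn0 addnC.
case: (st kk <= s') => /=; last by rewrite !addn0 addnC.
case: (ltngtP l.+1 (rb k kk)) => _ /=; lia.
Qed.

(** Conservation of the queues longer than [l.+1]: they are created by arrivals at queues of length
    [l.+1] and lost by departures that leave [l.+1] jobs, whose number is the difference of the two
    sums of [Jf]. *)
Lemma sum_flow k (s : R) l : (on0 o <= k)%N -> 0 <= s ->
  (forall j, (j < k)%N -> ot o j <= s) ->
  (\sum_(i < oN o) (l.+1 < Q k i s) + \sum_(kk < k) Jf k s l.+1 kk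
   = \sum_(i < oN o) (l.+1 < Q (on0 o) i 0%R) + \sum_(kk < k) Jf k s l.+2 kk
   + \sum_(on0 o <= j < k) (Q j (sv j) (ot o j) == l.+1))%N.
Proof.
move=> n0k; rewrite -(subnKC n0k); move: (k - on0 o)%N => m {k n0k}.
elim: m s => [|m IH] s s0 ht.
  rewrite addn0 in ht *; rewrite big_geq // addn0.
  have h0 j : (j < on0 o)%N -> ot o j <= 0 by move=> /(wf_t0 wo) ->.
  have := sum_flow_advance l (lexx 0) s0 h0.
  have J0 l' : (\sum_(kk < on0 o) Jf (on0 o) 0%R l' kk = 0)%N.
    by rewrite big1 // => kk _; rewrite Jf_start.
  by rewrite !J0 addn0 add0n.
rewrite addnS in ht *; set k := (on0 o + m)%N in ht *.
have tk : ot o k <= s by apply: ht.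
have tk0 := wf_tge0 wo k.
have htk j : (j < k.+1)%N -> ot o j <= ot o k by rewrite ltnS => /(wf_tle wo).
have := sum_flow_advance l tk0 tk htk.
have := IH (ot o k) tk0 (fun j jk => htk j (ltnW jk)); rewrite -/k.
have -> : (\sum_(i < oN o) (l.+1 < Q k.+1 i (ot o k)) =
   \sum_(i < oN o) (l.+1 < Q k i (ot o k)) + (Q k (sv k) (ot o k) == l.+1))%N.
  rewrite (bigD1 (Ordinal (sv_lt k))) //= [in RHS](bigD1 (Ordinal (sv_lt k))) //=.
  rewrite QS eqxx t_dp /= addn1 ltnS -!addnA [in RHS](addnC _ (nat_of_bool _)) addnA.
  congr addn; first by case: (ltngtP (Q k (sv k) (ot o k)) l.+1).
  by apply: eq_bigr => i; rewrite -val_eqE /= QS eq_sym => /negbTE ->; rewrite addn0.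
have JS l' : (\sum_(kk < k.+1) Jf k.+1 (ot o k) l' kk = \sum_(kk < k) Jf k (ot o k) l' kk)%N.
  rewrite big_ord_recr /= Jf_arrival_last addn0.
  by apply: eq_bigr => kk _; rewrite Jf_arrival.
rewrite !JS big_nat_recr ?leq_addr //= -/k; lia.
Qed.

End Recursion.
End System.

(** * Insensitivity of the past to a single service requirement *)

Section Resample.
Variables (R : realType) (o : outer R).
Hypothesis wo : wf_outer o.

Lemma hist_eq (w w' : inner R) k :
  (forall j, (j < k)%N -> iy w' j = iy w j) ->
  (forall j, (on0 o <= j < k)%N ->
     [/\ ic1 w' j = ic1 w j, ic2 w' j = ic2 w j & ib w' j = ib w j]) ->
  hist o w' k = hist o w k.
Proof.
elim: k => //= k IH hy hc.
rewrite IH; last 2 first.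
- by move=> j jk; apply: hy; rewrite ltnS ltnW.
- by move=> j /andP[jn jk]; apply: hc; rewrite jn ltnS ltnW.
rewrite hy // /hsv; case: ltnP => // kn.
by have [|-> -> ->] := hc k; rewrite ?kn ?ltnSn.
Qed.

Lemma hist_sv_dp (w w' : inner R) k : hist o w' k.+1 = hist o w k.+1 ->
  sv o w' k = sv o w k /\ dp o w' k = dp o w k.
Proof. by move=> /= /rcons_inj[_ e1 e2]; split. Qed.

(* What happens before the job [k0] starts service, at time [st o w k0], does
   not depend on the service requirement of [k0]. *)
Definition resampled k0 (w w' : inner R) : Prop :=
  [/\ forall j, ic1 w' j = ic1 w j, forall j, ic2 w' j = ic2 w j,
      forall j, ib w' j = ib w j & forall j, j != k0 -> iy w' j = iy w j].

Lemma resampled_sym k0 w w' : resampled k0 w w' -> resampled k0 w' w.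
Proof. by case=> h1 h2 h3 h4; split=> j; rewrite ?h1 ?h2 ?h3 // => /h4. Qed.

Section Before.
Variables (w w' : inner R) (k0 : nat).
Hypotheses (wi : wf_inner o w) (wi' : wf_inner o w') (rs : resampled k0 w w').
Let u0 := st o w k0.

(** Only [k0] and the jobs behind it at its server can change their completion times, and these lie
    after [u0] in both systems. Hence arrivals before [u0] see the same queues and are routed alike.
    [L] need not agree, but where it differs it exceeds [u0] on both sides. *)
Lemma resample_before k : (forall j, (j < k)%N -> ot o j < u0) ->
  (forall i s, s < u0 -> Q o w' k i s = Q o w k i s) /\
  (forall i, L o w' k i = L o w k i \/
     [/\ i = sv o w k0, (k0 < k)%N, u0 < L o w k i & u0 < L o w' k i]).
Proof.
have [rc1 rc2 rb' ry] := rs.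
elim: k => [|k IH] ht; first by split=> [i s|i]; rewrite ?Q0 ?L0; [|left].
have [IQ IL] := IH (fun j jk => ht j (ltnW jk)).
have tk : ot o k < u0 by apply: ht.
have esv : sv o w' k = sv o w k.
  rewrite !svE; case: ifP => // _; rewrite /pick2 rc1 rc2 rb'.
  by rewrite !IQ.
have key : dp o w' k = dp o w k \/
   [/\ sv o w k = sv o w k0, (k0 <= k)%N, u0 < dp o w k & u0 < dp o w' k].
  have [kk0|kk0] := eqVneq k k0.
    right; subst k0; split=> //; first exact: st_dp.
    have [eL|[_]] := IL (sv o w k); last by rewrite ltnn.
    have : st o w' k = u0 by rewrite /st esv eL.
    by move=> <-; apply: st_dp.
  have [eL|[e1 e2 e3 e4]] := IL (sv o w k).
    by left; rewrite /dp /st esv eL ry.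
  right; split=> //; first exact: ltnW.
    by apply: lt_trans e3 _; apply: L_dp.
  by apply: lt_trans e4 _; rewrite -esv; apply: L_dp.
split=> [i s su|i].
  rewrite !QS esv IQ //; case: key => [->//|[_ _ h1 h2]].
  by rewrite (lt_trans su h1) (lt_trans su h2).
rewrite !LS esv; case: eqP => [e|_]; last first.
  have [->|[? ? ? ?]] := IL i; first by left.
  by right; split=> //; apply: ltnW.
by case: key => [->|[? ? ? ?]]; [left|right; split=> //; rewrite -e].
Qed.

Lemma resample_sv k : ot o k < u0 -> sv o w' k = sv o w k.
Proof.
have [rc1 rc2 rb' _] := rs; move=> h.
have [IQ _] := resample_before (fun j jk => le_lt_trans (wf_tle wo (ltnW jk)) h).
rewrite !svE; case: ifP => // _; rewrite /pick2 rc1 rc2 rb'.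
by rewrite !IQ.
Qed.

(* In the case [k1 != k0] both jobs must start at different positions of the
   order of starts; positivity of the services excludes that [k1] is behind
   [k0] at the same server. *)
Lemma resample_start k1 : wait o w k1 -> st o w k1 <= u0 ->
  [/\ sv o w' k1 = sv o w k1, wait o w' k1, st o w' k1 = st o w k1 &
      forall k, rk o w' k k1 = rk o w k k1].
Proof.
move=> w1 s1.
have t1 : ot o k1 < u0 by apply: lt_le_trans s1; rewrite -wait_st.
have [_ IL] := resample_before (fun j jk => le_lt_trans (wf_tle wo (ltnW jk)) t1).
have e1 := resample_sv t1.
have eL : L o w' k1 (sv o w k1) = L o w k1 (sv o w k1).
  have [//|[_ _ h _]] := IL (sv o w k1).
  by have := le_lt_trans s1 h; rewrite waitE // ltxx.
have e2 : st o w' k1 = st o w k1 by rewrite /st e1 eL.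
split=> //; first by rewrite /wait e1 eL.
move=> k; rewrite /rk; apply: eq_bigr => j _; rewrite e1 e2.
case: (ltP (ot o j) (st o w k1)) => h; rewrite ?andbF //.
by rewrite resample_sv // (lt_le_trans h).
Qed.

Lemma resample_Jf k s l k1 : Jf o w k s l k1 -> st o w k1 <= u0 ->
  Jf o w' k s l k1 /\ st o w' k1 = st o w k1.
Proof.
move=> /and3P[h1 h2 h3] h.
by have [_ e1 e2 e] := resample_start h1 h; rewrite /Jf e e1 e2 h2 h3.
Qed.

End Before.

(** Used in both directions, this makes the event that both jobs are counted and [k1] starts no
    later than [k0] independent of the service of [k0]. *)
Lemma resample_pair w w' k0 k1 k s l :
  wf_inner o w -> wf_inner o w' -> resampled k0 w w' ->
  Jf o w k s l k0 -> Jf o w k s l k1 -> st o w k1 <= st o w k0 ->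
  [/\ Jf o w' k s l k0, Jf o w' k s l k1, st o w' k0 = st o w k0 &
      st o w' k1 = st o w k1].
Proof.
move=> wi wi' rs h0 h1 h.
have [? ?] := resample_Jf wi wi' rs h0 (lexx _).
by have [? ?] := resample_Jf wi wi' rs h1 h.
Qed.

End Resample.

(** * Agreement of the recursion with the given queue dynamics *)

Section Correspondence.
Variable R : realType.

Lemma all_behead (T : Type) (p : pred T) q : all p q -> all p (behead q).
Proof. by case: q => //= x q /andP[]. Qed.

(** Partial sums of the requirements, begun at the time the head was taken up, are the completion
    times, and serving removes those that have passed. Positivity of the waiting requirements makes
    them increasing, so that removing a prefix is the same as filtering. *)
Lemma adv_scanl (q : seq R) (e s dt : R) : 0 <= dt -> all (fun x => 0 < x) (behead q) ->
  scanl +%R (s + dt - (adv dt q e).2) (adv dt q e).1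
  = [seq c <- scanl +%R (s - e) q | s + dt < c] /\
  all (fun x => 0 < x) (behead (adv dt q e).1).
Proof.
elim: q e s dt => [|h q IH] e s dt dt0 //= q0.
have eq_lt : (dt < h - e) = (s + dt < s - e + h).
  by rewrite -ltrBrDl; congr (_ < _); ring.
rewrite -eq_lt; case: ifP => hlt /=; last first.
  move/negbT: hlt; rewrite -leNgt => hle.
  have := IH 0 (s - e + h) (dt - (h - e)) _ (all_behead q0); rewrite subr_ge0 => /(_ hle).
  have -> : s - e + h + (dt - (h - e)) = s + dt by ring.
  by rewrite subr0.
rewrite q0; split=> //.
have -> : s + dt - (e + dt) = s - e by ring.
congr (_ :: _); symmetry; apply/all_filterP.
have hc : s + dt < s - e + h by rewrite -eq_lt.
elim: q q0 (s - e + h) hc {IH eq_lt hlt} => [|y q IH] //= /andP[y0 q0] c hc.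
have hy : s + dt < c + y by apply: lt_trans hc _; rewrite ltrDl.
by rewrite hy IH.
Qed.

Section Lists.
Variables (o : outer R) (w : inner R).
Hypotheses (wo : wf_outer o) (wi : wf_inner o w).

Definition cl h i : seq R :=
  (if ohb o i then [:: ohr o i] else [::]) ++ [seq p.2 | p <- h & p.1 == i].

Lemma cl_rcons h p i :
  cl (rcons h p) i = if p.1 == i then rcons (cl h i) p.2 else cl h i.
Proof.
rewrite /cl filter_rcons; case: (p.1 == i) => //.
by rewrite map_rcons rcons_cat.
Qed.

Lemma count_cl h i s : count (fun c => s < c) (cl h i) = hq o h i s.
Proof.
rewrite /cl /hq count_cat count_map count_filter; congr addn.
  by case: (ohb o i) => //=; rewrite addn0.
by apply: eq_count => p /=; rewrite andbC.
Qed.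

Lemma last_cl h i : last 0 (cl h i) = hl o h i.
Proof.
elim/last_ind: h => [|h p IH].
  by rewrite /cl /hl /=; case: (ohb o i).
rewrite cl_rcons /hl -[in RHS]cats1 foldl_cat /= -/(hl o h i).
by case: ifP; rewrite ?last_rcons.
Qed.

(* [(q, e)] describes the server [i] at time [s], after [k] jobs. *)
Definition repr k s i (qe : seq R * R) : Prop :=
  [/\ scanl +%R (s - qe.2) qe.1 = [seq c <- cl (hist o w k) i | s < c],
      all (fun x => 0 < x) (behead qe.1) & qe.1 = [::] -> qe.2 = 0].

Lemma repr_size k s i qe : repr k s i qe -> size qe.1 = Q o w k i s.
Proof.
case=> h _ _; have := congr1 size h.
by rewrite size_scanl size_filter count_cl.
Qed.

Lemma repr_adv k s dt i qe : 0 <= dt -> repr k s i qe ->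
  repr k (s + dt) i (adv dt qe.1 qe.2).
Proof.
move=> dt0 [h1 h2 h3].
have [h4 h5] := adv_scanl qe.2 s dt0 h2.
split=> //; last first.
  elim: (qe.1) (qe.2) dt {dt0 h1 h2 h3 h4 h5} => [|x q IH] e dt //=.
  by case: ifP => // _; apply: IH.
rewrite h4 h1 -filter_predI; apply: eq_filter => c /=.
by case: (ltP (s + dt) c) => //= h; rewrite (le_lt_trans _ h) // lerDl.
Qed.

Lemma repr_add k i qe : repr k (ot o k) i qe ->
  repr k.+1 (ot o k) i
    (if i == sv o w k then (rcons qe.1 (iy w k), qe.2) else qe).
Proof.
case=> h1 h2 h3; rewrite /repr /= cl_rcons -/(sv o w k) -/(L o w k (sv o w k)) /=.
rewrite -/(st o w k) -/(dp o w k) eq_sym; case: eqP => // e; split=> /=.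
- rewrite filter_rcons t_dp // -h1 -!cats1 scanl_cat /=.
  congr (_ ++ [:: _]); rewrite /dp; congr +%R.
  (* The last partial sum is the end of the present work, or the arrival time itself if the server
     is idle; the third clause of [repr] gives an idle server age 0. *)
  have -> : foldl +%R (ot o k - qe.2) qe.1 
          = last (ot o k - qe.2) (scanl +%R (ot o k - qe.2) qe.1).
    elim: (qe.1) (ot o k - qe.2) => //= x q IH c; exact: IH.
  rewrite h1 /st e; have t0 := wf_tge0 wo k.
  have [Lt|tL] := leP (L o w k i) (ot o k).
    have /eqP q0 : Q o w k i (ot o k) == 0%N by rewrite Q_eq0.
    have f0 : [seq c <- cl (hist o w k) i | ot o k < c] = [::].
      by apply/nilP; rewrite /nilp size_filter count_cl -/(Q o w k i (ot o k)) q0.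
    rewrite f0 /= h3 ?subr0 //.
    by apply/nilP; rewrite /nilp (repr_size (And3 h1 h2 h3)) q0.
  rewrite -[RHS]/(hl o (hist o w k) i) -last_cl.
  have : ot o k < last 0 (cl (hist o w k) i) by rewrite last_cl.
  elim/last_ind: (cl _ i) => [|c z IH]; first by rewrite /= ltNge t0.
  by rewrite !last_rcons filter_rcons => ->; rewrite last_rcons.
- by case: (qe.1) h2 => //= x q h2; rewrite all_rcons (wf_y wi).
- by case: (qe.1).
Qed.

Lemma cl_start k i : (k <= on0 o)%N ->
  cl (hist o w k) i =
  if ohb o i then scanl +%R 0 (ohr o i :: [seq iy w j | j <- iota 0 k & ofs o j == i])
  else [::].
Proof.
elim: k => [|k IH] hk; first by rewrite /cl /= add0r cats0.
have -> : iota 0 k.+1 = iota 0 k ++ [:: k] by rewrite -addn1 iotaD.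
rewrite filter_cat map_cat [hist _ _ _]/= cl_rcons /= -/(sv o w k) svE hk.
have [hs hb] := wf_fs wo hk.
case: eqP => [e|_]; last by rewrite cats0 IH // (ltnW hk).
rewrite IH ?(ltnW hk) //; subst i; rewrite hb /= scanl_cat /= -cats1; congr (_ :: _ ++ [:: _]).
congr +%R; rewrite (wf_t0 wo hk) -last_cl IH ?(ltnW hk) // hb /= !add0r.
set q := [seq _ | _ <- _].
have -> : last (ohr o (ofs o k)) (scanl +%R (ohr o (ofs o k)) q)
   = foldl +%R (ohr o (ofs o k)) q.
  elim: q (ohr o (ofs o k)) => //= x q0 IHq c; exact: IHq.
apply/max_idPr.
have : all (fun x => 0 < x) q by apply/allP => x /mapP[j _ ->]; apply: (wf_y wi).
elim: q (ohr o _) (wf_hr wo hb) => [|x q IHq] c c0 /=; first by move=> _; apply: ltW.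
by case/andP=> x0; apply: IHq; apply: addr_gt0.
Qed.

End Lists.

(* The waiting initial jobs, [(i, m)] being the [m]-th one at server [i]. *)
Definition waiting N (x0 : nat -> nat) : seq (nat * nat) :=
  flatten [seq [seq (i, m) | m <- iota 0 (x0 i).-1] | i <- iota 0 N].

Definition wjob N x0 k := nth (0, 0)%N (waiting N x0) k.

Definition mk_outer N x0 (res tau : nat -> R) : outer R :=
  let n0 := size (waiting N x0) in
  Outer N n0 (fun k => (wjob N x0 k).1) (fun i => (i < N)%N && (0 < x0 i)%N) res
    (fun k => if (k < n0)%N then 0 else tau (k - n0)%N).

Definition mk_inner N x0 (W : nat -> nat -> R) (V : nat -> R)
    (C1 C2 : nat -> nat) (B : nat -> bool) : inner R :=
  let n0 := size (waiting N x0) in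
  Inner (fun k => if (k < n0)%N then W (wjob N x0 k).1 (wjob N x0 k).2
                  else V (k - n0)%N)
    (fun k => C1 (k - n0)%N) (fun k => C2 (k - n0)%N) (fun k => B (k - n0)%N).

Lemma waiting_filter N x0 i : (i < N)%N ->
  [seq p <- waiting N x0 | p.1 == i] = [seq (i, m) | m <- iota 0 (x0 i).-1].
Proof.
move=> iN; rewrite /waiting filter_flatten -map_comp.
rewrite (eq_map (g := fun j => if j == i then [seq (i, m) | m <- iota 0 (x0 i).-1] else [::])); last first.
  move=> j /=; case: eqP => [->|ne].
    by apply/all_filterP/allP => p /mapP[m _ ->] /=.
  apply/nilP; rewrite /nilp size_filter -leqn0 leqNgt -has_count.
  by apply/hasPn => p /mapP[m _ ->] /=; apply/eqP.
have -> : iota 0 N = iota 0 i ++ i :: iota i.+1 (N - i.+1).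
  have e : iota 0 i.+1 = iota 0 i ++ [:: i] by rewrite -addn1 iotaD.
  by rewrite -{1}(subnKC iN) iotaD add0n e -catA.
have z s : i \notin s -> flatten [seq if j == i then [seq (i, m) | m <- iota 0 (x0 i).-1] else [::] | j <- s] = [::].
  elim: s => //= j s IH; rewrite inE negb_or => /andP[ij /IH ->].
  by rewrite eq_sym (negbTE ij).
by rewrite map_cat flatten_cat /= eqxx !z ?cats0 // mem_iota ?ltnn ?add0n ?ltnn ?andbF.
Qed.

Lemma wjobP N x0 k : (k < size (waiting N x0))%N ->
  ((wjob N x0 k).1 < N)%N /\ ((wjob N x0 k).2 < (x0 (wjob N x0 k).1).-1)%N.
Proof.
move=> /(mem_nth (0, 0)%N) /flattenP[s /mapP[i + ->] /mapP[m + e]].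
by rewrite /wjob e !mem_iota.
Qed.

Lemma wjob_inj N x0 k k' : (k < size (waiting N x0))%N ->
  (k' < size (waiting N x0))%N -> wjob N x0 k = wjob N x0 k' -> k = k'.
Proof.
move=> h h' /eqP; rewrite /wjob nth_uniq //; first by move/eqP.
suff U a n : uniq (flatten [seq [seq (i, m) | m <- iota 0 (x0 i).-1] | i <- iota a n]).
  exact: U.
elim: n a => //= n IH a.
rewrite cat_uniq IH andbT map_inj_uniq ?iota_uniq; last by move=> ? ? [].
apply/hasPn => p /flattenP[s /mapP[i + ->] /mapP[m _ ->]] /=.
rewrite mem_iota => /andP[ai _]; apply/negP => /mapP[m' _ []] e _.
by rewrite e ltnn in ai.
Qed.

Section Queues.
Variables (N : nat) (x0 : nat -> nat) (a0 res : nat -> R) (W : nat -> nat -> R).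
Variables (Ec : R -> nat) (V : nat -> R) (C1 C2 : nat -> nat) (B : nat -> bool).
Variable tau : nat -> R.
Let o := mk_outer N x0 res tau.
Let w := mk_inner N x0 W V C1 C2 B.
Hypotheses (wo : wf_outer o) (wi : wf_inner o w).

Lemma repr_start i : (i < N)%N ->
  repr o w (on0 o) 0 i (init_state x0 a0 res W i).
Proof.
move=> iN; rewrite /repr (cl_start wo wi) ?leqnn // /init_state /= iN /=.
have Wf : [seq iy w j | j <- iota 0 (size (waiting N x0)) & (wjob N x0 j).1 == i]
   = mkseq (W i) (x0 i).-1.
  have -> : [seq iy w j | j <- iota 0 (size (waiting N x0)) & (wjob N x0 j).1 == i]
     = [seq W p.1 p.2 | p <- [seq p <- waiting N x0 | p.1 == i]].
    rewrite -{2}(mkseq_nth (0, 0)%N (waiting N x0)) /mkseq filter_map -map_comp.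
    apply/eq_in_map => j; rewrite mem_filter mem_iota add0n => /andP[_ /andP[_ h]].
    by rewrite /w /= h.
  by rewrite waiting_filter // -map_comp.
have := wf_hr wo (i := i); rewrite /= iN /=.
case x0i : (x0 i) => [|n] //= hr; rewrite sub0r.
have ap : all (fun x => 0 < x) (mkseq (W i) n).
  have -> : n = (x0 i).-1 by rewrite x0i.
  by rewrite -Wf; apply/allP => x /mapP[j _ ->]; exact: (wf_y wi).
rewrite Wf x0i /= addKr add0r hr //; split=> //.
congr (_ :: _); symmetry; apply/all_filterP.
elim: (mkseq _ _) (res i) (hr isT) ap => //= x q IH c c0 /andP[xx0 ap].
by rewrite addr_gt0 // IH // addr_gt0.
Qed.

Lemma repr_after n : (forall j, (j < n)%N -> tau j = arr_time Ec j) ->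
  let: (s, tl) := after (init_state x0 a0 res W) Ec V C1 C2 B n in
  tl = (if n is m.+1 then tau m else 0) /\
  forall i, (i < N)%N -> repr o w (on0 o + n) tl i (s i).
Proof.
have n0E : on0 o = size (waiting N x0) by [].
have tE m : ot o (on0 o + m) = tau m by rewrite /o /= ltnNge leq_addr addKn.
elim: n => [|n IH] ht /=; first by split=> // i; rewrite addn0; apply: repr_start.
have := IH (fun j jn => ht j (ltnW jn)).
case: (after _ _ _ _ _ _ n) => s tl [etl hr]; split; first by rewrite ht.
move=> i iN; rewrite -ht // addnS -tE.
have tl_le : 0 <= ot o (on0 o + n) - tl.
  rewrite subr_ge0 etl; case: (n) => [|m]; first exact: (wf_tge0 wo).
  by rewrite -tE; apply: (wf_tle wo); rewrite leq_add2l.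
have hadv i' : (i' < N)%N ->
    repr o w (on0 o + n) (ot o (on0 o + n)) i' (adv_all (ot o (on0 o + n) - tl) s i').
  move=> h; have := repr_adv tl_le (hr _ h).
  by have -> : tl + (ot o (on0 o + n) - tl) = ot o (on0 o + n) by rewrite addrC subrK.
have -> : sq2_pick (adv_all (ot o (on0 o + n) - tl) s) (C1 n) (C2 n) (B n)
   = sv o w (on0 o + n).
  rewrite svE ltnNge leq_addr /sq2_pick /pick2 {-1 2 3}/w [ic1 _ _]/= [ic2 _ _]/= [ib _ _]/= -!n0E !addKn.
  rewrite !(repr_size (hadv _ _)) //.
    by have := wf_c2 wi (on0 o + n); rewrite /= addKn.
  by have := wf_c1 wi (on0 o + n); rewrite /= addKn.
have := repr_add wo wi (hadv i iN).
rewrite /add_job /= ltnNge leq_addr addKn /=; exact.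
Qed.

(** [tau] must agree with the arrival times only for the arrivals up to [t]; later values are free
    and can be given a default. *)
Lemma qlen_Q i t : (i < N)%N -> 0 <= t ->
  (forall j, (j < Ec t)%N -> tau j = arr_time Ec j /\ tau j <= t) ->
  qlen (init_state x0 a0 res W) Ec V C1 C2 B i t = Q o w (on0 o + Ec t) i t.
Proof.
move=> iN t0 ht; have := repr_after (fun j jn => (ht j jn).1).
rewrite /qlen /state_at; case: (after _ _ _ _ _ _ _) => s tl [etl hr].
have tl_le : 0 <= t - tl.
  rewrite subr_ge0 etl; case E : (Ec t) => [|m] //.
  by have [] := ht m; rewrite ?E.
have := repr_adv tl_le (hr _ iN).
have -> : tl + (t - tl) = t by rewrite addrC subrK.
exact: repr_size.
Qed.

End Queues.
End Correspondence.

(** * Expectations and laws on spaces of coordinates *)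

Section Expectation.
Context d (T : measurableType d) (R : realType).

(** On this class expectations are real numbers, and they are linear without further integrability
    conditions. *)
Definition bm (f : T -> R) : Prop :=
  measurable_fun setT f /\ exists M, forall x, `|f x| <= M.

Lemma bm_le (f : T -> R) M : measurable_fun setT f -> (forall x, `|f x| <= M) -> bm f.
Proof. by move=> mf h; split=> //; exists M. Qed.

Lemma bm_cst c : bm (fun=> c).
Proof. by split=> //; exists `|c|. Qed.

Lemma bmD f g : bm f -> bm g -> bm (fun x => f x + g x).
Proof.
move=> [mf [M hM]] [mg [M' hM']]; split; first exact: measurable_funD.
exists (M + M') => x; exact: le_trans (ler_normD _ _) (lerD (hM x) (hM' x)).
Qed.

Lemma bmN f : bm f -> bm (fun x => - f x).
Proof.
move=> [mf [M hM]]; split; first exact: measurableT_comp.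
by exists M => x; rewrite normrN.
Qed.

Lemma bmB f g : bm f -> bm g -> bm (fun x => f x - g x).
Proof. by move=> hf hg; apply: bmD => //; exact: bmN. Qed.

Lemma bmM f g : bm f -> bm g -> bm (fun x => f x * g x).
Proof.
move=> [mf [M hM]] [mg [M' hM']]; split; first exact: measurable_funM.
by exists (M * M') => x; rewrite normrM; apply: ler_pM.
Qed.

Lemma bmZ c f : bm f -> bm (fun x => c * f x).
Proof. exact: bmM (bm_cst c). Qed.

Lemma bmX n f : bm f -> bm (fun x => f x ^+ n).
Proof.
move=> bf; elim: n => [|n IH]; first by under eq_fun do rewrite expr0; exact: bm_cst.
by under eq_fun do rewrite exprS; exact: bmM.
Qed.

Lemma bm_norm f : bm f -> bm (fun x => `|f x|).
Proof.
move=> [mf [M hM]]; split; first exact: measurableT_comp.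
by exists M => x; rewrite normr_id.
Qed.

Lemma bm_sum (I : Type) (s : seq I) (Q : pred I) (f : I -> T -> R) :
  (forall i, Q i -> bm (f i)) -> bm (fun x => \sum_(i <- s | Q i) f i x).
Proof.
move=> h; elim: s => [|i s IH].
  by under eq_fun do rewrite big_nil; exact: bm_cst.
under eq_fun do rewrite big_cons.
case E : (Q i) => //; apply: bmD => //; exact: h.
Qed.

Lemma bm_prod (I : Type) (s : seq I) (Q : pred I) (f : I -> T -> R) :
  (forall i, Q i -> bm (f i)) -> bm (fun x => \prod_(i <- s | Q i) f i x).
Proof.
move=> h; elim: s => [|i s IH].
  by under eq_fun do rewrite big_nil; exact: bm_cst.
under eq_fun do rewrite big_cons.
case E : (Q i) => //; apply: bmM => //; exact: h.
Qed.

Lemma bm_bool (b : T -> bool) : measurable_fun setT b -> bm (fun x => (b x)%:R).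
Proof.
move=> mb; split; last by exists 1 => x; case: (b x); rewrite ?normr1 ?normr0.
have -> : (fun x => (b x)%:R : R) = (fun x => if b x then 1 else 0).
  by apply/funext => x; case: (b x).
exact: measurable_fun_ifT.
Qed.

Lemma measurable_bool (b : T -> bool) :
  measurable [set x | b x] -> measurable_fun setT b.
Proof. by move=> mb; apply: (measurable_fun_bool true); rewrite setTI. Qed.

Lemma bool_measurable (b : T -> bool) :
  measurable_fun setT b -> measurable [set x | b x].
Proof. by move=> mb; have := mb measurableT [set true] I; rewrite setTI. Qed.

Section Ex.
Variable P : probability T R.

Definition Ex (f : T -> R) : R := \int[P]_x f x.

Lemma bm_integrable f : bm f -> P.-integrable setT (EFin \o f).
Proof.
move=> [mf [M hM]]; apply: measurable_bounded_integrable => //.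
  exact: fin_num_fun_lty.
exists `|M|; split; first by rewrite realE normr_ge0.
by move=> y hy x _ /=; apply: le_trans (hM x) (le_trans (ler_norm M) (ltW hy)).
Qed.
Hint Resolve bm_integrable : core.

Lemma Ex_EFin f : bm f -> (\int[P]_x (f x)%:E = (Ex f)%:E)%E.
Proof.
move=> bf; rewrite /Ex /Rintegral fineK //.
exact: (integrable_fin_num _ (bm_integrable bf)).
Qed.

Lemma Ex_cst c : Ex (fun=> c) = c.
Proof.
by rewrite /Ex /Rintegral integral_cst //= probability_setT mule1.
Qed.

Lemma ExD f g : bm f -> bm g -> Ex (fun x => f x + g x) = Ex f + Ex g.
Proof. by move=> hf hg; rewrite /Ex RintegralD //; exact: bm_integrable. Qed.

Lemma ExB f g : bm f -> bm g -> Ex (fun x => f x - g x) = Ex f - Ex g.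
Proof. by move=> hf hg; rewrite /Ex RintegralB //; exact: bm_integrable. Qed.

Lemma ExZ c f : bm f -> Ex (fun x => c * f x) = c * Ex f.
Proof. by move=> hf; rewrite /Ex RintegralZl //; exact: bm_integrable. Qed.

Lemma ExN f : bm f -> Ex (fun x => - f x) = - Ex f.
Proof.
move=> hf; rewrite -[RHS]mulN1r -ExZ //; congr Ex.
by apply/funext => x; rewrite mulN1r.
Qed.

Lemma Ex_sum (I : Type) (s : seq I) (Q : pred I) (f : I -> T -> R) :
  (forall i, Q i -> bm (f i)) ->
  Ex (fun x => \sum_(i <- s | Q i) f i x) = \sum_(i <- s | Q i) Ex (f i).
Proof.
move=> h; elim: s => [|i s IH].
  by rewrite big_nil; under eq_fun do rewrite big_nil; rewrite Ex_cst.
rewrite big_cons; under eq_fun do rewrite big_cons.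
case E : (Q i) => //; rewrite ExD ?IH //; first exact: h.
exact: bm_sum.
Qed.

Lemma le_Ex f g : bm f -> bm g -> (forall x, f x <= g x) -> Ex f <= Ex g.
Proof.
by move=> hf hg h; apply: le_Rintegral => //; exact: bm_integrable.
Qed.

Lemma Ex_ge0 f : (forall x, 0 <= f x) -> 0 <= Ex f.
Proof. by move=> h; apply: Rintegral_ge0. Qed.

Lemma Ex_le_cst f c : bm f -> (forall x, f x <= c) -> Ex f <= c.
Proof. by move=> hf h; rewrite -[leRHS]Ex_cst; apply: le_Ex => //; exact: bm_cst. Qed.

Lemma Ex_norm f : bm f -> `|Ex f| <= Ex (fun x => `|f x|).
Proof.
move=> hf; rewrite ler_norml -ExN; last exact: bm_norm.
apply/andP; split; apply: le_Ex => //; try exact: bm_norm.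
- by apply: bmN; exact: bm_norm.
- by move=> x; rewrite lerNl -normrN ler_norm.
- by move=> x; rewrite ler_norm.
Qed.

(** The variance of the absolute value is nonnegative. *)
Lemma Ex_sqr f : bm f -> Ex (fun x => `|f x|) ^+ 2 <= Ex (fun x => f x ^+ 2).
Proof.
move=> hf; set m := Ex _.
have hn : bm (fun x => `|f x|) by exact: bm_norm.
have : 0 <= Ex (fun x => (`|f x| - m) ^+ 2) by apply: Ex_ge0 => x; rewrite sqr_ge0.
have -> : (fun x => (`|f x| - m) ^+ 2)
   = (fun x => (f x ^+ 2 - (2 * m) * `|f x|) + m ^+ 2).
  by apply/funext => x; rewrite -(real_normK (num_real (f x))); ring.
have h2 : bm (fun x => f x ^+ 2) by exact: bmX.
have h3 : bm (fun x => 2 * m * `|f x|) by exact: bmZ.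
rewrite ExD ?ExB ?ExZ ?Ex_cst //; [|exact: bm_cst|exact: bmB|exact: bm_cst].
rewrite -/m; lra.
Qed.

Lemma Ex_bool (b : T -> bool) : measurable_fun setT b ->
  Ex (fun x => (b x)%:R) = fine (P [set x | b x]).
Proof.
move=> mb; rewrite /Ex /Rintegral.
have -> : (fun x => (b x)%:R%:E) = (fun x => (\1_[set x | b x] x)%:E :> \bar R).
  apply/funext => x; rewrite indicE; congr (_%:R%:E); congr nat_of_bool.
  by apply/idP/idP; rewrite in_setE.
by rewrite integral_indic ?setIT //; exact: bool_measurable.
Qed.

Lemma eq_Ex f g : f =1 g -> Ex f = Ex g.
Proof. by move=> h; congr Ex; apply/funext. Qed.

End Ex.
End Expectation.
#[global] Hint Resolve bm_integrable : core.

Lemma bm_comp d d' (T : measurableType d) (T' : measurableType d') (R : realType)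
    (f : T' -> R) (h : T -> T') :
  measurable_fun setT h -> bm f -> bm (fun x => f (h x)).
Proof.
move=> mh [mf [M hM]]; split; first exact: measurableT_comp.
by exists M.
Qed.

Section Product.
Context d d' (T : measurableType d) (T' : measurableType d') (R : realType).
Variables (P : probability T R) (P' : probability T' R).

Lemma bm_Ex2 (f : T * T' -> R) : bm f -> bm (fun x => Ex P' (fun y => f (x, y))).
Proof.
move=> bf; have [mf [M hM]] := bf.
have bs x : bm (fun y => f (x, y)).
  by split; [exact: measurableT_comp|exists M].
split; last first.
  exists M => x; apply: le_trans (Ex_norm _ (bs x)) _.
  by apply: Ex_le_cst => //; exact: bm_norm.
apply/measurable_EFinP.
have -> : EFin \o (fun x => Ex P' (fun y => f (x, y)))
   = fubini_F P' (EFin \o f).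
  by apply/funext => x; rewrite /fubini_F /= Ex_EFin.
by apply: (measurable_fubini_F (m1 := P)); exact: (bm_integrable (P \x P')%E bf).
Qed.

Lemma Ex_prod (f : T * T' -> R) : bm f ->
  Ex (P \x P')%E f = Ex P (fun x => Ex P' (fun y => f (x, y))).
Proof.
move=> bf; have [mf [M hM]] := bf.
have bs x : bm (fun y => f (x, y)).
  by split; [exact: measurableT_comp|exists M].
rewrite /Ex /Rintegral; congr fine.
rewrite -(integral12_prod_meas1 (bm_integrable (P \x P')%E bf)).
by apply: eq_integral => x _; rewrite /fubini_F /= Ex_EFin.
Qed.

End Product.

Section CoordinateSpace.
Variables (I : choiceType) (R : realType).

(** Strict lower bounds on finitely many coordinates form a pi-system and match the events
    [r i < Res N i w] through which the law of the residual services is given. *)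
Definition upper (s : seq I) (r : I -> R) : set (I -> R) :=
  [set y | forall c, c \in s -> r c < y c].
Definition uppers : set (set (I -> R)) := [set A | exists s r, A = upper s r].
Definition MI := g_sigma_algebraType uppers.

Lemma uppersI : setI_closed uppers.
Proof.
move=> _ _ [s [r ->]] [s' [r' ->]].
exists (s ++ s'), (fun c => if c \in s then (if c \in s' then Num.max (r c) (r' c) else r c) else r' c).
apply/seteqP; split=> [y [h h'] c|y h].
  rewrite mem_cat; case cs : (c \in s); case cs' : (c \in s') => //= _;
    by rewrite ?gt_max ?h ?h'.
split=> c cs; have := h c; rewrite mem_cat cs ?orbT; move=> /(_ isT).
  by case: ifP => _ //; rewrite gt_max => /andP[].
by case: ifP => _ //; rewrite gt_max => /andP[].
Qed.

Lemma measurable_coord c : measurable_fun setT (fun y : MI => y c).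
Proof.
apply: (measurability _ (RGenOInfty.measurableE R)).
move=> _ [_ [x ->] <-]; rewrite setTI.
apply: sub_sigma_algebra; exists [:: c], (fun=> x).
apply/seteqP; split=> y /=; rewrite in_itv /= andbT.
  by move=> h c'; rewrite inE => /eqP ->.
by move=> /(_ c); rewrite inE eqxx; apply.
Qed.

Section Maps.
Context d (T : measurableType d).

Lemma measurable_MI (Y : T -> MI) :
  (forall c, measurable_fun setT (fun w => Y w c)) -> measurable_fun setT Y.
Proof.
move=> h; apply: (@measurability _ _ T MI setT Y uppers) => //.
move=> _ [_ [s [r ->]] <-]; rewrite setTI.
have -> : Y @^-1` upper s r = [set w | all (fun c => r c < Y w c) s].
  by apply/seteqP; split=> w /=; [move=> H; apply/allP|move/allP].
apply: bool_measurable; elim: s => [|c s IH] /=; first exact: measurable_cst.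
by apply: measurable_and => //; apply: measurable_fun_ltr.
Qed.

Lemma measurable_upper (Y : T -> MI) s r : measurable_fun setT Y ->
  measurable [set w | upper s r (Y w)].
Proof.
move=> mY; rewrite -[X in measurable X]setTI; apply: mY => //.
by apply: sub_sigma_algebra; exists s, r.
Qed.

End Maps.

Lemma law_unique d d' (T : measurableType d) (T' : measurableType d')
    (P : probability T R) (P' : probability T' R) (Y : T -> MI) (Y' : T' -> MI) f :
  measurable_fun setT Y -> measurable_fun setT Y' ->
  (forall s r, P [set w | upper s r (Y w)] = P' [set w | upper s r (Y' w)]) ->
  bm f -> Ex P (fun w => f (Y w)) = Ex P' (fun w => f (Y' w)).
Proof.
move=> mY mY' h bf.
pose p1 : {measure set MI -> \bar R} := pushforward P Y.
pose p2 : {measure set MI -> \bar R} := pushforward P' Y'.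
pose m1 := p1 mY; pose m2 := p2 mY'.
have eqm A : measurable A -> m1 A = m2 A.
  move=> mA.
  apply: (@measure_unique _ _ MI uppers (fun=> setT) erefl _ _ _ m1 m2) => //.
  - exact: uppersI.
  - by move=> _; exists [::], (fun=> 0); apply/seteqP; split.
  - by rewrite bigcup_const.
  - by move=> _ [s [r ->]]; exact: h.
  - move=> _; rewrite -[X in (X < _)%E]/(P (Y @^-1` setT)).
    by rewrite preimage_setT probability_setT ltry.
have E1 : Ex P (fun w => f (Y w)) = \int[m1]_y f y.
  rewrite /Ex /Rintegral; congr fine; symmetry; apply: (integral_pushforward mY).
  - by apply/measurable_EFinP; exact: bf.1.
  - exact: (bm_integrable P (bm_comp mY bf)).
  - by [].
have E2 : Ex P' (fun w => f (Y' w)) = \int[m2]_y f y.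
  rewrite /Ex /Rintegral; congr fine; symmetry; apply: (integral_pushforward mY').
  - by apply/measurable_EFinP; exact: bf.1.
  - exact: (bm_integrable P' (bm_comp mY' bf)).
  - by [].
rewrite E1 E2 /Rintegral; congr fine.
by apply: eq_measure_integral => A mA _; exact: eqm.
Qed.

Definition mix (S : I -> bool) (y y' : I -> R) : I -> R :=
  fun c => if S c then y' c else y c.

(** Independence of the block [S] from the other coordinates, tested on the generating sets. *)
Definition splits d (T : measurableType d) (P : probability T R) (Y : T -> MI)
    (S : I -> bool) : Prop :=
  forall s r, P [set w | upper s r (Y w)] =
    (P [set w | upper [seq c <- s | ~~ S c] r (Y w)] *
     P [set w | upper [seq c <- s | S c] r (Y w)])%E.

(** By independence, replacing the block [S] by that of an independent copy does not change the law
    of [Y]. The centring arguments take the mean over [w'] while [w] is fixed. *)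
Lemma Ex_mix d (T : measurableType d) (P : probability T R) (Y : T -> MI) S f :
  measurable_fun setT Y -> splits P Y S -> bm f ->
  Ex P (fun w => f (Y w)) = Ex P (fun w => Ex P (fun w' => f (mix S (Y w) (Y w')))).
Proof.
move=> mY hS bf.
pose Y2 (z : T * T) : MI := mix S (Y z.1) (Y z.2).
have mYc c : measurable_fun setT (fun w => Y w c).
  exact: measurableT_comp (measurable_coord c) mY.
have mY2 : measurable_fun setT Y2.
  apply: measurable_MI => c; rewrite /Y2 /mix; case: (S c).
    exact: measurableT_comp (mYc c) measurable_snd.
  exact: measurableT_comp (mYc c) measurable_fst.
rewrite (law_unique (P' := (P \x P)%E) (Y' := Y2) mY mY2) //; last first.
  move=> s r; rewrite hS.
  have -> : [set z | upper s r (Y2 z)] =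
     [set w | upper [seq c <- s | ~~ S c] r (Y w)] `*`
     [set w | upper [seq c <- s | S c] r (Y w)].
    apply/seteqP; split=> [z /= h|z /= [h h'] c cs].
      by split=> c; rewrite mem_filter => /andP[Sc cs]; have := h c cs;
        rewrite /Y2 /mix ?(negbTE Sc) ?Sc.
    by rewrite /Y2 /mix; case: ifPn => Sc; [apply: h'|apply: h];
      rewrite mem_filter Sc.
  by symmetry; apply: product_measure1E; exact: measurable_upper.
by rewrite (Ex_prod P P (bm_comp mY2 bf)).
Qed.

End CoordinateSpace.

(** * The random input of a network *)

Inductive coord := cX of nat | cR of nat | cT of nat | cE | cW of nat & nat
  | cV of nat | cC1 of nat | cC2 of nat | cB of nat.
HB.instance Definition _ := gen_eqMixin coord.
HB.instance Definition _ := gen_choiceMixin coord.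
HB.instance Definition _ := gen_eqMixin prim.

Definition prim_of (c : coord) : prim :=
  match c with
  | cX _ | cR _ => PInit
  | cT _ | cE => PArr
  | cW i k => PW i k
  | cV j => PV j
  | cC1 j => PC1 j
  | cC2 j => PC2 j
  | cB j => PB j
  end.

Lemma measurable_fun_gt d (T : measurableType d) (R : realType) (f : T -> R) :
  (forall r, measurable [set w | r < f w]) -> measurable_fun setT f.
Proof.
move=> h; apply: (measurability _ (RGenOInfty.measurableE R)).
move=> _ [_ [x ->] <-]; rewrite setTI.
have -> : f @^-1` `]x, +oo[ = [set w | x < f w]; last exact: h.
by apply/seteqP; split=> w /=; rewrite in_itv /= andbT.
Qed.

Section ArrivalTimes.
Variables (R : realType) (Ec : R -> nat).
Hypotheses (Emono : forall s t, 0 <= s -> s <= t -> (Ec s <= Ec t)%N)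
  (Ercont : forall t, 0 <= t -> exists2 del, 0 < del &
        forall s, t <= s -> s < t + del -> Ec s = Ec t).

(** Right continuity gives an interval after [u] without new arrivals, so the infimum is attained.
    The hypothesis on [t] excludes the empty set, whose infimum is 0 by convention. *)
Lemma arr_time_gt j t u : 0 <= t -> (j < Ec t)%N -> 0 <= u ->
  (u < arr_time Ec j) = (Ec u <= j)%N.
Proof.
move=> t0 jt u0; have lb : has_lbound [set s | 0 <= s /\ (j < Ec s)%N].
  by exists 0 => s [].
have hi : has_inf [set s | 0 <= s /\ (j < Ec s)%N] by split=> //; exists t.
rewrite ltNge leqNgt; congr negb; apply/idP/idP => [h|ju]; last exact: ge_inf.
rewrite ltnNge; apply/negP => Eu.
have [del del0 hd] := Ercont u0.
suff : u + del <= arr_time Ec j.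
  by move=> /le_trans /(_ h); rewrite gerDl leNgt del0.
apply: lb_le_inf; first by exists t.
move=> s [s0 js]; rewrite leNgt; apply/negP => su.
have [us|su'] := leP u s; first by rewrite (hd s us su) ltnNge Eu in js.
by have := leq_trans js (leq_trans (Emono s0 (ltW su')) Eu); rewrite ltnn.
Qed.

Lemma arr_time_ge0 j : 0 <= arr_time Ec j.
Proof.
rewrite /arr_time; set A := [set s | _].
have [A0|/set0P/negP/negPn/eqP ->] := pselect (A !=set0).
  by apply: lb_le_inf => // s [].
by rewrite inf0.
Qed.

Lemma arr_time_le j t : 0 <= t -> (j < Ec t)%N -> arr_time Ec j <= t.
Proof. by move=> t0 jt; apply: ge_inf => //; exists 0 => s []. Qed.

Lemma arr_time_mono i j t : 0 <= t -> (i <= j)%N -> (j < Ec t)%N ->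
  arr_time Ec i <= arr_time Ec j.
Proof.
move=> t0 ij jt; rewrite leNgt; apply/negP => h.
have it := leq_ltn_trans ij jt.
have a0 := arr_time_ge0 j.
rewrite (arr_time_gt t0 it a0) in h.
by have := ltxx (arr_time Ec j); rewrite (arr_time_gt t0 jt a0) (leq_trans h).
Qed.

End ArrivalTimes.

Section Input.
Context (R : realType) (d : measure_display) (Omega : measurableType d)
  (P : probability Omega R).
Variables (G lam : R -> R) (aN : nat -> R)
  (X0 : nat -> nat -> Omega -> nat) (A0 Res : nat -> nat -> Omega -> R)
  (W : nat -> nat -> nat -> Omega -> R) (E : nat -> R -> Omega -> nat)
  (V : nat -> nat -> Omega -> R) (C1 C2 : nat -> nat -> Omega -> nat)
  (Bt : nat -> nat -> Omega -> bool) (N : nat) (t : R).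
Hypotheses (net : sq2_network P X0 A0 Res W E V C1 C2 Bt G lam aN N)
  (N0 : (0 < N)%N) (t0 : 0 <= t).

(** Ages are left out, as they act only through the law of the residual services. The residual of an
    empty server is replaced by 1, because the events of [PInit] do not constrain it. Arrivals
    beyond the horizon share the time [t + 1], which keeps the times nondecreasing. *)
Definition input (w : Omega) : MI coord R := fun c =>
  match c with
  | cX i => if (i < N)%N then (X0 N i w)%:R else 0
  | cR i => if (i < N)%N && (0 < X0 N i w)%N then Res N i w else 1
  | cT j => if (j < E N t w)%N then arr_time (E N ^~ w) j else t + 1
  | cE => (E N t w)%:R
  | cW i k => W N i k w
  | cV j => V N j w
  | cC1 j => (C1 N j w)%:R
  | cC2 j => (C2 N j w)%:R
  | cB j => (Bt N j w)%:R
  end.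

(** The event depends on the arrival process at the single time [min r t], hence is expressed by
    generating events of [PArr]. *)
Lemma input_tau j r w : (r < input w (cT j)) =
  if r < 0 then true else if r < t + 1 then (E N (Num.min r t) w <= j)%N else false.
Proof.
have [_ [cp _]] := net; have [_ Em Er] := cp w; rewrite /=.
case: (ltP r 0) => r0.
  case: ifP => _; rewrite (lt_le_trans r0) //; first exact: arr_time_ge0.
  by rewrite addr_ge0.
case: ifPn => jE.
  rewrite (arr_time_gt Em Er t0 jE r0).
  case: (ltP r (t + 1)) => rt1.
    case: (leP r t) => rt //; apply/idP/idP => h; last by rewrite leqNgt jE in h.
    by rewrite (leq_trans _ h) // Em // ltW.
  have tr : t <= r by apply: le_trans rt1; rewrite lerDl.
  by apply/negbTE; rewrite -ltnNge (leq_trans jE) // Em.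
case: ltP => // _; symmetry; rewrite -leqNgt in jE; rewrite (leq_trans _ jE) //.
by apply: Em; [rewrite le_min r0 t0|rewrite ge_min lexx orbT].
Qed.

Lemma input_tau_ge0 j w : 0 <= input w (cT j).
Proof.
rewrite /=; case: ifP => _; first exact: arr_time_ge0.
by rewrite addr_ge0.
Qed.

Lemma input_tau_mono i j w : (i <= j)%N -> input w (cT i) <= input w (cT j).
Proof.
have [_ [cp _]] := net; have [_ Em Er] := cp w => ij /=.
case: (ltnP j (E N t w)) => jE.
  rewrite (leq_ltn_trans ij jE); exact: (arr_time_mono Em Er t0 ij jE).
case: (ltnP i (E N t w)) => iE //; apply: le_trans (arr_time_le t0 iE) _.
by rewrite lerDl.
Qed.

Lemma measurable_nat_fun (f : Omega -> nat) :
  (forall m, measurable [set w | f w = m]) ->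
  forall S : set nat, measurable [set w | S (f w)].
Proof.
move=> h S.
have -> : [set w | S (f w)] = \bigcup_(m in S) [set w | f w = m].
  by apply/seteqP; split=> [w Sw|w [m Sm /= e]] /=; [exists (f w)|rewrite e].
exact: bigcup_measurable.
Qed.

Lemma measurable_natr (f : Omega -> nat) :
  (forall m, measurable [set w | f w = m]) -> measurable_fun setT (fun w => (f w)%:R : R).
Proof.
by move=> h; apply: measurable_fun_gt => r; apply: (measurable_nat_fun h (fun m => r < m%:R)).
Qed.

Lemma measurable_input : measurable_fun setT input.
Proof.
have [[mX [_ [mR [mW [mE [mV [mC mB]]]]]]] _] := net.
apply: measurable_MI => -[i|i|j||i k|j|j|j|j] //=.
- by case: (i < N)%N; [exact: measurable_natr|exact: measurable_cst].
- case: (i < N)%N => /=; last exact: measurable_cst.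
  apply: measurable_fun_ifT => //; apply: measurable_bool.
  exact: (measurable_nat_fun (mX i) (fun m => (0 < m)%N)).
- apply: measurable_fun_gt => r.
  rewrite [X in measurable X](_ : _ = [set w | if r < 0 then true else if r < t + 1 then (E N (Num.min r t) w <= j)%N else false]); last first.
    by apply/seteqP; split=> w /=; rewrite -(input_tau j r w).
  case: (r < 0).
    by rewrite [X in measurable X](_ : _ = setT) //; apply/seteqP; split.
  case: (r < t + 1); last by rewrite [X in measurable X](_ : _ = set0) //; apply/seteqP; split.
  exact: (measurable_nat_fun (mE _) (fun m => (m <= j)%N)).
- exact: measurable_natr.
- by apply: measurable_natr => m; case: (mC j m).
- by apply: measurable_natr => m; case: (mC j m).
- by have [] := bm_bool R (measurable_bool (mB j)).
Qed.

Definition prim_upper (p : prim) (s : seq coord) (r : coord -> R) : set Omega :=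
  [set w | forall c, c \in s -> prim_of c = p -> r c < input w c].

Lemma prim_upperP p s r :
  prim_events X0 A0 Res W E V C1 C2 Bt N p (prim_upper p s r).
Proof.
case: p => [||i k|j|j|j|j] /=.
(* Bounds on coordinates of servers outside the network are deterministic conditions. They are put
   into the sets for the lengths and recovered from server 0, which exists because [N] is
   positive. *)
- pose K : Prop := forall c, c \in s -> 
    match c with cX i => (N <= i)%N -> r c < 0 | cR i => (N <= i)%N -> r c < 1 | _ => True end.
  exists (fun i n => [/\ K, (cX i \in s -> r (cX i) < n%:R) &
     (cR i \in s -> n = 0%N -> r (cR i) < 1)]), (fun=> setT), (fun i => cR i \in s), (fun i => r (cR i)).
  split; first by move=> _; exact: measurableT.
  apply/seteqP; split=> w.
    move=> h i iN; split=> //.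
      split=> [[i'|i'|?||? ?|?|?|?|?] cs //= Ni'|cs|cs x0].
      - by have := h _ cs erefl; rewrite /= ltnNge Ni'.
      - by have := h _ cs erefl; rewrite /= ltnNge Ni'.
      - by have := h _ cs erefl; rewrite /= iN.
      - by have := h _ cs erefl; rewrite /= x0 andbF.
    by move=> cs x0; have := h _ cs erefl; rewrite /= iN x0.
  move=> h [i|i|?||? ?|?|?|?|?] cs //= _.
    have [[k _ _] _ _] := h 0%N N0.
    case: ltnP => iN; last exact: (k _ cs).
    by have [[_ + _] _ _] := h i iN; apply.
  have [[k _ _] _ _] := h 0%N N0.
  case: ltnP => iN /=; last exact: (k _ cs).
  have [[_ _ hR] _ hR'] := h i iN.
  by case: posnP => x0; [apply: hR|apply: hR'].
- exists (size s), (fun i => if nth cE s i is cT j then Num.min (r (cT j)) t else t),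
    (fun i n => match nth cE s i return Prop with
       | cT j => is_true (if r (cT j) < 0 then true else if r (cT j) < t + 1 then (n <= j)%N else false)
       | cE => r cE < n%:R | _ => True end).
  apply/seteqP; split=> w /= h.
    move=> i ins; have := h _ (mem_nth cE ins).
    case: (nth cE s i) => //= [j|] /(_ erefl) //.
    by have /= -> := input_tau j (r (cT j)) w.
  move=> c cs pc; have := h (index c s); rewrite index_mem cs => /(_ isT).
  rewrite nth_index //; case: c cs pc => //= j cs _.
  by have /= -> := input_tau j (r (cT j)) w.
- exists [set x | cW i k \in s -> r (cW i k) < x]; split.
    case: (cW i k \in s); last by rewrite [X in measurable X](_ : _ = setT) //; apply/seteqP; split.
    rewrite [X in measurable X](_ : _ = `]r (cW i k), +oo[%classic) //.
    by apply/seteqP; split=> x /=; rewrite in_itv /= andbT; [apply|move=> ? _].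
  apply/seteqP; split=> w /= h; first by move=> cs; apply: (h _ cs).
  by move=> [?|?|?||? ?|?|?|?|?] cs //= [e1 e2]; subst; apply: h.
- exists [set x | cV j \in s -> r (cV j) < x]; split.
    case: (cV j \in s); last by rewrite [X in measurable X](_ : _ = setT) //; apply/seteqP; split.
    rewrite [X in measurable X](_ : _ = `]r (cV j), +oo[%classic) //.
    by apply/seteqP; split=> x /=; rewrite in_itv /= andbT; [apply|move=> ? _].
  apply/seteqP; split=> w /= h; first by move=> cs; apply: (h _ cs).
  by move=> [?|?|?||? ?|?|?|?|?] cs //= [e1]; subst; apply: h.
- exists [set n | cC1 j \in s -> r (cC1 j) < n%:R].
  apply/seteqP; split=> w /= h; first by move=> cs; apply: (h _ cs).
  by move=> [?|?|?||? ?|?|?|?|?] cs //= [e1]; subst; apply: h.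
- exists [set n | cC2 j \in s -> r (cC2 j) < n%:R].
  apply/seteqP; split=> w /= h; first by move=> cs; apply: (h _ cs).
  by move=> [?|?|?||? ?|?|?|?|?] cs //= [e1]; subst; apply: h.
- exists [set b | cB j \in s -> r (cB j) < (nat_of_bool b)%:R].
  apply/seteqP; split=> w /= h; first by move=> cs; apply: (h _ cs).
  by move=> [?|?|?||? ?|?|?|?|?] cs //= [e1]; subst; apply: h.
Qed.

Lemma prim_upper_out p s r : (forall c, c \in s -> prim_of c != p) ->
  prim_upper p s r = setT.
Proof.
by move=> h; apply/seteqP; split=> // w _ c cs pc; have := h c cs; rewrite pc eqxx.
Qed.

Lemma upper_prod (ps : seq prim) s r : uniq ps ->
  (forall c, c \in s -> prim_of c \in ps) ->
  P [set w | upper s r (input w)] = (\prod_(p <- ps) P (prim_upper p s r))%E.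
Proof.
move=> ups sps; have [_ [_ [indep _]]] := net.
rewrite (big_nth PInit) big_mkord.
rewrite -(indep (size ps) (nth PInit ps) (fun k => prim_upper (nth PInit ps k) s r)); last first.
- by move=> k _; exact: prim_upperP.
- by move=> k k' kp kp' /eqP; rewrite nth_uniq // => /eqP.
congr (P _); apply/seteqP; split=> [w h k _ c cs _|w h c cs]; first exact: h.
have := h (index (prim_of c) ps); rewrite /= index_mem sps // => /(_ isT) /(_ c cs).
by rewrite nth_index ?sps //; apply.
Qed.

(** The law factors over primitives, so any block consisting of whole primitives splits off. *)
Lemma input_splits (S : coord -> bool) (S' : prim -> bool) :
  (forall c, S c = S' (prim_of c)) -> splits P input S.
Proof.
move=> SS s r.
pose ps := undup (map prim_of s).
have ups : uniq ps by exact: undup_uniq.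
have sps c : c \in s -> prim_of c \in ps by rewrite mem_undup; exact: map_f.
rewrite (upper_prod r ups sps).
rewrite (upper_prod (s := [seq c <- s | ~~ S c]) r ups); last first.
  by move=> c; rewrite mem_filter => /andP[_ /sps].
rewrite (upper_prod (s := [seq c <- s | S c]) r ups); last first.
  by move=> c; rewrite mem_filter => /andP[_ /sps].
rewrite -big_split /=; apply: eq_bigr => p _.
case Sp : (S' p).
  rewrite (@prim_upper_out p [seq c <- s | ~~ S c]); last first.
    by move=> c; rewrite mem_filter SS => /andP[+ _]; apply: contra => /eqP ->; rewrite Sp.
  rewrite probability_setT mul1e; congr (P _).
  apply/seteqP; split=> w h c cs pc; first by apply: h => //; move: cs; rewrite mem_filter => /andP[].
  by apply: h => //; rewrite mem_filter SS pc Sp.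
rewrite (@prim_upper_out p [seq c <- s | S c]); last first.
  by move=> c; rewrite mem_filter SS => /andP[Sc _]; apply/eqP => pc; rewrite pc Sp in Sc.
rewrite probability_setT mule1; congr (P _).
apply/seteqP; split=> w h c cs pc; first by apply: h => //; move: cs; rewrite mem_filter => /andP[].
by apply: h => //; rewrite mem_filter SS pc Sp.
Qed.

Lemma Ex_resample (S : coord -> bool) (S' : prim -> bool) (f : MI coord R -> R) :
  (forall c, S c = S' (prim_of c)) -> bm f ->
  Ex P (fun w => f (input w)) =
  Ex P (fun w => Ex P (fun w' => f (mix S (input w) (input w')))).
Proof.
move=> SS; apply: Ex_mix; first exact: measurable_input.
exact: input_splits SS.
Qed.

End Input.

(** * Measurability of the path functionals *)

Section NatMeasurable.
Context d (T : measurableType d).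

Lemma mf_natP (c : T -> nat) :
  (forall n, measurable [set x | c x = n]) -> measurable_fun setT c.
Proof.
move=> h _ Y _; rewrite setTI.
have -> : c @^-1` Y = \bigcup_(m in Y) [set x | c x = m].
  by apply/seteqP; split=> [w Sw|w [m Sm /= e]] /=; [exists (c w)|rewrite e].
exact: bigcup_measurable.
Qed.

Lemma nat_mf (c : T -> nat) n : measurable_fun setT c -> measurable [set x | c x = n].
Proof. by move=> mc; have := mc measurableT [set n] I; rewrite setTI. Qed.

Lemma mf_index d' (T' : measurableType d') (f : nat -> T -> T') (c : T -> nat) :
  (forall n, measurable_fun setT (f n)) -> measurable_fun setT c ->
  measurable_fun setT (fun x => f (c x) x).
Proof.
move=> mf mc _ Y mY; rewrite setTI.
have -> : (fun x => f (c x) x) @^-1` Y =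
    \bigcup_n ([set x | c x = n] `&` f n @^-1` Y).
  apply/seteqP; split=> [w Sw|w [m _ [/= e]]] /=; first by exists (c w).
  by rewrite e.
apply: bigcup_measurable => n _; apply: measurableI; first exact: nat_mf.
by have := mf n measurableT Y mY; rewrite setTI.
Qed.

(** A countable case distinction on the value of [c]; it is applied to the list of initial queue
    lengths. *)
Lemma mf_count_index (C : countType) d' (T' : measurableType d')
    (f : C -> T -> T') (c : T -> C) (a0 : C) :
  (forall a, measurable_fun setT (f a)) ->
  (forall a, measurable [set x | c x = a]) ->
  measurable_fun setT (fun x => f (c x) x).
Proof.
move=> mf mc.
have -> : (fun x => f (c x) x) = (fun x => (fun n => f (odflt a0 (unpickle n))) (pickle (c x)) x).
  by apply/funext => x; rewrite pickleK.
apply: (mf_index (f := fun n => f (odflt a0 (unpickle n)))) => //.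
apply: mf_natP => n.
case E : (pickle_inv n : option C) => [a|].
  rewrite [X in measurable X](_ : _ = [set x | c x = a]) //.
  have := pickle_invK n (T := C); rewrite /oapp E => ean.
  apply/seteqP; split=> x /=; last by move=> ->.
  by rewrite -ean => /(pcan_inj pickleK).
rewrite [X in measurable X](_ : _ = set0) //; apply/seteqP; split=> x //= e.
by move: E; rewrite -e pickleK_inv.
Qed.

Lemma mf_bool_nat (b : T -> bool) : measurable_fun setT b ->
  measurable_fun setT (fun x => nat_of_bool (b x)).
Proof.
move=> mb; have -> : (fun x => nat_of_bool (b x)) = (fun x => if b x then 1%N else 0%N).
  by apply/funext => x; case: (b x).
exact: measurable_fun_ifT.
Qed.

Lemma mf_sumn (I : Type) (s : seq I) (p : pred I) (f : I -> T -> nat) :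
  (forall i, measurable_fun setT (f i)) ->
  measurable_fun setT (fun x => \sum_(i <- s | p i) f i x)%N.
Proof.
move=> h; elim: s => [|i s IH].
  by under eq_fun do rewrite big_nil; exact: measurable_cst.
under eq_fun do rewrite big_cons.
by case: (p i) => //; apply: measurable_fun_addn.
Qed.

Lemma mf_natr (R : realType) (c : T -> nat) : measurable_fun setT c ->
  measurable_fun setT (fun x => (c x)%:R : R).
Proof.
move=> mc; apply: measurable_fun_gt => r.
have := mc measurableT [set m | r < m%:R] I; rewrite setTI; exact.
Qed.

Lemma mf_trunc (R : realType) (f : T -> R) : measurable_fun setT f ->
  measurable_fun setT (fun x => Num.truncn (f x)).
Proof.
move=> mf; apply: mf_natP => n.
have mge m : measurable [set x | (m < Num.truncn (f x))%N].
  rewrite [X in measurable X](_ : _ = [set x | m.+1%:R <= f x]); last first.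
    by apply/seteqP; split=> x /=; rewrite truncn_gt_nat.
  by apply: bool_measurable; apply: measurable_fun_ler.
case: n => [|n].
  rewrite [X in measurable X](_ : _ = ~` [set x | (0 < Num.truncn (f x))%N]).
    exact: measurableC.
  apply/seteqP; split=> x /=; first by move=> ->.
  by move/negP; rewrite lt0n negbK => /eqP.
rewrite [X in measurable X](_ : _ = [set x | (n < Num.truncn (f x))%N] `\` [set x | (n.+1 < Num.truncn (f x))%N]).
  exact: measurableD.
apply/seteqP; split=> x /=; first by move=> ->; rewrite ltnn ltnSn; split.
by case=> h1 /negP; rewrite -leqNgt => h2; apply/eqP; rewrite eqn_leq h1 h2.
Qed.

End NatMeasurable.

Section MeasurableSystem.
Context d (T : measurableType d) (R : realType).
Variables (oT : T -> outer R) (wT : T -> inner R).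
Variables (N n0 : nat) (fs : nat -> nat) (hb : nat -> bool).
Hypotheses (o1 : forall x, on0 (oT x) = n0) (o2 : forall x, ofs (oT x) = fs)
  (o3 : forall x, ohb (oT x) = hb) (oNE : forall x, oN (oT x) = N)
  (mhr : forall i, measurable_fun setT (fun x => ohr (oT x) i))
  (mot : forall i, measurable_fun setT (fun x => ot (oT x) i))
  (my : forall i, measurable_fun setT (fun x => iy (wT x) i))
  (mc1 : forall i, measurable_fun setT (fun x => ic1 (wT x) i))
  (mc2 : forall i, measurable_fun setT (fun x => ic2 (wT x) i))
  (mb : forall i, measurable_fun setT (fun x => ib (wT x) i)).

Let mQL k :
  (forall i s, measurable_fun setT s ->
     measurable_fun setT (fun x => Q (oT x) (wT x) k i (s x))) /\
  (forall i, measurable_fun setT (fun x => L (oT x) (wT x) k i)).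
Proof.
have key k' : (forall i s, measurable_fun setT s ->
     measurable_fun setT (fun x => Q (oT x) (wT x) k' i (s x))) ->
     measurable_fun setT (fun x => sv (oT x) (wT x) k').
  move=> mQ; under eq_fun do rewrite svE o1 o2.
  case: (k' < n0)%N; first exact: measurable_cst.
  rewrite /pick2.
  have mq1 : measurable_fun setT (fun x => Q (oT x) (wT x) k' (ic1 (wT x) k') (ot (oT x) k')).
    by apply: (mf_index (f := fun i x => Q (oT x) (wT x) k' i (ot (oT x) k'))) => // i; apply: mQ.
  have mq2 : measurable_fun setT (fun x => Q (oT x) (wT x) k' (ic2 (wT x) k') (ot (oT x) k')).
    by apply: (mf_index (f := fun i x => Q (oT x) (wT x) k' i (ot (oT x) k'))) => // i; apply: mQ.
  apply: measurable_fun_ifT => //; first exact: measurable_fun_ltn.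
  apply: measurable_fun_ifT => //; first exact: measurable_fun_ltn.
  exact: measurable_fun_ifT.
elim: k => [|k [IQ IL]].
  split=> [i s ms|i].
    under eq_fun do rewrite Q0 o3; apply: mf_bool_nat; apply: measurable_and => //.
    exact: measurable_fun_ltr.
  by under eq_fun do rewrite L0 o3; case: (hb i); [exact: mhr|exact: measurable_cst].
have msv := key k IQ.
have mLs : measurable_fun setT (fun x => L (oT x) (wT x) k (sv (oT x) (wT x) k)).
  exact: (mf_index (f := fun i x => L (oT x) (wT x) k i)).
have mdp : measurable_fun setT (fun x => dp (oT x) (wT x) k).
  rewrite /dp /st; apply: measurable_funD => //.
  exact: measurable_maxr.
have mse i : measurable_fun setT (fun x => sv (oT x) (wT x) k == i).
  by apply: measurable_fun_eqn => //.
split=> [i s ms|i].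
  under eq_fun do rewrite QS; apply: measurable_fun_addn; first exact: IQ.
  apply: mf_bool_nat; apply: measurable_and => //; exact: measurable_fun_ltr.
under eq_fun do rewrite LS; exact: measurable_fun_ifT.
Qed.

Lemma mf_Q k i (s : T -> R) : measurable_fun setT s ->
  measurable_fun setT (fun x => Q (oT x) (wT x) k i (s x)).
Proof. by case: (mQL k) => + _; apply. Qed.

Lemma mf_L k i : measurable_fun setT (fun x => L (oT x) (wT x) k i).
Proof. by case: (mQL k) => _; apply. Qed.

Lemma mf_sv k : measurable_fun setT (fun x => sv (oT x) (wT x) k).
Proof.
have mQ := mf_Q k.
under eq_fun do rewrite svE o1 o2.
case: (k < n0)%N; first exact: measurable_cst.
rewrite /pick2.
have mq1 : measurable_fun setT (fun x => Q (oT x) (wT x) k (ic1 (wT x) k) (ot (oT x) k)).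
  by apply: (mf_index (f := fun i x => Q (oT x) (wT x) k i (ot (oT x) k))) => // i; apply: mQ.
have mq2 : measurable_fun setT (fun x => Q (oT x) (wT x) k (ic2 (wT x) k) (ot (oT x) k)).
  by apply: (mf_index (f := fun i x => Q (oT x) (wT x) k i (ot (oT x) k))) => // i; apply: mQ.
apply: measurable_fun_ifT => //; first exact: measurable_fun_ltn.
apply: measurable_fun_ifT => //; first exact: measurable_fun_ltn.
exact: measurable_fun_ifT.
Qed.

Lemma mf_Qsv j k (s : T -> R) : measurable_fun setT s ->
  measurable_fun setT (fun x => Q (oT x) (wT x) k (sv (oT x) (wT x) j) (s x)).
Proof.
move=> ms; apply: (mf_index (f := fun i x => Q (oT x) (wT x) k i (s x))).
  by move=> i; apply: mf_Q.
exact: mf_sv.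
Qed.

Lemma mf_Lsv j k : measurable_fun setT (fun x => L (oT x) (wT x) k (sv (oT x) (wT x) j)).
Proof.
apply: (mf_index (f := fun i x => L (oT x) (wT x) k i)); last exact: mf_sv.
by move=> i; apply: mf_L.
Qed.

Lemma mf_st k : measurable_fun setT (fun x => st (oT x) (wT x) k).
Proof. by apply: measurable_maxr => //; exact: mf_Lsv. Qed.

Lemma mf_dp k : measurable_fun setT (fun x => dp (oT x) (wT x) k).
Proof. by apply: measurable_funD => //; exact: mf_st. Qed.

Lemma mf_zi k (s s' : T -> R) l i : measurable_fun setT s -> measurable_fun setT s' ->
  measurable_fun setT (fun x => zi (oT x) (wT x) k (s x) (s' x) l i).
Proof.
move=> ms ms'; apply: measurable_and.
  by apply: measurable_fun_leq => //; apply: mf_Q.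
by apply: measurable_fun_eqn; apply: mf_Q.
Qed.

Lemma mf_Jf k (s : T -> R) l kk : measurable_fun setT s ->
  measurable_fun setT (fun x => Jf (oT x) (wT x) k (s x) l kk).
Proof.
move=> ms; apply: measurable_and.
  by apply: measurable_fun_ltr => //; exact: mf_Lsv.
apply: measurable_and; first by apply: measurable_fun_ler => //; exact: mf_st.
apply: measurable_fun_leq => //; apply: mf_sumn => j.
apply: mf_bool_nat; apply: measurable_and.
  by apply: measurable_fun_eqn; exact: mf_sv.
by apply: measurable_fun_ltr => //; exact: mf_st.
Qed.

Lemma mf_arr l (s : T -> R) j : measurable_fun setT s ->
  measurable_fun setT (fun x => arr (oT x) (wT x) l (s x) j).
Proof.
move=> ms; rewrite /arr; case: (l == 1)%N; apply: measurable_and.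
- by apply: measurable_fun_eqn => //; apply: mf_Qsv.
- by apply: measurable_fun_ltr => //; exact: mf_dp.
- by apply: measurable_fun_eqn => //; apply: mf_Qsv.
- by apply: measurable_fun_eqn; apply: mf_Qsv.
Qed.

End MeasurableSystem.

Section InputSystem.
Variables (R : realType) (N : nat).

(** [pos] and [clip] make every point of the coordinate space a well-formed input, so that the
    pathwise identities hold everywhere and not just almost surely. *)
Definition pos (r : R) : R := if 0 < r then r else 1.
Definition clip (n : nat) : nat := if (n < N)%N then n else 0%N.

Lemma pos_gt0 r : 0 < pos r. Proof. by rewrite /pos; case: ifP. Qed.
Lemma clip_lt n : (0 < N)%N -> (clip n < N)%N.
Proof. by rewrite /clip; case: ifP. Qed.

(** For fixed initial lengths the numbering of the waiting jobs is constant. Separating this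
    discrete argument reduces measurability to a countable case distinction. *)
Definition xs (y : coord -> R) : seq nat := mkseq (fun i => Num.truncn (y (cX i))) N.

Definition outer_at (x : seq nat) (y : coord -> R) : outer R :=
  mk_outer N (nth 0%N x) (fun i => pos (y (cR i))) (fun j => y (cT j)).

Definition inner_at (x : seq nat) (y : coord -> R) : inner R :=
  mk_inner N (nth 0%N x) (fun i k => pos (y (cW i k))) (fun j => pos (y (cV j)))
    (fun j => clip (Num.truncn (y (cC1 j)))) (fun j => clip (Num.truncn (y (cC2 j))))
    (fun j => 0 < y (cB j)).

Definition outer_of y := outer_at (xs y) y.
Definition inner_of y := inner_at (xs y) y.

Definition arrivals (y : coord -> R) : nat := Num.truncn (y cE).

(* The queue length of server [i] at the horizon [t] of the arrival times. *)
Definition queue i t (y : coord -> R) : nat :=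
  Q (outer_of y) (inner_of y) (on0 (outer_of y) + arrivals y) i t.

Lemma wf_inner_at o x y : (0 < N)%N -> oN o = N -> wf_inner o (inner_at x y).
Proof.
move=> N0 oE; split=> k /=; rewrite ?oE ?clip_lt //.
by case: ifP => _; exact: pos_gt0.
Qed.

Lemma wf_outer_at x y : (0 < N)%N -> (forall j, 0 <= y (cT j)) ->
  (forall i j, (i <= j)%N -> y (cT i) <= y (cT j)) -> wf_outer (outer_at x y).
Proof.
move=> N0 t0 tm; split=> //= [k|k|k|j k jk|i _]; last exact: pos_gt0.
- move=> /wjobP[h1 h2]; rewrite h1; split=> //.
  by move: h2; case: (nth _ x _).
- by move=> ->.
- by case: ifP.
- case: (ltnP k) => kn; first by rewrite (leq_ltn_trans jk kn).
  by case: ltnP => jn //; apply: tm; rewrite leq_sub2r.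
Qed.

Lemma mf_pos d (T : measurableType d) (f : T -> R) :
  measurable_fun setT f -> measurable_fun setT (fun x => pos (f x)).
Proof.
move=> mf; apply: measurable_fun_ifT => //; exact: measurable_fun_ltr.
Qed.

Section InnerMeasurable.
Context d (T : measurableType d) (h : T -> MI coord R) (x : seq nat).
Hypothesis mh : measurable_fun setT h.

Lemma mf_coord c : measurable_fun setT (fun z => h z c).
Proof. exact: measurableT_comp (measurable_coord c) mh. Qed.

Lemma mf_clip (f : T -> R) : measurable_fun setT f ->
  measurable_fun setT (fun z => clip (Num.truncn (f z))).
Proof.
move=> mf; have mt := mf_trunc mf.
by apply: measurable_fun_ifT => //; exact: measurable_fun_ltn.
Qed.

Lemma mf_inner_y i : measurable_fun setT (fun z => iy (inner_at x (h z)) i).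
Proof. by rewrite /=; case: (i < _)%N; apply: mf_pos; exact: mf_coord. Qed.
Lemma mf_inner_c1 i : measurable_fun setT (fun z => ic1 (inner_at x (h z)) i).
Proof. by apply: mf_clip; exact: mf_coord. Qed.
Lemma mf_inner_c2 i : measurable_fun setT (fun z => ic2 (inner_at x (h z)) i).
Proof. by apply: mf_clip; exact: mf_coord. Qed.
Lemma mf_inner_b i : measurable_fun setT (fun z => ib (inner_at x (h z)) i).
Proof. by apply: measurable_fun_ltr => //; exact: mf_coord. Qed.

End InnerMeasurable.

Lemma mf_queue i t : measurable_fun setT (queue i t : MI coord R -> nat).
Proof.
have mid : measurable_fun setT (id : MI coord R -> MI coord R) by [].
pose f (x : seq nat) (y : MI coord R) :=
  Q (outer_at x y) (inner_at x y) (on0 (outer_at x y) + arrivals y) i t.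
have -> : queue i t = fun y => f (xs y) y by [].
apply: (mf_count_index (f := f) (c := xs) [::]) => [x|x].
  pose g n (y : MI coord R) := Q (outer_at x y) (inner_at x y) (on0 (outer_at x y) + n) i t.
  have -> : f x = (fun y : MI coord R => g (arrivals y) y) by [].
  apply: (mf_index (f := g) (c := fun y : MI coord R => arrivals y)).
    move=> n; apply: (@mf_Q _ (MI coord R) R (outer_at x) (inner_at x)
      (size (waiting N (nth 0%N x))) (fun k => (wjob N (nth 0%N x) k).1)
      (fun i => (i < N)%N && (0 < nth 0 x i)%N)) => //.
    - by move=> k; apply: mf_pos; exact: (mf_coord mid).
    - by move=> k /=; case: (k < _)%N; [exact: measurable_cst|exact: (mf_coord mid)].
    - exact: (mf_inner_y x mid).
    - exact: (mf_inner_c1 x mid).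
    - exact: (mf_inner_c2 x mid).
    - exact: (mf_inner_b x mid).
  by apply: mf_trunc; exact: (mf_coord mid).
have [sx|sx] := eqVneq (size x) N; last first.
  rewrite [X in measurable X](_ : _ = set0) //; apply/seteqP; split=> y //= e.
  by move: sx; rewrite -e size_mkseq eqxx.
rewrite [X in measurable X](_ : _ = [set y : MI coord R |
    all (fun k => Num.truncn (y (cX k)) == nth 0%N x k) (iota 0 N)]).
  apply: bool_measurable; elim: (iota 0 N) => [|k s IH] /=; first exact: measurable_cst.
  apply: measurable_and => //; apply: measurable_fun_eqn => //.
  by apply: mf_trunc; exact: (mf_coord mid).
apply/seteqP; split=> y /=.
  by move=> <-; apply/allP => k; rewrite mem_iota => /andP[_ kN]; rewrite /xs nth_mkseq.
move=> h; apply: (@eq_from_nth _ 0%N); first by rewrite size_mkseq sx.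
move=> k; rewrite size_mkseq => kN; rewrite nth_mkseq //.
by have /allP/(_ k) := h; rewrite mem_iota kN => /(_ isT)/eqP.
Qed.

End InputSystem.

(** * Noise of services and of routing *)

Definition service_coord (c : coord) : bool :=
  match c with cW _ _ | cV _ => true | _ => false end.

(** What the noise estimates need of the law of the input: resampling of whole primitives, the
    service law, and the joint law of the two samples, the coin and the service of one arrival. *)
Record driving (R : realType) d (T : measurableType d) (P : probability T R)
    (Y : T -> MI coord R) (G : R -> R) (N : nat) : Prop := Driving {
  drv_meas : measurable_fun setT Y;
  drv_mix : forall (S : coord -> bool) (S' : prim -> bool) (f : MI coord R -> R),
    (forall c, S c = S' (prim_of c)) -> bm f ->
    Ex P (fun w => f (Y w)) = Ex P (fun w => Ex P (fun w' => f (mix S (Y w) (Y w'))));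
  drv_service : forall c r, service_coord c ->
    Ex P (fun w => (r < pos (Y w c))%R%:R) = 1 - G r;
  drv_choice : forall j i1 i2 b r, (i1 < N)%N -> (i2 < N)%N ->
    Ex P (fun w => [&& clip N (Num.truncn (Y w (cC1 j))) == i1,
      clip N (Num.truncn (Y w (cC2 j))) == i2, (0 < Y w (cB j))%R == b &
      (r < pos (Y w (cV j)))%R]%:R) = (2 * N%:R ^+ 2)^-1 * (1 - G r) }.

Lemma Ex_sum_orthogonal d (T : measurableType d) (R : realType)
    (P : probability T R) n (X : nat -> T -> R) (c : R) :
  (forall i, (i < n)%N -> bm (X i)) ->
  (forall i w, (i < n)%N -> `|X i w| <= c) ->
  (forall i j, (i < n)%N -> (j < n)%N -> i != j -> Ex P (fun w => X i w * X j w) = 0) ->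
  Ex P (fun w => (\sum_(i < n) X i w) ^+ 2) <= c ^+ 2 * n%:R.
Proof.
move=> hb h1 h0.
have -> : (fun w => (\sum_(i < n) X i w) ^+ 2) =
    (fun w => \sum_(i < n) \sum_(j < n) X i w * X j w).
  apply/funext => w; rewrite expr2 big_distrl /=; apply: eq_bigr => i _.
  by rewrite big_distrr.
have bij (i j : 'I_n) : bm (fun w => X i w * X j w) by apply: bmM; apply: hb.
rewrite Ex_sum; last by move=> i _; apply: bm_sum => j _; exact: bij.
apply: (@le_trans _ _ (\sum_(i < n) (c ^+ 2 : R))); last by rewrite sumr_const card_ord mulr_natr.
apply: ler_sum => i _; rewrite Ex_sum; last by move=> j _; exact: bij.
rewrite (bigD1 i) //= big1 ?addr0; last first.
  by move=> j ji; apply: h0 => //; rewrite eq_sym.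
apply: Ex_le_cst; first exact: bij.
move=> w; apply: le_trans (ler_norm _) _; rewrite normrM.
by rewrite expr2 ler_pM // h1.
Qed.

Section Pick.
Variables (R : realType) (N m : nat) (q : nat -> nat) (p : nat -> bool).
Hypothesis pq : forall i, p i -> q i = m.

(** A sampled server of length [m] is chosen for both values of the coin if the other one is longer,
    and for one value in a tie. Summed over the other server this gives the counts of [m <= q j] and
    of [m < q j], the source of the factor Z_(l-1) + Z_l in the PDE. *)
Lemma sum_pick2 :
  \sum_(i < N) \sum_(j < N) ((p (pick2 q i j true))%:R + (p (pick2 q i j false))%:R) =
  2 * (\sum_(i < N) (p i)%:R) * (\sum_(j < N) (m <= q j)%:R + \sum_(j < N) (m < q j)%:R) :> R.
Proof.
pose b i j : R := (p i)%:R * ((m <= q j)%:R + (m < q j)%:R).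
have e i j : (p (pick2 q i j true))%:R + (p (pick2 q i j false))%:R = b i j + b j i.
  rewrite /b /pick2.
  case pi : (p i); case pj : (p j); rewrite ?mul0r ?mul1r ?addr0 ?add0r.
  - by rewrite (pq pi) (pq pj) ltnn leqnn pi pj !addr0.
  - rewrite (pq pi); case: (ltngtP m (q j)) => h; rewrite ?pi ?pj //= ?addr0 ?add0r //.
  - rewrite (pq pj); case: (ltngtP (q i) m) => h; rewrite ?pi ?pj //= ?addr0 ?add0r //.
  - by case: ifP => _; [|case: ifP => _]; rewrite ?pi ?pj addr0.
under eq_bigr do under eq_bigr do rewrite e.
have -> : \sum_(i < N) \sum_(j < N) (b i j + b j i) =
    \sum_(i < N) \sum_(j < N) b i j + \sum_(i < N) \sum_(j < N) b j i.
  by rewrite -big_split /=; apply: eq_bigr => i _; rewrite -big_split.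
rewrite [X in _ + X]exchange_big /=.
have -> : \sum_(i < N) \sum_(j < N) b i j = (\sum_(i < N) (p i)%:R) *
    (\sum_(j < N) (m <= q j)%:R + \sum_(j < N) (m < q j)%:R).
  rewrite big_distrl /=; apply: eq_bigr => i _.
  by rewrite -big_split /= big_distrr.
ring.
Qed.

End Pick.

Section Noise.
Context (R : realType) d (T : measurableType d) (P : probability T R).
Variables (Y : T -> MI coord R) (G : R -> R) (N : nat).
Hypotheses (drv : driving P Y G N) (N0 : (0 < N)%N)
  (G01 : forall r, 0 <= G r <= 1) (mG : measurable_fun setT G).
Variables (x : seq nat) (y0 : coord -> R).
Let o := outer_at N x y0.
Hypothesis wo : wf_outer o.

Let v (y : MI coord R) := inner_at N x y.
Let wi y : wf_inner o (v y). Proof. exact: wf_inner_at. Qed.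

Let mY := drv_meas drv.
Let mid : measurable_fun setT (id : MI coord R -> MI coord R). Proof. by []. Qed.

Section Measurability.
Context d' (T' : measurableType d') (h : T' -> MI coord R).
Hypothesis mh : measurable_fun setT h.


Lemma mf_at_st k : measurable_fun setT (fun z => st o (v (h z)) k).
Proof.
apply: (@mf_st _ T' R (fun=> o) (fun z => v (h z)) (on0 o) (ofs o) (ohb o)) => //.
- exact: mf_inner_y. - exact: mf_inner_c1. - exact: mf_inner_c2. - exact: mf_inner_b.
Qed.

Lemma mf_at_dp k : measurable_fun setT (fun z => dp o (v (h z)) k).
Proof.
apply: (@mf_dp _ T' R (fun=> o) (fun z => v (h z)) (on0 o) (ofs o) (ohb o)) => //.
- exact: mf_inner_y. - exact: mf_inner_c1. - exact: mf_inner_c2. - exact: mf_inner_b.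
Qed.

Lemma mf_at_Q k i (s : T' -> R) : measurable_fun setT s ->
  measurable_fun setT (fun z => Q o (v (h z)) k i (s z)).
Proof.
apply: (@mf_Q _ T' R (fun=> o) (fun z => v (h z)) (on0 o) (ofs o) (ohb o)) => //.
- exact: mf_inner_y. - exact: mf_inner_c1. - exact: mf_inner_c2. - exact: mf_inner_b.
Qed.

Lemma mf_at_zi k (s s' : T' -> R) l i : measurable_fun setT s -> measurable_fun setT s' ->
  measurable_fun setT (fun z => zi o (v (h z)) k (s z) (s' z) l i).
Proof.
apply: (@mf_zi _ T' R (fun=> o) (fun z => v (h z)) (on0 o) (ofs o) (ohb o)) => //.
- exact: mf_inner_y. - exact: mf_inner_c1. - exact: mf_inner_c2. - exact: mf_inner_b.
Qed.

Lemma mf_at_Jf k (s : T' -> R) l kk : measurable_fun setT s ->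
  measurable_fun setT (fun z => Jf o (v (h z)) k (s z) l kk).
Proof.
apply: (@mf_Jf _ T' R (fun=> o) (fun z => v (h z)) (on0 o) (ofs o) (ohb o)) => //.
- exact: mf_inner_y. - exact: mf_inner_c1. - exact: mf_inner_c2. - exact: mf_inner_b.
Qed.

Lemma mf_at_arr l (s : T' -> R) j : measurable_fun setT s ->
  measurable_fun setT (fun z => arr o (v (h z)) l (s z) j).
Proof.
apply: (@mf_arr _ T' R (fun=> o) (fun z => v (h z)) (on0 o) (ofs o) (ohb o)) => //.
- exact: mf_inner_y. - exact: mf_inner_c1. - exact: mf_inner_c2. - exact: mf_inner_b.
Qed.

End Measurability.

Section ServiceNoise.
Variables (k l : nat) (s x' : R).

(** When the job starts, the time left until [x'] is [x' - st]; the indicator is centred by the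
    probability that the service exceeds it. *)
Definition xi (y : MI coord R) kk : R :=
  (x' < dp o (v y) kk)%R%:R - (1 - G (x' - st o (v y) kk)).

Definition snz (y : MI coord R) kk : R := (Jf o (v y) k s l kk)%:R * xi y kk.

Lemma bm_G (f : MI coord R -> R) : measurable_fun setT f -> bm (fun y => G (f y)).
Proof.
move=> mf; apply: (bm_le (M := 1)); first exact: measurableT_comp.
by move=> y; have /andP[? ?] := G01 (f y); rewrite ger0_norm.
Qed.

Lemma bm_xi kk : bm (fun y => xi y kk).
Proof.
apply: bmB.
  apply: bm_bool; apply: measurable_fun_ltr => //; exact: (mf_at_dp mid).
apply: bmB; first exact: bm_cst.
by apply: bm_G; apply: measurable_funB => //; exact: (mf_at_st mid).
Qed.

Lemma bm_snz kk : bm (fun y => snz y kk).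
Proof.
by apply: bmM; [apply: bm_bool; exact: (mf_at_Jf mid)|exact: bm_xi].
Qed.

Lemma snz_le1 y kk : `|snz y kk| <= 1.
Proof.
rewrite /snz /xi; have /andP[] := G01 (x' - st o (v y) kk); move: (G _) => z ? ?.
by case: Jf; case: (x' < _); rewrite /= ?mul0r ?mul1r ?normr0 // ler_norml; apply/andP; split; lra.
Qed.

Definition job_coord kk : coord :=
  if (kk < on0 o)%N then cW (wjob N (nth 0%N x) kk).1 (wjob N (nth 0%N x) kk).2
  else cV (kk - on0 o)%N.

Lemma iy_job y kk : iy (v y) kk = pos (y (job_coord kk)).
Proof. by rewrite /job_coord /=; case: ifP. Qed.

Lemma job_coord_inj kk k' : job_coord kk = job_coord k' -> kk = k'.
Proof.
rewrite /job_coord; case: ltnP => h1; case: ltnP => h2 // [].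
  by move=> e1 e2; apply: wjob_inj h1 h2 _; rewrite [LHS]surjective_pairing e1 e2 -surjective_pairing.
by move=> e; rewrite -(subnK h1) e subnK.
Qed.

Lemma resampled_mix k0 y y' :
  resampled k0 (v y) (v (mix (fun c => c == job_coord k0) y y')).
Proof.
have jc c : (forall a b, c <> cW a b) -> (forall a, c <> cV a) -> (c == job_coord k0) = false.
  by move=> h1 h2; apply/eqP; rewrite /job_coord; case: ifP.
split=> [j|j|j|j jk].
- by rewrite /= /mix jc.
- by rewrite /= /mix jc.
- by rewrite /= /mix jc.
- rewrite !iy_job /mix; case: eqP => // /job_coord_inj e.
  by rewrite e eqxx in jk.
Qed.

(** The service of [k0], the later starter, is resampled: the event and the factor of [k1] stay the
    same, and the factor of [k0] has mean zero. The flag [strict] allows ties of the starting times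
    to be assigned to one of the two orders. *)
Lemma snz_cross k0 k1 (strict : bool) : k1 != k0 ->
  Ex P (fun w => (if strict then st o (v (Y w)) k1 < st o (v (Y w)) k0
     else st o (v (Y w)) k1 <= st o (v (Y w)) k0)%:R * (snz (Y w) k1 * snz (Y w) k0)) = 0.
Proof.
move=> k10.
pose cmp (y : MI coord R) : bool := if strict then st o (v y) k1 < st o (v y) k0
     else st o (v y) k1 <= st o (v y) k0.
pose A (y : MI coord R) := [&& Jf o (v y) k s l k1, Jf o (v y) k s l k0 & cmp y].
pose F (y : MI coord R) := (A y)%:R * (xi y k1 * xi y k0).
have eF y : (cmp y)%:R * (snz y k1 * snz y k0) = F y.
  rewrite /F /A /snz; case: (cmp y); case: Jf; case: Jf; rewrite /= ?mul1r ?mul0r ?mulr0 ?mul0r //.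
have mcmp : measurable_fun setT cmp.
  rewrite /cmp; case: (strict); [apply: measurable_fun_ltr|apply: measurable_fun_ler];
    exact: (mf_at_st mid).
have bF : bm F.
  apply: bmM; last by apply: bmM; exact: bm_xi.
  apply: bm_bool; apply: measurable_and; first exact: (mf_at_Jf mid).
  by apply: measurable_and => //; exact: (mf_at_Jf mid).
transitivity (Ex P (fun w => F (Y w))); first by apply: eq_Ex => w; exact: eF.
pose S c := c == job_coord k0.
rewrite (drv_mix drv (S := S) (S' := fun p => p == prim_of (job_coord k0))) //; last first.
  move=> c; rewrite /S; apply/eqP/eqP => [->//|].
  by rewrite /job_coord; case: ifP => _; case: c => //= *; congruence.
rewrite -[RHS](Ex_cst P 0); apply: eq_Ex => w.
set y := Y w.
(* The past is known to be preserved only where [A] holds; symmetry of [resampled] gives the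
   converse. *)
have eA y' : A (mix S y y') = A y.
  have rs := resampled_mix k0 y y'.
  have half (u u' : MI coord R) : resampled k0 (v u) (v u') -> A u -> A u'.
    move=> r /and3P[h1 h0 hc].
    have h10 : st o (v u) k1 <= st o (v u) k0.
      by move: hc; rewrite /cmp; case: (strict) => // /ltW.
    have [j0 j1 e0 e1] := resample_pair wo (wi u) (wi u') r h0 h1 h10.
    by rewrite /A j0 j1 /cmp e0 e1.
  by apply/idP/idP; apply: half => //; exact: resampled_sym.
have eF2 y' : F (mix S y y') = (A y)%:R * xi y k1 *
    ((x' - st o (v y) k0 < pos (y' (job_coord k0)))%R%:R - (1 - G (x' - st o (v y) k0))).
  rewrite /F eA; case Ay : (A y); last by rewrite !mul0r.
  rewrite !mul1r; have rs := resampled_mix k0 y y'.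
  move: Ay => /and3P[h1 h0 hc].
  have h10 : st o (v y) k1 <= st o (v y) k0.
    by move: hc; rewrite /cmp; case: (strict) => // /ltW.
  have [j0 j1 e0 e1] := resample_pair wo (wi y) (wi _) rs h0 h1 h10.
  rewrite /xi /dp e0 e1; have [_ _ _ ey] := rs.
  by rewrite ey // (iy_job _ k0) /mix /S eqxx ltrBlDl.
under eq_fun do rewrite eF2.
have bs : bm (fun w' => (x' - st o (v y) k0 < pos (Y w' (job_coord k0)))%R%:R : R).
  apply: bm_bool; apply: measurable_fun_ltr => //; apply: mf_pos.
  exact: (mf_coord mY).
rewrite ExZ ?ExB ?Ex_cst //; try exact: bm_cst; last first.
  by apply: bmB => //; exact: bm_cst.
rewrite (drv_service drv); first by rewrite subrr mulr0.
by rewrite /job_coord; case: ifP.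
Qed.

Lemma Ex_snoise :
  Ex P (fun w => (\sum_(kk < k) snz (Y w) kk) ^+ 2) <= k%:R.
Proof.
have b kk : bm (fun w => snz (Y w) kk) by exact: (bm_comp mY (bm_snz kk)).
suff : Ex P (fun w => (\sum_(kk < k) snz (Y w) kk) ^+ 2) <= 1 ^+ 2 * k%:R by rewrite expr1n mul1r.
apply: (@Ex_sum_orthogonal _ T R P k (fun kk w => snz (Y w) kk)) => [i _|i w _|i j _ _ ij]; [exact: b|exact: snz_le1|].
(* Each product is split by the order of the two starts, ties going to one part, so that the service
   resampled never belongs to the earlier start. *)
pose c (b : bool) w a a' : R := (if b then st o (v (Y w)) a < st o (v (Y w)) a'
     else st o (v (Y w)) a <= st o (v (Y w)) a')%:R.
have -> : (fun w => snz (Y w) i * snz (Y w) j) =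
    (fun w => c false w i j * (snz (Y w) i * snz (Y w) j)
            + c true w j i * (snz (Y w) j * snz (Y w) i)).
  apply/funext => w; rewrite /c /= [snz _ j * _]mulrC.
  by case: leP; rewrite ?mul0r ?mul1r ?addr0 ?add0r.
have bc (b0 : bool) a a' : bm (fun w => c b0 w a a' * (snz (Y w) a * snz (Y w) a')).
  apply: bmM; last by apply: bmM.
  apply: bm_bool; case: b0; [apply: measurable_fun_ltr|apply: measurable_fun_ler];
    exact: (mf_at_st mY).
rewrite ExD //.
have := @snz_cross j i false ij; rewrite /c /= => ->.
by have := @snz_cross i j true; rewrite eq_sym => /(_ ij) /= ->; rewrite addr0.
Qed.

End ServiceNoise.
Section ArrivalNoise.
Hypothesis Gneg : forall r, r <= 0 -> G r = 0.
Variables (l : nat) (x' : nat -> R).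

(* Whether an arriving job [j] routed to server [i] contributes, up to its own
   service requirement, which matters only for [l = 1]. *)
Definition elig (y : MI coord R) j i : bool :=
  if (l == 1)%N then Q o (v y) j i (ot o j) == 0%N
  else (Q o (v y) j i (ot o j) == l.-1) && (Q o (v y) j i (x' j) == Q o (v y) j i (ot o j)).

(** For [l] other than 1 the newcomer's own service is under no condition. The value -1 expresses
    this, since [G] vanishes there and services are positive. *)
Definition lag j : R := if (l == 1)%N then x' j - ot o j else -1.

(** The conditional probability of [arr] given the first [j] jobs, as computed by [sum_pick2]. *)
Definition rate (y : MI coord R) j : R :=
  (N%:R ^+ 2)^-1 * (1 - G (lag j)) * (\sum_(i < N) (elig y j i)%:R) *
  (\sum_(i < N) (l.-1 <= Q o (v y) j i (ot o j))%:R +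
   \sum_(i < N) (l.-1 < Q o (v y) j i (ot o j))%:R).

Definition anz (y : MI coord R) j : R := (arr o (v y) l (x' j) j)%:R - rate y j.

Lemma bm_anz j : bm (fun y => anz y j).
Proof.
apply: bmB; first by apply: bm_bool; exact: (mf_at_arr mid).
have bQ i (b : nat -> bool) (s : MI coord R -> R) : measurable_fun setT s ->
    measurable_fun setT (fun y => b (Q o (v y) j i (s y))).
  move=> ms; apply: (mf_index (f := fun n y => b n)) => //.
  exact: (mf_at_Q mid).
apply: bmM.
  apply: bmM; first exact: bm_cst.
  apply: bm_sum => i _; apply: bm_bool; rewrite /elig; case: (l == 1)%N.
    exact: (bQ i (fun n => n == 0%N)).
  apply: measurable_and; first exact: (bQ i (fun n => n == l.-1)).
  by apply: measurable_fun_eqn; exact: (mf_at_Q mid).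
apply: bmD; apply: bm_sum => i _; apply: bm_bool.
  exact: (bQ i (fun n => l.-1 <= n)%N).
exact: (bQ i (fun n => l.-1 < n)%N).
Qed.

Lemma sum_bool_le (b : nat -> bool) : 0 <= (\sum_(i < N) (b i)%:R : R) <= N%:R.
Proof.
apply/andP; split; first by apply: sumr_ge0.
apply: (@le_trans _ _ (\sum_(i < N) (1 : R))); last by rewrite sumr_const card_ord.
by apply: ler_sum => i _; case: (b i).
Qed.

Lemma anz_le y j : `|anz y j| <= 3.
Proof.
have N1 : (0 : R) < N%:R by rewrite ltr0n.
have : 0 <= rate y j <= 2.
  rewrite /rate; have /andP[] := G01 (lag j); move: (G _) => z z0 z1.
  have /andP[] := sum_bool_le (elig y j); move: (\sum_(i < N) _) => A A0 A1.
  have /andP[] := sum_bool_le (fun i => (l.-1 <= Q o (v y) j i (ot o j))%N).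
  move: (\sum_(i < N) _) => B B0 B1.
  have /andP[] := sum_bool_le (fun i => (l.-1 < Q o (v y) j i (ot o j))%N).
  move: (\sum_(i < N) _) => C C0 C1.
  have i0 : 0 <= (N%:R ^+ 2 : R)^-1 by rewrite invr_ge0 exprn_ge0 // ltW.
  apply/andP; split; first by rewrite !mulr_ge0 ?subr_ge0 ?addr_ge0.
  rewrite -!mulrA ler_pdivrMl ?exprn_gt0 //.
  apply: (@le_trans _ _ (1 * (N%:R * (N%:R + N%:R)))); last by rewrite expr2; lra.
  apply: ler_pM => //; [by rewrite subr_ge0|by rewrite mulr_ge0 // addr_ge0|lra|].
  by apply: ler_pM => //; [rewrite addr_ge0|apply: lerD].
rewrite /anz; move: (rate _ _) => z /andP[z0 z2].
by case: arr; rewrite /= ler_norml; apply/andP; split; lra.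
Qed.

Section Cross.
Variables (j0 : nat) (n0j : (on0 o <= j0)%N).

Let S c := match c with
  | cV m | cC1 m | cC2 m | cB m => m == (j0 - on0 o)%N | _ => false end.
Let S' p := match p with
  | PV m | PC1 m | PC2 m | PB m => m == (j0 - on0 o)%N | _ => false end.

Let hist_mix y y' k : (k <= j0)%N ->
  hist o (v (mix S y y')) k = hist o (v y) k.
Proof.
move=> kj.
have ne j : (on0 o <= j)%N -> (j < k)%N -> ((j - on0 o)%N == (j0 - on0 o)%N) = false.
  move=> h jk; apply/eqP => e; have := leq_trans jk kj.
  by rewrite -(subnK h) e subnK // ltnn.
apply: hist_eq => j; last first.
  by case/andP=> nj jk; rewrite /v /inner_at /mk_inner /= /mix /S ne.
move=> jk; rewrite !iy_job /job_coord /mix /S.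
by case: (ltnP j (on0 o)) => // h; rewrite ne.
Qed.

Let Q_mix y y' k i s : (k <= j0)%N -> Q o (v (mix S y y')) k i s = Q o (v y) k i s.
Proof. by move=> kj; rewrite /Q hist_mix. Qed.

Let elig_mix y y' j i : (j <= j0)%N -> elig (mix S y y') j i = elig y j i.
Proof. by move=> jj; rewrite /elig !Q_mix. Qed.

Let rate_mix y y' j : (j <= j0)%N -> rate (mix S y y') j = rate y j.
Proof.
move=> jj; rewrite /rate; congr (_ * _ * (_ + _)); apply: eq_bigr => i _.
- by rewrite elig_mix.
- by rewrite Q_mix.
- by rewrite Q_mix.
Qed.

Let arr_mix y y' j : (j < j0)%N -> arr o (v (mix S y y')) l (x' j) j = arr o (v y) l (x' j) j.
Proof.
move=> jj; have [e1 e2] := hist_sv_dp (hist_mix y y' jj).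
by rewrite /arr e1 e2 !Q_mix // ltnW.
Qed.

Let q y i := Q o (v y) j0 i (ot o j0).

Let thr : R := if (l == 1)%N then x' j0 - ot o j0 else -1.

Let ind (y' : MI coord R) i i' b : bool :=
  [&& clip N (Num.truncn (y' (cC1 (j0 - on0 o)))) == i,
      clip N (Num.truncn (y' (cC2 (j0 - on0 o)))) == i',
      (0 < y' (cB (j0 - on0 o))) == b & thr < pos (y' (cV (j0 - on0 o)))].

Let arr_mix0 y y' : (arr o (v (mix S y y')) l (x' j0) j0)%:R =
  \sum_(i < N) \sum_(i' < N)
    ((elig y j0 (pick2 (q y) i i' true))%:R * (ind y' i i' true)%:R +
     (elig y j0 (pick2 (q y) i i' false))%:R * (ind y' i i' false)%:R) :> R.
Proof.
pose c1 := clip N (Num.truncn (y' (cC1 (j0 - on0 o)))).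
pose c2 := clip N (Num.truncn (y' (cC2 (j0 - on0 o)))).
pose b := 0 < y' (cB (j0 - on0 o)).
have c1N : (c1 < N)%N by exact: clip_lt.
have c2N : (c2 < N)%N by exact: clip_lt.
rewrite (bigD1 (Ordinal c1N)) //= [X in _ + X]big1 ?addr0; last first.
  move=> i /negbTE; rewrite -val_eqE /= eq_sym => ne; apply: big1 => i' _.
  by rewrite /ind -/c1 ne !mulr0 addr0.
rewrite (bigD1 (Ordinal c2N)) //= [X in _ + X]big1 ?addr0; last first.
  move=> i /negbTE; rewrite -val_eqE /= eq_sym => ne.
  by rewrite /ind -/c2 ne !andbF !mulr0 addr0.
rewrite /ind -/c1 -/c2 !eqxx -/b /=.
have Ssv : sv o (v (mix S y y')) j0 = pick2 (q y) c1 c2 b.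
  rewrite svE ltnNge n0j /=; have e i : Q o (v (mix S y y')) j0 i (ot o j0) = q y i.
    exact: Q_mix.
  rewrite /pick2 !e /= /mix /S eqxx -/c1 -/c2 /b.
  by rewrite -!fun_if; congr (if _ then _ else _).
(* For [l = 1] the chosen server is idle, so the job starts on arrival and the condition on its
   completion becomes one on its service. *)
have -> : arr o (v (mix S y y')) l (x' j0) j0 =
    elig y j0 (pick2 (q y) c1 c2 b) && (thr < pos (y' (cV (j0 - on0 o)))).
  rewrite /arr Ssv /elig /thr; case: (l == 1)%N.
    rewrite Q_mix //; case: eqP => [/eqP q0|//]; rewrite !andTb.
    rewrite /dp /st Ssv iy_job /job_coord ltnNge n0j /= /mix /S eqxx.
    have Lt : L o (v (mix S y y')) j0 (pick2 (q y) c1 c2 b) <= ot o j0.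
      by rewrite -(Q_eq0 (wi (mix S y y'))) ?Q_mix // (wf_tge0 wo).
    by rewrite (max_idPl Lt) ltrBlDl.
  rewrite !Q_mix //.
  by rewrite (lt_trans _ (pos_gt0 _)) ?andbT // oppr_lt0 ltr01.
by case: (b); rewrite /= ?mulr0 ?addr0 ?add0r -natrM mulnb.
Qed.

(** The choices and the service of the later arrival [j0] are resampled. Although the term of [j1]
    looks ahead to time [x' j1], it does so within the system of the jobs up to [j1], hence is
    determined by the history before [j0]. *)
Lemma anz_cross j1 : (j1 < j0)%N -> Ex P (fun w => anz (Y w) j1 * anz (Y w) j0) = 0.
Proof.
move=> j10; pose F (y : MI coord R) := anz y j1 * anz y j0.
transitivity (Ex P (fun w => F (Y w))); first by [].
rewrite (drv_mix drv (S := S) (S' := S')); last 2 first.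
- by case.
- by apply: bmM; exact: bm_anz.
rewrite -[RHS](Ex_cst P 0); apply: eq_Ex => w; set y := Y w.
have eF y' : F (mix S y y') = anz y j1 * ((arr o (v (mix S y y')) l (x' j0) j0)%:R - rate y j0).
  by rewrite /F /anz arr_mix // !rate_mix // ltnW.
under eq_fun do rewrite eF.
have mc c : measurable_fun setT (fun w' => Y w' c) by exact: (mf_coord mY).
have mind i i' b : measurable_fun setT (fun w' => ind (Y w') i i' b).
  apply: measurable_and; first by apply: measurable_fun_eqn => //; exact: mf_clip.
  apply: measurable_and; first by apply: measurable_fun_eqn => //; exact: mf_clip.
  apply: measurable_and.
    have m1 : measurable_fun setT (fun w' => 0 < Y w' (cB (j0 - on0 o))).
      exact: measurable_fun_ltr.
    by case: b; [under eq_fun do rewrite eqb_id|under eq_fun do rewrite eqbF_neg; exact: measurable_neg].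
  by apply: measurable_fun_ltr => //; exact: mf_pos.
have bterm i i' : bm (fun w' => 
    (elig y j0 (pick2 (q y) i i' true))%:R * (ind (Y w') i i' true)%:R +
    (elig y j0 (pick2 (q y) i i' false))%:R * (ind (Y w') i i' false)%:R : R).
  by apply: bmD; apply: bmZ; exact: bm_bool.
have barr : bm (fun w' => (arr o (v (mix S y (Y w'))) l (x' j0) j0)%:R : R).
  under eq_fun do rewrite arr_mix0.
  by apply: bm_sum => i _; apply: bm_sum => i' _; exact: bterm.
have Earr : Ex P (fun w' => (arr o (v (mix S y (Y w'))) l (x' j0) j0)%:R) = rate y j0.
  under eq_fun do rewrite arr_mix0.
  rewrite Ex_sum; last by move=> i _; apply: bm_sum => i' _; exact: bterm.
  rewrite /rate -/thr.
  have pq i : elig y j0 i -> q y i = l.-1.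
    by rewrite /elig; case: eqP => [-> /eqP//|_ /andP[/eqP]].
  rewrite -/(q y); have := sum_pick2 R N pq.
  have -> : \sum_(i < N) Ex P (fun w' => \sum_(i' < N)
    ((elig y j0 (pick2 (q y) i i' true))%:R * (ind (Y w') i i' true)%:R +
     (elig y j0 (pick2 (q y) i i' false))%:R * (ind (Y w') i i' false)%:R))
    = (2 * N%:R ^+ 2)^-1 * (1 - G thr) * \sum_(i < N) \sum_(j < N)
        ((elig y j0 (pick2 (q y) i j true))%:R + (elig y j0 (pick2 (q y) i j false))%:R).
    rewrite big_distrr /=; apply: eq_bigr => i _.
    rewrite Ex_sum; last by move=> i' _; exact: bterm.
    rewrite big_distrr /=; apply: eq_bigr => i' _.
    rewrite ExD ?ExZ; try (by apply: bm_bool); try (by apply: bmZ; apply: bm_bool).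
    by rewrite !(drv_choice drv) //; ring.
  move=> ->; rewrite invfM /lag; 
  set A := \sum_(i < N) _; set B := (\sum_(j < N) _ + _).
  have two : (2 : R) != 0 by rewrite pnatr_eq0.
  rewrite -/thr; set u : R := 1 - G thr; set z : R := (N%:R ^+ 2)^-1.
  by transitivity ((2^-1 * 2) * (z * u * A * B)); [ring|rewrite mulVf // mul1r].
rewrite ExZ ?ExB ?Ex_cst // ?Earr ?subrr ?mulr0 //; try exact: bm_cst.
by apply: bmB => //; exact: bm_cst.
Qed.

End Cross.

Lemma Ex_anoise k :
  Ex P (fun w => (\sum_(on0 o <= j < k) anz (Y w) j) ^+ 2) <= 9 * (k - on0 o)%:R.
Proof.
have b j : bm (fun w => anz (Y w) j) by exact: (bm_comp mY (bm_anz j)).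
have -> : (fun w => (\sum_(on0 o <= j < k) anz (Y w) j) ^+ 2) =
   (fun w => (\sum_(j < k - on0 o) anz (Y w) (j + on0 o)) ^+ 2).
  by apply/funext => w; rewrite -{1}[on0 o]add0n big_addn big_mkord.
have -> : (9 : R) = 3 ^+ 2 by rewrite -natrX.
apply: (@Ex_sum_orthogonal _ T R P _ (fun j w => anz (Y w) (j + on0 o))) => [i _|i w _|i j _ _].
- exact: b.
- exact: anz_le.
- rewrite neq_ltn => /orP[ij|ij].
    by apply: anz_cross; rewrite ?leq_addl ?ltn_add2r.
  under eq_fun do rewrite mulrC.
  by apply: anz_cross; rewrite ?leq_addl ?ltn_add2r.
Qed.

End ArrivalNoise.
End Noise.

(** * Integrals over compact intervals *)

Section IntervalIntegral.
Variable R : realType.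
Local Notation mu := (@lebesgue_measure R).
Implicit Types (a b c : R) (f h : R -> R).

Definition integ a b f := mu.-integrable `[a, b] (EFin \o f).
Definition int a b f : R := intR `[a, b] f.

Lemma mu_itv a b : (mu `[a, b]%classic = if (a < b)%R then (b - a)%:E else 0)%E.
Proof.
have := lebesgue_measure_itv `[a, b]; rewrite /= lte_fin => ->.
by case: ifP.
Qed.

Lemma integ_sub a b c e f : a <= c -> e <= b -> integ a b f -> integ c e f.
Proof.
move=> ac eb; apply: integrableS => //.
move=> x /=; rewrite !in_itv /= => /andP[h1 h2].
by rewrite (le_trans ac h1) (le_trans h2 eb).
Qed.

Lemma integ_meas a b f : integ a b f -> measurable_fun `[a, b] f.
Proof. by move=> h; apply/measurable_EFinP; exact: (measurable_int mu). Qed.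

Lemma integ_bounded a b f M : measurable_fun `[a, b] f ->
  (forall x, a <= x <= b -> `|f x| <= M) -> integ a b f.
Proof.
move=> mf hM; apply: measurable_bounded_integrable => //.
  have h : (mu `[a, b]%classic < +oo)%E by rewrite mu_itv; case: ifP; rewrite ltry.
  exact: h.
exists `|M|; split; first by rewrite realE normr_ge0.
move=> y hy x /=; rewrite in_itv /= => h.
by apply: le_trans (hM x h) (le_trans (ler_norm M) (ltW hy)).
Qed.

Lemma integ_cst a b c : integ a b (fun=> c).
Proof. by apply: (integ_bounded (M := `|c|)) => //; exact: measurable_cst. Qed.

Lemma integD a b f h : integ a b f -> integ a b h -> integ a b (fun x => f x + h x).
Proof. by move=> hf hh; apply: (integrableD _ hf hh). Qed.

Lemma integB a b f h : integ a b f -> integ a b h -> integ a b (fun x => f x - h x).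
Proof. by move=> hf hh; apply: (integrableB _ hf hh). Qed.

Lemma integ_norm a b f : integ a b f -> integ a b (fun x => `|f x|).
Proof. by move=> hf; have := integrable_norm hf. Qed.

Lemma integZ a b c f : integ a b f -> integ a b (fun x => c * f x).
Proof. by move=> hf; exact: (integrableZl _ c hf). Qed.

Lemma integM_bounded a b f h M : integ a b f -> measurable_fun `[a, b] h ->
  (forall x, a <= x <= b -> `|h x| <= M) -> integ a b (fun x => f x * h x).
Proof.
move=> hf mh hM.
have mf := integ_meas hf.
have hg : integ a b (fun x => `|M| * `|f x|) by apply: integZ; exact: integ_norm.
apply: (le_integrable _ _ _ hg) => //.
  by apply/measurable_EFinP; exact: measurable_funM.
move=> x /=; rewrite in_itv /= => hx.
rewrite lee_fin normrM [leRHS]ger0_norm ?mulr_ge0 // mulrC ler_wpM2r //.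
exact: le_trans (hM x hx) (ler_norm _).
Qed.

Lemma eq_int a b f h : (forall x, a <= x <= b -> f x = h x) -> int a b f = int a b h.
Proof.
by move=> e; apply: eq_Rintegral => x; rewrite inE /= in_itv /=; exact: e.
Qed.

Lemma eq_integ a b f h : (forall x, a <= x <= b -> f x = h x) -> integ a b f -> integ a b h.
Proof.
move=> e; apply: eq_integrable => // x; rewrite inE /= in_itv /= => hx.
by rewrite e.
Qed.

Lemma intD a b f h : integ a b f -> integ a b h ->
  int a b (fun x => f x + h x) = int a b f + int a b h.
Proof. by move=> hf hh; apply: RintegralD. Qed.

Lemma intB a b f h : integ a b f -> integ a b h ->
  int a b (fun x => f x - h x) = int a b f - int a b h.
Proof. by move=> hf hh; apply: RintegralB. Qed.

Lemma intZ a b c f : integ a b f -> int a b (fun x => c * f x) = c * int a b f.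
Proof. by move=> hf; apply: RintegralZl. Qed.

Lemma int_le a b f h : integ a b f -> integ a b h ->
  (forall x, a <= x <= b -> f x <= h x) -> int a b f <= int a b h.
Proof.
by move=> hf hh e; apply: le_Rintegral => // x /=; rewrite in_itv /=; exact: e.
Qed.

Lemma int_ge0 a b f : (forall x, a <= x <= b -> 0 <= f x) -> 0 <= int a b f.
Proof. by move=> h; apply: Rintegral_ge0 => x /=; rewrite in_itv /=; exact: h. Qed.

Lemma int_norm a b f : integ a b f -> `|int a b f| <= int a b (fun x => `|f x|).
Proof. by move=> hf; apply: le_normr_Rintegral. Qed.

Lemma int_cst a b c : a <= b -> int a b (fun=> c) = c * (b - a).
Proof.
move=> ab; rewrite /int /intR Rintegral_cst //.
transitivity (c * fine (mu `[a, b]%classic)); first by [].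
rewrite mu_itv; case: ltP => h //=.
have -> : a = b by apply/eqP; rewrite eq_le ab h.
by rewrite subrr.
Qed.

Lemma int_split a b c f : a <= b -> b <= c -> integ a c f ->
  int a c f = int a b f + int b c f.
Proof.
move=> ab bc hf; apply/eqP; rewrite addrC -subr_eq; apply/eqP.
rewrite /int /intR (Rintegral_itvB hf); last 2 first.
- by rewrite bnd_simp.
- by rewrite bnd_simp.
rewrite Rintegral_itv_obnd_cbnd //; apply: integrableS hf => //.
move=> x /=; rewrite !in_itv /= => /andP[h1 h2].
by rewrite (le_trans ab (ltW h1)) h2.
Qed.

Lemma int_aa a f : int a a f = 0.
Proof. by rewrite /int /intR set_itv1 Rintegral_set1. Qed.

End IntervalIntegral.

(** * The service distribution and its hazard bound *)

Section ServiceLaw.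
Variables (R : realType) (G g : R -> R) (H : R).
Hypothesis sa : service_assumption G g H.
Local Notation mu := (@lebesgue_measure R).

Let g0 x : 0 <= g x. Proof. by case: sa => h _. Qed.
Let mg : measurable_fun [set: R] g. Proof. by case: sa => _ []. Qed.
Let GE x : ((G x)%:E = \int[mu]_(y in `]-oo, x]) (g y)%:E)%E.
Proof. by case: sa => _ [_ [h _]]. Qed.

Lemma density_integrable : mu.-integrable setT (EFin \o g).
Proof.
have [_ [_ [_ [_ [h _]]]]] := sa.
apply/integrableP; split; first exact/measurable_EFinP.
under eq_integral do rewrite /= ger0_norm //.
by rewrite h ltry.
Qed.

Lemma density_integ a b : integ a b g.
Proof. exact: integrableS density_integrable. Qed.

Lemma cdf_int a b : a <= b -> G b - G a = int a b g.
Proof.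
move=> ab.
have e x : G x = \int[mu]_(y in `]-oo, x]) g y by rewrite /Rintegral -GE.
rewrite !e (@Rintegral_itvB _ _ -oo%O (BRight b) a) //; last first.
  exact: integrableS density_integrable.
rewrite Rintegral_itv_obnd_cbnd //; exact: integrableS density_integrable.
Qed.

Lemma cdf_mono a b : a <= b -> G a <= G b.
Proof. by move=> ab; rewrite -subr_ge0 cdf_int // int_ge0. Qed.

Lemma cdf_ge0 a : 0 <= G a.
Proof. by rewrite -lee_fin GE; apply: integral_ge0 => y _; rewrite lee_fin. Qed.

Lemma cdf_neg a : a <= 0 -> G a = 0.
Proof.
move=> a0; have [_ [_ [_ [h _]]]] := sa.
by apply/eqP; rewrite eq_le cdf_ge0 andbT -h cdf_mono.
Qed.

Lemma cdf_lt1 a : G a < 1.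
Proof.
have [_ [_ [_ [_ [_ [_ h]]]]]] := sa.
have [a0|a0] := leP 0 a; first by case: (h a a0).
by rewrite cdf_neg ?ltr01 // ltW.
Qed.

Lemma cdf01 a : 0 <= G a <= 1.
Proof. by rewrite cdf_ge0 ltW ?cdf_lt1. Qed.

Lemma measurable_cdf : measurable_fun setT G.
Proof. by apply: nondecreasing_measurable => // x y; exact: cdf_mono. Qed.

Lemma measurable_density : measurable_fun setT g. Proof. exact: mg. Qed.

Lemma density_ge0 x : 0 <= g x. Proof. exact: g0. Qed.

Lemma hazard x : 0 <= x -> g x <= H * (1 - G x).
Proof.
move=> x0; have [_ [_ [_ [_ [_ [_ h]]]]]] := sa.
have [l1 l2] := h x x0; by rewrite -ler_pdivrMr ?subr_gt0.
Qed.

Lemma hazard_ge0 : 0 <= H.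
Proof.
have := le_trans (g0 0) (hazard (lexx 0)).
by rewrite pmulr_lge0 // subr_gt0 cdf_lt1.
Qed.

Lemma density_le x : 0 <= x -> g x <= H.
Proof.
move=> x0; apply: le_trans (hazard x0) _; rewrite ler_piMr ?hazard_ge0 //.
by rewrite lerBlDr lerDl cdf_ge0.
Qed.

(** The survival factor at [a] is kept: after division by [1 - G a] the bound is Lipschitz in the
    residual time, uniformly in the age. *)
Lemma cdf_lip a u v : a <= u -> u <= v -> G v - G u <= H * (1 - G a) * (v - u).
Proof.
move=> au uv; have H0 := hazard_ge0.
have key u' v' : 0 <= u' -> a <= u' -> u' <= v' -> G v' - G u' <= H * (1 - G a) * (v' - u').
  move=> u0 au' uv'; rewrite cdf_int // -int_cst //.
  apply: int_le => //; [exact: density_integ|exact: integ_cst|].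
  move=> x /andP[ux _]; apply: le_trans (hazard (le_trans u0 ux)) _.
  by rewrite ler_wpM2l // lerB // cdf_mono // (le_trans au').
have c0 : 0 <= H * (1 - G a) by rewrite mulr_ge0 // subr_ge0 ltW // cdf_lt1.
have [u0|u0] := leP 0 u; first exact: key.
have [v0|v0] := leP v 0.
  by rewrite (cdf_neg v0) (cdf_neg (ltW u0)) subrr mulr_ge0 // subr_ge0.
rewrite (cdf_neg (ltW u0)) -(cdf_neg (lexx 0)).
apply: le_trans (key 0 v (lexx 0) (le_trans au (ltW u0)) (ltW v0)) _.
by rewrite ler_wpM2l // lerB // ltW.
Qed.

End ServiceLaw.

Section InputDriving.
Context (R : realType) (d : measure_display) (Omega : measurableType d)
  (P : probability Omega R).
Variables (G g lam : R -> R) (H : R) (aN : nat -> R)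
  (X0 : nat -> nat -> Omega -> nat) (A0 Res : nat -> nat -> Omega -> R)
  (W : nat -> nat -> nat -> Omega -> R) (E : nat -> R -> Omega -> nat)
  (V : nat -> nat -> Omega -> R) (C1 C2 : nat -> nat -> Omega -> nat)
  (Bt : nat -> nat -> Omega -> bool) (N : nat) (t : R).
Hypotheses (sa : service_assumption G g H)
  (net : sq2_network P X0 A0 Res W E V C1 C2 Bt G lam aN N)
  (N0 : (0 < N)%N) (t0 : 0 <= t).
Local Notation Y := (input X0 Res W E V C1 C2 Bt N t).

(** [pos] alters [f] only on the event [f <= 0], which is null because [G 0 = 0]. *)
Lemma prob_pos (f : Omega -> R) r : measurable_fun setT f ->
  (forall x, P [set w | f w <= x] = (G x)%:E) ->
  P [set w | r < pos (f w)] = (1 - G r)%:E.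
Proof.
move=> mf hf.
have mle x : measurable [set w | f w <= x].
  by apply: bool_measurable; apply: measurable_fun_ler.
have gtE : P [set w | r < f w] = (1 - G r)%:E.
  have -> : [set w | r < f w] = ~` [set w | f w <= r].
    by apply/seteqP; split=> w /=; rewrite real_ltNge ?num_real //; move/negP.
  by rewrite probability_setC // hf.
have mgt : measurable [set w | r < f w].
  by apply: bool_measurable; apply: measurable_fun_ltr.
have mpos : measurable [set w | r < pos (f w)].
  by apply: bool_measurable; apply: measurable_fun_ltr => //; exact: mf_pos.
have [r0|r0] := ltP r 0.
  rewrite (cdf_neg sa (ltW r0)) subr0 [X in P X](_ : _ = setT) ?probability_setT //.
  by apply/seteqP; split=> // w _ /=; rewrite (lt_trans r0) // pos_gt0.
rewrite -gtE; apply/eqP; rewrite eq_le; apply/andP; split.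
  rewrite -[X in (_ <= X)%E]adde0.
  have <- : P [set w | f w <= 0] = 0%E by rewrite hf (cdf_neg sa (lexx 0)).
  apply: le_trans (measureU2 P _ _) => //; apply: le_measure; rewrite ?inE //.
    exact: measurableU.
  by move=> w; rewrite /pos /=; case: (ltP 0 (f w)) => h; [left|right].
apply: le_measure; rewrite ?inE // => w /= rf.
by rewrite /pos (le_lt_trans r0 rf).
Qed.

(** The values below [N] already have total mass one, so clipping acts on a null event. *)
Lemma prob_clip (f : Omega -> nat) i : (forall m, measurable [set w | f w = m]) ->
  (forall j, (j < N)%N -> P [set w | f w = j] = (N%:R^-1)%:E) -> (i < N)%N ->
  P [set w | clip N (f w) = i] = (N%:R^-1)%:E.
Proof.
move=> mf hf iN; have mS := measurable_nat_fun mf.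
have out0 : P [set w | (N <= f w)%N] = 0%E.
  have -> : [set w | (N <= f w)%N] = ~` [set w | (f w < N)%N].
    by apply/seteqP; split=> w /=; [rewrite leqNgt => /negP|move/negP; rewrite -leqNgt].
  rewrite probability_setC; last exact: (mS (fun n => (n < N)%N)).
  have -> : [set w | (f w < N)%N] = \big[setU/set0]_(j < N) [set w | f w = j].
    rewrite -(bigcup_mkord N (fun j => [set w | f w = j])); apply/seteqP; split=> w /=.
      by move=> h; exists (f w).
    by case=> j /= jN e; rewrite e.
  rewrite measure_semi_additive_ord //=.
  - under eq_bigr => j _ do rewrite hf //.
    have e : \sum_(j < N) (N%:R^-1) = 1 :> R.
      by rewrite sumr_const card_ord -[LHS]mulr_natr mulVf // pnatr_eq0 -lt0n.
    by rewrite sumEFin e subee.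
  - by move=> j j' _ _ [w []] /= e e'; apply/val_inj; rewrite /= -e -e'.
  - by apply: bigsetU_measurable.
rewrite -(hf i iN); apply/eqP; rewrite eq_le; apply/andP; split.
  rewrite -[X in (_ <= X)%E]adde0 -out0.
  apply: le_trans (measureU2 P _ _) => //; last first.
  - exact: (mS (fun n => (N <= n)%N)).
  apply: le_measure; rewrite ?inE.
  - exact: (mS (fun n => clip N n = i)).
  - by apply: measurableU => //; exact: (mS (fun n => (N <= n)%N)).
  - by move=> w; rewrite /clip /=; case: ltnP => h e; [left|right].
apply: le_measure; rewrite ?inE //; first exact: (mS (fun n => clip N n = i)).
by move=> w /= e; rewrite /clip e iN.
Qed.

Lemma input_driving : driving P Y G N.
Proof.
have mY := measurable_input net t0.
have [pm [_ [indep [_ [[lW lV lC lB] _]]]]] := net.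
have [_ [_ [_ [mW [_ [mV [mC mB]]]]]]] := pm.
split=> //.
- by move=> S S' f SS bf; exact: (Ex_resample net N0 t0 SS bf).
- move=> c r; have mc := mf_coord mY c.
  have mb : measurable_fun setT (fun w => r < pos (Y w c)).
    by apply: measurable_fun_ltr => //; exact: mf_pos.
  rewrite Ex_bool //; case: c mc mb => //= [i k|j] mc mb _.
    by rewrite prob_pos.
  by rewrite prob_pos.
- move=> j i1 i2 b r i1N i2N.
  have mc c := mf_coord mY c.
  rewrite Ex_bool; last first.
    apply: measurable_and; first by apply: measurable_fun_eqn => //; exact: mf_clip.
    apply: measurable_and; first by apply: measurable_fun_eqn => //; exact: mf_clip.
    apply: measurable_and.
      have m1 : measurable_fun setT (fun w' => 0 < Y w' (cB j)).
        exact: measurable_fun_ltr.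
      by case: b; [under eq_fun do rewrite eqb_id|under eq_fun do rewrite eqbF_neg; exact: measurable_neg].
    by apply: measurable_fun_ltr => //; exact: mf_pos.
  pose A (k : nat) : set Omega := match k with
    | 0 => C1 N j @^-1` [set n | clip N n = i1]
    | 1 => C2 N j @^-1` [set n | clip N n = i2]
    | 2 => Bt N j @^-1` [set b]
    | _ => V N j @^-1` [set v | r < pos v] end.
  pose idx (k : nat) : prim := match k with 
    | 0 => PC1 j | 1 => PC2 j | 2 => PB j | _ => PV j end.
  rewrite [X in fine (P X)](_ : _ = \bigcap_(k in `I_4) A k); last first.
    apply/seteqP; split=> w /=.
      move=> /and4P[/eqP h1 /eqP h2 /eqP h3 h4] [|[|[|[|k]]]] //= _; rewrite /A /=.
      - by rewrite -h1 natrK.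
      - by rewrite -h2 natrK.
      - by rewrite -h3; case: (Bt N j w); rewrite /= ?ltr01 ?ltxx.
    move=> h; have := h 0%N isT; have := h 1%N isT; have := h 2%N isT.
    have := h 3%N isT; rewrite /A /= => h4 h3 h2 h1; rewrite !natrK h1 h2 !eqxx h4 andbT /= -h3.
    by case: (Bt N j w); rewrite /= ?ltr01 ?ltxx.
  rewrite (indep 4%N idx A); last 2 first.
  - by move=> [|[|[|[|k]]]] [|[|[|[|k']]]].
  - move=> [|[|[|[|k]]]] //= _; [by exists [set n | clip N n = i1]|by exists [set n | clip N n = i2]|by exists [set b]|].
    exists [set v | r < pos v]; split=> //; apply: bool_measurable.
    by apply: measurable_fun_ltr => //; exact: mf_pos.
  rewrite !big_ord_recl big_ord0 /= mule1 /A /=.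
  rewrite (prob_clip (f := C1 N j)) //; last 2 first.
  - by move=> m; case: (mC j m).
  - by move=> m mN; case: (lC j m mN).
  rewrite (prob_clip (f := C2 N j)) //; last 2 first.
  - by move=> m; case: (mC j m).
  - by move=> m mN; case: (lC j m mN).
  have -> : P (Bt N j @^-1` [set b]) = (2^-1)%:E.
    rewrite /A; case: (b); first by rewrite -(lB j); congr (P _); apply/seteqP; split.
    rewrite (_ : Bt N j @^-1` [set false] = ~` [set w | Bt N j w]); last first.
      by apply/seteqP; split=> w /=; case: (Bt N j w).
    rewrite probability_setC // lB; congr (_%:E); lra.
  rewrite (prob_pos (f := V N j)) //= invfM expr2 invfM; ring.
Qed.

End InputDriving.

Section Reflection.
Variable R : realType.
Local Notation mu := (@lebesgue_measure R).

Lemma int_sum (I : Type) (s : seq I) (p : pred I) (a b : R) (f : I -> R -> R) :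
  (forall i, p i -> integ a b (f i)) ->
  integ a b (fun u => \sum_(i <- s | p i) f i u) /\
  int a b (fun u => \sum_(i <- s | p i) f i u) = \sum_(i <- s | p i) int a b (f i).
Proof.
move=> h; elim: s => [|i s [IH1 IH2]].
  split; first by under eq_fun do rewrite big_nil; exact: integ_cst.
  rewrite big_nil; have -> : (fun u => \sum_(i <- [::] | p i) f i u) = fun=> (0 : R).
    by apply/funext => u; rewrite big_nil.
  by rewrite /int /intR /Rintegral integral0_eq.
case E : (p i); last first.
  rewrite big_cons E; have -> : (fun u => \sum_(j <- i :: s | p j) f j u) =
     fun u => \sum_(j <- s | p j) f j u by apply/funext => u; rewrite big_cons E.
  by [].
rewrite big_cons E; have -> : (fun u => \sum_(j <- i :: s | p j) f j u) =
    fun u => f i u + \sum_(j <- s | p j) f j u by apply/funext => u; rewrite big_cons E.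
by split; [apply: integD => //; exact: h|rewrite intD ?IH2 //; exact: h].
Qed.

(** It will be applied to [g], which is merely measurable. The substitution therefore rests on the
    uniqueness of Lebesgue measure: its image under the reflection has the same values on half-open
    intervals. *)
Lemma int_reflect (a b c : R) (f : R -> R) : measurable_fun setT f ->
  (forall x, 0 <= f x) -> int a b (fun u => f (c - u)) = int (c - b) (c - a) f.
Proof.
move=> mf f0; pose phi (u : measurableTypeR R) : measurableTypeR R := c - u.
have mphi : measurable_fun setT phi by apply: measurable_funB.
pose m0 : {measure set (measurableTypeR R) -> \bar R} := pushforward mu phi.
pose m := m0 mphi.
have U (X : set R) : ocitv X -> lebesgue_measure X = m X.
  move=> [[x y] _ <-] /=.
  have -> : m `]x, y]%classic = lebesgue_measure (`[c - y, c - x[)%classic.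
    rewrite /m /m0 /pushforward /=; congr (lebesgue_measure _).
    apply/seteqP; split=> u /=; rewrite /phi !in_itv /= => /andP[h1 h2]; apply/andP; split; lra.
  rewrite !lebesgue_measure_itv /= !lte_fin ltrD2l ltrN2.
  by case: ifP => // _; congr (_%:E); ring.
have eqm (A : set R) : measurable A -> lebesgue_measure A = m A.
  by move=> mA; exact: (lebesgue_measure_unique U mA).
rewrite /int /intR /Rintegral; congr fine.
transitivity (\int[m]_(x in `[(c - b)%R, (c - a)%R]) (f x)%:E)%E.
  rewrite /m /m0 ge0_integral_pushforward //.
  - congr (integral _ _ _); apply/seteqP; split=> u /=; rewrite /phi !in_itv /= => /andP[h1 h2]; apply/andP; split; lra.
  - by apply/measurable_EFinP; apply: measurable_funS mf.
  - by move=> x _ /=; rewrite lee_fin.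
by apply: eq_measure_integral => A mA _; exact: esym (eqm A mA).
Qed.

End Reflection.

Section Kernel.
Variables (R : realType) (G g : R -> R) (H : R).
Hypothesis sa : service_assumption G g H.

Lemma measurable_kernel (c : R) : measurable_fun setT (fun u : R => g (c - u)).
Proof.
apply: measurableT_comp; first exact: (measurable_density sa).
exact: measurable_funB.
Qed.

Lemma kernel_integ (c a b : R) : b <= c -> integ a b (fun u => g (c - u)).
Proof.
move=> bc; apply: (integ_bounded (M := H)).
  by apply: measurable_funTS; exact: measurable_kernel.
move=> u /andP[_ ub]; rewrite ger0_norm ?(density_ge0 sa) //.
by apply: (density_le sa); rewrite subr_ge0 (le_trans ub).
Qed.

Lemma kernel_int (c a b : R) : a <= b -> int a b (fun u => g (c - u)) = G (c - a) - G (c - b).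
Proof.
move=> ab; rewrite int_reflect.
- by rewrite (cdf_int sa) // lerB.
- exact: (measurable_density sa).
- exact: (density_ge0 sa).
Qed.

Lemma kernel_int_step (c s t : R) : 0 <= t -> t <= s -> s <= c ->
  int 0 s (fun u => g (c - u) * (t <= u)%R%:R) = G (c - t) - G (c - s).
Proof.
move=> t0 ts sc; rewrite -kernel_int //.
rewrite /int /intR.
have -> : `[t, s]%classic = `[0, s]%classic `&` `[t, +oo[%classic.
  apply/seteqP; split=> u /=; rewrite !in_itv /= ?andbT.
    by move=> /andP[h1 h2]; rewrite h1 h2 (le_trans t0 h1).
  by case=> /andP[h1 h2] h3; rewrite h3 h2.
rewrite Rintegral_mkcondr; apply: eq_Rintegral => u _.
rewrite patchE mem_setE in_itv /= andbT.
by case: (t <= u); rewrite ?mulr1 ?mulr0.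
Qed.

End Kernel.

(** * The pathwise identities after scaling *)

Section RealPath.
Variables (R : realType) (G g : R -> R) (H : R).
Hypothesis sa : service_assumption G g H.
Variables (N : nat) (x : seq nat) (y0 : coord -> R).
Hypothesis N0 : (0 < N)%N.
Let o := outer_at N x y0.
Hypothesis wo : wf_outer o.
Let v (y : MI coord R) := inner_at N x y.
Let wi y : wf_inner o (v y). Proof. exact: wf_inner_at. Qed.

Definition Zh (y : MI coord R) k (s x' : R) l : R :=
  N%:R^-1 * \sum_(i < N) (zi o (v y) k s x' l i)%:R.
(** The empirical counterpart of minus the time integral of the boundary slope at level [l.+1]. *)
Definition Dl (y : MI coord R) k (s : R) l : R :=
  N%:R^-1 * \sum_(kk < k) (Jf o (v y) k s l kk)%:R.
Definition start_frac l (x' : R) : R :=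
  N%:R^-1 * \sum_(i < N) ((l <= nth 0 x i)%N && (x' < ohr o i)%R)%:R.

Lemma L_ge_hr y k i : ohb o i -> ohr o i <= L o (v y) k i.
Proof.
move=> hb; elim: k => [|k IH]; first by rewrite L0 hb.
rewrite LS; case: eqP => // e; apply: le_trans IH _.
by rewrite -e ltW ?L_dp.
Qed.

Lemma zi_start y l i (x' : R) : (i < N)%N -> (0 < l)%N -> 0 <= x' ->
  zi o (v y) (on0 o) 0 x' l i = (l <= nth 0 x i)%N && (x' < ohr o i).
Proof.
move=> iN l0 x0; rewrite /zi.
have Q0E : Q o (v y) (on0 o) i 0 = nth 0%N x i.
  rewrite -(repr_size (repr_start (fun=> 0) wo (wi y) iN)) /init_state.
  by case: (nth 0%N x i) => //= n; rewrite size_mkseq.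
rewrite Q0E; have [xi|xi] := posnP (nth 0%N x i).
  by rewrite xi leqNgt l0.
have hb : ohb o i by rewrite /o /= iN xi.
congr (_ && _); rewrite -Q0E.
have hr := wf_hr wo hb.
case: (ltP x' (ohr o i)) => h.
  apply/eqP; elim: (on0 o) => [|k IH]; first by rewrite !Q0 hb h hr.
  rewrite !QS IH; congr (_ + nat_of_bool _)%N.
  case: eqP => // e; rewrite (le_lt_trans (ltW hr)) ?(lt_trans h) //.
    by apply: le_lt_trans (L_ge_hr y k hb) _; rewrite -e L_dp.
  by apply: le_lt_trans (L_ge_hr y k hb) _; rewrite -e L_dp.
apply/ltn_eqF; elim: (on0 o) => [|k IH]; first by rewrite !Q0 hb hr (le_gtF h).
rewrite !QS -addSn leq_add //; case: eqP => //= _.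
by case: (ltP x' (dp o (v y) k)) => // hx; rewrite (le_lt_trans x0 hx).
Qed.

Lemma Zh_start y l (x' : R) : (0 < l)%N -> 0 <= x' ->
  Zh y (on0 o) 0 x' l = start_frac l x'.
Proof.
move=> l0 x0; rewrite /Zh /start_frac; congr (_ * _).
by apply: eq_bigr => i _; rewrite zi_start.
Qed.

Lemma Zh_path y k (s x' : R) l : (on0 o <= k)%N -> 0 <= s -> s <= x' ->
  (forall j, (j < k)%N -> ot o j <= s) -> (0 < l)%N ->
  Zh y k s x' l = start_frac l x'
    + N%:R^-1 * (\sum_(kk < k) (Jf o (v y) k s l kk)%:R * (1 - G (x' - st o (v y) kk)))
    + N%:R^-1 * (\sum_(kk < k) snz G N x y0 k l s x' y kk)
    + N%:R^-1 * (\sum_(on0 o <= j < k) rate G N x y0 l (fun=> x') y j)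
    + N%:R^-1 * (\sum_(on0 o <= j < k) anz G N x y0 l (fun=> x') y j).
Proof.
move=> n0k s0 sx ht l0; rewrite -(Zh_start y l0 (le_trans s0 sx)) /Zh -!mulrDr; congr (_ * _).
have := sum_zi wo (wi y) l.-1 n0k s0 sx ht; rewrite prednK //.
move=> /(congr1 (fun n => n%:R : R)); rewrite !natrD !natr_sum => ->.
rewrite -!addrA; congr (_ + _); rewrite addrA -big_split /= -big_split /=.
congr (_ + _); apply: eq_bigr => kk _; last by rewrite /anz addrC subrK.
rewrite /snz /xi -mulrDr addrC subrK.
by case: Jf => /=; rewrite ?mul1r ?mul0r.
Qed.

Lemma Zh_le1 y k (s x' : R) l : 0 <= Zh y k s x' l <= 1.
Proof.
have N1 : (0 : R) < N%:R by rewrite ltr0n.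
have /andP[h1 h2] := @sum_bool_le R N (zi o (v y) k s x' l).
rewrite /Zh mulr_ge0 ?invr_ge0 ?ler0n //=.
by rewrite ler_pdivrMl // mulr1.
Qed.

Definition sflux y l j (x' : R) : R :=
  if (l == 1)%N then (1 - G (x' - ot o j)) * (1 - Zh y j (ot o j) (ot o j) 1 ^+ 2)
  else (Zh y j (ot o j) (ot o j) l.-1 + Zh y j (ot o j) (ot o j) l) *
       (Zh y j (ot o j) x' l.-1 - Zh y j (ot o j) x' l).

(** For [l = 1] the eligible servers are the idle ones, and (1 - Z_1)(1 + Z_1) = 1 - Z_1^2. For
    larger [l] they are the queues of length [l.-1] without departure up to [x' j], whose fraction
    is a difference of two values of [Zh]. *)
Lemma rateE y l j (x' : nat -> R) : (0 < l)%N -> rate G N x y0 l x' y j = sflux y l j (x' j).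
Proof.
move=> l0; have N1 : (N%:R : R) != 0 by rewrite pnatr_eq0 -lt0n.
have XE l' : \sum_(i < N) (l' <= Q o (v y) j i (ot o j))%:R =
    N%:R * Zh y j (ot o j) (ot o j) l' :> R.
  rewrite /Zh mulVKf //; apply: eq_bigr => i _.
  by rewrite /zi eqxx andbT.
rewrite /rate /sflux -/o -/v; case: eqP => [e|/eqP ne].
  subst l; rewrite /lag /= -/o XE.
  have -> : \sum_(i < N) (0 <= Q o (v y) j i (ot o j))%N%:R = N%:R :> R.
    by rewrite sumr_const card_ord.
  have -> : \sum_(i < N) (elig N x y0 1 x' y j i)%:R =
      N%:R * (1 - Zh y j (ot o j) (ot o j) 1) :> R.
    rewrite mulrBr mulr1 -XE; apply/eqP; rewrite eq_sym subr_eq -big_split /=; apply/eqP.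
    rewrite -[LHS](_ : \sum_(i < N) (1 : R) = _); last by rewrite sumr_const card_ord.
    apply: eq_bigr => i _; rewrite /elig /= -/o -/v.
    by case: posnP => h; rewrite /= ?h ?addr0 ?add0r.
  by field.
have l1 : (1 < l)%N by rewrite ltn_neqAle eq_sym ne.
have -> : lag N x y0 l x' j = -1 by rewrite /lag (negbTE ne).
rewrite (cdf_neg sa) ?oppr_le0 ?ler01 // subr0 mulr1.
have -> : \sum_(i < N) (l.-1 < Q o (v y) j i (ot o j))%N%:R = N%:R * Zh y j (ot o j) (ot o j) l :> R.
  by rewrite -XE; apply: eq_bigr => i _; rewrite prednK.
rewrite XE.
have -> : \sum_(i < N) (elig N x y0 l x' y j i)%:R =
    N%:R * (Zh y j (ot o j) (x' j) l.-1 - Zh y j (ot o j) (x' j) l) :> R.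
  rewrite /Zh mulrBr !mulVKf //; apply/eqP; rewrite eq_sym subr_eq -big_split /=; apply/eqP.
  apply: eq_bigr => i _; rewrite /elig (negbTE ne) /zi -/o -/v.
  rewrite -natrD; congr (_%:R).
  set q := Q o (v y) j i (ot o j); case: (Q o (v y) j i (x' j) == q); rewrite ?andbF ?andbT //.
  rewrite -[in (l <= q)%N](prednK l0).
  by case: (ltngtP q l.-1).
by field.
Qed.

Lemma sum_reindex_flow y k (s : R) l : (on0 o <= k)%N -> 0 <= s ->
  (forall j, (j < k)%N -> ot o j <= s) -> (0 < l)%N ->
  Zh y k s s l.+1 + Dl y k s l = start_frac l.+1 0 + Dl y k s l.+1
    + N%:R^-1 * (\sum_(on0 o <= j < k) (rate G N x y0 l.+1 (ot o) y j + anz G N x y0 l.+1 (ot o) y j)).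
Proof.
move=> n0k s0 ht l0.
have := sum_flow wo (wi y) l.-1 n0k s0 ht; rewrite prednK //.
move=> /(congr1 (fun n => n%:R : R)); rewrite !natrD !natr_sum => h.
rewrite -(Zh_start y (ltn0Sn l) (lexx 0)) /Zh /Dl -!mulrDr; congr (_ * _).
under eq_bigr => i _ do rewrite /zi eqxx andbT.
rewrite h; congr (_ + _ + _).
  by apply: eq_bigr => i _; rewrite /zi eqxx andbT.
apply: eq_bigr => j _; rewrite /anz addrC subrK /arr eqxx andbT eqSS.
by rewrite -/o -/v; case: (l) l0.
Qed.

(** Conservation and [Zh_path] at [x' = s] both express [Zh] at level [l.+1], and subtraction
    eliminates it. Of the starts at level [l.+1] only the part weighted by [G] survives, an integral
    of [Dl] over the past; no term of that level at time [s] itself remains, so a Gronwall estimate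
    is possible. *)
Lemma Dl_path y k (s : R) l : (on0 o <= k)%N -> 0 <= s ->
  (forall j, (j < k)%N -> ot o j <= s) -> (0 < l)%N ->
  Dl y k s l = start_frac l.+1 0 - start_frac l.+1 s
    + N%:R^-1 * (\sum_(kk < k) (Jf o (v y) k s l.+1 kk)%:R * G (s - st o (v y) kk))
    - N%:R^-1 * (\sum_(kk < k) snz G N x y0 k l.+1 s s y kk)
    + N%:R^-1 * (\sum_(on0 o <= j < k) rate G N x y0 l.+1 (ot o) y j)
    + N%:R^-1 * (\sum_(on0 o <= j < k) anz G N x y0 l.+1 (ot o) y j)
    - N%:R^-1 * (\sum_(on0 o <= j < k) rate G N x y0 l.+1 (fun=> s) y j)
    - N%:R^-1 * (\sum_(on0 o <= j < k) anz G N x y0 l.+1 (fun=> s) y j).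
Proof.
move=> n0k s0 ht l0.
have := sum_reindex_flow y n0k s0 ht l0.
rewrite (Zh_path y n0k s0 (lexx s) ht (ltn0Sn l)).
have -> : \sum_(on0 o <= j < k) (rate G N x y0 l.+1 (ot o) y j + anz G N x y0 l.+1 (ot o) y j) =
  \sum_(on0 o <= j < k) rate G N x y0 l.+1 (ot o) y j + \sum_(on0 o <= j < k) anz G N x y0 l.+1 (ot o) y j.
  exact: big_split.
have -> : Dl y k s l.+1 = N%:R^-1 * (\sum_(kk < k) (Jf o (v y) k s l.+1 kk)%:R * (1 - G (s - st o (v y) kk)))
   + N%:R^-1 * (\sum_(kk < k) (Jf o (v y) k s l.+1 kk)%:R * G (s - st o (v y) kk)).
  rewrite /Dl -mulrDr -big_split /=; congr (_ * _); apply: eq_bigr => kk _.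
  by rewrite -mulrDr subrK mulr1.
move=> h; lra.
Qed.

Lemma Jf_le y k (u s : R) l kk : u <= s ->
  Jf o (v y) k u l kk = Jf o (v y) k s l kk && (st o (v y) kk <= u).
Proof.
move=> us; rewrite /Jf; case: (leP (st o (v y) kk) u) => h; rewrite ?andbF ?andbT //.
by rewrite (le_trans h us).
Qed.

(** In the time variable [Dl] is a finite sum of steps at the starts, and each step is integrated
    against [g] by [kernel_int_step]. *)
Lemma Dl_kernel y k (s x' : R) l : 0 <= s -> s <= x' ->
  integ 0 s (fun u => g (x' - u) * Dl y k u l) /\
  int 0 s (fun u => g (x' - u) * Dl y k u l) =
  N%:R^-1 * (\sum_(kk < k) (Jf o (v y) k s l kk)%:R * (G (x' - st o (v y) kk) - G (x' - s))).
Proof.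
move=> s0 sx.
pose f (kk : 'I_k) (u : R) := (N%:R^-1 * (Jf o (v y) k s l kk)%:R) *
   (g (x' - u) * (st o (v y) kk <= u)%R%:R).
have fi kk : integ 0 s (f kk).
  apply: integZ; apply: (integM_bounded (M := 1)).
  - exact: (kernel_integ sa).
  - apply: measurable_funTS.
    suff [] : @bm _ R R (fun u => (st o (v y) kk <= u)%R%:R) by [].
    by apply: bm_bool; apply: measurable_fun_ler.
  - by move=> u _; case: (_ <= u); rewrite ?normr0 ?normr1.
have [h1 h2] := @int_sum R _ (index_enum 'I_k) xpredT 0 s f (fun kk _ => fi kk).
have e u : 0 <= u <= s -> \sum_(kk < k) f kk u = g (x' - u) * Dl y k u l.
  move=> /andP[u0 us]; rewrite /Dl mulrCA !big_distrr /=; apply: eq_bigr => kk _.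
  rewrite /f (Jf_le y k l kk us); case: Jf => /=; rewrite ?mulr0 ?mul0r ?mulr1 //.
split; first by apply: eq_integ h1.
rewrite -(eq_int e) h2 big_distrr /=; apply: eq_bigr => kk _.
rewrite intZ; last first.
  apply: (integM_bounded (M := 1)).
  - exact: (kernel_integ sa).
  - apply: measurable_funTS.
    suff [] : @bm _ R R (fun u => (st o (v y) kk <= u)%R%:R) by [].
    by apply: bm_bool; apply: measurable_fun_ler.
  - by move=> u _; case: (_ <= u); rewrite ?normr0 ?normr1.
case E : (Jf o (v y) k s l kk); last by rewrite !mulr0 !mul0r mulr0.
have /and3P[_ sts _] := E.
by rewrite (kernel_int_step sa) ?mulr1 ?mul1r //; exact: st_ge0.
Qed.

Lemma Dl_by_parts y k (s x' : R) l : 0 <= s -> s <= x' ->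
  N%:R^-1 * (\sum_(kk < k) (Jf o (v y) k s l kk)%:R * (1 - G (x' - st o (v y) kk))) =
  (1 - G (x' - s)) * Dl y k s l - int 0 s (fun u => g (x' - u) * Dl y k u l).
Proof.
move=> s0 sx; rewrite (Dl_kernel y k l s0 sx).2 /Dl mulrCA -mulrBr; congr (_ * _).
rewrite big_distrr -sumrB /=; apply: eq_bigr => kk _; ring.
Qed.

Lemma Dl_step y k (u : R) l : u <= ot o k -> Dl y k.+1 u l = Dl y k u l.
Proof.
move=> ut; rewrite /Dl big_ord_recr /=; congr (_ * _).
have -> : Jf o (v y) k.+1 u l k = false.
  rewrite /Jf wait_st; case: ltP => //= h; rewrite leNgt (le_lt_trans ut h) //.
rewrite addr0; apply: eq_bigr => kk _; rewrite /Jf /rk.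
case: (leP (st o (v y) kk) u) => h; rewrite ?andbF //.
by rewrite big_nat_recr ?(ltnW (ltn_ord kk)) //= (le_gtF (le_trans h ut)) andbF addn0.
Qed.

(** Error bounds at an earlier time [u] are available only with the number [k'] of jobs arrived by
    then. Jobs arriving later do not affect [Dl] at [u], so [k] may be replaced by [k'] under a time
    integral. *)
Lemma valid_before k (s u : R) : (on0 o <= k)%N -> valid o k s -> 0 <= u -> u <= s ->
  exists k', [/\ (on0 o <= k' <= k)%N, valid o k' u & forall y l, Dl y k u l = Dl y k' u l].
Proof.
move=> n0k [_ v2] u0 us.
have {v2} : forall j, (k <= j)%N -> u <= ot o j by move=> j /v2; apply: le_trans us.
elim: k n0k => [|k IH] n0k v2; first by exists 0%N; rewrite n0k; split=> //; split.
have [tu|ut] := leP (ot o k) u.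
  exists k.+1; rewrite n0k leqnn; split=> //; split=> // j jk.
  by apply: le_trans tu; apply: (wf_tle wo).
have [n0k'|n0k'] := leqP (on0 o) k; last by rewrite (wf_t0 wo) // ltNge u0 in ut.
have [|k' [/andP[h1 h2] h3 h4]] := IH n0k'.
  by move=> j; rewrite leq_eqVlt => /orP[/eqP <-|/v2 //]; exact: ltW.
by exists k'; rewrite h1 (leq_trans h2 (leqnSn k)); split=> // y l; rewrite Dl_step // ltW.
Qed.

End RealPath.

(** * Stability of the limit equations *)

Section Tonelli.
Context (R : realType) d (T : measurableType d) (P : probability T R).
Local Notation mu := (@lebesgue_measure R).

Lemma Ex_int (F : R * T -> R) (a b M : R) : measurable_fun setT F ->
  (forall z, 0 <= F z <= M) -> a <= b ->
  [/\ bm (fun w => int a b (fun u => F (u, w))),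
      integ a b (fun u => Ex P (fun w => F (u, w))) &
      Ex P (fun w => int a b (fun u => F (u, w))) =
      int a b (fun u => Ex P (fun w => F (u, w)))].
Proof.
move=> mF hF ab.
have F0 z : 0 <= F z by case/andP: (hF z).
have FM z : F z <= M by case/andP: (hF z).
have M0 : 0 <= M by apply: le_trans (F0 (0, point)) (FM _).
have mFu w : measurable_fun setT (fun u : R => F (u, w)) by exact: measurableT_comp.
have bFw u : bm (fun w => F (u, w)).
  by apply: (bm_le (M := M)) => [|w]; [exact: measurableT_comp|rewrite ger0_norm].
have iFu w : integ a b (fun u => F (u, w)).
  by apply: (integ_bounded (M := M)) => [|u _]; [exact: measurable_funTS|rewrite ger0_norm].
pose D := `[a, b]%classic : set R.
pose F' (z : T * measurableTypeR R) : \bar R := (F (z.2, z.1) * \1_D z.2)%:E.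
have mF' : measurable_fun setT F'.
  apply/measurable_EFinP; apply: measurable_funM.
    by apply: (measurableT_comp mF); apply: measurable_fun_pair.
  have mI : measurable_fun setT (\1_D : measurableTypeR R -> R) by apply: measurable_indic; exact: measurable_itv.
  exact: (measurableT_comp mI measurable_snd).
have F'0 z : (0 <= F' z)%E by rewrite lee_fin mulr_ge0.
have intE w : (\int[mu]_u F' (w, u) = (int a b (fun u => F (u, w)))%:E)%E.
  rewrite /int /intR /Rintegral fineK; last first.
    by apply: integrable_fin_num => //; exact: iFu.
  rewrite [RHS]integral_mkcond; apply: eq_integral => u _.
  rewrite /F' /= patchE /indic /D; case: ifP => h; rewrite ?mulr1 ?mulr0 //.
have ExE u : (\int[P]_w F' (w, u) = (Ex P (fun w => F (u, w)) * \1_D u)%:E)%E.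
  rewrite /F' /=.
  under eq_integral do rewrite mulrC.
  rewrite (Ex_EFin P (bmZ _ (bFw u))) ExZ // mulrC //.
have mE : measurable_fun setT (fun u : R => Ex P (fun w => F (u, w))).
  have := @measurable_fun_fubini_tonelli_F _ _ _ _ R P (fun z : R * T => (F z)%:E).
  move=> h; apply/measurable_EFinP.
  rewrite [X in measurable_fun _ X](_ : _ = fubini_F P (fun z : R * T => (F z)%:E)); last first.
    by apply/funext => u /=; rewrite -(Ex_EFin P (bFw u)).
  apply: h; first by apply/measurable_EFinP.
  by move=> z; rewrite lee_fin.
have iE : integ a b (fun u => Ex P (fun w => F (u, w))).
  apply: (integ_bounded (M := M)) => [|u _]; first exact: measurable_funTS.
  by rewrite ger0_norm ?Ex_ge0 //; apply: Ex_le_cst.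
have bI : bm (fun w => int a b (fun u => F (u, w))).
  apply: (bm_le (M := M * (b - a))).
    apply/measurable_EFinP; rewrite [X in measurable_fun _ X](_ : _ = fubini_F mu F').
      exact: measurable_fun_fubini_tonelli_F.
    by apply/funext => w; rewrite /= -intE.
  move=> w; rewrite ger0_norm ?int_ge0 // -int_cst //.
  by apply: int_le => //; exact: integ_cst.
split=> //; apply: EFin_inj; rewrite -(Ex_EFin P bI).
under eq_integral do rewrite -intE.
rewrite (fubini_tonelli F' mF' F'0).
under eq_integral do rewrite ExE.
rewrite /int /intR /Rintegral fineK; last first.
  by apply: integrable_fin_num => //; exact: iE.
rewrite [RHS]integral_mkcond; apply: eq_integral => u _.
by rewrite patchE /indic /D; case: ifP => h; rewrite ?mulr1 ?mulr0.
Qed.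

End Tonelli.

Lemma int_expR (R : realType) (c s : R) : 0 < c -> 0 <= s ->
  integ 0 s (fun u => expR (c * u)) /\ int 0 s (fun u => expR (c * u)) <= expR (c * s) / c.
Proof.
move=> c0; rewrite le_eqVlt => /predU1P[<-|s0].
  split; last by rewrite int_aa mulr0 expR0 mul1r invr_ge0 ltW.
  apply: (integ_bounded (M := 1)) => [|u /andP[h1 h2]].
    by apply: measurable_funTS; apply: measurableT_comp => //; exact: measurable_funM.
  have -> : u = 0 by lra.
  by rewrite mulr0 expR0 normr1.
have cE : continuous (fun u : R => expR (c * u)).
  move=> u; apply: continuous_comp; last exact: continuous_expR.
  exact: mulrl_continuous.
have dE (u : R) : is_derive u 1 (fun u => expR (c * u) / c) (expR (c * u)).
  have h : is_derive u (1:R) (fun u : R => c * u) c.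
    by apply: is_derive_eq; rewrite /GRing.scale /= mulr1.
  have h2 := is_derive1_comp (is_derive_expR (c * u)) h.
  have -> : (fun u => expR (c * u) / c) = c^-1 \*: (expR \o (fun u : R => c * u)).
    by apply/funext => z /=; rewrite mulrC.
  apply: is_derive_eq; rewrite /GRing.scale /=; field; lra.
have dd (u : R) : derivable (fun u => expR (c * u) / c) u 1 by exact: (ex_derive (is_derive := dE u)).
have cF : continuous (fun u : R => expR (c * u) / c).
  by move=> u; apply/differentiable_continuous/derivable1_diffP.
split.
  by apply: continuous_compact_integrable; [exact: segment_compact|exact: continuous_subspaceT].
rewrite /int /intR /Rintegral (@continuous_FTC2 _ _ (fun u => expR (c * u) / c)) //=.
- by rewrite mulr0 expR0 lerBlDr lerDl divr_ge0 // ltW.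
- exact: continuous_subspaceT.
- by split=> [u _||]; [exact: dd|exact: cvg_at_right_filter (cF 0)|exact: cvg_at_left_filter (cF s)].
- by move=> u _; rewrite derive1E (derive_val (is_derive := dE u)).
Qed.

(** The discrete counterpart of [int_expR]: a scaled sum of the weight over past arrivals gains a
    factor 1/c. *)
Lemma geometric_sum (R : realType) (c : R) (N n0 k : nat) : 0 < c -> (0 < N)%N ->
  (n0 <= k)%N ->
  N%:R^-1 * (\sum_(n0 <= j < k) (1 + c / N%:R) ^+ (j - n0)) <=
    (1 + c / N%:R) ^+ (k - n0) / c :> R.
Proof.
move=> c0 N0 n0k; have N1 : (0 : R) < N%:R by rewrite ltr0n.
set q : R := 1 + c / N%:R.
have q0 : 0 < q by rewrite addr_gt0 // divr_gt0.
rewrite -{1}(subnKC n0k); elim: (k - n0)%N => [|m IH].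
  by rewrite addn0 big_geq // mulr0 expr0 divr_ge0 // ltW.
rewrite addnS big_nat_recr ?leq_addr //= mulrDr.
apply: le_trans (lerD IH (lexx _)) _; rewrite addKn exprS.
rewrite [leRHS](_ : _ = q ^+ m / c + N%:R^-1 * q ^+ m) // {1}/q; field; lra.
Qed.

Section LimitSystem.
Variable R : realType.

Definition flux (G : R -> R) (fz : nat -> R -> R -> R) l (u x : R) : R :=
  if (l == 1)%N then (1 - G (x - u)) * (1 - fz 1%N u u ^+ 2)
  else (fz l.-1 u u + fz l u u) * (fz l.-1 u x - fz l u x).

(* The limit in the coordinates [s] (time) and [x] (completion time):
   [fz l s x] is Z_l(s, x - s), and [psi l s] is minus the integral over [0, s]
   of the derivative of Z_(l+1) at 0. *)
Record limit_system (G g : R -> R) (T C : R) (fz : nat -> R -> R -> R)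
    (psi Z0 : nat -> R -> R) (A : nat -> R -> R -> R) (Ad : nat -> R -> R) : Prop := {
  ls_le1 : forall l (s x : R), (0 < l)%N -> 0 <= s -> s <= x -> x <= T -> `|fz l s x| <= 1;
  ls_meas : forall l, (0 < l)%N -> measurable_fun setT (psi l);
  ls_bound : forall l u, (0 < l)%N -> `|psi l u| <= C * 2 ^+ l;
  ls_Z : forall l (s x : R), (0 < l)%N -> 0 <= s -> s <= x -> x <= T ->
    fz l s x = Z0 l x + (1 - G (x - s)) * psi l s
      - int 0 s (fun u => g (x - u) * psi l u) + A l s x;
  ls_D : forall l (s : R), (0 < l)%N -> 0 <= s -> s <= T ->
    psi l s = Z0 l.+1 0 - Z0 l.+1 s + int 0 s (fun u => g (s - u) * psi l.+1 u)
      + Ad l.+1 s - A l.+1 s s }.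

Record good_input (G : R -> R) (N : nat) (x : seq nat) (y0 : coord -> R) (T : R)
    (kmax : nat) (fz : nat -> R -> R -> R)
    (Z0 : nat -> R -> R) (A : nat -> R -> R -> R) (Ad : nat -> R -> R) (a : R) : Prop := {
  gi_pos : 0 < a;
  gi_start : forall l (x' : R), (0 < l)%N -> 0 <= x' -> x' <= T ->
    `|start_frac N x y0 l x' - Z0 l x'| <= a * 2 ^+ l;
  gi_flux : forall l k (s x' : R), (0 < l)%N -> (on0 (outer_at N x y0) <= k <= kmax)%N ->
    valid (outer_at N x y0) k s -> 0 <= s -> s <= x' -> x' <= T ->
    `|N%:R^-1 * (\sum_(on0 (outer_at N x y0) <= j < k)
        flux G fz l (ot (outer_at N x y0) j) x') - A l s x'| <= a * 2 ^+ l;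
  gi_fluxd : forall l k (s : R), (1 < l)%N -> (on0 (outer_at N x y0) <= k <= kmax)%N ->
    valid (outer_at N x y0) k s -> 0 <= s -> s <= T ->
    `|N%:R^-1 * (\sum_(on0 (outer_at N x y0) <= j < k)
        flux G fz l (ot (outer_at N x y0) j) (ot (outer_at N x y0) j)) - Ad l s| <= a * 2 ^+ l;
  gi_noise : 3 * Num.sqrt kmax%:R / N%:R <= a }.

End LimitSystem.

(** * Contraction of the mean errors *)

Section Contraction.
Context (R : realType) d (Om : measurableType d) (P : probability Om R).
Variables (G g : R -> R) (H : R) (Y : Om -> MI coord R) (N : nat).
Hypotheses (sa : service_assumption G g H) (drv : driving P Y G N) (N0 : (0 < N)%N).
Variables (x : seq nat) (y0 : coord -> R).
Let o := outer_at N x y0.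
Hypothesis wo : wf_outer o.
Let v (y : MI coord R) := inner_at N x y.
Variables (T C : R) (fz : nat -> R -> R -> R) (psi Z0 : nat -> R -> R)
  (A : nat -> R -> R -> R) (Ad : nat -> R -> R) (kmax : nat) (a : R).
Hypotheses (ls : limit_system G g T C fz psi Z0 A Ad)
  (gi : good_input G N x y0 T kmax fz Z0 A Ad a).

Let mY := drv_meas drv.
Let mid : measurable_fun setT (id : MI coord R -> MI coord R). Proof. by []. Qed.
Let H0 : 0 <= H := hazard_ge0 sa.
Let G01 : forall r, 0 <= G r <= 1 := cdf01 sa.
Let mG : measurable_fun setT G := measurable_cdf sa.
Let Gneg : forall r, r <= 0 -> G r = 0 := cdf_neg sa.
Let Ni : (0 : R) < N%:R^-1. Proof. by rewrite invr_gt0 ltr0n. Qed.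

Local Notation zh y k s x' l := (Zh N x y0 y k s x' l).
Local Notation dl y k s l := (Dl N x y0 y k s l).

Lemma bm_Zh k s x' l : bm (fun w => zh (Y w) k s x' l).
Proof.
apply: bmZ; apply: bm_sum => i _; apply: bm_bool.
by apply: (mf_at_zi N x y0 mY); exact: measurable_cst.
Qed.

Lemma Dl_bound y k (s : R) l : 0 <= dl y k s l <= N%:R^-1 * k%:R.
Proof.
rewrite /Dl pmulr_rge0 // ler_pM2l //.
have := @sum_bool_le R k (Jf (outer_at N x y0) (inner_at N x y) k s l); exact.
Qed.

Lemma measurable_Dl k l : measurable_fun setT (fun z : R * Om => dl (Y z.2) k z.1 l).
Proof.
apply: measurable_funM => //; apply: measurable_sum => i.
suff [] : @bm _ (R * Om)%type R (fun z => (Jf o (inner_at N x (Y z.2)) k z.1 l i)%:R) by [].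
have m2 : measurable_fun setT (fun z : R * Om => Y z.2) by exact: measurableT_comp mY measurable_snd.
by apply: bm_bool; apply: (mf_at_Jf N x y0 m2); exact: measurable_fst.
Qed.

Lemma bm_Dl k s l : bm (fun w => dl (Y w) k s l).
Proof.
apply: bmZ; apply: bm_sum => i _; apply: bm_bool.
by apply: (mf_at_Jf N x y0 mY); exact: measurable_cst.
Qed.

Definition errZ k s x' l : R := Ex P (fun w => `|zh (Y w) k s x' l - fz l s x'|).
Definition errD k s l : R := Ex P (fun w => `|dl (Y w) k s l - psi l s|).

Lemma psi_integ l s : (0 < l)%N -> integ 0 s (psi l).
Proof.
move=> l0; apply: (integ_bounded (M := C * 2 ^+ l)) => [|u _].
  by apply: measurable_funTS; exact: (ls_meas ls).
exact: (ls_bound ls).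
Qed.

Lemma errD_int k s l : (0 < l)%N -> 0 <= s ->
  [/\ bm (fun w => int 0 s (fun u => `|dl (Y w) k u l - psi l u|)),
      integ 0 s (fun u => errD k u l) &
      Ex P (fun w => int 0 s (fun u => `|dl (Y w) k u l - psi l u|)) =
      int 0 s (fun u => errD k u l)].
Proof.
move=> l0 s0.
apply: (@Ex_int _ _ _ P (fun z => `|dl (Y z.2) k z.1 l - psi l z.1|) 0 s
  (N%:R^-1 * k%:R + C * 2 ^+ l)) => //.
  apply: measurableT_comp => //; apply: measurable_funB; first exact: measurable_Dl.
  exact: measurableT_comp (ls_meas ls l0) measurable_fst.
move=> z; rewrite normr_ge0 /=; apply: le_trans (ler_normB _ _) _.
have /andP[h1 h2] := Dl_bound (Y z.2) k z.1 l.
by rewrite (ger0_norm h1) lerD // (ls_bound ls).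
Qed.

Lemma kernel_diff y k (s x' : R) l : (0 < l)%N -> 0 <= s -> s <= x' ->
  `|int 0 s (fun u => g (x' - u) * dl y k u l) - int 0 s (fun u => g (x' - u) * psi l u)| <=
  H * int 0 s (fun u => `|dl y k u l - psi l u|).
Proof.
move=> l0 s0 sx.
have i1 := (Dl_kernel sa wo y k l s0 sx).1.
have i2 : integ 0 s (fun u => g (x' - u) * psi l u).
  apply: (integM_bounded (M := C * 2 ^+ l)); first exact: (kernel_integ sa).
    by apply: measurable_funTS; exact: (ls_meas ls).
  by move=> u _; exact: (ls_bound ls).
rewrite -intB //; apply: le_trans (int_norm (integB i1 i2)) _.
have mD : measurable_fun setT (fun u : R => dl y k u l).
  apply: measurable_funM => //; apply: measurable_sum => i.
  suff [] : @bm _ R R (fun u => (Jf o (inner_at N x y) k u l i)%:R) by [].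
  by apply: bm_bool; apply: (mf_at_Jf N x y0 (measurable_cst y)).
have i3 : integ 0 s (fun u => dl y k u l).
  apply: (integ_bounded (M := N%:R^-1 * k%:R)) => [|u _]; first exact: measurable_funTS.
  by have /andP[h1 h2] := Dl_bound y k u l; rewrite ger0_norm.
have i4 := integ_norm (integB i3 (psi_integ s l0)).
rewrite -intZ //; apply: int_le; [exact: integ_norm (integB i1 i2)|exact: integZ|].
move=> u /andP[u0 us]; rewrite -mulrBr normrM ler_wpM2r //.
rewrite ger0_norm ?(density_ge0 sa) // (density_le sa) // subr_ge0; exact: le_trans us sx.
Qed.


Definition fdiff l (xf : nat -> R) y j : R :=
  `|sflux G N x y0 y l j (xf j) - flux G fz l (ot o j) (xf j)|.
Definition errF l xf j : R := Ex P (fun w => fdiff l xf (Y w) j).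

Lemma rate_sum_diff l xf y k : (0 < l)%N ->
  `|N%:R^-1 * (\sum_(on0 o <= j < k) rate G N x y0 l xf y j) -
    N%:R^-1 * (\sum_(on0 o <= j < k) flux G fz l (ot o j) (xf j))| <=
  N%:R^-1 * (\sum_(on0 o <= j < k) fdiff l xf y j).
Proof.
move=> l0; rewrite -mulrBr normrM gtr0_norm // ler_pM2l // -sumrB.
apply: le_trans (ler_norm_sum _ _ _) _; apply: ler_sum => j _.
by rewrite (rateE sa).
Qed.

Definition snoise k s x' l y : R := N%:R^-1 * `|\sum_(kk < k) snz G N x y0 k l s x' y kk|.
Definition anoise k xf l y : R :=
  N%:R^-1 * `|\sum_(on0 o <= j < k) anz G N x y0 l xf y j|.

Lemma Zh_diff y k (s x' : R) l : (on0 o <= k <= kmax)%N -> valid o k s -> 0 <= s ->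
  s <= x' -> x' <= T -> (0 < l)%N ->
  `|zh y k s x' l - fz l s x'| <= `|dl y k s l - psi l s|
    + H * int 0 s (fun u => `|dl y k u l - psi l u|)
    + N%:R^-1 * (\sum_(on0 o <= j < k) fdiff l (fun=> x') y j)
    + (snoise k s x' l y + anoise k (fun=> x') l y) + 2 * (a * 2 ^+ l).
Proof.
move=> nk vk s0 sx xT l0; have /andP[n0k _] := nk.
have x0 := le_trans s0 sx.
rewrite (Zh_path G N0 wo y n0k s0 sx vk.1 l0) (Dl_by_parts sa wo y k l s0 sx).
rewrite (ls_Z ls l0 s0 sx xT).
have := kernel_diff y k l0 s0 sx.
have := gi_start gi l0 x0 xT.
have := gi_flux gi l0 nk vk s0 sx xT.
have := rate_sum_diff (fun=> x') y k l0.
have := lexx (snoise k s x' l y); rewrite {1}/snoise -[X in X * _](gtr0_norm Ni) -normrM.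
have := lexx (anoise k (fun=> x') l y); rewrite {1}/anoise -[X in X * _](gtr0_norm Ni) -normrM.
have : `|(1 - G (x' - s)) * dl y k s l - (1 - G (x' - s)) * psi l s| <= `|dl y k s l - psi l s|.
  rewrite -mulrBr normrM ler_piMl // ger0_norm; have /andP[? ?] := G01 (x' - s); lra.
rewrite -/o !ler_norml.
do 7![case/andP => ? ?]; apply/andP; split; lra.
Qed.

Lemma Dl_diff y k (s : R) l : (on0 o <= k <= kmax)%N -> valid o k s -> 0 <= s ->
  s <= T -> (0 < l)%N ->
  `|dl y k s l - psi l s| <= H * int 0 s (fun u => `|dl y k u l.+1 - psi l.+1 u|)
    + N%:R^-1 * (\sum_(on0 o <= j < k) fdiff l.+1 (ot o) y j)
    + N%:R^-1 * (\sum_(on0 o <= j < k) fdiff l.+1 (fun=> s) y j)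
    + (snoise k s s l.+1 y + anoise k (ot o) l.+1 y + anoise k (fun=> s) l.+1 y)
    + 4 * (a * 2 ^+ l.+1).
Proof.
move=> nk vk s0 sT l0; have /andP[n0k _] := nk; have T0 := le_trans s0 sT.
rewrite (Dl_path G N0 wo y n0k s0 vk.1 l0).
have -> : N%:R^-1 * (\sum_(kk < k) (Jf o (inner_at N x y) k s l.+1 kk)%:R *
    G (s - st o (inner_at N x y) kk)) = int 0 s (fun u => g (s - u) * dl y k u l.+1).
  rewrite (Dl_kernel sa wo y k l.+1 s0 (lexx s)).2; congr (_ * _); apply: eq_bigr => kk _.
  by rewrite subrr (Gneg (lexx 0)) subr0.
rewrite (ls_D ls l0 s0 sT).
have := kernel_diff y k (ltn0Sn l) s0 (lexx s).
have := gi_start gi (ltn0Sn l) (lexx 0) T0.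
have := gi_start gi (ltn0Sn l) s0 sT.
have := gi_flux gi (ltn0Sn l) nk vk s0 (lexx s) sT.
have := gi_fluxd gi (l0 : 1 < l.+1)%N nk vk s0 sT.
have := rate_sum_diff (fun=> s) y k (ltn0Sn l).
have := rate_sum_diff (ot o) y k (ltn0Sn l).
have := lexx (snoise k s s l.+1 y); rewrite {1}/snoise -[X in X * _](gtr0_norm Ni) -normrM.
have := lexx (anoise k (fun=> s) l.+1 y); rewrite {1}/anoise -[X in X * _](gtr0_norm Ni) -normrM.
have := lexx (anoise k (ot o) l.+1 y); rewrite {1}/anoise -[X in X * _](gtr0_norm Ni) -normrM.
rewrite -/o !ler_norml.
do 10![case/andP => ? ?]; apply/andP; split; lra.
Qed.

Lemma bm_snoise k s x' l : bm (fun w => snoise k s x' l (Y w)).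
Proof.
apply: bmZ; apply: bm_norm; apply: bm_sum => kk _.
by apply: (bm_comp (f := fun y => snz G N x y0 k l s x' y kk) mY); exact: bm_snz.
Qed.

Lemma bm_anoise k xf l : bm (fun w => anoise k xf l (Y w)).
Proof.
apply: bmZ; apply: bm_norm; apply: bm_sum => j _.
by apply: (bm_comp (f := fun y => anz G N x y0 l xf y j) mY); exact: bm_anz.
Qed.

Lemma Ex_sqrt_le (f : Om -> R) (c : R) : bm f -> Ex P (fun w => f w ^+ 2) <= c ->
  Ex P (fun w => `|f w|) <= Num.sqrt c.
Proof.
move=> bf h; have h1 := le_trans (Ex_sqr P bf) h.
rewrite -(ger0_norm (Ex_ge0 P (fun w => normr_ge0 (f w)))) -sqrtr_sqr.
exact: ler_wsqrtr.
Qed.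

Lemma Ex_snoise_le k s x' l : (k <= kmax)%N -> Ex P (fun w => snoise k s x' l (Y w)) <= a.
Proof.
move=> kk; rewrite /snoise ExZ; last first.
  apply: bm_norm; apply: bm_sum => j _.
  by apply: (bm_comp (f := fun y => snz G N x y0 k l s x' y j) mY); exact: bm_snz.
have h : Ex P (fun w => `|\sum_(kk < k) snz G N x y0 k l s x' (Y w) kk|) <= Num.sqrt k%:R.
  apply: Ex_sqrt_le; last exact: (Ex_snoise drv).
  apply: bm_sum => j _.
  by apply: (bm_comp (f := fun y => snz G N x y0 k l s x' y j) mY); exact: bm_snz.
apply: le_trans (gi_noise gi); rewrite [leRHS]mulrC ler_pM2l //; apply: le_trans h _.
have : Num.sqrt k%:R <= Num.sqrt kmax%:R :> R by rewrite ler_wsqrtr // ler_nat.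
by have := sqrtr_ge0 (kmax%:R : R); lra.
Qed.

Lemma Ex_anoise_le k xf l : (k <= kmax)%N -> Ex P (fun w => anoise k xf l (Y w)) <= a.
Proof.
move=> kk; have bf : bm (fun w => \sum_(on0 o <= j < k) anz G N x y0 l xf (Y w) j).
  apply: bm_sum => j _.
  by apply: (bm_comp (f := fun y => anz G N x y0 l xf y j) mY); exact: bm_anz.
rewrite /anoise ExZ; last exact: bm_norm.
have h := Ex_sqrt_le bf (Ex_anoise drv N0 G01 wo l xf k).
apply: le_trans (gi_noise gi); rewrite [leRHS]mulrC ler_pM2l //; apply: le_trans h _.
have -> : 9 * (k - on0 (outer_at N x y0))%:R = 3 ^+ 2 * (k - on0 (outer_at N x y0))%:R :> R.
  by congr (_ * _); ring.
rewrite sqrtrM ?exprn_ge0 // sqrtr_sqr ger0_norm // ler_pM2l // ler_wsqrtr // ler_nat.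
exact: leq_trans (leq_subr _ _) kk.
Qed.

Lemma bm_sflux l j x' : bm (fun w => sflux G N x y0 (Y w) l j x').
Proof.
rewrite /sflux; case: (l == 1)%N.
  by apply: bmM; [exact: bm_cst|apply: bmB; [exact: bm_cst|apply: bmX; exact: bm_Zh]].
by apply: bmM; [apply: bmD; exact: bm_Zh|apply: bmB; exact: bm_Zh].
Qed.

Lemma bm_fdiff l xf j : bm (fun w => fdiff l xf (Y w) j).
Proof. by apply: bm_norm; apply: bmB; [exact: bm_sflux|exact: bm_cst]. Qed.

Lemma bm_diffD k s l : bm (fun w => `|dl (Y w) k s l - psi l s|).
Proof. by apply: bm_norm; apply: bmB; [exact: bm_Dl|exact: bm_cst]. Qed.

Lemma bm_diffZ k s x' l : bm (fun w => `|zh (Y w) k s x' l - fz l s x'|).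
Proof. by apply: bm_norm; apply: bmB; [exact: bm_Zh|exact: bm_cst]. Qed.

Lemma bm_sum_fdiff l xf k : bm (fun w => N%:R^-1 * (\sum_(on0 o <= j < k) fdiff l xf (Y w) j)).
Proof. by apply: bmZ; apply: bm_sum => j _; exact: bm_fdiff. Qed.

Lemma Ex_sum_fdiff l xf k : Ex P (fun w => N%:R^-1 * (\sum_(on0 o <= j < k) fdiff l xf (Y w) j)) =
  N%:R^-1 * (\sum_(on0 o <= j < k) errF l xf j).
Proof.
rewrite ExZ; last by apply: bm_sum => j _; exact: bm_fdiff.
by rewrite Ex_sum // => j _; exact: bm_fdiff.
Qed.

Lemma errZ_le k (s x' : R) l : (on0 o <= k <= kmax)%N -> valid o k s -> 0 <= s ->
  s <= x' -> x' <= T -> (0 < l)%N ->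
  errZ k s x' l <= errD k s l + H * int 0 s (fun u => errD k u l)
    + N%:R^-1 * (\sum_(on0 o <= j < k) errF l (fun=> x') j) + (a + a) + 2 * (a * 2 ^+ l).
Proof.
move=> nk vk s0 sx xT l0; have /andP[_ kk] := nk.
have [b1 _ e1] := errD_int k l0 s0.
have b2 := bm_diffD k s l; have b3 := bm_sum_fdiff l (fun=> x') k.
have b4 := bm_snoise k s x' l; have b5 := bm_anoise k (fun=> x') l.
have b6 := bmZ H b1.
have b7 := bmD b2 b6; have b8 := bmD b7 b3; have b9 := bmD b4 b5; have b10 := bmD b8 b9.
have b11 := bmD b10 (@bm_cst _ Om R (2 * (a * 2 ^+ l))).
apply: le_trans (le_Ex P (bm_diffZ _ _ _ _) b11 (fun w => Zh_diff (Y w) nk vk s0 sx xT l0)) _.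
rewrite (ExD P b10 (@bm_cst _ Om R _)) Ex_cst (ExD P b8 b9) (ExD P b4 b5) (ExD P b7 b3) (ExD P b2 b6).
rewrite (ExZ P H b1) e1 Ex_sum_fdiff lerD2r lerD2l lerD //; [exact: Ex_snoise_le|exact: Ex_anoise_le].
Qed.

Lemma errD_le k (s : R) l : (on0 o <= k <= kmax)%N -> valid o k s -> 0 <= s ->
  s <= T -> (0 < l)%N ->
  errD k s l <= H * int 0 s (fun u => errD k u l.+1)
    + N%:R^-1 * (\sum_(on0 o <= j < k) errF l.+1 (ot o) j)
    + N%:R^-1 * (\sum_(on0 o <= j < k) errF l.+1 (fun=> s) j)
    + (a + a + a) + 4 * (a * 2 ^+ l.+1).
Proof.
move=> nk vk s0 sT l0; have /andP[_ kk] := nk.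
have [b1 _ e1] := errD_int k (ltn0Sn l) s0.
have b2 := bmZ H b1; have b3 := bm_sum_fdiff l.+1 (ot o) k.
have b4 := bm_sum_fdiff l.+1 (fun=> s) k.
have b5 := bm_snoise k s s l.+1; have b6 := bm_anoise k (ot o) l.+1.
have b7 := bm_anoise k (fun=> s) l.+1.
have b8 := bmD b2 b3; have b9 := bmD b8 b4; have b10 := bmD b5 b6; have b11 := bmD b10 b7.
have b12 := bmD b9 b11; have b13 := bmD b12 (@bm_cst _ Om R (4 * (a * 2 ^+ l.+1))).
apply: le_trans (le_Ex P (bm_diffD _ _ _) b13 (fun w => Dl_diff (Y w) nk vk s0 sT l0)) _.
rewrite (ExD P b12 (@bm_cst _ Om R _)) Ex_cst (ExD P b9 b11) (ExD P b8 b4) (ExD P b2 b3).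
rewrite (ExD P b10 b7) (ExD P b5 b6) (ExZ P H b1) e1 !Ex_sum_fdiff lerD2r lerD2l !lerD //;
  [exact: Ex_snoise_le|exact: Ex_anoise_le|exact: Ex_anoise_le].
Qed.

(** The difference of two products is written with one factor changed at a time, the other factor
    being at most 2. *)
Lemma errF_le l (xf : nat -> R) j : (0 < l)%N -> ot o j <= xf j -> xf j <= T ->
  errF l xf j <= if (l == 1)%N then 2 * errZ j (ot o j) (ot o j) 1
    else 2 * (errZ j (ot o j) (ot o j) l.-1 + errZ j (ot o j) (ot o j) l)
       + 2 * (errZ j (ot o j) (xf j) l.-1 + errZ j (ot o j) (xf j) l).
Proof.
move=> l0 tx xT; have t0 : 0 <= ot o j by exact: (wf_tge0 wo).
have tT := le_trans tx xT.
have f1 l' z : (0 < l')%N -> ot o j <= z -> z <= T -> -1 <= fz l' (ot o j) z <= 1.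
  by move=> h1 h2 h3; have := ls_le1 ls h1 t0 h2 h3; rewrite ler_norml.
have z1 y z l' : 0 <= zh y j (ot o j) z l' <= 1 by exact: Zh_le1.
case: eqP => [e|/eqP ne].
  subst l; rewrite -ExZ; last exact: bm_diffZ.
  apply: le_Ex; [exact: bm_fdiff|by apply: bmZ; exact: bm_diffZ|move=> w].
  rewrite /fdiff /sflux /flux /=.
  have /andP[h1 h2] := f1 1%N _ isT (lexx _) tT.
  have /andP[h3 h4] := z1 (Y w) (ot o j) 1%N.
  rewrite -mulrBr normrM.
  set p := Zh _ _ _ _ _ _ _ _ in h3 h4 *; set q := fz _ _ _ in h1 h2 *.
  have -> : 1 - p ^+ 2 - (1 - q ^+ 2) = - ((p + q) * (p - q)) by ring.
  rewrite normrN normrM mulrA ler_wpM2r //.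
  have /andP[g1 g2] := G01 (xf j - ot o j).
  have u1 : `|1 - G (xf j - ot o j)| <= 1 by rewrite ger0_norm; lra.
  have u2 : `|p + q| <= 2 by rewrite ler_norml; apply/andP; split; lra.
  by rewrite -[2]mul1r ler_pM.
have l1 : (0 < l.-1)%N by rewrite -ltnS prednK // ltn_neqAle eq_sym ne.
have b1 := bm_diffZ j (ot o j) (ot o j) l.-1; have b2 := bm_diffZ j (ot o j) (ot o j) l.
have b3 := bm_diffZ j (ot o j) (xf j) l.-1; have b4 := bm_diffZ j (ot o j) (xf j) l.
have b5 := bmD b1 b2; have b6 := bmD b3 b4.
rewrite -(ExD P b1 b2) -(ExD P b3 b4) -(ExZ P 2 b5) -(ExZ P 2 b6) -(ExD P (bmZ 2 b5) (bmZ 2 b6)).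
apply: le_Ex; [exact: bm_fdiff|exact: bmD (bmZ 2 b5) (bmZ 2 b6)|move=> w].
rewrite /fdiff /sflux /flux (negbTE ne).
have /andP[] := f1 _ _ l1 (lexx _) tT; have /andP[] := f1 _ _ l0 (lexx _) tT.
have /andP[] := f1 _ _ l1 tx xT; have /andP[] := f1 _ _ l0 tx xT.
have /andP[] := z1 (Y w) (ot o j) l.-1; have /andP[] := z1 (Y w) (ot o j) l.
have /andP[] := z1 (Y w) (xf j) l.-1; have /andP[] := z1 (Y w) (xf j) l.
set p1 := Zh _ _ _ _ _ _ _ _; set p2 := Zh _ _ _ _ _ _ _ _.
set p3 := Zh _ _ _ _ _ _ _ _; set p4 := Zh _ _ _ _ _ _ _ _.
set q1 := fz _ _ _; set q2 := fz _ _ _; set q3 := fz _ _ _; set q4 := fz _ _ _.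
move=> *.
have -> : (p4 + p3) * (p2 - p1) - (q4 + q3) * (q2 - q1) =
  (p2 - p1) * ((p4 - q4) + (p3 - q3)) + (q4 + q3) * ((p2 - q2) - (p1 - q1)) by ring.
apply: le_trans (ler_normD _ _) _; rewrite !normrM; apply: lerD; apply: ler_pM => //.
- by rewrite ler_norml; apply/andP; split; lra.
- exact: ler_normD.
- by rewrite ler_norml; apply/andP; split; lra.
- exact: ler_normB.
Qed.


Variables (c ka : R).
Hypotheses (c1024 : 1024 <= c) (kaH : 16 * H + 1 <= ka).

Definition wt k (s : R) : R := expR (ka * s) * (1 + c / N%:R) ^+ (k - on0 o).

(** The larger constant for [errZ] leaves room for [errD], which enters [errZ_le] at the same time
    and level with coefficient 1, without a small factor. *)
Definition close (K : R) : Prop := forall k (s : R), (on0 o <= k <= kmax)%N ->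
  valid o k s -> 0 <= s -> s <= T ->
  (forall l (x' : R), (0 < l)%N -> s <= x' -> x' <= T ->
     errZ k s x' l <= 8 * K * 2 ^+ l * wt k s) /\
  (forall l, (0 < l)%N -> errD k s l <= 2 * K * 2 ^+ l * wt k s).

Let ka0 : 0 < ka. Proof. by move: H0 kaH; lra. Qed.
Let c0 : 0 < c. Proof. by move: c1024; lra. Qed.
Let q1 : 1 <= 1 + c / N%:R. Proof. by rewrite lerDl divr_ge0 // ltW. Qed.

Lemma wt_ge1 k (s : R) : 0 <= s -> 1 <= wt k s.
Proof.
move=> s0; rewrite /wt mulr_ege1 ?exprn_ege1 //.
by rewrite -expR0 ler_expR mulr_ge0 // ltW.
Qed.

Lemma valid_at j : valid o j (ot o j).
Proof. by split=> i ij; apply: (wf_tle wo) => //; exact: ltnW. Qed.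

Lemma sum_wt k s : (on0 o <= k)%N -> valid o k s -> 0 <= s ->
  N%:R^-1 * (\sum_(on0 o <= j < k) wt j (ot o j)) <= wt k s / c.
Proof.
move=> nk [vk _] s0; rewrite /wt -mulrA.
apply: le_trans (ler_wpM2l (expR_ge0 _) (geometric_sum c0 N0 nk)).
rewrite mulrCA; apply: ler_wpM2l; first exact: ltW.
rewrite big_distrr /= !big_nat; apply: ler_sum => j /andP[_ jk].
rewrite ler_wpM2r ?exprn_ge0 ?(le_trans ler01 q1) //.
by rewrite ler_expR ler_pM2l // vk.
Qed.

(** The constant is 48 = 2 * 2 * (4 + 8): two pairs of errors with coefficient 2, each pair bounded
    by 8 K 2^(l-1) + 8 K 2^l. *)
Lemma close_errF K l xf j : close K -> 0 <= K -> (0 < l)%N -> (on0 o <= j <= kmax)%N ->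
  ot o j <= xf j -> xf j <= T -> errF l xf j <= 48 * K * 2 ^+ l * wt j (ot o j).
Proof.
move=> cK K0 l0 nj tx xT; have t0 : 0 <= ot o j by exact: (wf_tge0 wo).
have tT := le_trans tx xT.
have [hZ _] := cK j (ot o j) nj (valid_at j) t0 tT.
apply: le_trans (errF_le l0 tx xT) _.
have w1 := le_trans ler01 (wt_ge1 j t0).
case: eqP => [e|/eqP ne].
  subst l; have := hZ 1%N _ isT (lexx _) tT; rewrite expr1.
  have : 0 <= K * wt j (ot o j) by apply: mulr_ge0.
  move: (K) (wt j (ot o j)) => a1 a2.
  have -> : 48 * a1 * 2 * a2 = 96 * (a1 * a2) by ring.
  have -> : 8 * a1 * 2 * a2 = 16 * (a1 * a2) by ring.
  by move=> ? ?; lra.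
have l1 : (0 < l.-1)%N by rewrite -ltnS prednK // ltn_neqAle eq_sym ne.
have := hZ _ _ l1 (lexx _) tT; have := hZ _ _ l0 (lexx _) tT.
have := hZ _ _ l1 tx xT; have := hZ _ _ l0 tx xT.
rewrite -[in 2 ^+ l](prednK l0) exprS.
have -> : 8 * K * (2 * 2 ^+ l.-1) * wt j (ot o j) = 16 * (K * 2 ^+ l.-1 * wt j (ot o j)) by ring.
have -> : 48 * K * (2 * 2 ^+ l.-1) * wt j (ot o j) = 96 * (K * 2 ^+ l.-1 * wt j (ot o j)) by ring.
have -> : 8 * K * 2 ^+ l.-1 * wt j (ot o j) = 8 * (K * 2 ^+ l.-1 * wt j (ot o j)) by ring.
lra.
Qed.

Lemma close_sum_errF K l xf k s : close K -> 0 <= K -> (0 < l)%N -> (on0 o <= k <= kmax)%N ->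
  valid o k s -> 0 <= s ->
  (forall j, (j < k)%N -> ot o j <= xf j <= T) ->
  N%:R^-1 * (\sum_(on0 o <= j < k) errF l xf j) <= 48 * K * 2 ^+ l * wt k s / 1024.
Proof.
move=> cK K0 l0 /andP[nk kk] vk s0 hx.
apply: (@le_trans _ _ (N%:R^-1 * (\sum_(on0 o <= j < k) (48 * K * 2 ^+ l) * wt j (ot o j)))).
  rewrite ler_pM2l // !big_nat; apply: ler_sum => j /andP[nj jk].
  have /andP[h1 h2] := hx j jk.
  by apply: close_errF => //; rewrite nj (leq_trans (ltnW jk)).
set D := 48 * K * 2 ^+ l.
have -> : N%:R^-1 * (\sum_(on0 o <= j < k) D * wt j (ot o j)) =
    D * (N%:R^-1 * \sum_(on0 o <= j < k) wt j (ot o j)).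
  by rewrite -big_distrr mulrCA.
rewrite -[leRHS]mulrA; apply: ler_wpM2l.
  by rewrite /D !mulr_ge0 // exprn_ge0.
apply: le_trans (sum_wt nk vk s0) _.
rewrite ler_wpM2l ?(le_trans ler01 (wt_ge1 k s0)) // lef_pV2 // posrE; lra.
Qed.

(** At time [u] the bound holds with the index valid there, and monotonicity of the weight in the
    index leads back to [k]. The integral of the exponential gains 1/ka; since 16 H is at most ka,
    the constant 2 K H/ka is at most K/8. *)
Lemma close_int K l k s : close K -> 0 <= K -> (0 < l)%N -> (on0 o <= k <= kmax)%N ->
  valid o k s -> 0 <= s -> s <= T ->
  H * int 0 s (fun u => errD k u l) <= K * 2 ^+ l * wt k s / 8.
Proof.
move=> cK K0 l0 /andP[nk kk] vk s0 sT.
have [_ i1 _] := errD_int k l0 s0.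
have [i2 i3] := int_expR ka0 s0.
set B : R := 2 * K * 2 ^+ l * (1 + c / N%:R) ^+ (k - on0 o).
have B0 : 0 <= B by rewrite !mulr_ge0 ?exprn_ge0 // (le_trans ler01 q1).
have h : int 0 s (fun u => errD k u l) <= B * int 0 s (fun u => expR (ka * u)).
  rewrite -intZ //; apply: int_le => //; first exact: integZ.
  move=> u /andP[u0 us].
  have [k' [/andP[nk' k'k] vk' e]] := valid_before wo nk vk u0 us.
  have -> : errD k u l = errD k' u l by apply: eq_Ex => w; rewrite e.
  have nk2 : (on0 o <= k' <= kmax)%N by rewrite nk' (leq_trans k'k).
  apply: le_trans ((cK k' u nk2 vk' u0 (le_trans us sT)).2 l l0) _.
  rewrite /wt /B -!mulrA [expR _ * _]mulrC !ler_wpM2l ?exprn_ge0 //.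
  by rewrite ler_wpM2r ?expR_ge0 // ler_weXn2l // leq_sub2r.
apply: le_trans (ler_wpM2l H0 h) _.
apply: le_trans (ler_wpM2l H0 (ler_wpM2l B0 i3)) _.
have -> : H * (B * (expR (ka * s) / ka)) = (H / ka) * (B * expR (ka * s)).
  by field; rewrite gt_eqF.
have -> : K * 2 ^+ l * wt k s / 8 = 16^-1 * (B * expR (ka * s)).
  by rewrite /B /wt; field.
apply: ler_wpM2r; first by apply: mulr_ge0 => //; exact: expR_ge0.
by rewrite ler_pdivrMr //; move: H0 kaH; lra.
Qed.

(** The estimate of [errD] uses level [l.+1], which doubles 2^l. The time integral then contributes
    1/4 and the two flux sums 3/32 each, in all 7/16 of K, while the claim allows K. *)
Lemma close_contract K : 0 <= K -> close K -> close (K / 2 + 8 * a).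
Proof.
move=> K0 cK k s nk vk s0 sT.
have a0 := ltW (gi_pos gi).
have /andP[n0k kk] := nk.
have W1 := wt_ge1 k s0.
have two l : (0 < l)%N -> 2 <= 2 ^+ l :> R.
  by move=> l0; rewrite -(prednK l0) exprS ler_pMr // exprn_ege1 // ler1n.
have hD l : (0 < l)%N -> errD k s l <= (K * 7 / 16 + a * 10) * (2 ^+ l * wt k s).
  move=> l0; apply: le_trans (errD_le nk vk s0 sT l0) _.
  have h1 := close_int cK K0 (ltn0Sn l) nk vk s0 sT.
  have h2 := @close_sum_errF K l.+1 (ot o) k s cK K0 (ltn0Sn l) nk vk s0.
  have h3 := @close_sum_errF K l.+1 (fun=> s) k s cK K0 (ltn0Sn l) nk vk s0.
  have {}h2 := h2 (fun j jk => introT andP (conj (lexx _) (le_trans (vk.1 j jk) sT))).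
  have {}h3 := h3 (fun j jk => introT andP (conj (vk.1 j jk) sT)).
  have W2 := two l l0; rewrite exprS in h1 h2 h3 *.
  set P2 : R := 2 ^+ l in W2 h1 h2 h3 *; set W := wt k s in W1 h1 h2 h3 *.
  have u1 : a * P2 <= a * (P2 * W) by rewrite ler_wpM2l // ler_peMr //; lra.
  have u2 : 2 * a <= a * P2 by rewrite [leLHS]mulrC ler_wpM2l.
  have -> : (K * 7 / 16 + a * 10) * (P2 * W) = 7 / 16 * (K * (P2 * W)) + 10 * (a * (P2 * W)) by field.
  have e1 : K * (2 * P2) * W / 8 = K * (P2 * W) / 4 by field.
  have e2 : 48 * K * (2 * P2) * W / 1024 = K * (P2 * W) * (3 / 32) by field.
  rewrite e1 in h1; rewrite e2 in h2 h3; have e3 : a * (2 * P2) = 2 * (a * P2) by ring.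
  rewrite e3; lra.
have KW l : 0 <= K * (2 ^+ l * wt k s).
  apply: mulr_ge0 => //; apply: mulr_ge0; [exact: exprn_ge0|exact: le_trans ler01 W1].
have aW l : 0 <= a * (2 ^+ l * wt k s).
  apply: mulr_ge0 => //; apply: mulr_ge0; [exact: exprn_ge0|exact: le_trans ler01 W1].
split=> [l x' l0 sx xT|l l0]; last first.
  apply: le_trans (hD l l0) _.
  have -> : 2 * (K / 2 + 8 * a) * 2 ^+ l * wt k s =
     K * (2 ^+ l * wt k s) + 16 * (a * (2 ^+ l * wt k s)) by field.
  have -> : (K * 7 / 16 + a * 10) * (2 ^+ l * wt k s) =
    7 / 16 * (K * (2 ^+ l * wt k s)) + 10 * (a * (2 ^+ l * wt k s)) by field.
  by have := KW l; have := aW l; lra.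
apply: le_trans (errZ_le nk vk s0 sx xT l0) _.
have h1 := close_int cK K0 l0 nk vk s0 sT.
have h2 := @close_sum_errF K l (fun=> x') k s cK K0 l0 nk vk s0.
have {}h2 := h2 (fun j jk => introT andP (conj (le_trans (vk.1 j jk) sx) xT)).
have h3 := hD l l0; have W2 := two l l0; have := KW l; have := aW l.
set P2 : R := 2 ^+ l in W2 h1 h2 h3 *; set W := wt k s in W1 h1 h2 h3 *.
have u1 : a * P2 <= a * (P2 * W) by rewrite ler_wpM2l // ler_peMr //; lra.
have u2 : 2 * a <= a * P2 by rewrite [leLHS]mulrC ler_wpM2l.
have e0 : 8 * (K / 2 + 8 * a) * P2 * W = 4 * (K * (P2 * W)) + 64 * (a * (P2 * W)) by field.
have e1 : K * P2 * W / 8 = K * (P2 * W) / 8 by ring.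
have e2 : 48 * K * P2 * W / 1024 = K * (P2 * W) * (3 / 64) by field.
have e3 : (K * 7 / 16 + a * 10) * (P2 * W) = 7 / 16 * (K * (P2 * W)) + 10 * (a * (P2 * W)) by field.
rewrite e1 in h1; rewrite e2 in h2; rewrite e3 in h3; rewrite e0; lra.
Qed.

(** Crude bounds: at most [kmax] starts are counted, and [psi l] grows no faster than 2^l. The size
    of this constant does not affect the final estimate, as it is halved at every iteration. *)
Lemma close_start : close (N%:R^-1 * kmax%:R + 1 + `|C|).
Proof.
set K := _ + _ + _.
have k0 : 0 <= N%:R^-1 * kmax%:R :> R by rewrite mulr_ge0 // ltW.
have C0 := normr_ge0 C.
have K0 : 0 <= K by rewrite /K; lra.
move=> k s /andP[_ kk] vk s0 sT; have W1 := wt_ge1 k s0.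
have two l : 1 <= 2 ^+ l :> R by rewrite exprn_ege1 // ler1n.
have KW l : K * 2 ^+ l <= K * 2 ^+ l * wt k s.
  by rewrite ler_peMr // mulr_ge0 // (le_trans ler01 (two l)).
have K2 l : K <= K * 2 ^+ l by rewrite ler_peMr.
split=> [l x' l0 sx xT|l l0].
  apply: (@le_trans _ _ 2).
    apply: Ex_le_cst => [|w]; first exact: bm_diffZ.
    apply: le_trans (ler_normB _ _) _; have := ls_le1 ls l0 s0 sx xT.
    have /andP[h1 h2] := Zh_le1 x y0 N0 (Y w) k s x' l.
    rewrite (ger0_norm h1); lra.
  have := KW l; have := K2 l; rewrite -!mulrA; move: (K * _) (K * _) => z z'.
  rewrite /K; lra.
apply: (@le_trans _ _ (N%:R^-1 * kmax%:R + `|C| * 2 ^+ l)).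
  apply: Ex_le_cst => [|w]; first exact: bm_diffD.
  apply: le_trans (ler_normB _ _) _; have := ls_bound ls s l0.
  have /andP[h1 h2] := Dl_bound (Y w) k s l.
  rewrite (ger0_norm h1) => h3; apply: lerD.
    by apply: le_trans h2 _; rewrite ler_pM2l // ler_nat.
  by apply: le_trans h3 _; rewrite ler_wpM2r ?exprn_ge0 // ler_norm.
have := KW l; have K2' : N%:R^-1 * kmax%:R + `|C| * 2 ^+ l <= K * 2 ^+ l.
  have := two l; rewrite /K !mulrDl mul1r => h.
  have : N%:R^-1 * kmax%:R <= N%:R^-1 * kmax%:R * 2 ^+ l :> R by rewrite ler_peMr.
  lra.
have : 0 <= K * 2 ^+ l by rewrite mulr_ge0 // (le_trans ler01 (two l)).
rewrite -!mulrA; lra.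
Qed.

(** The map K -> K/2 + 8a has the fixed point 16a. Iterated until the remainder is at most [a], it
    yields K = 17a, and 8 * 17 = 136. *)
Lemma Zh_close k (s x' : R) l : (on0 o <= k <= kmax)%N -> valid o k s -> 0 <= s ->
  s <= x' -> x' <= T -> (0 < l)%N ->
  Ex P (fun w => `|zh (Y w) k s x' l - fz l s x'|) <= 136 * a * 2 ^+ l * wt k s.
Proof.
move=> nk vk s0 sx xT l0; have sT := le_trans sx xT.
set K0 : R := N%:R^-1 * kmax%:R + 1 + `|C|.
have K00 : 0 <= K0.
  by rewrite /K0 !addr_ge0 // mulr_ge0 // ltW.
have a0 := gi_pos gi.
have it n : close (K0 / 2 ^+ n + 16 * a).
  elim: n => [|n IH].
    have := close_start; rewrite -/K0 expr0 divr1 => h k' s' h1 h2 h3 h4.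
    have [u1 u2] := h k' s' h1 h2 h3 h4; have W1 := le_trans ler01 (wt_ge1 k' h3).
    split=> [l' z l'0 h5 h6|l' l'0].
      apply: le_trans (u1 l' z l'0 h5 h6) _.
      by rewrite !ler_wpM2r ?exprn_ge0 // ler_wpM2l // lerDl mulr_ge0 // ltW.
    apply: le_trans (u2 l' l'0) _.
    by rewrite !ler_wpM2r ?exprn_ge0 // ler_wpM2l // lerDl mulr_ge0 // ltW.
  have -> : K0 / 2 ^+ n.+1 + 16 * a = (K0 / 2 ^+ n + 16 * a) / 2 + 8 * a.
    by rewrite exprS; field; rewrite expf_neq0 // pnatr_eq0.
  by apply: close_contract => //; rewrite addr_ge0 ?divr_ge0 ?exprn_ge0 ?mulr_ge0 // ltW.
have [n hn] : exists n, K0 / 2 ^+ n <= a.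
  exists (Num.truncn (K0 / a)).+1; set n := _.+1.
  rewrite ler_pdivrMr ?exprn_gt0 // mulrC -ler_pdivrMr //.
  apply: le_trans (ltW (truncnS_gt _)) _; rewrite -natrX ler_nat.
  by apply: ltnW; exact: ltn_expl.
have [h _] := it n k s nk vk s0 sT.
apply: le_trans (h l x' l0 sx xT) _.
have W1 := le_trans ler01 (wt_ge1 k s0).
rewrite !ler_wpM2r ?exprn_ge0 //; lra.
Qed.

End Contraction.

(** * The hydrodynamic equations in completion times *)

Section ByParts.
Variables (R : realType) (G g : R -> R) (H : R).
Hypothesis sa : service_assumption G g H.
Local Notation mu := (@lebesgue_measure R).

Lemma int_indic (a b : R) (h : R -> R) : integ a b h ->
  (\int[mu]_u (h u * \1_(`[a, b]%classic : set R) u)%:E = (int a b h)%:E)%E.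
Proof.
move=> ih; rewrite /int /intR /Rintegral fineK; last by apply: integrable_fin_num.
rewrite [RHS]integral_mkcond; apply: eq_integral => u _.
by rewrite patchE /indic; case: ifP => h'; rewrite ?mulr1 ?mulr0.
Qed.

Lemma int_continuous (a b : R) (h : R -> R) : a <= b -> integ a b h ->
  {within `[a, b], continuous (fun v => int a v h)}.
Proof. by move=> ab ih; exact: parameterized_integral_continuous. Qed.

Lemma measurable_int_upper (a b : R) (h : R -> R) : a <= b -> integ a b h ->
  measurable_fun `[a, b] (fun v => int a v h).
Proof.
by move=> ab ih; apply: subspace_continuous_measurable_fun => //; exact: int_continuous.
Qed.

Lemma int_upper_le (a b v : R) (h : R -> R) : integ a b h -> a <= v -> v <= b ->
  `|int a v h| <= int a b (fun u => `|h u|).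
Proof.
move=> ih av vb; have iv : integ a v h by apply: integ_sub ih.
apply: le_trans (int_norm iv) _.
rewrite (int_split av vb (integ_norm ih)) lerDl; exact: int_ge0.
Qed.

(** As [phi] is only integrable, integration by parts is done by Fubini for [phi u * g (x - v)] on
    the triangle [u <= v <= s]: one inner integral is [G (x - u) - G (x - s)], the other the
    primitive of [phi]. *)
Lemma int_kernel_parts (phi : R -> R) (s x : R) : 0 <= s -> s <= x -> integ 0 s phi ->
  integ 0 s (fun v => g (x - v) * int 0 v phi) /\
  int 0 s (fun u => (1 - G (x - u)) * phi u) =
    (1 - G (x - s)) * int 0 s phi - int 0 s (fun v => g (x - v) * int 0 v phi).
Proof.
move=> s0 sx iphi.
have i1 : integ 0 s (fun v => g (x - v) * int 0 v phi).
  apply: (integM_bounded (M := int 0 s (fun u => `|phi u|))); first exact: (kernel_integ sa).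
    exact: measurable_int_upper.
  by move=> v /andP[v0 vs]; exact: int_upper_le.
split=> //.
have mGx : measurable_fun setT (fun u : R => G (x - u)).
  apply: measurableT_comp; first exact: (measurable_cdf sa).
  exact: measurable_funB.
pose D := `[0, s]%classic : set R.
have mI : measurable_fun setT (\1_D : R -> R) by apply: measurable_indic; exact: measurable_itv.
pose phi' (u : R) : R := phi u * \1_D u.
have mphi' : measurable_fun setT phi'.
  have mD : measurable D by exact: measurable_itv.
  have := (measurable_restrictT phi mD).1 (integ_meas iphi).
  congr (measurable_fun _ _); apply/funext => u.
  by rewrite /phi' patchE /indic; case: ifP; rewrite ?mulr1 ?mulr0.
pose k (u v : R) : R := g (x - v) * (u <= v)%R%:R * \1_D v.
have k0 u v : 0 <= k u v by rewrite /k !mulr_ge0 // (density_ge0 sa).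
have mle : measurable_fun setT (fun z : R * R => (z.1 <= z.2)%R%:R : R).
  suff [] : @bm _ (R * R)%type R (fun z => (z.1 <= z.2)%R%:R) by [].
  by apply: bm_bool; apply: measurable_fun_ler; [exact: measurable_fst|exact: measurable_snd].
have mk : measurable_fun setT (fun z : R * R => k z.1 z.2).
  apply: measurable_funM; first apply: measurable_funM => //.
    by apply: (measurableT_comp (measurable_kernel sa x)); exact: measurable_snd.
  exact: (measurableT_comp mI measurable_snd).
have inner1 (c u : R) : (c = 0 \/ 0 <= u <= s) ->
    (\int[mu]_v (c * k u v)%:E = (c * (G (x - u) - G (x - s)))%:E)%E.
  move=> hc; transitivity (\int[mu]_v (c * (g (x - v) * (u <= v)%R%:R) * \1_D v)%:E)%E.
    by apply: eq_integral => v _; rewrite /k !mulrA.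
  have ig : integ 0 s (fun v => g (x - v) * (u <= v)%R%:R).
    apply: (integM_bounded (M := 1)); first exact: (kernel_integ sa).
      apply: measurable_funTS.
      suff [] : @bm _ R R (fun v => (u <= v)%R%:R) by [].
      by apply: bm_bool; apply: measurable_fun_ler.
    by move=> v _; case: (u <= v); rewrite ?normr0 ?normr1.
  rewrite int_indic; last exact: integZ.
  rewrite intZ //; congr (_%:E); case: hc => [->|/andP[u0 us]]; first by rewrite !mul0r.
  by rewrite (kernel_int_step sa).
have phiD u : phi' u = 0 \/ 0 <= u <= s.
  rewrite /phi' /indic; case: (boolP (u \in D)) => h; last by left; rewrite mulr0.
  by right; move: h; rewrite inE /D /= in_itv.
pose f (z : R * R) : \bar R := (phi' z.1 * k z.1 z.2)%:E.
have mf : measurable_fun setT f.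
  apply/measurable_EFinP; apply: measurable_funM => //.
  exact: (measurableT_comp mphi' measurable_fst).
have iphi' : mu.-integrable setT (EFin \o phi').
  have : mu.-integrable setT (EFin \o (phi \_ D)).
    rewrite -restrict_EFin; apply/integrable_restrict => //; first exact: measurable_itv.
    by rewrite setTI.
  congr (integrable _ _ _); apply/funext => u; congr (_%:E).
  by rewrite /phi' patchE /indic; case: ifP; rewrite ?mulr1 ?mulr0.
have G01 u : 0 <= u <= s -> 0 <= G (x - u) - G (x - s) <= 1.
  move=> /andP[u0 us]; rewrite subr_ge0 (cdf_mono sa) ?lerB //=.
  have := cdf_ge0 sa (x - s); have := ltW (cdf_lt1 sa (x - u)); lra.
have intf : (mu \x mu)%E.-integrable setT f.
  apply/integrable12ltyP => //.
  apply: (@le_lt_trans _ _ (\int[mu]_u `|(phi' u)%:E|)%E); last first.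
    by have /integrableP[] := iphi'.
  apply: ge0_le_integral => //.
  - by move=> u _; apply: integral_ge0.
  - have := @measurable_fun_fubini_tonelli_F _ _ (measurableTypeR R) (measurableTypeR R) R mu
      (fun z => `|f z|%E).
    by apply; [exact: measurableT_comp|].
  - by apply: measurableT_comp => //; apply/measurable_EFinP.
  move=> u _.
  under eq_integral => v _ do rewrite /f abse_EFin /= normrM (ger0_norm (k0 _ _)).
  have := phiD u; case=> h.
    rewrite (inner1 `|phi' u| u (or_introl _)); last by rewrite h normr0.
    by rewrite h normr0 mul0r abse_EFin normr0.
  rewrite (inner1 _ _ (or_intror h)) lee_fin ler_piMr //.
  by case/andP: (G01 u h).
have := integral12_prod_meas1 intf; rewrite -(integral21_prod_meas1 intf).
rewrite /fubini_F /fubini_G /f /=.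
under eq_integral => u _ do rewrite (inner1 _ _ (phiD u)).
have inner2 (v : R) : (\int[mu]_u (phi' u * k u v)%:E = (g (x - v) * int 0 v phi * \1_D v)%:E)%E.
  rewrite {1}/k /indic; case: (boolP (v \in D)) => h; last first.
    by rewrite mulr0; under eq_integral do rewrite !mulr0; rewrite integral0.
  have /andP[v0 vs] : 0 <= v <= s by move: h; rewrite inE /D /= in_itv.
  rewrite mulr1 -(intZ (g (x - v)) (integ_sub (lexx 0) vs iphi)).
  rewrite -int_indic; last by apply: integZ; apply: integ_sub iphi.
  apply: eq_integral => u _; congr (_%:E).
  rewrite /phi' mulr1 /indic !mem_setE !in_itv /=.
  case: (leP 0 u) => u0 /=; last by rewrite !mulr0 mul0r.
  case: (leP u v) => uv /=; last by rewrite !mulr0.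
  by rewrite (le_trans uv vs) !mulr1 mulrC.
under [in X in _ = X -> _]eq_integral => v _ do rewrite inner2.
rewrite (int_indic i1).
have i2 : integ 0 s (fun u => phi u * (G (x - u) - G (x - s))).
  apply: (integM_bounded (M := 1)) => //.
    by apply: measurable_funTS; apply: measurable_funB.
  by move=> u /G01/andP[h1 h2]; rewrite ger0_norm.
have -> : (\int[mu]_u (phi' u * (G (x - u) - G (x - s)))%:E =
    (int 0 s (fun u => phi u * (G (x - u) - G (x - s))))%:E)%E.
  rewrite -(int_indic i2); apply: eq_integral => u _; congr (_%:E).
  by rewrite /phi' mulrAC.
move=> [<-]; rewrite -intZ // -intB //; last exact: integZ.
by apply: eq_int => u _; ring.
Qed.

End ByParts.

Section HydroLimit.
Variables (R : realType) (G g : R -> R) (H : R) (lam : R -> R)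
  (Z0 : nat -> R -> R) (Z : nat -> R -> R -> R) (T : R).
Hypotheses (sa : service_assumption G g H)
  (lam0 : forall t, 0 <= t -> 0 <= lam t) (lami : forall t, 0 <= t -> integ 0 t lam)
  (hs : hydro_sol lam (fun x => 1 - G x) Z0 Z) (T0 : 0 <= T).

Definition slope l (u : R) : R := dr (Z l u) 0.
Definition fzZ l (s x : R) : R := Z l s (x - s).
(** Time is clamped to [0, T], which makes the function measurable and bounded on the whole line. *)
Definition psiZ l (u : R) : R := - int 0 (Num.max 0 (Num.min u T)) (slope l.+1).
Definition AZ l (s x : R) : R := int 0 s (fun u => lam u * flux G fzZ l u x).
Definition AdZ l (s : R) : R := int 0 s (fun u => lam u * flux G fzZ l u u).

Let G01 := cdf01 sa.

Lemma Z_le1 l (t r : R) : (0 < l)%N -> 0 <= t -> 0 <= r -> `|Z l t r| <= 1.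
Proof.
by case: hs => h _ _ _ _ l0 t0 r0; have [hX _] := h l l0; have [+ _ _ _] := hX t t0; apply.
Qed.

Lemma flux1E u (x : R) : flux G fzZ 1 u x = (1 - G (x - u)) * (1 - Z 1%N u 0 ^+ 2).
Proof. by rewrite /flux /fzZ subrr. Qed.

Lemma fluxE l u (x : R) : (1 < l)%N -> flux G fzZ l u x =
  (Z l.-1 u 0 + Z l u 0) * (Z l.-1 u (x - u) - Z l u (x - u)).
Proof. by move=> l1; rewrite /flux /fzZ subrr gtn_eqF. Qed.

Lemma flux_diagE l (u : R) : (0 < l)%N -> flux G fzZ l u u =
  (if l == 1%N then 1 else Z l.-1 u 0 ^+ 2) - Z l u 0 ^+ 2.
Proof.
move=> l0; case: eqP => [->|/eqP ne].
  by rewrite flux1E subrr (cdf_neg sa (lexx 0)) subr0 mul1r.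
rewrite fluxE ?subrr; last by rewrite ltn_neqAle eq_sym ne.
by rewrite mulrC -subr_sqr.
Qed.

Lemma Z_sq_le l (u : R) : (0 < l)%N -> 0 <= u -> 0 <= Z l u 0 ^+ 2 <= 1.
Proof.
move=> l0 u0; rewrite sqr_ge0 -(expr1n _ 2) -real_normK ?num_real //.
by rewrite lerXn2r ?nnegrE //= Z_le1.
Qed.

Lemma flux_le l (u x : R) : (0 < l)%N -> 0 <= u -> u <= x -> `|flux G fzZ l u x| <= 4.
Proof.
move=> l0 u0 ux; have x0 : 0 <= x - u by rewrite subr_ge0.
have [->|/eqP ne] := eqVneq l 1%N.
  rewrite flux1E normrM -[4]mulr1; apply: ler_pM => //.
    rewrite ger0_norm; have /andP[? ?] := G01 (x - u); lra.
  by have /andP[? ?] := Z_sq_le (ltn0Sn 0) u0; rewrite ger0_norm; lra.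
have l1 : (1 < l)%N by rewrite ltn_neqAle eq_sym l0 andbT; apply/eqP.
have l2 : (0 < l.-1)%N by rewrite -ltnS prednK.
rewrite fluxE // normrM (_ : 4 = 2 * 2); last by ring.
have := Z_le1 l0 u0 x0; have := Z_le1 l2 u0 x0.
have := Z_le1 l0 u0 (lexx 0); have := Z_le1 l2 u0 (lexx 0) => *.
apply: ler_pM => //.
  apply: le_trans (ler_normD _ _) _; lra.
apply: le_trans (ler_normB _ _) _; lra.
Qed.

(** In completion times the equations for [l = 1] and for [l >= 2] have one form, the cases being
    absorbed by [flux]. *)
Lemma hydro_shifted l (s x : R) : (0 < l)%N -> 0 <= s -> s <= x ->
  [/\ integ 0 s (fun u => (1 - G (x - u)) * slope l.+1 u),
      integ 0 s (fun u => lam u * flux G fzZ l u x) &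
      fzZ l s x = Z0 l x - int 0 s (fun u => (1 - G (x - u)) * slope l.+1 u) + AZ l s x].
Proof.
move=> l0 s0 sx; have x0 : 0 <= x - s by rewrite subr_ge0.
have e (u : R) : s + (x - s) - u = x - u by ring.
have [->|/eqP ne] := eqVneq l 1%N.
  have [_ h _ _ _] := hs; have [h1 h2 h3] := h s (x - s) s0 x0.
  have c1 : integ 0 s (fun u => (1 - G (x - u)) * slope 2 u).
    by apply: eq_integ h1 => u _; rewrite e.
  have ef u : lam u * (1 - G (s + (x - s) - u)) * (1 - Z 1%N u 0 ^+ 2) = lam u * flux G fzZ 1 u x.
    by rewrite e flux1E mulrA.
  split=> //; first by apply: eq_integ h2 => u _.
  rewrite /fzZ h3 /AZ subrKC; congr (_ - _ + _); apply: eq_int => u _ //.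
  by rewrite flux1E mulrA.
have l1 : (1 < l)%N by rewrite ltn_neqAle eq_sym l0 andbT; apply/eqP.
have [_ _ _ h _] := hs; have [h1 h2 h3] := h l s (x - s) l1 s0 x0.
have ef u : lam u * (Z l.-1 u 0 + Z l u 0) * (Z l.-1 u (s + (x - s) - u) - Z l u (s + (x - s) - u))
    = lam u * flux G fzZ l u x by rewrite e fluxE // mulrA.
split; first by apply: eq_integ h1 => u _; rewrite e.
  by apply: eq_integ h2 => u _.
rewrite /fzZ h3 /AZ subrKC; congr (_ - _ + _); apply: eq_int => u _ //.
by rewrite fluxE // mulrA.
Qed.

Lemma hydro_boundary l (s : R) : (0 < l)%N -> 0 <= s ->
  [/\ integ 0 s (fun u => slope l u - slope l.+1 u),
      integ 0 s (fun u => lam u * flux G fzZ l u u) &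
      Z l s 0 = Z0 l 0 + int 0 s (fun u => slope l u - slope l.+1 u) + AdZ l s].
Proof.
move=> l0 s0.
have [->|/eqP ne] := eqVneq l 1%N.
  have [_ _ h _ _] := hs; have [h1 h2 h3] := h s s0.
  have ef u : lam u * (1 - Z 1%N u 0 ^+ 2) = lam u * flux G fzZ 1 u u by rewrite flux_diagE.
  split=> //; first by apply: eq_integ h2 => u _.
  by rewrite h3 /AdZ; congr (_ + _); apply: eq_int => u _.
have l1 : (1 < l)%N by rewrite ltn_neqAle eq_sym l0 andbT; apply/eqP.
have [_ _ _ _ h] := hs; have [h1 h2 h3] := h l s l1 s0.
have ef u : lam u * (Z l.-1 u 0 ^+ 2 - Z l u 0 ^+ 2) = lam u * flux G fzZ l u u.
  by rewrite flux_diagE //; move/eqP/negbTE: ne => ->.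
split=> //; first by apply: eq_integ h2 => u _.
by rewrite h3 /AdZ; congr (_ + _); apply: eq_int => u _.
Qed.

(** The PDE provides integrability of the slope against [1 - G (s - u)]. On [0, s] this weight is at
    least [1 - G s > 0] and can be divided out. *)
Lemma slope_integ l (s : R) : (1 < l)%N -> 0 <= s -> integ 0 s (slope l).
Proof.
case: l => // l l0 s0; have [h _ _] := hydro_shifted l0 s0 (lexx s).
have Gs : 0 < 1 - G s by rewrite subr_gt0 (cdf_lt1 sa).
have Gu u : 0 <= u <= s -> 1 - G s <= 1 - G (s - u).
  by move=> /andP[u0 us]; rewrite lerB // (cdf_mono sa) // gerBl.
have := integM_bounded (M := (1 - G s)^-1) h.
move=> /(_ (fun u => (1 - G (s - u))^-1)) h'.
apply: eq_integ (h' _ _).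
- move=> u /Gu hu; rewrite mulrAC divff ?mul1r //.
  by rewrite gt_eqF // (lt_le_trans Gs).
- apply: nonincreasing_measurable => // u v uv.
  by rewrite lef_pV2 ?posrE ?subr_gt0 ?(cdf_lt1 sa) // lerB // (cdf_mono sa) // lerB.
- move=> u /Gu hu; have Gp := lt_le_trans Gs hu.
  have Gi : 0 <= (1 - G (s - u))^-1 by rewrite invr_ge0 ltW.
  by rewrite (ger0_norm Gi) lef_pV2.
Qed.

Let clamp (u : R) : R := Num.max 0 (Num.min u T).
Let clamp_in u : 0 <= clamp u <= T.
Proof. by rewrite /clamp le_max lexx /= ge_max T0 ge_min lexx orbT. Qed.
Let clamp_id u : 0 <= u -> u <= T -> clamp u = u.
Proof. by move=> u0 uT; rewrite /clamp (min_idPl uT) (max_idPr u0). Qed.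

Lemma psiZE l (u : R) : 0 <= u -> u <= T -> psiZ l u = - int 0 u (slope l.+1).
Proof. by move=> u0 uT; rewrite /psiZ -/(clamp u) clamp_id. Qed.

Let Lam : R := int 0 T lam.

Lemma psiZ_step l (s : R) : (1 < l)%N -> 0 <= s -> s <= T ->
  psiZ l s = Z l s 0 - Z0 l 0 + psiZ l.-1 s - AdZ l s.
Proof.
move=> l1 s0 sT; have l0 := ltnW l1; have [_ _ ->] := hydro_boundary l0 s0.
rewrite intB; try exact: slope_integ.
by rewrite !psiZE // prednK //; ring.
Qed.

Lemma AdZ_le l (s : R) : (0 < l)%N -> 0 <= s -> s <= T -> `|AdZ l s| <= Lam.
Proof.
move=> l0 s0 sT; have [_ h _] := hydro_boundary l0 s0.
apply: le_trans (int_norm h) _.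
rewrite /Lam (int_split s0 sT (lami T0)) -[leLHS]addr0; apply: lerD; last first.
  by apply: int_ge0 => u /andP[su _]; apply: lam0; exact: le_trans su.
apply: int_le; [exact: integ_norm|exact: lami|move=> u /andP[u0 us]].
rewrite normrM (ger0_norm (lam0 u0)) ler_piMr ?lam0 // flux_diagE //.
have /andP[? ?] := Z_sq_le l0 u0; rewrite ler_norml.
case: eqP => [_|/eqP ne]; first by apply/andP; split; lra.
have l2 : (0 < l.-1)%N by rewrite -ltnS prednK // ltn_neqAle eq_sym ne.
by have /andP[? ?] := Z_sq_le l2 u0; apply/andP; split; lra.
Qed.

Lemma Z0_le1 l (x : R) : (0 < l)%N -> 0 <= x -> `|Z0 l x| <= 1.
Proof.
move=> l0 x0; have [_ _ e] := hydro_shifted l0 (lexx 0) x0.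
by have := Z_le1 l0 (lexx 0) x0; move: e; rewrite /AZ !int_aa /fzZ subr0 addr0 subr0 => ->.
Qed.

Definition hydro_bound : R := int 0 T (fun u => `|slope 2 u|) + 2 + Lam.

(** By the boundary equation the passage to the next level costs at most [2 + Lam], so the growth in
    [l] is linear, and linear growth is below 2^l. *)
Lemma psiZ_le l (u : R) : (0 < l)%N -> `|psiZ l u| <= hydro_bound * 2 ^+ l.
Proof.
move=> l0; have Lam0 : 0 <= Lam by apply: int_ge0 => v /andP[v0 _]; exact: lam0.
have I0 : 0 <= int 0 T (fun u => `|slope 2 u|) by apply: int_ge0 => v _.
have C0 : 0 <= hydro_bound by rewrite /hydro_bound; lra.
suff h s : 0 <= s -> s <= T -> `|psiZ l s| <= hydro_bound * l%:R.
  have -> : psiZ l u = psiZ l (clamp u).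
    by have /andP[c0 cT] := clamp_in u; rewrite (psiZE _ c0 cT).
  have /andP[c0 cT] := clamp_in u; apply: le_trans (h _ c0 cT) _.
  by rewrite ler_wpM2l // -natrX ler_nat ltnW // ltn_expl.
move=> s0 sT; case: l l0 => // l _; elim: l => [|l IH].
  rewrite mulr1 psiZE // normrN; apply: le_trans (int_upper_le _ s0 sT) _; first exact: slope_integ.
  by rewrite /hydro_bound; lra.
rewrite psiZ_step //= -natr1 mulrDr mulr1.
apply: le_trans (ler_normB _ _) _.
apply: le_trans (lerD (ler_normD _ _) (lexx _)) _.
apply: le_trans (lerD (lerD (ler_normB _ _) (lexx _)) (lexx _)) _.
have := Z_le1 (ltn0Sn l.+1) s0 (lexx 0); have := Z0_le1 (ltn0Sn l.+1) (lexx 0).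
have := AdZ_le (ltn0Sn l.+1) s0 sT; move: IH I0; rewrite {3}/hydro_bound; lra.
Qed.

(** A difference of two nondecreasing functions, obtained by adding the absolute value to the
    integrand. *)
Lemma measurable_psiZ l : (0 < l)%N -> measurable_fun setT (psiZ l).
Proof.
move=> l0; have ip : integ 0 T (slope l.+1) by apply: slope_integ.
have ia := integ_norm ip; have isum := integD ip ia.
have mono (h : R -> R) : integ 0 T h -> (forall u, 0 <= h u) ->
    measurable_fun setT (fun u => int 0 (clamp u) h).
  move=> ih h0; apply: nondecreasing_measurable => // u v uv.
  have /andP[cu0 cuT] := clamp_in u; have /andP[cv0 cvT] := clamp_in v.
  have cuv : clamp u <= clamp v by rewrite /clamp ge_max le_max lexx /= le_max le_min !ge_min uv lexx !orbT.
  rewrite (@int_split _ 0 (clamp u) (clamp v)) //; last by apply: integ_sub ih.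
  by rewrite lerDl int_ge0.
have -> : psiZ l = fun u => int 0 (clamp u) (fun v => `|slope l.+1 v|) -
    int 0 (clamp u) (fun v => slope l.+1 v + `|slope l.+1 v|).
  apply/funext => u; have /andP[cu0 cuT] := clamp_in u; rewrite intD; first last.
  - by apply: integ_sub ia.
  - by apply: integ_sub ip.
  by rewrite /psiZ -/(clamp u); ring.
apply: measurable_funB; apply: mono => //.
by move=> u; have := ler_norm (- slope l.+1 u); rewrite normrN; lra.
Qed.

(** The equation [ls_D] equates two expressions of Z_(l+1)(s, 0), one from the shifted equation at
    [x = s] and one from the boundary equation. It parallels the elimination in [Dl_path]. *)
Lemma hydro_limit_system : limit_system G g T hydro_bound fzZ psiZ Z0 AZ AdZ.
Proof.
have psi_parts l (s x : R) : (0 < l)%N -> 0 <= s -> s <= x -> x <= T ->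
    fzZ l s x = Z0 l x + (1 - G (x - s)) * psiZ l s
      - int 0 s (fun u => g (x - u) * psiZ l u) + AZ l s x.
  move=> l0 s0 sx xT; have sT := le_trans sx xT; have [_ _ ->] := hydro_shifted l0 s0 sx.
  have [i1 ->] := int_kernel_parts sa s0 sx (@slope_integ l.+1 s l0 s0).
  congr (_ + _); rewrite -addrA; congr (_ + _); rewrite psiZE //.
  have -> : int 0 s (fun u => g (x - u) * psiZ l u) =
      int 0 s (fun v => -1 * (g (x - v) * int 0 v (slope l.+1))).
    apply: eq_int => v /andP[v0 vs]; rewrite psiZE //; first by ring.
    exact: le_trans vs sT.
  by rewrite intZ //; ring.
split.
- by move=> l s x l0 s0 sx _; apply: Z_le1 => //; rewrite subr_ge0.
- exact: measurable_psiZ.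
- by move=> l u l0; exact: psiZ_le.
- exact: psi_parts.
move=> l s l0 s0 sT.
have := psi_parts l.+1 s s (ltn0Sn l) s0 (lexx s) sT.
have := psiZ_step (l0 : 1 < l.+1)%N s0 sT.
by rewrite /fzZ !subrr (cdf_neg sa (lexx 0)) /=; lra.
Qed.

End HydroLimit.

(** * Discretization of the time axis *)

Section Grid.
Variable R : realType.

(** The cells are cut at equally spaced levels of the primitive of [f], found by the intermediate
    value theorem, so that an unbounded [f] is no obstacle. *)
Lemma exists_grid (f : R -> R) (T e : R) : 0 <= T -> 0 < e -> integ 0 T f ->
  (forall u, 0 <= u <= T -> 0 <= f u) ->
  exists (m : nat) (t : nat -> R), [/\ t 0%N = 0, t m = T,
    (forall i, (i <= m)%N -> 0 <= t i <= T),
    (forall i, (i < m)%N -> t i <= t i.+1) &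
    (forall i, (i < m)%N -> int (t i) (t i.+1) f <= e)].
Proof.
move=> T0 e0 fi f0; pose S v := int 0 v f.
have Smono u v : 0 <= u -> u <= v -> v <= T -> S u <= S v.
  move=> u0 uv vT; rewrite /S (@int_split _ 0 u v) //; last by apply: integ_sub fi.
  by rewrite lerDl int_ge0 // => z /andP[h1 h2]; apply: f0; rewrite (le_trans u0 h1) (le_trans h2 vT).
have [sm|Sbig] := leP (S T) e.
  exists 1%N, (fun i => if i is 0%N then 0 else T); split=> //.
  - by move=> [|i] _; rewrite lexx ?T0.
  - by move=> [|i].
  - by move=> [|i].
have ST0 := lt_trans e0 Sbig.
pose K := (Num.truncn (S T / e)).+1.
have K0 : (0 : R) < K%:R by rewrite ltr0n.
have SK : S T / K%:R <= e.
  by rewrite ler_pdivrMr // mulrC -ler_pdivrMr // ltW // truncnS_gt.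
have ex i : exists v, [/\ 0 <= v <= T, S v = (minn i K)%:R * (S T / K%:R),
    i = 0%N -> v = 0 & (K <= i)%N -> v = T].
  have [->|i0] := posnP i.
    by exists 0; rewrite lexx T0; split=> //; rewrite /S int_aa min0n mul0r.
  have [Ki|iK] := leqP K i.
    exists T; rewrite lexx T0; split=> //; last by move=> ei; rewrite ei in i0.
    by field; rewrite gt_eqF.
  have [||c] := @IVT R S 0 T ((minn i K)%:R * (S T / K%:R)) T0.
  - exact: int_continuous.
  - have S0 : S 0 = 0 by rewrite /S int_aa.
    have v0 : 0 <= (minn i K)%:R * (S T / K%:R) by rewrite mulr_ge0 // divr_ge0 // ltW.
    rewrite S0 (min_idPl (ltW ST0)) (max_idPr (ltW ST0)) v0 /=.
    rewrite mulrCA ler_piMr ?(ltW ST0) // ler_pdivrMr // mul1r ler_nat.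
    exact: geq_minr.
  rewrite in_itv /= => c0T Sc; exists c; split=> // [|ei]; last by rewrite ei in i0.
  by rewrite Sc (minn_idPl (ltnW iK)).
have [t ht] := choice ex.
exists K, t; split.
- by have [_ _ h _] := ht 0%N; exact: h.
- by have [_ _ _ h] := ht K; exact: h.
- by move=> i _; have [] := ht i.
- move=> i iK; have [/andP[h1 h2] h3 _ _] := ht i; have [/andP[h4 h5] h6 _ _] := ht i.+1.
  rewrite leNgt; apply/negP => /ltW lt; have := Smono _ _ h4 lt h2.
  rewrite h3 h6 (minn_idPl iK) (minn_idPl (ltnW iK)) ler_pM2r ?divr_gt0 // ler_nat.
  by rewrite ltnn.
move=> i iK; have [/andP[h1 h2] h3 _ _] := ht i; have [/andP[h4 h5] h6 _ _] := ht i.+1.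
have le_t : t i <= t i.+1.
  rewrite leNgt; apply/negP => /ltW lt; have := Smono _ _ h4 lt h2.
  rewrite h3 h6 (minn_idPl iK) (minn_idPl (ltnW iK)) ler_pM2r ?divr_gt0 // ler_nat.
  by rewrite ltnn.
have := @int_split _ 0 (t i) (t i.+1) f h1 le_t (integ_sub (lexx _) h5 fi).
rewrite -/(S _) -/(S (t i)) h3 h6 (minn_idPl iK) (minn_idPl (ltnW iK)) -natr1 mulrDl mul1r.
move/addrI => <-; exact: SK.
Qed.

End Grid.

Section Riemann.
Variables (R : realType) (lam sig : R -> R) (T : R) (tau : nat -> R) (N n0 m : nat)
  (t : nat -> R) (n : nat -> nat) (de ep : R).
Hypotheses (N0 : (0 < N)%N) (ep0 : 0 <= ep)
  (lam0 : forall u, 0 <= u -> 0 <= lam u) (ilam : integ 0 T lam)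
  (lamsig : forall u, 0 <= u <= T -> lam u <= sig u) (isig : integ 0 T sig)
  (t_0 : t 0%N = 0) (t_m : t m = T) (t_in : forall i, (i <= m)%N -> 0 <= t i <= T)
  (t_le : forall i, (i < m)%N -> t i <= t i.+1)
  (cell : forall i, (i < m)%N -> int (t i) (t i.+1) sig <= ep)
  (n_0 : n 0%N = n0) (n_le : forall i, (i < m)%N -> (n i <= n i.+1)%N)
  (before : forall i j, (i <= m)%N -> (j < n i)%N -> tau j <= t i)
  (after : forall i j, (i <= m)%N -> (n i <= j < n m)%N -> t i < tau j)
  (count : forall i, (i <= m)%N -> `|N%:R^-1 * (n i - n0)%:R - int 0 (t i) lam| <= de).

Let Ni : (0 : R) < N%:R^-1. Proof. by rewrite invr_gt0 ltr0n. Qed.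

Lemma n_mono i j : (i <= j <= m)%N -> (n i <= n j)%N.
Proof.
move=> /andP[]; elim: j => [|j IH]; first by rewrite leqn0 => /eqP ->.
rewrite leq_eqVlt => /orP[/eqP -> //|]; rewrite ltnS => ij jm.
exact: leq_trans (IH ij (ltnW jm)) (n_le jm).
Qed.

Let n0_le i : (i <= m)%N -> (n0 <= n i)%N.
Proof. by move=> im; rewrite -n_0 n_mono. Qed.

Let lamsub a b : 0 <= a -> b <= T -> integ a b lam.
Proof. by move=> a0 bT; apply: integ_sub ilam. Qed.

Let lam_int_ge0 a b : 0 <= a -> 0 <= int a b lam.
Proof. by move=> a0; apply: int_ge0 => u /andP[h _]; apply: lam0; exact: le_trans h. Qed.

Lemma cell_count i : (i < m)%N ->
  `|N%:R^-1 * (n i.+1 - n i)%:R - int (t i) (t i.+1) lam| <= 2 * de.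
Proof.
move=> im; have := count (ltnW im); have := count im.
have /andP[h1 h2] := t_in (ltnW im); have /andP[h3 h4] := t_in im.
rewrite (int_split h1 (t_le im) (lamsub (lexx 0) h4)).
rewrite (natrB _ (n_le im)) (natrB _ (n0_le im)) (natrB _ (n0_le (ltnW im))) !mulrBr !ler_norml.
move=> /andP[? ?] /andP[? ?]; apply/andP; split; lra.
Qed.

Lemma cell_lam i : (i < m)%N -> int (t i) (t i.+1) lam <= ep.
Proof.
move=> im; have /andP[h1 h2] := t_in (ltnW im); have /andP[h3 h4] := t_in im.
apply: le_trans (cell im); apply: int_le; [exact: lamsub|exact: integ_sub isig|].
by move=> u /andP[h5 h6]; apply: lamsig; rewrite (le_trans h1 h5) (le_trans h6 h4).
Qed.

Lemma total_count k : (n0 <= k <= n m)%N -> N%:R^-1 * (k - n0)%:R <= int 0 T lam + de.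
Proof.
move=> /andP[h1 h2]; have := count (leqnn m); rewrite t_m ler_norml => /andP[_ h].
have : N%:R^-1 * (k - n0)%:R <= N%:R^-1 * (n m - n0)%:R :> R.
  by rewrite ler_pM2l // ler_nat leq_sub2r.
lra.
Qed.

Section Integrand.
Variables (s : R) (phi : R -> R).
Hypotheses (s0 : 0 <= s) (sT : s <= T)
  (phi_le : forall u, 0 <= u -> u <= s -> `|phi u| <= 4)
  (phi_mod : forall u v, 0 <= u -> u <= v -> v <= s -> `|phi v - phi u| <= int u v sig)
  (iphi : integ 0 s (fun u => lam u * phi u)).

Let phisub a b : 0 <= a -> b <= s -> integ a b (fun u => lam u * phi u).
Proof. by move=> a0 bT; apply: integ_sub iphi. Qed.

Lemma cell_sum i : (i < m)%N -> t i.+1 <= s ->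
  `|N%:R^-1 * (\sum_(n i <= j < n i.+1) phi (tau j)) -
    int (t i) (t i.+1) (fun u => lam u * phi u)| <=
  8 * de + ep * (N%:R^-1 * (n i.+1 - n i)%:R + int (t i) (t i.+1) lam).
Proof.
move=> im ts; have /andP[h1 h2] := t_in (ltnW im); have /andP[h3 h4] := t_in im.
have tl := t_le im; set a := t i in h1 h2 tl *; set b := t i.+1 in ts h3 h4 tl *.
have close u : a <= u -> u <= b -> `|phi u - phi a| <= ep.
  move=> au ub; apply: le_trans (phi_mod h1 au (le_trans ub ts)) _.
  apply: le_trans (cell im); rewrite (int_split au ub (integ_sub h1 h4 isig)) lerDl.
  apply: int_ge0 => z /andP[h5 h6]; have z0 : 0 <= z by rewrite (le_trans h1) // (le_trans au).
  by apply: le_trans (lam0 z0) (lamsig _); rewrite z0 (le_trans h6 h4).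
have e1 : N%:R^-1 * (\sum_(n i <= j < n i.+1) phi (tau j)) =
    N%:R^-1 * (\sum_(n i <= j < n i.+1) (phi (tau j) - phi a)) +
    phi a * (N%:R^-1 * (n i.+1 - n i)%:R).
  rewrite sumrB big_const_nat iter_addr_0 mulrBr -[phi a *+ _]mulr_natr; ring.
have ia : integ a b (fun u => lam u * phi u) by exact: phisub.
have il : integ a b lam by exact: lamsub.
have e2 : int a b (fun u => lam u * phi u) =
    int a b (fun u => lam u * phi u - phi a * lam u) + phi a * int a b lam.
  by rewrite intB ?intZ ?subrK //; exact: integZ.
have b1 : `|N%:R^-1 * (\sum_(n i <= j < n i.+1) (phi (tau j) - phi a))| <=
    ep * (N%:R^-1 * (n i.+1 - n i)%:R).
  rewrite normrM (gtr0_norm Ni) [leRHS]mulrCA ler_pM2l //.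
  apply: le_trans (ler_norm_sum _ _ _) _.
  apply: (@le_trans _ _ (\sum_(n i <= j < n i.+1) ep)).
    rewrite !big_nat; apply: ler_sum => j /andP[j1 j2]; apply: close.
      apply: ltW; apply: after; rewrite ?(ltnW im) // j1 (leq_trans j2) // n_mono // im leqnn.
      by [].
    exact: before.
  by rewrite big_const_nat iter_addr_0 mulr_natr.
have b2 : `|int a b (fun u => lam u * phi u - phi a * lam u)| <= ep * int a b lam.
  have ib : integ a b (fun u => lam u * phi u - phi a * lam u) by apply: integB => //; exact: integZ.
  apply: le_trans (int_norm ib) _; rewrite -intZ //; apply: int_le.
  - exact: integ_norm.
  - exact: integZ.
  move=> u /andP[au ub]; have lu : 0 <= lam u by apply: lam0; exact: le_trans au.
  rewrite (_ : _ - _ = lam u * (phi u - phi a)); last by ring.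
  by rewrite normrM (ger0_norm lu) mulrC ler_wpM2r // close.
have b3 : `|phi a * (N%:R^-1 * (n i.+1 - n i)%:R - int a b lam)| <= 4 * (2 * de).
  by rewrite normrM ler_pM // ?cell_count // phi_le // (le_trans tl).
rewrite e1 e2; move: b1 b2 b3; rewrite mulrBr !ler_norml.
move=> /andP[? ?] /andP[? ?] /andP[? ?]; apply/andP; split; lra.
Qed.

Lemma prefix_sum i : (i <= m)%N -> t i <= s ->
  `|N%:R^-1 * (\sum_(n0 <= j < n i) phi (tau j)) - int 0 (t i) (fun u => lam u * phi u)| <=
  8 * i%:R * de + ep * (N%:R^-1 * (n i - n0)%:R + int 0 (t i) lam).
Proof.
elim: i => [|i IH] im ts.
  by rewrite n_0 t_0 big_geq // !int_aa subnn !mulr0 mul0r subr0 normr0 addr0 mulr0 addr0.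
have tl := t_le im; have {}IH := IH (ltnW im) (le_trans tl ts).
have /andP[h1 h2] := t_in (ltnW im); have /andP[h3 h4] := t_in im.
have := cell_sum im ts; move: IH.
rewrite (int_split h1 tl (lamsub (lexx 0) h4)) (int_split h1 tl (phisub (lexx 0) ts)).
rewrite (big_cat_nat (n := n i) (n0_le (ltnW im)) (n_le im)) /= (mulrDr N%:R^-1).
rewrite (natrB _ (n_le im)) (natrB _ (n0_le im)) (natrB _ (n0_le (ltnW im))) -natr1 !ler_norml.
move=> /andP[? ?] /andP[? ?]; apply/andP; split; lra.
Qed.

(** In a complete cell the integrand is frozen at the left end: its oscillation costs [ep] per unit
    of mass, the count of arrivals costs [4 * (2 * de)]. The last, incomplete cell is estimated
    trivially by [8 * ep + 8 * de]. *)
Lemma riemann_sum k : (n0 <= k <= n m)%N ->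
  (forall j, (j < k)%N -> tau j <= s) -> (forall j, (k <= j)%N -> s <= tau j) ->
  `|N%:R^-1 * (\sum_(n0 <= j < k) phi (tau j)) - int 0 s (fun u => lam u * phi u)| <=
  8 * m.+1%:R * de + ep * (2 * int 0 T lam + de + 8).
Proof.
move=> /andP[nk kn] bk ak.
have T0 := le_trans s0 sT.
have de0 : 0 <= de by apply: le_trans (count (leq0n m)); exact: normr_ge0.
have Lam0 : 0 <= int 0 T lam by exact: lam_int_ge0.
have [s00|sp] := eqVneq s 0.
  have -> : k = n0.
    apply/eqP; rewrite eqn_leq nk andbT leqNgt; apply/negP => n0k.
    have := @after 0%N n0 (leq0n m); rewrite n_0 leqnn (leq_trans n0k kn) => /(_ isT).
    by rewrite t_0 ltNge -s00 bk.
  rewrite s00 int_aa big_geq // mulr0 subr0 normr0.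
  by rewrite addr_ge0 ?mulr_ge0 //; lra.
have s1 : 0 < s by rewrite lt_neqAle eq_sym sp.
have exi : exists i, (i <= m)%N && (s <= t i) by exists m; rewrite leqnn t_m.
have := ex_minnP exi => -[i /andP[im si] imin].
have i0 : (0 < i)%N by rewrite lt0n; apply/eqP => ii; rewrite ii t_0 leNgt s1 in si.
case: i i0 => // i _ in im si imin *.
have ti : t i < s.
  by rewrite ltNge; apply/negP => h; have := imin i; rewrite (ltnW im) h ltnn => /(_ isT).
have /andP[h1 h2] := t_in (ltnW im); have /andP[h3 h4] := t_in im.
have nik : (n i <= k)%N.
  rewrite leqNgt; apply/negP => kni; have := before (ltnW im) kni.
  by rewrite leNgt (lt_le_trans ti) // ak.
have kni : (k <= n i.+1)%N.
  rewrite leqNgt; apply/negP => h; have := @after i.+1 (n i.+1) im.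
  rewrite leqnn (leq_trans h kn) => /(_ isT); rewrite ltNge (le_trans _ si) //.
  by apply: bk.
have := prefix_sum (ltnW im) (ltW ti).
rewrite (int_split h1 (ltW ti) iphi) (big_cat_nat (n := n i) (n0_le (ltnW im)) nik) /= mulrDr.
have c1 : N%:R^-1 * (k - n i)%:R <= ep + 2 * de.
  have := cell_count im; have := cell_lam im; rewrite ler_norml => ? /andP[? ?].
  have : N%:R^-1 * (k - n i)%:R <= N%:R^-1 * (n i.+1 - n i)%:R :> R.
    by rewrite ler_pM2l // ler_nat leq_sub2r.
  lra.
have c2 : `|N%:R^-1 * (\sum_(n i <= j < k) phi (tau j))| <= 4 * (N%:R^-1 * (k - n i)%:R).
  rewrite normrM (gtr0_norm Ni) [leRHS]mulrCA ler_pM2l //.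
  apply: le_trans (ler_norm_sum _ _ _) _.
  apply: (@le_trans _ _ (\sum_(n i <= j < k) 4)); last by rewrite big_const_nat iter_addr_0 mulr_natr.
  rewrite !big_nat; apply: ler_sum => j /andP[j1 j2]; apply: phi_le; last exact: bk.
  by apply: le_trans h1 (ltW _); apply: after; rewrite ?(ltnW im) // j1 (leq_trans j2).
have c3 : int (t i) s lam <= ep.
  apply: le_trans (cell_lam im); rewrite (int_split (ltW ti) si (lamsub h1 h4)) lerDl.
  exact: lam_int_ge0.
have c4 : `|int (t i) s (fun u => lam u * phi u)| <= 4 * int (t i) s lam.
  apply: le_trans (int_norm (phisub h1 (lexx s))) _; rewrite -intZ; last exact: lamsub.
  apply: int_le; [by apply: integ_norm; exact: phisub|by apply: integZ; exact: lamsub|].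
  move=> u /andP[tu us]; have u0 := le_trans h1 tu.
  by rewrite normrM (ger0_norm (lam0 u0)) mulrC ler_wpM2r ?lam0 // phi_le.
have c5 : int 0 (t i) lam <= int 0 T lam.
  by rewrite (int_split h1 h2 ilam) lerDl lam_int_ge0.
have c6 : N%:R^-1 * (n i - n0)%:R <= int 0 T lam + de.
  by apply: total_count; rewrite (n0_le (ltnW im)) n_mono // (ltnW im) leqnn.
have c7 : 8 * i%:R * de <= 8 * m%:R * de by rewrite ler_wpM2r // ler_pM2l // ler_nat ltnW.
have c8 : ep * (N%:R^-1 * (n i - n0)%:R + int 0 (t i) lam) <= ep * (2 * int 0 T lam + de).
  by apply: ler_wpM2l => //; lra.
rewrite -natr1; move: c2 c4; rewrite !ler_norml.
move=> /andP[? ?] /andP[? ?] /andP[? ?]; apply/andP; split; lra.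
Qed.

End Integrand.
End Riemann.

(** * Moduli of continuity of the limit fluxes *)

Section GoodInput.
Variables (R : realType) (G g : R -> R) (H : R) (lam : R -> R)
  (Z0 : nat -> R -> R) (Z : nat -> R -> R -> R) (T : R).
Hypotheses (sa : service_assumption G g H)
  (lam0 : forall t, 0 <= t -> 0 <= lam t) (lami : forall t, 0 <= t -> integ 0 t lam)
  (hs : hydro_sol lam (fun x => 1 - G x) Z0 Z) (T0 : 0 <= T).

Local Notation fz := (fzZ Z).
Local Notation sl := (slope Z).

Definition modulus l (u : R) : R :=
  4 * lam u + `|sl l u - sl l.+1 u| + `|sl l.+1 u|.

Lemma modulus_integ l (t : R) : (0 < l)%N -> 0 <= t -> integ 0 t (modulus l).
Proof.
move=> l0 t0; have [h _ _] := hydro_boundary sa hs l0 t0.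
apply: integD; first by apply: integD; [exact: integZ (lami t0)|exact: integ_norm].
by apply: integ_norm; exact: (slope_integ sa hs).
Qed.

Lemma modulus_ge0 l (u : R) : 0 <= u -> 0 <= modulus l u.
Proof. by move=> u0; rewrite !addr_ge0 ?mulr_ge0 ?lam0. Qed.

Let lamflux_le l (u x : R) : (0 < l)%N -> 0 <= u -> u <= x ->
  `|lam u * flux G fz l u x| <= 4 * lam u.
Proof.
move=> l0 u0 ux; rewrite normrM (ger0_norm (lam0 u0)) mulrC ler_wpM2r ?lam0 //.
exact: (flux_le sa hs).
Qed.

Lemma boundary_modulus l (u v : R) : (0 < l)%N -> 0 <= u -> u <= v ->
  `|Z l v 0 - Z l u 0| <= int u v (modulus l).
Proof.
move=> l0 u0 uv; have v0 := le_trans u0 uv.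
have [h1 h2 ->] := hydro_boundary sa hs l0 v0; have [_ _ ->] := hydro_boundary sa hs l0 u0.
rewrite /AdZ (int_split u0 uv h1) (int_split u0 uv h2).
have j1 : integ u v (fun w => sl l w - sl l.+1 w) by apply: integ_sub h1.
have j2 : integ u v (fun w => lam w * flux G fz l w w) by apply: integ_sub h2.
have -> : forall a b b' c c' : R, a + (b + b') + (c + c') - (a + b + c) = b' + c' by move=> *; ring.
rewrite -intD //; apply: le_trans (int_norm (integD j1 j2)) _.
apply: int_le; [exact: integ_norm (integD j1 j2)|by apply: integ_sub (modulus_integ l0 v0)|].
move=> w /andP[uw wv]; have w0 := le_trans u0 uw.
apply: le_trans (ler_normD _ _) _; rewrite /modulus.
have := lamflux_le l0 w0 (lexx w); have := normr_ge0 (sl l.+1 w); lra.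
Qed.

(** For fixed [x] the transport in [r] disappears, and the increment in time consists of two
    integrals over [u, v]. Hence the modulus does not depend on [x]. *)
Lemma shifted_modulus l (u v x : R) : (0 < l)%N -> 0 <= u -> u <= v -> v <= x ->
  `|fz l v x - fz l u x| <= int u v (modulus l).
Proof.
move=> l0 u0 uv vx; have v0 := le_trans u0 uv.
have [h1 h2 ->] := hydro_shifted hs l0 v0 vx; have [_ _ ->] := hydro_shifted hs l0 u0 (le_trans uv vx).
rewrite /AZ (int_split u0 uv h1) (int_split u0 uv h2).
have j1 : integ u v (fun w => (1 - G (x - w)) * sl l.+1 w) by apply: integ_sub h1.
have j2 : integ u v (fun w => lam w * flux G fz l w x) by apply: integ_sub h2.
have -> : forall a b b' c c' : R, a - (b + b') + (c + c') - (a - b + c) = c' - b' by move=> *; ring.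
rewrite -intB //; apply: le_trans (int_norm (integB j2 j1)) _.
apply: int_le; [exact: integ_norm (integB j2 j1)|by apply: integ_sub (modulus_integ l0 v0)|].
move=> w /andP[uw wv]; have w0 := le_trans u0 uw.
apply: le_trans (ler_normB _ _) _; rewrite /modulus.
have := lamflux_le l0 w0 (le_trans wv vx); have := normr_ge0 (sl l w - sl l.+1 w).
have : `|(1 - G (x - w)) * sl l.+1 w| <= `|sl l.+1 w|.
  rewrite normrM ler_piMl // ger0_norm; have /andP[? ?] := cdf01 sa (x - w); lra.
lra.
Qed.

(** [H] accounts for the factor [1 - G (x - u)] at level 1 and makes [H] times the length of a cell
    small, as needed for [Z0]. The summand [lam] lets cells of small modulus also carry a small
    arrival intensity. *)
Definition flux_modulus l (u : R) : R :=
  H + lam u + 4 * modulus l u + (if (l == 1)%N then 0 else 4 * modulus l.-1 u).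

Let pred_gt0 l : (0 < l)%N -> l != 1%N -> (0 < l.-1)%N.
Proof. by move=> l0 ne; rewrite -ltnS prednK // ltn_neqAle eq_sym ne. Qed.

Lemma flux_modulus_integ l (t : R) : (0 < l)%N -> 0 <= t -> integ 0 t (flux_modulus l).
Proof.
move=> l0 t0; apply: integD; last first.
  by case: eqP => [_|/eqP ne]; [exact: integ_cst|apply: integZ; apply: modulus_integ => //; exact: pred_gt0].
apply: integD; last by apply: integZ; exact: modulus_integ.
by apply: integD; [exact: integ_cst|exact: lami].
Qed.

Lemma flux_modulus_ge l (u : R) : 0 <= u -> H + lam u <= flux_modulus l u.
Proof.
move=> u0; rewrite /flux_modulus; have := modulus_ge0 l u0; have := modulus_ge0 l.-1 u0.
by case: ifP => _; lra.
Qed.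

Let int_flux_modulus l (u v : R) : (0 < l)%N -> 0 <= u -> u <= v ->
  H * (v - u) + int u v lam + 4 * int u v (modulus l) +
    (if (l == 1)%N then 0 else 4 * int u v (modulus l.-1)) = int u v (flux_modulus l).
Proof.
move=> l0 u0 uv; have v0 := le_trans u0 uv.
have i1 : integ u v lam by apply: integ_sub (lami v0).
have i2 : integ u v (modulus l) by apply: integ_sub (modulus_integ l0 v0).
have i3 : integ u v (fun w => H + lam w) by apply: integD i1; exact: integ_cst.
have i4 : integ u v (fun w => H + lam w + 4 * modulus l w) by apply: integD => //; exact: integZ.
rewrite /flux_modulus; case: eqP => [_|/eqP ne].
  rewrite (intD i4 (integ_cst _ _ _)) intD //; last exact: integZ.
  by rewrite intD ?int_cst ?intZ ?mul0r //; exact: integ_cst.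
have i5 : integ u v (modulus l.-1).
  by apply: integ_sub (modulus_integ (pred_gt0 l0 ne) v0).
rewrite (intD i4 (integZ _ i5)) intD //; last exact: integZ.
by rewrite intD ?int_cst ?intZ //; exact: integ_cst.
Qed.

Lemma flux_close l (u v x : R) : (0 < l)%N -> 0 <= u -> u <= v -> v <= x ->
  `|flux G fz l v x - flux G fz l u x| <= int u v (flux_modulus l).
Proof.
move=> l0 u0 uv vx; have v0 := le_trans u0 uv; have ux := le_trans uv vx.
have xu : 0 <= x - u by rewrite subr_ge0.
have xv : 0 <= x - v by rewrite subr_ge0.
rewrite -int_flux_modulus //.
have l1 : 0 <= int u v lam by apply: int_ge0 => w /andP[uw _]; apply: lam0; exact: le_trans uw.
have b1 := boundary_modulus l0 u0 uv.
have z1 := Z_le1 hs l0 v0 (lexx 0); have z2 := Z_le1 hs l0 u0 (lexx 0).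
have [e|ne] := eqVneq l 1%N.
  subst l; rewrite !flux1E.
  have gl := cdf_lip sa xv (lerB (lexx x) uv).
  have gm := cdf_mono sa (lerB (lexx x) uv).
  have /andP[g1 g2] := cdf01 sa (x - u); have /andP[g3 g4] := cdf01 sa (x - v).
  have /andP[s1 s2] := Z_sq_le hs (ltn0Sn 0) u0.
  have hl : G (x - u) - G (x - v) <= H * (v - u).
    apply: le_trans gl _; rewrite (_ : x - u - (x - v) = v - u); last by ring.
    by rewrite (cdf_neg sa (lexx 0)) subr0 mulr1.
  set p := Z 1%N v 0 in b1 z1 *; set q := Z 1%N u 0 in b1 z2 s1 s2 *.
  set A := G (x - u) in hl gm g1 g2 *; set B := G (x - v) in hl gm g3 g4 *.
  have -> : (1 - B) * (1 - p ^+ 2) - (1 - A) * (1 - q ^+ 2) =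
    (A - B) * (1 - q ^+ 2) - (1 - B) * ((p + q) * (p - q)) by ring.
  have t1 : `|(A - B) * (1 - q ^+ 2)| <= H * (v - u).
    by rewrite normrM -[leRHS]mulr1; apply: ler_pM => //; rewrite ger0_norm; lra.
  have t2 : `|(1 - B) * ((p + q) * (p - q))| <= 2 * int u v (modulus 1).
    rewrite normrM -[leRHS]mul1r; apply: ler_pM => //; first by rewrite ger0_norm; lra.
    rewrite normrM; apply: ler_pM => //; apply: le_trans (ler_normD _ _) _; lra.
  have i0 := le_trans (normr_ge0 _) b1.
  apply: le_trans (ler_normB _ _) _; lra.
have l2 := pred_gt0 l0 ne; have lgt : (1 < l)%N by rewrite ltn_neqAle eq_sym ne.
have b2 := boundary_modulus l2 u0 uv.
have c1 := shifted_modulus l0 u0 uv vx; have c2 := shifted_modulus l2 u0 uv vx.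
have z3 := Z_le1 hs l2 v0 (lexx 0); have z4 := Z_le1 hs l2 u0 (lexx 0).
have z5 := Z_le1 hs l0 v0 xv; have z6 := Z_le1 hs l2 v0 xv.
rewrite /fzZ in c1 c2; rewrite !fluxE //.
set p1 := Z l.-1 v 0 in b2 z3 *; set p2 := Z l v 0 in b1 z1 *.
set q1 := Z l.-1 u 0 in b2 z4 *; set q2 := Z l u 0 in b1 z2 *.
set f1 := Z l.-1 v (x - v) in c2 z6 *; set f2 := Z l v (x - v) in c1 z5 *.
set h1 := Z l.-1 u (x - u) in c2 *; set h2 := Z l u (x - u) in c1 *.
have -> : (p1 + p2) * (f1 - f2) - (q1 + q2) * (h1 - h2) =
  (f1 - f2) * ((p1 - q1) + (p2 - q2)) + (q1 + q2) * ((f1 - h1) - (f2 - h2)) by ring.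
set I1 := int u v (modulus l) in b1 c1 *; set I2 := int u v (modulus l.-1) in b2 c2 *.
have H1 : 0 <= H * (v - u) by rewrite mulr_ge0 ?(hazard_ge0 sa) ?subr_ge0.
have t1 : `|(f1 - f2) * ((p1 - q1) + (p2 - q2))| <= 2 * (I2 + I1).
  rewrite normrM; apply: ler_pM => //; first by apply: le_trans (ler_normB _ _) _; lra.
  by apply: le_trans (ler_normD _ _) _; lra.
have t2 : `|(q1 + q2) * ((f1 - h1) - (f2 - h2))| <= 2 * (I2 + I1).
  rewrite normrM; apply: ler_pM => //; first by apply: le_trans (ler_normD _ _) _; lra.
  by apply: le_trans (ler_normB _ _) _; lra.
apply: le_trans (ler_normD _ _) _; lra.
Qed.

Lemma flux_diag_close l (u v : R) : (1 < l)%N -> 0 <= u -> u <= v ->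
  `|flux G fz l v v - flux G fz l u u| <= int u v (flux_modulus l).
Proof.
move=> lgt u0 uv; have l0 := ltnW lgt; have v0 := le_trans u0 uv.
have ne : l != 1%N by rewrite gtn_eqF.
have l2 := pred_gt0 l0 ne.
rewrite -int_flux_modulus // (negbTE ne) !(flux_diagE Z sa) // (negbTE ne).
have l1 : 0 <= int u v lam by apply: int_ge0 => w /andP[uw _]; apply: lam0; exact: le_trans uw.
have H1 : 0 <= H * (v - u) by rewrite mulr_ge0 ?(hazard_ge0 sa) ?subr_ge0.
have b1 := boundary_modulus l0 u0 uv; have b2 := boundary_modulus l2 u0 uv.
have z1 := Z_le1 hs l0 v0 (lexx 0); have z2 := Z_le1 hs l0 u0 (lexx 0).
have z3 := Z_le1 hs l2 v0 (lexx 0); have z4 := Z_le1 hs l2 u0 (lexx 0).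
set p1 := Z l.-1 v 0 in b2 z3 *; set p2 := Z l v 0 in b1 z1 *.
set q1 := Z l.-1 u 0 in b2 z4 *; set q2 := Z l u 0 in b1 z2 *.
have -> : p1 ^+ 2 - p2 ^+ 2 - (q1 ^+ 2 - q2 ^+ 2) =
  (p1 + q1) * (p1 - q1) - (p2 + q2) * (p2 - q2) by ring.
set I1 := int u v (modulus l) in b1 *; set I2 := int u v (modulus l.-1) in b2 *.
have t1 : `|(p1 + q1) * (p1 - q1)| <= 2 * I2.
  by rewrite normrM; apply: ler_pM => //; apply: le_trans (ler_normD _ _) _; lra.
have t2 : `|(p2 + q2) * (p2 - q2)| <= 2 * I1.
  by rewrite normrM; apply: ler_pM => //; apply: le_trans (ler_normD _ _) _; lra.
have i1 := le_trans (normr_ge0 _) b1; have i2 := le_trans (normr_ge0 _) b2.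
apply: le_trans (ler_normB _ _) _; lra.
Qed.

(** One grid has to serve all levels up to [L.+1]. *)
Definition total_modulus L (u : R) : R := \sum_(1 <= l < L.+2) flux_modulus l u.

Lemma total_modulus_integ L (t : R) : 0 <= t -> integ 0 t (total_modulus L).
Proof.
move=> t0; rewrite /total_modulus; under eq_fun do rewrite big_nat.
apply: (int_sum _ _).1 => i /andP[i0 _]; exact: flux_modulus_integ.
Qed.

Lemma le_total_modulus L l (u : R) : (0 < l <= L.+1)%N -> 0 <= u ->
  flux_modulus l u <= total_modulus L u.
Proof.
move=> /andP[l0 lL] u0; rewrite /total_modulus.
rewrite (big_cat_nat (n := l)) //=; last exact: leqW.
rewrite (big_ltn (m := l)) // addrCA lerDl.
have h i : 0 <= flux_modulus i u.
  by apply: le_trans (flux_modulus_ge i u0); rewrite addr_ge0 ?(hazard_ge0 sa) ?lam0.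
by rewrite addr_ge0 // sumr_ge0.
Qed.

End GoodInput.

Section GridInput.
Variables (R : realType) (G g : R -> R) (H : R) (lam : R -> R)
  (Z0 : nat -> R -> R) (Z : nat -> R -> R -> R) (T : R).
Hypotheses (sa : service_assumption G g H)
  (lam0 : forall t, 0 <= t -> 0 <= lam t) (lami : forall t, 0 <= t -> integ 0 t lam)
  (hs : hydro_sol lam (fun x => 1 - G x) Z0 Z) (T0 : 0 <= T)
  (Z0_lip : forall l (u v : R), (0 < l)%N -> 0 <= u -> u <= v -> Z0 l u - Z0 l v <= H * (v - u)).
Variables (N : nat) (x : seq nat) (y0 : coord -> R) (N0 : (0 < N)%N).
Let o := outer_at N x y0.
Hypothesis wo : wf_outer o.

Let Ni : (0 : R) < N%:R^-1. Proof. by rewrite invr_gt0 ltr0n. Qed.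

Lemma start_frac_mono l (u v : R) : u <= v -> start_frac N x y0 l v <= start_frac N x y0 l u.
Proof.
move=> uv; rewrite /start_frac ler_pM2l //; apply: ler_sum => i _.
case: (l <= _)%N => //=; rewrite ler_nat.
by case: (ltP v) => // h; rewrite (le_lt_trans uv h).
Qed.

Lemma start_frac01 l (u : R) : 0 <= start_frac N x y0 l u <= 1.
Proof.
have N1 : (0 : R) < N%:R by rewrite ltr0n.
have /andP[h1 h2] := @sum_bool_le R N (fun i => (l <= nth 0 x i)%N && (u < ohr o i)).
by rewrite /start_frac pmulr_rge0 // h1 /= ler_pdivrMl // mulr1.
Qed.

Variables (L m : nat) (t : nat -> R) (n : nat -> nat) (de ep a : R).
Local Notation sig := (total_modulus H lam Z L).
Hypotheses (ep0 : 0 <= ep) (a0 : 0 < a)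
  (t_0 : t 0%N = 0) (t_m : t m = T) (t_in : forall i, (i <= m)%N -> 0 <= t i <= T)
  (t_le : forall i, (i < m)%N -> t i <= t i.+1)
  (cell : forall i, (i < m)%N -> int (t i) (t i.+1) sig <= ep)
  (n_0 : n 0%N = on0 o) (n_le : forall i, (i < m)%N -> (n i <= n i.+1)%N)
  (before : forall i j, (i <= m)%N -> (j < n i)%N -> ot o j <= t i)
  (after : forall i j, (i <= m)%N -> (n i <= j < n m)%N -> t i < ot o j)
  (count : forall i, (i <= m)%N -> `|N%:R^-1 * (n i - on0 o)%:R - int 0 (t i) lam| <= de)
  (start : forall l i, (0 < l <= L.+1)%N -> (i <= m)%N ->
     `|start_frac N x y0 l (t i) - Z0 l (t i)| <= de)
  (a1 : 8 * m.+1%:R * de + ep * (2 * int 0 T lam + de + 8) <= a)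
  (a2 : de + ep <= a) (a3 : 8 * int 0 T lam + 4 * de <= a * 2 ^+ L) (a4 : 2 <= a * 2 ^+ L)
  (a5 : 3 * Num.sqrt (n m)%:R / N%:R <= a).

Let sig_ge u : 0 <= u -> H + lam u <= sig u.
Proof.
move=> u0; apply: le_trans (flux_modulus_ge H Z lam0 1%N u0) _.
exact: (le_total_modulus Z sa lam0).
Qed.

Let isig : integ 0 T sig. Proof. exact: (total_modulus_integ sa lami hs _ T0). Qed.

Let a_le l : a <= a * 2 ^+ l.
Proof. by rewrite ler_peMr ?(ltW a0) // exprn_ege1 // ler1n. Qed.

Let aL l : (L <= l)%N -> a * 2 ^+ L <= a * 2 ^+ l.
Proof. by move=> h; rewrite ler_pM2l // ler_weXn2l // ler1n. Qed.

Let cell_width i : (i < m)%N -> H * (t i.+1 - t i) <= ep.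
Proof.
move=> im; have /andP[h1 h2] := t_in (ltnW im); have /andP[h3 h4] := t_in im.
rewrite -int_cst ?t_le //; apply: le_trans (cell im); apply: int_le.
- exact: integ_cst.
- by apply: integ_sub isig.
move=> u /andP[h5 h6]; have u0 := le_trans h1 h5.
by apply: le_trans (sig_ge u0); rewrite lerDl lam0.
Qed.

(** Between grid points [start_frac] is controlled by monotonicity and [Z0] by its Lipschitz bound.
    Above level [L.+1] the trivial bound 2 is enough. *)
Lemma start_grid l (x' : R) : (0 < l)%N -> 0 <= x' -> x' <= T ->
  `|start_frac N x y0 l x' - Z0 l x'| <= a * 2 ^+ l.
Proof.
move=> l0 x0 xT; have [lL|Ll] := leqP l L.+1; last first.
  apply: le_trans (aL (ltnW (ltnW Ll))); apply: le_trans a4.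
  have /andP[h1 h2] := start_frac01 l x'; have := Z0_le1 hs l0 x0.
  by rewrite !ler_norml => /andP[? ?]; apply/andP; split; lra.
apply: le_trans (a_le l); apply: le_trans a2.
have exi : exists i, (i <= m)%N && (x' <= t i) by exists m; rewrite leqnn t_m.
have := ex_minnP exi => -[[|i] /andP[im si] imin].
  have -> : x' = t 0%N by rewrite t_0 in si *; apply/eqP; rewrite eq_le si.
  by apply: le_trans (start _ _) _; rewrite ?l0 // lerDl.
have ti : t i <= x'.
  rewrite leNgt; apply/negP => h; have := imin i.
  by rewrite (ltnW im) (ltW h) ltnn => /(_ isT).
have /andP[h1 h2] := t_in (ltnW im).
have := start (_ : 0 < l <= L.+1)%N im; have := start (_ : 0 < l <= L.+1)%N (ltnW im).
rewrite l0 lL => /(_ isT) + /(_ isT).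
have := start_frac_mono l ti; have := start_frac_mono l si.
have := Z0_lip l0 h1 ti; have := Z0_lip l0 x0 si; have := cell_width im.
have H0 := hazard_ge0 sa.
have : H * (x' - t i) <= H * (t i.+1 - t i) by rewrite ler_wpM2l // lerB.
have : H * (t i.+1 - x') <= H * (t i.+1 - t i) by rewrite ler_wpM2l // lerB.
rewrite !ler_norml => ? ? ? ? ? ? ? /andP[? ?] /andP[? ?]; apply/andP; split; lra.
Qed.

Lemma good_input_of_grid :
  good_input G N x y0 T (n m) (fzZ Z) Z0 (AZ G lam Z) (AdZ G lam Z) a.
Proof.
have lamsig u : 0 <= u <= T -> lam u <= sig u.
  move=> /andP[u0 _]; apply: le_trans (sig_ge u0); rewrite lerDr; exact: (hazard_ge0 sa).
have Lam0 : 0 <= int 0 T lam by apply: int_ge0 => u /andP[? _]; exact: lam0.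
(* From level [L] on, a 2^l exceeds the sum and the integral together, each bounded through
   [|phi| <= 4]. *)
have trivial k s phi l : (L <= l)%N -> (on0 o <= k <= n m)%N -> valid o k s -> 0 <= s -> s <= T ->
    (forall u, 0 <= u -> u <= s -> `|phi u| <= 4) ->
    integ 0 s (fun u => lam u * phi u) ->
    `|N%:R^-1 * (\sum_(on0 o <= j < k) phi (ot o j)) - int 0 s (fun u => lam u * phi u)| <=
    a * 2 ^+ l.
  move=> Ll nk vk s0 sT p4 ip; apply: le_trans (aL Ll); apply: le_trans a3.
  have il : integ 0 s lam by exact: lami.
  have c1 : `|N%:R^-1 * (\sum_(on0 o <= j < k) phi (ot o j))| <= 4 * (N%:R^-1 * (k - on0 o)%:R).
    rewrite normrM (gtr0_norm Ni) [leRHS]mulrCA ler_pM2l //.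
    apply: le_trans (ler_norm_sum _ _ _) _.
    apply: (@le_trans _ _ (\sum_(on0 o <= j < k) 4)); last by rewrite big_const_nat iter_addr_0 mulr_natr.
    by rewrite !big_nat; apply: ler_sum => j /andP[j1 j2]; apply: p4; [exact: (wf_tge0 wo)|exact: vk.1].
  have c2 : `|int 0 s (fun u => lam u * phi u)| <= 4 * int 0 s lam.
    apply: le_trans (int_norm ip) _; rewrite -intZ //.
    apply: int_le; [exact: integ_norm|exact: integZ|].
    move=> u /andP[u0 us].
    by rewrite normrM (ger0_norm (lam0 u0)) mulrC ler_wpM2r ?lam0 // p4.
  have c3 : int 0 s lam <= int 0 T lam.
    rewrite (int_split s0 sT (lami T0)) lerDl; apply: int_ge0 => u /andP[su _].
    by apply: lam0; exact: le_trans su.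
  have c4 := total_count N0 t_m count nk.
  apply: le_trans (ler_normB _ _) _; lra.
have main k s phi l : (0 < l)%N -> (on0 o <= k <= n m)%N -> valid o k s -> 0 <= s -> s <= T ->
    (forall u, 0 <= u -> u <= s -> `|phi u| <= 4) ->
    (forall u v, 0 <= u -> u <= v -> v <= s -> `|phi v - phi u| <= int u v (flux_modulus H lam Z l)) ->
    integ 0 s (fun u => lam u * phi u) ->
    `|N%:R^-1 * (\sum_(on0 o <= j < k) phi (ot o j)) - int 0 s (fun u => lam u * phi u)| <=
    a * 2 ^+ l.
  move=> l0 nk vk s0 sT p4 pm ip; have [Ll|lL] := leqP L l; first exact: trivial.
  apply: le_trans (a_le l); apply: le_trans a1.
  apply: (riemann_sum N0 ep0 lam0 (lami T0) lamsig isig t_0 t_m t_in t_le cell n_0 n_le) => //.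
  - move=> u v u0 uv vs; apply: le_trans (pm _ _ u0 uv vs) _; apply: int_le.
    + by apply: integ_sub (flux_modulus_integ sa lami hs l0 (le_trans u0 (le_trans uv vs))).
    + by apply: integ_sub isig => //; exact: le_trans vs sT.
    move=> w /andP[uw wv]; apply: (le_total_modulus Z sa lam0); last exact: le_trans uw.
    by rewrite l0 ltnW // ltnW.
  - exact: vk.1.
  - exact: vk.2.
split=> //.
- exact: start_grid.
- move=> l k s x' l0 nk vk s0 sx xT; have sT := le_trans sx xT.
  apply: (main k s (fun u => flux G (fzZ Z) l u x') l) => //.
  + by move=> u u0 us; apply: (flux_le sa hs) => //; exact: le_trans sx.
  + by move=> u v u0 uv vs; apply: (flux_close sa lam0 lami hs) => //; exact: le_trans sx.
  + by have [_ h _] := hydro_shifted hs l0 s0 sx.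
- move=> l k s l1 nk vk s0 sT; have l0 := ltnW l1.
  apply: (main k s (fun u => flux G (fzZ Z) l u u) l) => //.
  + by move=> u u0 us; apply: (flux_le sa hs).
  + by move=> u v u0 uv vs; apply: (flux_diag_close sa lam0 lami hs).
  + by have [_ h _] := hydro_boundary sa hs l0 s0.
Qed.

End GridInput.

(** * Arrivals and initial data of large networks *)

Lemma poisson_pmf_step (R : realType) (m : R) n :
  n.+1%:R * Defs.poisson_pmf m n.+1 = m * Defs.poisson_pmf m n.
Proof.
rewrite /Defs.poisson_pmf exprS factS natrM invfM.
have -> : n.+1%:R * (expR (- m) * (m * m ^+ n) * (n.+1%:R^-1 * n`!%:R^-1)) =
  m * (expR (- m) * m ^+ n / n`!%:R) * (n.+1%:R / n.+1%:R) :> R by ring.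
by rewrite divff ?pnatr_eq0 // mulr1.
Qed.

(** An exact formula for the truncated sum. Its boundary term is nonpositive once [K >= m], so the
    truncated variance is at most [m] and no infinite series has to be summed. *)
Lemma poisson_second_moment (R : realType) (m : R) K :
  \sum_(n < K.+1) (n%:R - m) ^+ 2 * Defs.poisson_pmf m n =
  m * (\sum_(n < K.+1) Defs.poisson_pmf m n) + Defs.poisson_pmf m K * (m ^+ 2 - m * K%:R - m).
Proof.
elim: K => [|K IH]; first by rewrite !big_ord1 /=; ring.
rewrite big_ord_recr /= IH [in RHS]big_ord_recr /=.
have := poisson_pmf_step m K; rewrite -natr1; set p := Defs.poisson_pmf m K.+1 => h.
have -> : Defs.poisson_pmf m K * (m ^+ 2 - m * K%:R - m) = (K%:R + 1) * p * (m - K%:R - 1).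
  by rewrite h; ring.
ring.
Qed.

Lemma poisson_pmf_ge0 (R : realType) (m : R) n : 0 <= m -> 0 <= Defs.poisson_pmf m n.
Proof.
move=> m0; apply: mulr_ge0; last by rewrite invr_ge0.
by apply: mulr_ge0; [exact: expR_ge0|exact: exprn_ge0].
Qed.

Section Deviations.
Context (R : realType) d (T : measurableType d) (P : probability T R).

Lemma Ex_nat_tail (c : T -> nat) : measurable_fun setT c ->
  (fun K => Ex P (fun w => (K < c w)%N%:R)) @ \oo --> (0 : R).
Proof.
move=> mc; have mb K : measurable_fun setT (fun w => (K < c w)%N).
  by apply: measurable_fun_ltn => //; exact: measurable_cst.
have e K : Ex P (fun w => (K < c w)%N%:R) = fine (P [set w | (K < c w)%N]) by rewrite Ex_bool.
under eq_fun do rewrite e.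
apply: fine_cvg; rewrite -[X in _ --> X](measure0 P).
have -> : set0 = \bigcap_K [set w | (K < c w)%N].
  by apply/seteqP; split=> // w /(_ (c w) I) /=; rewrite ltnn.
apply: nonincreasing_cvg_mu => //.
- by apply: (le_lt_trans (probability_le1 _ _)); [exact: bool_measurable|exact: ltry].
- by move=> K; exact: bool_measurable.
- by apply: bigcap_measurable => // K _; exact: bool_measurable.
- move=> i j ij; apply/subsetPset => w /=; exact: leq_ltn_trans.
Qed.

Lemma poisson_chebyshev (c : T -> nat) (m e : R) : measurable_fun setT c -> 0 <= m -> 0 < e ->
  (forall n, fine (P [set w | c w = n]) = Defs.poisson_pmf m n) ->
  Ex P (fun w => (e < `|(c w)%:R - m|)%R%:R) <= m / e ^+ 2.
Proof.
move=> mc m0 e0 hp.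
have me n : measurable_fun setT (fun w => c w == n).
  by apply: measurable_fun_eqn => //; exact: measurable_cst.
have pE n : Ex P (fun w => (c w == n)%:R) = Defs.poisson_pmf m n.
  rewrite Ex_bool // -hp; congr (fine (P _)); apply/seteqP; split=> w /= /eqP //.
have mcr : measurable_fun setT (fun w => (c w)%:R : R) by exact: mf_natr.
have mb : measurable_fun setT (fun w => (e < `|(c w)%:R - m|)%R).
  apply: measurable_fun_ltr => //; apply: measurableT_comp => //.
  exact: measurable_funB.
have mt K : measurable_fun setT (fun w => (K < c w)%N).
  by apply: measurable_fun_ltn => //; exact: measurable_cst.
apply/ler_addgt0Pl => h h0.
(* The truncation level exceeds the mean, for the sign of the boundary term, and leaves a tail of
   mass at most [h]. *)
have [K0 hK] : exists K, m <= K%:R /\ Ex P (fun w => (K < c w)%N%:R) <= h.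
  have /cvgrPdist_le /(_ h h0) [K1 _ hK1] := Ex_nat_tail mc.
  exists (maxn K1 (Num.truncn m).+1); split.
    by apply: le_trans (ltW (truncnS_gt m)) _; rewrite ler_nat leq_maxr.
  have := hK1 (maxn K1 (Num.truncn m).+1) (leq_maxl _ _).
  by rewrite /= sub0r normrN; apply: le_trans; exact: ler_norm.
have [mK tK] := hK.
pose f n w : R := e^-2 * ((n%:R - m) ^+ 2 * (c w == n)%:R).
have bf n : bm (f n) by apply: bmZ; apply: bmZ; exact: bm_bool.
have bs : bm (fun w => \sum_(n < K0.+1) f n w) by apply: bm_sum => n _; exact: bf.
have bt : bm (fun w => (K0 < c w)%N%:R : R) by exact: bm_bool.
apply: le_trans (le_Ex P (bm_bool _ mb) (bmD bt bs) _) _.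
  move=> w; have f0 n : 0 <= f n w.
    rewrite /f; apply: mulr_ge0; first by rewrite invr_ge0; exact: exprn_ge0 (ltW e0).
    by apply: mulr_ge0; [exact: sqr_ge0|].
  have s0 : 0 <= \sum_(n < K0.+1) f n w by apply: sumr_ge0.
  case: (ltP e) => he; last by rewrite addr_ge0.
  have [kc|ck] := ltnP K0 (c w); first by rewrite lerDl.
  rewrite add0r (bigD1 (Ordinal (ck : c w < K0.+1)%N)) //=.
  apply: (@le_trans _ _ (f (c w) w)); last by rewrite lerDl; apply: sumr_ge0.
  rewrite /f eqxx mulr1 -(@ler_pM2l _ (e ^+ 2)) ?exprn_gt0 // mulr1 mulVKf ?expf_neq0 ?gt_eqF //.
  by rewrite -[leRHS]real_normK ?num_real // lerXn2r ?nnegrE // ltW.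
rewrite (ExD P bt bs); apply: lerD => //.
rewrite Ex_sum; last by move=> n _; exact: bf.
rewrite [leLHS](_ : _ = e^-2 * \sum_(n < K0.+1) (n%:R - m) ^+ 2 * Defs.poisson_pmf m n); last first.
  rewrite big_distrr /=; apply: eq_bigr => n _; rewrite /f.
  rewrite ExZ; last by apply: bmZ; exact: bm_bool.
  by rewrite ExZ ?pE //; exact: bm_bool.
rewrite mulrC; apply: ler_wpM2r; first by rewrite invr_ge0; exact: exprn_ge0 (ltW e0).
rewrite poisson_second_moment.
have S1 : \sum_(n < K0.+1) Defs.poisson_pmf m n <= 1.
  under eq_bigr do rewrite -pE; rewrite -Ex_sum; last by move=> n _; exact: bm_bool.
  apply: Ex_le_cst; first by apply: bm_sum => n _; exact: bm_bool.
  move=> w; have [ck|kc] := ltnP (c w) K0.+1.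
    rewrite (bigD1 (Ordinal ck)) //= eqxx big1 ?addr0 // => i ni.
    by case: eqP => // e1; move: ni; rewrite -(inj_eq val_inj) /= e1 eqxx.
  rewrite big1 // => i _; case: eqP => // e1; by have := ltn_ord i; rewrite -e1 ltnNge kc.
have p0 := poisson_pmf_ge0 K0 m0.
have : Defs.poisson_pmf m K0 * (m ^+ 2 - m * K0%:R - m) <= 0.
  have -> : m ^+ 2 - m * K0%:R - m = m * (m - K0%:R - 1) by ring.
  by rewrite mulr_ge0_le0 // mulr_ge0_le0 //; lra.
have : m * \sum_(n < K0.+1) Defs.poisson_pmf m n <= m by rewrite ler_piMr.
lra.
Qed.

Lemma Ex_dominated (f : nat -> T -> R) (M : R) : (forall n, measurable_fun setT (f n)) ->
  (forall n w, `|f n w| <= M) -> {ae P, forall w, f ^~ w @ \oo --> (0 : R)} ->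
  (fun n => Ex P (f n)) @ \oo --> (0 : R).
Proof.
move=> mf hM ae0.
have bf n : bm (f n) by exact: bm_le (mf n) (hM n).
have [|||||_ _ h] := @dominated_convergence _ _ _ P setT measurableT (fun n w => (f n w)%:E)
  (fun=> 0%E) (fun=> M%:E) _ _ _ _ _.
- by move=> n; apply/measurable_EFinP.
- by [].
- by apply: filterS ae0 => w h _; apply: cvg_EFin => //; exact: nearW.
- exact: finite_measure_integrable_cst.
- by apply: aeW => w n _; rewrite abse_EFin lee_fin.
rewrite integral0 in h.
have -> : (fun n => Ex P (f n)) = fun n => fine (\int[P]_w (f n w)%:E)%E.
  by apply/funext => n; rewrite (Ex_EFin P (bf n)).
apply: fine_cvg; exact: h.
Qed.


Lemma ae_bool (b : T -> bool) : measurable_fun setT b -> Ex P (fun w => (b w)%:R) = 1 ->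
  {ae P, forall w, b w}.
Proof.
move=> mb; rewrite Ex_bool // => h; have mB := bool_measurable mb.
exists (~` [set w | b w]); split; first exact: measurableC.
  rewrite probability_setC //; have -> : P [set w | b w] = 1%E; last by rewrite subee.
  by rewrite -(@fineK _ (P _)) ?fin_num_measure // h.
by move=> w /=; apply: contra_not.
Qed.

Lemma eq_Ex_ae (f h : T -> R) : bm f -> bm h -> {ae P, forall w, f w = h w} -> Ex P f = Ex P h.
Proof.
move=> bf bh e; rewrite /Ex /Rintegral; congr fine; apply: ae_eq_integral => //.
- by apply/measurable_EFinP; case: bf.
- by apply/measurable_EFinP; case: bh.
by apply: filterS e => w -> _.
Qed.

End Deviations.

Section NetworkLimits.
Context (R : realType) (d : measure_display) (Omega : measurableType d)
  (P : probability Omega R).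
Variables (G g lam : R -> R) (H : R) (aN : nat -> R)
  (X0 : nat -> nat -> Omega -> nat) (A0 Res : nat -> nat -> Omega -> R)
  (W : nat -> nat -> nat -> Omega -> R) (E : nat -> R -> Omega -> nat)
  (V : nat -> nat -> Omega -> R) (C1 C2 : nat -> nat -> Omega -> nat)
  (Bt : nat -> nat -> Omega -> bool) (Z0 : nat -> R -> R).
Hypotheses (sa : service_assumption G g H) (arr : arrival_assumption lam aN)
  (net : forall N, sq2_network P X0 A0 Res W E V C1 C2 Bt G lam aN N)
  (init : init_assumption_a P X0 A0)
  (Zlim : {ae P, forall w, forall l r, (1 <= l)%N -> 0 <= r ->
      (fun N => Zbar0 X0 A0 G N l r w) @ \oo --> Z0 l r}).

Let lam0 t : 0 <= t -> 0 <= lam t. Proof. by case: arr => h _ _ _; exact: h. Qed.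
Let lami t : 0 <= t -> integ 0 t lam. Proof. by case: arr => _ h _ _; exact: h. Qed.

Let mX0 N i : measurable_fun setT (X0 N i).
Proof. by have [[h _] _] := net N; apply: mf_natP. Qed.
Let mA0 N i : measurable_fun setT (A0 N i).
Proof. by have [[_ [h _]] _] := net N; exact: h. Qed.
Let mRes N i : measurable_fun setT (Res N i).
Proof. by have [[_ [_ [h _]]] _] := net N; exact: h. Qed.
Let mE N t : measurable_fun setT (E N t).
Proof. by have [[_ [_ [_ [_ [h _]]]]] _] := net N; apply: mf_natP. Qed.

Lemma arrivals_poisson N t n : 0 <= t ->
  fine (P [set w | E N t w = n]) = Defs.poisson_pmf (aN N * int 0 t lam) n.
Proof.
move=> t0; have [_ [cp [_ [pl _]]]] := net N.
have := pl 1%N (fun i => if i is 0%N then 0 else t) (fun=> n) erefl.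
have -> : [set w | forall i, (i < 1)%N -> (E N (if i.+1 is 0%N then 0 else t) w -
    E N (if i is 0%N then 0 else t) w)%N = n] = [set w | E N t w = n].
  apply/seteqP; split=> w /= h; first by have := h 0%N isT; have [-> _ _] := cp w; rewrite subn0.
  by move=> [|i] // _; have [-> _ _] := cp w; rewrite subn0.
move=> ->; last by case=> [|i].
by rewrite big_ord1.
Qed.

Lemma arrivals_lln t (de : R) : 0 <= t -> 0 < de ->
  (fun N => Ex P (fun w => (de < `|N%:R^-1 * (E N t w)%:R - int 0 t lam|)%R%:R)) @ \oo
    --> (0 : R).
Proof.
move=> t0 de0; have [_ _ ap alim] := arr.
set Lt : R := int 0 t lam.
have L0 : 0 <= Lt by apply: int_ge0 => u /andP[u0 _]; exact: lam0.
(* The bias of [aN N / N] takes up [de / 2]. As [aN N] is at most 2N, Chebyshev at distance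
   [N de / 2] gives 2 N Lt / (N de / 2)^2, hence the constant 8. *)
have bnd (N : nat) : (0 < N)%N -> `|aN N / N%:R - 1| <= 1 -> `|aN N / N%:R - 1| * Lt <= de / 2 ->
    Ex P (fun w => (de < `|N%:R^-1 * (E N t w)%:R - Lt|)%R%:R) <= (8 * Lt / de ^+ 2) / N%:R.
  move=> N0 a1 a2; have N1 : (0 : R) < N%:R by rewrite ltr0n.
  have m0 : 0 <= aN N * Lt by rewrite mulr_ge0 // ltW.
  have e0 : 0 < N%:R * (de / 2) by rewrite mulr_gt0 // divr_gt0.
  have := poisson_chebyshev (mE N t) m0 e0 (fun n => arrivals_poisson N n t0).
  move=> h; apply: le_trans (le_trans _ h) _.
    apply: le_Ex.
    - apply: bm_bool; apply: measurable_fun_ltr => //; apply: measurableT_comp => //.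
      by apply: measurable_funB => //; apply: measurable_funM => //; exact: mf_natr.
    - apply: bm_bool; apply: measurable_fun_ltr => //; apply: measurableT_comp => //.
      by apply: measurable_funB => //; exact: mf_natr.
    move=> w; case: (ltP de) => // h1; case: ltP => // h2; exfalso.
    have : `|N%:R^-1 * (E N t w)%:R - Lt| <= de / 2 + de / 2.
      have -> : N%:R^-1 * (E N t w)%:R - Lt =
          N%:R^-1 * ((E N t w)%:R - aN N * Lt) + (aN N / N%:R - 1) * Lt.
        by field; rewrite gt_eqF.
      apply: le_trans (ler_normD _ _) _; apply: lerD; last by rewrite normrM (ger0_norm L0).
      by rewrite normrM ger0_norm ?invr_ge0 // ler_pdivrMl.
    lra.
  rewrite ler_pdivrMr ?exprn_gt0 // exprMn.
  have -> : 8 * Lt / de ^+ 2 / N%:R * (N%:R ^+ 2 * (de / 2) ^+ 2) = 2 * (N%:R * Lt) :> R.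
    by field; rewrite !gt_eqF.
  rewrite mulrA; apply: ler_wpM2r => //; rewrite -ler_pdivrMr //.
  by move: a1; rewrite ler_norml => /andP[_ ?]; lra.
apply/cvgrPdist_le => e e0.
have t2 : 0 < Num.min 1 (de / (2 * (Lt + 1))).
  by rewrite lt_min ltr01 divr_gt0 // mulr_gt0 // ltr_wpDl.
move/cvgrPdist_le: alim => /(_ _ t2) [N1 _ hN1].
pose N2 := (Num.truncn (8 * Lt / de ^+ 2 / e)).+1.
exists (maxn N1 N2) => // N /=; rewrite geq_max => /andP[n1 n2].
have N0 : (0 < N)%N by apply: leq_trans n2.
have := hN1 N n1; rewrite /= distrC le_min => /andP[h1 h2].
have h3 : `|aN N / N%:R - 1| * Lt <= de / 2.
  rewrite ler_pdivlMr // in h2 *; first by nra.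
  by rewrite mulr_gt0 // ltr_wpDl.
rewrite sub0r normrN ger0_norm ?Ex_ge0 //; apply: le_trans (bnd N N0 h1 h3) _.
have Np : (0 : R) < N%:R by rewrite ltr0n.
rewrite ler_pdivrMr // [e * _]mulrC -ler_pdivrMr //.
by apply: le_trans (ltW (truncnS_gt _)) _; rewrite ler_nat.
Qed.

Let ratio N i r w : R := (1 - G (A0 N i w + r)) / (1 - G (A0 N i w)).
Let Gp a : 0 < 1 - G a. Proof. by rewrite subr_gt0 (cdf_lt1 sa). Qed.

Let ratio01 N i r w : 0 <= r -> 0 <= ratio N i r w <= 1.
Proof.
move=> r0; rewrite /ratio (divr_ge0 (ltW (Gp _)) (ltW (Gp _))) /= ler_pdivrMr // mul1r lerB //.
by rewrite (cdf_mono sa) // lerDl.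
Qed.

Let mratio N i r : measurable_fun setT (ratio N i r).
Proof.
have mi : measurable_fun setT (fun a : R => (1 - G a)^-1).
  apply: nondecreasing_measurable => // u v uv.
  by rewrite lef_pV2 ?posrE ?Gp // lerB // (cdf_mono sa).
apply: measurable_funM; last exact: measurableT_comp mi (mA0 N i).
apply: measurable_funB => //; apply: measurableT_comp (measurable_cdf sa) _.
exact: measurable_funD.
Qed.

Let bratio N i r : 0 <= r -> bm (ratio N i r).
Proof.
move=> r0; apply: (bm_le (M := 1)) => // w.
by have /andP[h1 h2] := ratio01 N i w r0; rewrite ger0_norm.
Qed.

Lemma residual_Ex N (S : nat -> nat -> bool) (J : nat -> bool) (r : nat -> R) :
  (forall i, 0 <= r i) ->
  Ex P (fun w => \prod_(i < N) (S i (X0 N i w) &&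
    (J i ==> (0 < X0 N i w)%N ==> (r i < Res N i w)))%:R) =
  Ex P (fun w => \prod_(i < N) ((S i (X0 N i w))%:R *
    (if J i && (0 < X0 N i w)%N then ratio N i (r i) w else 1))).
Proof.
move=> r0; have [_ [_ [_ [_ [_ [rl _]]]]]] := net N.
have := rl (fun i n => S i n) (fun=> setT) J r (fun=> measurableT) r0.
have prodb (b : 'I_N -> bool) : \prod_i ((b i)%:R : R) = [forall i, b i]%:R.
  case: (boolP [forall i, b i]) => [/forallP h|].
    by rewrite big1 // => i _; rewrite h.
  by rewrite negb_forall => /existsP[i ni]; rewrite (bigD1 i) //= (negbTE ni) mul0r.
have mb : measurable_fun setT (fun w => [forall i : 'I_N, S i (X0 N i w) &&
    (J i ==> (0 < X0 N i w)%N ==> (r i < Res N i w))]).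
  apply: measurable_bool; rewrite [X in measurable X](_ : _ =
     \bigcap_(i in [set i | (i < N)%N]) [set w | S i (X0 N i w) &&
    (J i ==> (0 < X0 N i w)%N ==> (r i < Res N i w))]).
    apply: bigcap_measurableType => i _.
    apply: bool_measurable; apply: measurable_and.
      by apply: (measurableT_comp (f := S i)).
    case: (J i) => //=; have -> : (fun w => (0 < X0 N i w)%N ==> (r i < Res N i w)) =
       (fun w => if (0 < X0 N i w)%N then r i < Res N i w else true).
      by apply/funext => w; case: (0 < _)%N.
    apply: measurable_fun_ifT => //; first by apply: measurable_fun_ltn => //; exact: measurable_cst.
    by apply: measurable_fun_ltr => //; exact: measurable_cst.
  apply/seteqP; split=> w /=; first by move=> /forallP h i /= iN; exact: (h (Ordinal iN)).
  by move=> h; apply/forallP => i; exact: (h i (ltn_ord i)).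
under eq_Ex do rewrite prodb.
rewrite Ex_bool // => h.
have -> : [set w | [forall i : 'I_N, S i (X0 N i w) &&
    (J i ==> (0 < X0 N i w)%N ==> (r i < Res N i w))]] =
    init_cyl X0 A0 Res N (fun i n => S i n) (fun=> setT) J r.
  apply/seteqP; split=> w /=.
    move=> /forallP h' i iN; have /andP[h1 h2] := h' (Ordinal iN); split=> //= Ji xi.
    by move: h2; rewrite /= Ji xi.
  move=> h'; apply/forallP => i; have [h1 _ h2] := h' i (ltn_ord i); rewrite h1 /=.
  by apply/implyP => Ji; apply/implyP => xi; exact: h2.
rewrite h /Ex /Rintegral; congr fine; apply: eq_integral => w _; congr (_%:E).
rewrite [RHS]big_split /= (prodb (fun i : 'I_N => S i (X0 N i w))) /indic; congr (_ * _).
  congr (_%:R); congr (nat_of_bool _); apply/idP/idP.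
    rewrite inE => h'; apply/forallP => i; by have [] := h' i (ltn_ord i).
  by move=> /forallP h'; rewrite inE => i iN; split=> //; exact: (h' (Ordinal iN)).
exact: big_mkcond.
Qed.


Lemma residual_prod N l (r : R) (K : nat -> bool) : (0 < l)%N -> 0 <= r ->
  Ex P (fun w => \prod_(i < N | K i) ((l <= X0 N i w)%N && (r < Res N i w))%:R) =
  Ex P (fun w => \prod_(i < N | K i) ((l <= X0 N i w)%N%:R * ratio N i r w)).
Proof.
move=> l0 r0.
have := @residual_Ex N (fun i n => K i ==> (l <= n)%N) K (fun=> r) (fun=> r0).
congr (_ = _); apply: eq_Ex => w; rewrite [RHS]big_mkcond; apply: eq_bigr => i _.
  case: (K i) => //=; case: (leqP l (X0 N i w)) => //= lx.
  by rewrite (leq_trans l0 lx).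
case: (K i) => /=; last by rewrite mul1r.
case: (leqP l (X0 N i w)) => lx; last by rewrite !mul0r.
by rewrite (leq_trans l0 lx).
Qed.

Definition residual_frac N l (r : R) w : R :=
  N%:R^-1 * \sum_(i < N) ((l <= X0 N i w)%N && (r < Res N i w))%:R.

Lemma Zbar0E N l r w : Zbar0 X0 A0 G N l r w =
  N%:R^-1 * \sum_(i < N) ((l <= X0 N i w)%N%:R * ratio N i r w).
Proof.
rewrite /Zbar0; congr (_ * _); rewrite big_mkcond; apply: eq_bigr => i _.
by case: (_ <= _)%N; rewrite ?mul1r ?mul0r.
Qed.

Let bb N l r i : bm (fun w => ((l <= X0 N i w)%N && (r < Res N i w))%:R : R).
Proof.
apply: bm_bool; apply: measurable_and.
  by apply: measurable_fun_leq => //; exact: measurable_cst.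
by apply: measurable_fun_ltr => //; exact: measurable_cst.
Qed.

Let bp N l r i : 0 <= r -> bm (fun w => (l <= X0 N i w)%N%:R * ratio N i r w).
Proof.
move=> r0; apply: bmM; last exact: bratio.
by apply: bm_bool; apply: measurable_fun_leq => //; exact: measurable_cst.
Qed.

Lemma bm_Zbar0 N l (r : R) : 0 <= r -> bm (Zbar0 X0 A0 G N l r).
Proof.
move=> r0; have -> : Zbar0 X0 A0 G N l r = fun w =>
    N%:R^-1 * \sum_(i < N) ((l <= X0 N i w)%N%:R * ratio N i r w).
  by apply/funext => w; exact: Zbar0E.
by apply: bmZ; apply: bm_sum => i _; exact: bp.
Qed.

Lemma bm_residual_frac N l (r : R) : bm (residual_frac N l r).
Proof. by apply: bmZ; apply: bm_sum => i _; exact: bb. Qed.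

(** Given lengths and ages, the residual indicators are independent with the summands of [Zbar0] as
    means. So first moments and moments of distinct pairs coincide, and each of the [N] diagonal
    terms exceeds its counterpart by at most 1, against the factor N^-2. *)
Lemma residual_second_moment N l (r z : R) : (0 < N)%N -> (0 < l)%N -> 0 <= r ->
  Ex P (fun w => (residual_frac N l r w - z) ^+ 2) <=
  Ex P (fun w => (Zbar0 X0 A0 G N l r w - z) ^+ 2) + N%:R^-1.
Proof.
move=> N0 l0 r0; have N1 : (0 : R) < N%:R by rewrite ltr0n.
pose b i w : R := ((l <= X0 N i w)%N && (r < Res N i w))%:R.
pose p i w : R := (l <= X0 N i w)%N%:R * ratio N i r w.
have bmb i : bm (b i) by exact: bb.
have bmp i : bm (p i) by exact: bp.
have sq (h : nat -> Omega -> R) w : (N%:R^-1 * (\sum_(i < N) h i w) - z) ^+ 2 =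
    N%:R^-2 * (\sum_(i < N) \sum_(j < N) ((h i w - z) * (h j w - z))).
  have -> : N%:R^-1 * (\sum_(i < N) h i w) - z = N%:R^-1 * (\sum_(i < N) (h i w - z)).
    by rewrite sumrB sumr_const card_ord mulrBr -[z *+ N]mulr_natr mulrCA mulVf ?mulr1 ?gt_eqF.
  rewrite exprMn exprVn; congr (_ * _); rewrite expr2 big_distrl /=; apply: eq_bigr => i _.
  by rewrite big_distrr.
have bmm (h : nat -> Omega -> R) i j : (forall i, bm (h i)) -> bm (fun w => (h i w - z) * (h j w - z)).
  by move=> hb; apply: bmM; apply: bmB => //; exact: bm_cst.
have ExE (h : nat -> Omega -> R) : (forall i, bm (h i)) ->
    Ex P (fun w => (N%:R^-1 * (\sum_(i < N) h i w) - z) ^+ 2) =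
    N%:R^-2 * (\sum_(i < N) \sum_(j < N) Ex P (fun w => (h i w - z) * (h j w - z))).
  move=> hb; under eq_Ex do rewrite sq.
  rewrite ExZ; last by apply: bm_sum => i _; apply: bm_sum => j _; exact: bmm.
  congr (_ * _); rewrite Ex_sum; last by move=> i _; apply: bm_sum => j _; exact: bmm.
  by apply: eq_bigr => i _; rewrite Ex_sum // => j _; exact: bmm.
have single i : (i < N)%N -> Ex P (b i) = Ex P (p i).
  move=> iN; have := @residual_prod N l r (pred1 i) l0 r0.
  have big1E (F : nat -> R) : \prod_(k < N | pred1 i k) F k = F i.
    by rewrite (big_pred1 (Ordinal iN)) // => k; rewrite /= -(inj_eq val_inj).
  by congr (_ = _); apply: eq_Ex => w; [exact: (big1E (b ^~ w))|exact: (big1E (p ^~ w))].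
have pair i j : (i < N)%N -> (j < N)%N -> i != j ->
    Ex P (fun w => b i w * b j w) = Ex P (fun w => p i w * p j w).
  move=> iN jN ij; have := @residual_prod N l r (pred2 i j) l0 r0.
  have big2E (F : nat -> R) : \prod_(k < N | pred2 i j k) F k = F i * F j.
    rewrite (bigD1 (Ordinal iN)) /= ?eqxx // (big_pred1 (Ordinal jN)) // => k /=.
    rewrite -!(inj_eq val_inj) /=; case: eqP => [->|_] /=; last by rewrite andbT.
    by rewrite (negbTE ij).
  by congr (_ = _); apply: eq_Ex => w; [exact: (big2E (b ^~ w))|exact: (big2E (p ^~ w))].
have expand (u v : Omega -> R) : bm u -> bm v -> Ex P (fun w => (u w - z) * (v w - z)) =
    Ex P (fun w => u w * v w) - z * Ex P u - z * Ex P v + z ^+ 2.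
  move=> hu hv; have huv := bmM hu hv.
  rewrite -(ExZ P z hu) -(ExZ P z hv) -(ExB P huv (bmZ z hu)).
  rewrite -(ExB P (bmB huv (bmZ z hu)) (bmZ z hv)) -[X in _ + X](Ex_cst P).
  rewrite -(ExD P (bmB (bmB huv (bmZ z hu)) (bmZ z hv)) (bm_cst _ _)).
  by apply: eq_Ex => w; ring.
have -> : Ex P (fun w => (residual_frac N l r w - z) ^+ 2) =
    Ex P (fun w => (N%:R^-1 * (\sum_(i < N) b i w) - z) ^+ 2) by [].
have -> : Ex P (fun w => (Zbar0 X0 A0 G N l r w - z) ^+ 2) =
    Ex P (fun w => (N%:R^-1 * (\sum_(i < N) p i w) - z) ^+ 2).
  by apply: eq_Ex => w; rewrite Zbar0E.
rewrite !ExE //.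
have -> : N%:R^-1 = N%:R^-2 * \sum_(i < N) 1 :> R.
  by rewrite sumr_const card_ord expr2 invfM mulfVK ?gt_eqF.
rewrite -mulrDr ler_pM2l ?invr_gt0 ?exprn_gt0 // -big_split /=.
apply: ler_sum => i _; rewrite (bigD1 i) //= [in leRHS](bigD1 i) //= -addrA [leRHS]addrC -addrA.
rewrite addrC; apply: lerD.
  by apply: ler_sum => j ji; rewrite !expand // pair ?single // 1?eq_sym.
rewrite !expand // !single //.
have h1 : Ex P (fun w => b i w * b i w) <= 1.
  apply: Ex_le_cst; first exact: bmM.
  by move=> w; rewrite /b; case: (_ && _); rewrite ?mulr1 ?mulr0.
have h2 : 0 <= Ex P (fun w => p i w * p i w) by apply: Ex_ge0 => w; exact: sqr_ge0.
lra.
Qed.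

(** Chebyshev's inequality; the second moment of [Zbar0] around its limit vanishes by dominated
    convergence. *)
Lemma residual_lln l (r de : R) : (0 < l)%N -> 0 <= r -> 0 < de ->
  (fun N => Ex P (fun w => (de < `|residual_frac N l r w - Z0 l r|)%R%:R)) @ \oo --> (0 : R).
Proof.
move=> l0 r0 de0; set z := Z0 l r.
have b1 N : bm (fun w => (residual_frac N l r w - z) ^+ 2).
  by apply: bmX; apply: bmB; [exact: bm_residual_frac|exact: bm_cst].
have Zb N w : `|Zbar0 X0 A0 G N l r w| <= 1.
  rewrite Zbar0E; have [->|N0] := posnP N; first by rewrite big_ord0 mulr0 normr0.
  have N1 : (0 : R) < N%:R by rewrite ltr0n.
  rewrite normrM ger0_norm ?invr_ge0 // ler_pdivrMl // mulr1.
  apply: le_trans (ler_norm_sum _ _ _) _; rewrite -[N in leRHS]card_ord -sumr_const.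
  apply: ler_sum => i _; have /andP[h1 h2] := ratio01 N i w r0.
  by case: (l <= _)%N; rewrite ?mul1r ?mul0r ?normr0 // ger0_norm.
have lim2 : (fun N => Ex P (fun w => (Zbar0 X0 A0 G N l r w - z) ^+ 2)) @ \oo --> (0 : R).
  apply: (@Ex_dominated _ _ _ P _ ((1 + `|z|) ^+ 2)).
  - by move=> N; have [] := bmX 2 (bmB (bm_Zbar0 N l r0) (@bm_cst _ Omega R z)).
  - move=> N w; rewrite normrX lerXn2r ?nnegrE //.
    apply: le_trans (ler_normB _ _) _; rewrite lerD2r; exact: Zb.
  apply: filterS Zlim => w /(_ l r l0 r0) h.
  have c : (fun N => Zbar0 X0 A0 G N l r w - z) @ \oo --> (0 : R).
    by rewrite -(subrr z); apply: cvgB h _; exact: cvg_cst.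
  by rewrite -[0](mulr0 0); exact: (cvgM c c).
have lim3 : (fun N => de^-2 * (Ex P (fun w => (Zbar0 X0 A0 G N l r w - z) ^+ 2) + N%:R^-1)) @ \oo
    --> (0 : R).
  rewrite -[0](mulr0 (de ^- 2)); apply: cvgM; first exact: cvg_cst.
  rewrite -[0]addr0; apply: cvgD => //; apply/gtr0_cvgV0; last exact: cvgr_idn.
  by exists 1%N => // n /=; rewrite ltr0n.
apply: (squeeze_cvgr _ (cvg_cst 0) lim3).
exists 1%N => // N /= N0; rewrite Ex_ge0 //=.
have h := residual_second_moment z N0 l0 r0.
have bN := bmB (bm_residual_frac N l r) (@bm_cst _ Omega R z).
apply: (@le_trans _ _ (Ex P (fun w => de^-2 * (residual_frac N l r w - z) ^+ 2))).
  apply: le_Ex; last 1 first.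
  - move=> w; case: ltP => hw; last by rewrite mulr_ge0 ?invr_ge0 ?sqr_ge0.
    rewrite -(@ler_pM2l _ (de ^+ 2)) ?exprn_gt0 // mulr1 mulVKf ?expf_neq0 ?gt_eqF //.
    by rewrite -[leRHS]real_normK ?num_real // lerXn2r ?nnegrE // ltW.
  - apply: bm_bool; apply: measurable_fun_ltr => //; have [m _] := bN.
    exact: measurableT_comp.
  - exact: bmZ.
by rewrite ExZ // ler_wpM2l // invr_ge0 exprn_ge0 // ltW.
Qed.

(** On this event [pos] and [clip] do not change the input, so the system built from the coordinates
    is the network itself. *)
Definition proper N w : Prop := forall i k, [/\ ((i < N)%N -> (0 < X0 N i w)%N -> 0 < Res N i w),
  0 < W N i k w, 0 < V N i w, (C1 N i w < N)%N & (C2 N i w < N)%N].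

Lemma ae_proper N : (0 < N)%N -> {ae P, forall w, proper N w}.
Proof.
move=> N0; have [[mX [_ [mR [mW [_ [mV [mC _]]]]]]] [_ [_ [_ [[lW lV lC _] _]]]]] := net N.
have G0 : G 0 = 0 by exact: (cdf_neg sa (lexx 0)).
have pos_ae (f : Omega -> R) : measurable_fun setT f -> (forall x, P [set w | f w <= x] = (G x)%:E) ->
    {ae P, forall w, 0 < f w}.
  move=> mf hf; exists [set w | f w <= 0]; split.
  - by apply: bool_measurable; apply: measurable_fun_ler => //; exact: measurable_cst.
  - by rewrite hf G0.
  - by move=> w /= /negP; rewrite -leNgt.
have clip_ae (f : Omega -> nat) : measurable_fun setT f ->
    (forall i, (i < N)%N -> P [set w | f w = i] = (N%:R^-1)%:E) -> {ae P, forall w, (f w < N)%N}.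
  move=> mf hf; have me i : measurable_fun setT (fun w => f w == i).
    by apply: measurable_fun_eqn => //; exact: measurable_cst.
  apply: ae_bool; first by apply: measurable_fun_ltn => //; exact: measurable_cst.
  transitivity (\sum_(i < N) Ex P (fun w => (f w == i)%:R)).
    rewrite -Ex_sum; last by move=> i _; exact: bm_bool.
    apply: eq_Ex => w; case: ltnP => h.
      rewrite (bigD1 (Ordinal h)) //= eqxx big1 ?addr0 // => i ni.
      by case: eqP => // e; move: ni; rewrite -(inj_eq val_inj) /= e eqxx.
    by rewrite big1 // => i _; case: eqP => // e; have := ltn_ord i; rewrite -e ltnNge h.
  rewrite (eq_bigr (fun=> N%:R^-1)) => [|i _]; last first.
    rewrite Ex_bool //; have -> : [set w | f w == i] = [set w | f w = i].
      by apply/seteqP; split=> w /= /eqP.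
    by rewrite hf.
  by rewrite sumr_const card_ord -[LHS]mulr_natr mulVf // pnatr_eq0 -lt0n.
(* At [r = 0] the survival ratio is 1, so a positive residual carries the whole mass of the event
   that the server is busy. *)
have res_ae i : {ae P, forall w, (i < N)%N -> (0 < X0 N i w)%N -> 0 < Res N i w}.
  have [iN|Ni] := ltnP i N; last by apply: aeW => w.
  have h := @residual_prod N 1 0 (pred1 i) isT (lexx 0).
  have big1E (F : nat -> R) : \prod_(k < N | pred1 i k) F k = F i.
    by rewrite (big_pred1 (Ordinal iN)) // => k; rewrite /= -(inj_eq val_inj).
  have ae1 : {ae P, forall w, ~~ ((0 < X0 N i w)%N && (Res N i w <= 0))}.
    have m1 : measurable_fun setT (fun w => (0 < X0 N i w)%N).
      by apply: measurable_fun_ltn => //; exact: measurable_cst.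
    have m2 : measurable_fun setT (fun w => (0 < X0 N i w)%N && (0 < Res N i w)).
      by apply: measurable_and => //; apply: measurable_fun_ltr => //; exact: measurable_cst.
    have m3 : measurable_fun setT (fun w => (0 < X0 N i w)%N && (Res N i w <= 0)).
      by apply: measurable_and => //; apply: measurable_fun_ler => //; exact: measurable_cst.
    apply: ae_bool; first exact: measurable_neg.
    transitivity (Ex P (fun w => 1 - ((0 < X0 N i w)%N%:R - ((0 < X0 N i w)%N && (0 < Res N i w))%:R))).
      apply: eq_Ex => w; case: (0 < _)%N; rewrite /= ?subrr ?subr0 //.
      by rewrite leNgt negbK; case: (0 < _); rewrite /= ?subrr ?subr0 ?subrr.
    rewrite ExB; [|exact: bm_cst|by apply: bmB; exact: bm_bool].
    rewrite ExB; [|exact: bm_bool|exact: bm_bool].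
    have -> : Ex P (fun w => ((0 < X0 N i w)%N && (0 < Res N i w))%:R) = Ex P (fun w => (0 < X0 N i w)%N%:R).
      have : Ex P (fun w => ((1 <= X0 N i w)%N && (0 < Res N i w))%:R) =
          Ex P (fun w => (1 <= X0 N i w)%N%:R * ratio N i 0 w).
        move: h; congr (_ = _); apply: eq_Ex => w.
          exact: (big1E (fun i => ((0 < X0 N i w)%N && (0 < Res N i w))%:R)).
        exact: (big1E (fun i => (0 < X0 N i w)%N%:R * ratio N i 0 w)).
      move=> ->; apply: eq_Ex => w; rewrite /ratio addr0 divff ?mulr1 // gt_eqF //.
    by rewrite subrr subr0 Ex_cst.
  apply: filterS ae1 => w /nandP[/negP h1|]; first by move=> _ /h1.
  by rewrite -ltNge.
apply/ae_foralln => i; apply/ae_foralln => k.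
have h1 := res_ae i; have h2 := pos_ae _ (mW i k) (lW i k); have h3 := pos_ae _ (mV i) (lV i).
have h4 : {ae P, forall w, (C1 N i w < N)%N}.
  by apply: clip_ae => [|j jN]; [apply: mf_natP => m; case: (mC i m)|case: (lC i j jN)].
have h5 : {ae P, forall w, (C2 N i w < N)%N}.
  by apply: clip_ae => [|j jN]; [apply: mf_natP => m; case: (mC i m)|case: (lC i j jN)].
by apply: filterS3 h1 h2 (filterI h3 (filterI h4 h5)) => w ? ? [? [? ?]].
Qed.

(** Markov's inequality; a finite upper limit bounds the means for all large [N]. *)
Lemma start_jobs_tight (e : R) : 0 < e -> exists M : R, 0 < M /\ \forall N \near \oo,
  Ex P (fun w => (M * N%:R < \sum_(i < N) (X0 N i w)%:R)%R%:R) <= e.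
Proof.
move=> e0; have [_ h] := init.
set u := fun N => _ in h.
have [n hn] : exists n, (esups u n < +oo)%E.
  apply/not_existsP => hn; move: h; rewrite limn_esup_lim.
  have -> : esups u = fun=> +oo%E.
    by apply/funext => n; apply/eqP; rewrite -leye_eq leNgt; apply/negP; exact: hn.
  by rewrite lim_cst // ltxx.
have [C C0 hC] : exists2 C : R, 0 < C & forall N, (n <= N)%N -> (u N <= C%:E)%E.
  have sup_le N : (n <= N)%N -> (u N <= esups u n)%E.
    by move=> nN; apply: ereal_sup_ubound; exists N.
  case E1 : (esups u n) hn sup_le => [c| |] // _ sup_le.
    exists (Num.max c 1); first by rewrite lt_max ltr01 orbT.
    by move=> N /sup_le h'; apply: le_trans h' _; rewrite lee_fin le_max lexx.
  by exists 1 => // N /sup_le h'; apply: le_trans h' _; exact: leNye.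
exists (C / e); split; first exact: divr_gt0.
exists (maxn n 1) => // N /=; rewrite geq_max => /andP[nN N0].
have N1 : (0 : R) < N%:R by rewrite ltr0n.
have mS : measurable_fun setT (fun w => \sum_(i < N) (X0 N i w)%:R : R).
  by apply: measurable_sum => i; exact: mf_natr.
have mb : measurable_fun setT (fun w => (C / e * N%:R < \sum_(i < N) (X0 N i w)%:R)%R).
  by apply: measurable_fun_ltr => //; exact: measurable_cst.
suff : C / e * Ex P (fun w => (C / e * N%:R < \sum_(i < N) (X0 N i w)%:R)%R%:R) <= C.
  by rewrite mulrAC -mulrA ger_pMr // ler_pdivrMr // mul1r.
rewrite -ExZ; last exact: bm_bool.
rewrite -lee_fin -(Ex_EFin P (bmZ _ (bm_bool _ mb))); apply: le_trans (hC N nN).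
apply: ge0_le_integral => //.
- by move=> w _; rewrite lee_fin mulr_ge0 // divr_ge0 // ltW.
- by apply/measurable_EFinP; have [] := bmZ (C / e) (bm_bool R mb).
- by apply/measurable_EFinP; exact: measurable_funM.
move=> w _; rewrite lee_fin; case: ltP => hs; rewrite ?mulr0 ?mulr1.
  by rewrite [leRHS]mulrC ler_pdivlMr // ltW.
by rewrite mulr_ge0 // ?invr_ge0 // sumr_ge0.
Qed.

End NetworkLimits.

Lemma le_Ex_ae (R : realType) d (T : measurableType d) (P : probability T R) (f h : T -> R) :
  bm f -> bm h -> {ae P, forall w, f w <= h w} -> Ex P f <= Ex P h.
Proof.
(* [k] is the pointwise maximum of [f] and [h], almost surely equal to [h]. *)
move=> bf bh fh; pose k w := h w + 2^-1 * (`|f w - h w| + (f w - h w)).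
have bk : bm k by apply: bmD => //; apply: bmZ; apply: bmD; [apply: bm_norm|]; exact: bmB.
rewrite -(eq_Ex_ae (f := k) bk bh); last first.
  apply: filterS fh => w fh; rewrite /k ler0_norm ?subr_le0 //; by lra.
apply: le_Ex => // w; rewrite /k; have := ler_norm (f w - h w); lra.
Qed.

Lemma ae_exists (R : realType) d (T : measurableType d) (P : probability T R) (Q : T -> Prop) :
  {ae P, forall w, Q w} -> exists w, Q w.
Proof.
move=> [A [mA A0 sub]]; apply/not_existsP => nQ.
have AT : A = setT by apply/seteqP; split=> // w _; apply: sub; exact: nQ.
by have := probability_setT P; rewrite -AT A0 => /eqP; rewrite eqe eq_sym oner_eq0.
Qed.

Lemma cvg_sum0 (R : realType) n (F : nat -> nat -> R) :
  (forall i, (i < n)%N -> F i @ \oo --> (0 : R)) ->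
  (fun N => \sum_(i < n) F i N) @ \oo --> (0 : R).
Proof.
elim: n => [|n IH] h; first by under eq_fun do rewrite big_ord0; exact: cvg_cst.
have -> : (fun N => \sum_(i < n.+1) F i N) = fun N => \sum_(i < n) F i N + F n N.
  by apply/funext => N; rewrite big_ord_recr.
have c : (fun N => \sum_(i < n) F i N) @ \oo --> (0 : R).
  by apply: IH => i /ltnW; exact: h.
have hn := h n (ltnSn n).
by have := cvgD c hn; rewrite addr0; exact.
Qed.

Lemma exp_growth (R : realType) (c A : R) (N n : nat) : 0 <= c -> (0 < N)%N ->
  n%:R <= A * N%:R -> (1 + c / N%:R) ^+ n <= expR (c * A).
Proof.
move=> c0 N0 nA; have Np : (0 : R) < N%:R by rewrite ltr0n.
have cN : 0 <= c / N%:R by rewrite divr_ge0.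
apply: (@le_trans _ _ (expR (c / N%:R) ^+ n)).
  by rewrite lerXn2r ?nnegrE ?expR_ge0 ?addr_ge0 // expR_ge1Dx.
rewrite -expRM_natl ler_expR mulrC -mulrA; apply: ler_wpM2l => //.
by rewrite mulrC ler_pdivrMr.
Qed.

(** * Convergence of the fraction of long queues *)

Section FractionLimit.
Context (R : realType) (d : measure_display) (Omega : measurableType d)
  (P : probability Omega R).
Variables (G g lam : R -> R) (H : R) (aN : nat -> R)
  (X0 : nat -> nat -> Omega -> nat) (A0 Res : nat -> nat -> Omega -> R)
  (W : nat -> nat -> nat -> Omega -> R) (E : nat -> R -> Omega -> nat)
  (V : nat -> nat -> Omega -> R) (C1 C2 : nat -> nat -> Omega -> nat)
  (Bt : nat -> nat -> Omega -> bool) (Z0 : nat -> R -> R) (Z : nat -> R -> R -> R) (T : R).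
Hypotheses (sa : service_assumption G g H) (arr : arrival_assumption lam aN)
  (net : forall N, sq2_network P X0 A0 Res W E V C1 C2 Bt G lam aN N)
  (init : init_assumption_a P X0 A0)
  (Zlim : {ae P, forall w, forall l r, (1 <= l)%N -> 0 <= r ->
      (fun N => Zbar0 X0 A0 G N l r w) @ \oo --> Z0 l r})
  (hs : hydro_sol lam (fun x => 1 - G x) Z0 Z) (T0 : 0 <= T).

Local Notation Y N := (input X0 Res W E V C1 C2 Bt N T).

Let lam0 t : 0 <= t -> 0 <= lam t. Proof. by case: arr => h _ _ _; exact: h. Qed.
Let lami t : 0 <= t -> integ 0 t lam. Proof. by case: arr => _ h _ _; exact: h. Qed.

(** The bound holds for each positive [N] whatever the ages, by [cdf_lip], and passes to the limit
    along a single sample point at which the convergence holds. *)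
Lemma Z0_lipschitz l (u v : R) : (0 < l)%N -> 0 <= u -> u <= v -> Z0 l u - Z0 l v <= H * (v - u).
Proof.
move=> l0 u0 uv; have [w hw] := ae_exists Zlim.
have H0 := hazard_ge0 sa.
have c1 : (fun N => Zbar0 X0 A0 G N l u w - Zbar0 X0 A0 G N l v w) @ \oo --> Z0 l u - Z0 l v.
  by apply: cvgB; apply: hw => //; exact: le_trans uv.
apply: (cvgr_to_le c1); exists 1%N => // N /= N0.
have N1 : (0 : R) < N%:R by rewrite ltr0n.
rewrite /Zbar0 -mulrBr -sumrB ler_pdivrMl //.
apply: (@le_trans _ _ (\sum_(i < N | (l <= X0 N i w)%N) (H * (v - u)))).
  apply: ler_sum => i _; have Gp : 0 < 1 - G (A0 N i w) by rewrite subr_gt0 (cdf_lt1 sa).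
  rewrite -mulrBl ler_pdivrMr //.
  have := cdf_lip sa (_ : A0 N i w <= A0 N i w + u) (_ : A0 N i w + u <= A0 N i w + v).
  rewrite lerDl lerD2l => /(_ u0 uv) h.
  have -> : H * (v - u) * (1 - G (A0 N i w)) =
    H * (1 - G (A0 N i w)) * (A0 N i w + v - (A0 N i w + u)) by ring.
  by apply: le_trans h; lra.
have h0 : 0 <= H * (v - u) by rewrite mulr_ge0 // subr_ge0.
apply: (@le_trans _ _ (\sum_(i < N) (H * (v - u)))).
  by rewrite [leLHS]big_mkcond; apply: ler_sum => i _; case: ifP.
by rewrite sumr_const card_ord mulr_natl.
Qed.

(** The block that is averaged: services, sampled servers and coins. Initial data and arrival times
    stay frozen. *)
Let S (c : coord) : bool :=
  match c with cW _ _ | cV _ | cC1 _ | cC2 _ | cB _ => true | _ => false end.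
Let S' (p : prim) : bool := match p with PInit | PArr => false | _ => true end.
Let SS c : S c = S' (prim_of c). Proof. by case: c. Qed.

Definition queue_frac N l (y : coord -> R) : R :=
  N%:R^-1 * \sum_(i < N) (l <= queue N i T y)%N%:R.

Lemma bm_queue_frac N l : bm (queue_frac N l : MI coord R -> R).
Proof.
apply: bmZ; apply: bm_sum => i _; apply: bm_bool; apply: measurable_fun_leq.
  exact: measurable_cst.
exact: mf_queue.
Qed.

Lemma queue_frac01 N l y : 0 <= queue_frac N l y <= 1.
Proof.
have /andP[h1 h2] := @sum_bool_le R N (fun i => (l <= queue N i T y)%N).
rewrite /queue_frac mulr_ge0 ?invr_ge0 //=; have [->|N0] := posnP N.
  by rewrite big_ord0 mulr0.
by rewrite ler_pdivrMl ?ltr0n // mulr1.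
Qed.

Section Fixed.
Variables (N : nat) (N0 : (0 < N)%N) (w : Omega).
Hypothesis pw : proper X0 Res W V C1 C2 N w.
Let y0 := Y N w.
Let x := xs N y0.
Let o := outer_at N x y0.
Let n0 := on0 o.

Let xE i : (i < N)%N -> nth 0%N x i = X0 N i w.
Proof. by move=> iN; rewrite nth_mkseq //= iN natrK. Qed.

Lemma wf_input : wf_outer o.
Proof.
by apply: wf_outer_at => // [j|i j ij]; [exact: input_tau_ge0|exact: (input_tau_mono (net N))].
Qed.

Let otE j : ot o j = if (j < n0)%N then 0 else
  if (j - n0 < E N T w)%N then arr_time (E N ^~ w) (j - n0) else T + 1.
Proof. by []. Qed.

Let Emono s t : 0 <= s -> s <= t -> (E N s w <= E N t w)%N.
Proof. by have [_ [cp _]] := net N; have [_ h _] := cp w; exact: h. Qed.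
Let Ercont t : 0 <= t -> exists2 del, 0 < del &
        forall s, t <= s -> s < t + del -> E N s w = E N t w.
Proof. by have [_ [cp _]] := net N; have [_ _ h] := cp w; exact: h. Qed.

Lemma input_before t j : 0 <= t -> t <= T -> (j < n0 + E N t w)%N -> ot o j <= t.
Proof.
move=> t0 tT jn; rewrite otE; case: ltnP => // nj.
have jE : (j - n0 < E N t w)%N by rewrite ltn_subLR.
rewrite (leq_trans jE (Emono t0 tT)); exact: arr_time_le.
Qed.

Lemma input_after t j : 0 <= t -> (n0 + E N t w <= j < n0 + E N T w)%N -> t < ot o j.
Proof.
move=> t0 /andP[j1 j2]; have nj : (n0 <= j)%N by rewrite (leq_trans _ j1) // leq_addr.
have jE : (j - n0 < E N T w)%N by rewrite ltn_subLR.
rewrite otE ltnNge nj /= jE (arr_time_gt Emono Ercont T0 jE t0).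
by rewrite leq_subRL.
Qed.

Lemma input_valid : valid o (n0 + E N T w) T.
Proof.
split=> j jk; first exact: input_before.
rewrite otE ltnNge (leq_trans (leq_addr _ _) jk) /= ltnNge leq_subRL ?(leq_trans (leq_addr _ _) jk) //.
by rewrite jk /= lerDl.
Qed.

Lemma input_start l r : (0 < l)%N -> start_frac N x y0 l r = residual_frac X0 Res N l r w.
Proof.
move=> l0; rewrite /start_frac /residual_frac; congr (_ * _); apply: eq_bigr => i _.
rewrite xE //; case: leqP => //= lx; have xi := leq_trans l0 lx.
have [ri _ _ _ _] := pw i 0%N; rewrite ltn_ord xi /=.
by rewrite /pos ri.
Qed.

Lemma size_waiting_le : (n0 <= \sum_(i < N) X0 N i w)%N.
Proof.
rewrite /n0 /o /= /waiting size_flatten sumnE /shape big_map big_map.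
rewrite -[X in iota 0 X](subn0 N) -/(index_iota 0 N) big_mkord.
by apply: leq_sum => i _; rewrite size_map size_iota xE // leq_pred.
Qed.

Lemma queue_frac_mix l w' : queue_frac N l (mix S y0 (Y N w')) =
  Zh N x y0 (Y N w') (n0 + E N T w) T T l.
Proof.
rewrite /queue_frac /Zh; congr (_ * _); apply: eq_bigr => i _.
rewrite /zi eqxx andbT; congr ((_ <= _)%N%:R).
rewrite /queue; have -> : arrivals (mix S y0 (Y N w')) = E N T w by rewrite /arrivals /= natrK.
by [].
Qed.

End Fixed.

Variable c : R.
Hypothesis c1024 : 1024 <= c.
Let c0 : 0 <= c. Proof. by move: c1024; lra. Qed.

Let Lam : R := int 0 T lam.
(** Bounds the weight [wt] at time [T], when at most [(Lam + 1) * N] jobs have arrived; [exp_growth]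
    turns the power of 1 + c/N into an exponential. *)
Let Wmax : R := expR ((16 * H + 1) * T) * expR (c * (Lam + 1)).

Lemma frac_bound N l (a de ep M : R) L m t w : (0 < N)%N -> proper X0 Res W V C1 C2 N w ->
  (0 < l)%N -> 0 <= ep -> 0 < a -> de <= 1 ->
  t 0%N = 0 -> t m = T -> (forall i, (i <= m)%N -> 0 <= t i <= T) ->
  (forall i, (i < m)%N -> t i <= t i.+1) ->
  (forall i, (i < m)%N -> int (t i) (t i.+1) (total_modulus H lam Z L) <= ep) ->
  (forall i, (i <= m)%N -> `|N%:R^-1 * (E N (t i) w)%:R - int 0 (t i) lam| <= de) ->
  (forall l i, (0 < l <= L.+1)%N -> (i <= m)%N ->
     `|residual_frac X0 Res N l (t i) w - Z0 l (t i)| <= de) ->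
  \sum_(i < N) (X0 N i w)%:R <= M * N%:R ->
  8 * m.+1%:R * de + ep * (2 * Lam + de + 8) <= a ->
  de + ep <= a -> 8 * Lam + 4 * de <= a * 2 ^+ L -> 2 <= a * 2 ^+ L ->
  3 * Num.sqrt ((M + Lam + 1) * N%:R) / N%:R <= a ->
  Ex P (fun w' => `|queue_frac N l (mix S (Y N w) (Y N w')) - Z l T 0|) <=
  136 * a * 2 ^+ l * Wmax.
Proof.
move=> N0 pw l0 ep0 a0 de1 t_0 t_m t_in t_le cell count start tight a1 a2 a3 a4 a5.
have Np : (0 : R) < N%:R by rewrite ltr0n.
set y0 := Y N w; set x := xs N y0; set n0 := on0 (outer_at N x y0).
pose n i := (n0 + E N (t i) w)%N.
have [_ [cp _]] := net N; have [E0 Emono _] := cp w.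
have cT := count m (leqnn m); rewrite t_m in cT.
have ET : (E N T w)%:R <= (Lam + 1) * N%:R :> R.
  rewrite -ler_pdivrMr // mulrC; move: cT; rewrite ler_norml -/Lam => /andP[_ ?]; lra.
have gi : good_input G N x y0 T (n m) (fzZ Z) Z0 (AZ G lam Z) (AdZ G lam Z) a.
  apply: (good_input_of_grid sa lam0 lami hs T0 Z0_lipschitz N0
    (wf_input N0 w) ep0 a0 t_0 t_m t_in t_le cell (n := n)) => //.
  - by rewrite /n t_0 E0 addn0.
  - move=> i im; rewrite /n leq_add2l; apply: Emono; last exact: t_le.
    by have /andP[] := t_in i (ltnW im).
  - by move=> i j im; have /andP[h1 h2] := t_in i im; exact: input_before.
  - move=> i j im; have /andP[h1 h2] := t_in i im; rewrite /n t_m; exact: input_after.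
  - by move=> i im; rewrite /n addKn; exact: count.
  - by move=> l' i /andP[l'0 l'L] im; rewrite input_start //; apply: start; rewrite ?l'0.
  - exact: a1.
  - exact: a2.
  - exact: a3.
  apply: le_trans a5; rewrite ler_pM2r ?invr_gt0 // ler_pM2l // ler_wsqrtr //.
  rewrite /n t_m natrD -addrA mulrDl lerD //.
  apply: le_trans tight; rewrite -natr_sum ler_nat; exact: size_waiting_le.
have ls := hydro_limit_system sa lam0 lami hs T0.
have drv := input_driving sa (net N) N0 T0.
have nk : (n0 <= n m <= n m)%N by rewrite leq_addr leqnn.
have vk : valid (outer_at N x y0) (n m) T by rewrite /n t_m; exact: input_valid.
have := Zh_close sa drv N0 (wf_input N0 w) ls gi c1024 (lexx (16 * H + 1)) nk vk T0
  (lexx T) (lexx T) l0.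
rewrite /fzZ subrr => h.
have -> : (fun w' => `|queue_frac N l (mix S (Y N w) (Y N w')) - Z l T 0|) =
    fun w' => `|Zh N x y0 (Y N w') (n m) T T l - Z l T 0|.
  by apply/funext => w'; rewrite queue_frac_mix // /n t_m.
apply: le_trans h _; apply: ler_wpM2l; first by rewrite !mulr_ge0 ?exprn_ge0 // ltW.
rewrite /wt /Wmax ler_wpM2l ?expR_ge0 // /n addKn t_m.
exact: exp_growth.
Qed.

Let Wmax_gt0 : 0 < Wmax. Proof. by apply: mulr_gt0; exact: expR_gt0. Qed.
Let Lam0 : 0 <= Lam. Proof. by apply: int_ge0 => u /andP[u0 _]; exact: lam0. Qed.

Let bm_arr N t (de : R) : bm (fun w => (de < `|N%:R^-1 * (E N t w)%:R - int 0 t lam|)%R%:R : R).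
Proof.
have [[_ [_ [_ [_ [h _]]]]] _] := net N; apply: bm_bool; apply: measurable_fun_ltr => //.
apply: measurableT_comp => //; apply: measurable_funB => //; apply: measurable_funM => //.
by apply: mf_natr; apply: mf_natP.
Qed.

Let bm_res N l r (de : R) : bm (fun w => (de < `|residual_frac X0 Res N l r w - Z0 l r|)%R%:R : R).
Proof.
apply: bm_bool; apply: measurable_fun_ltr => //.
have [m _] := bmB (bm_residual_frac net N l r) (@bm_cst _ Omega R (Z0 l r)).
exact: measurableT_comp.
Qed.

Let bm_tight N (M : R) : bm (fun w => (M * N%:R < \sum_(i < N) (X0 N i w)%:R)%R%:R : R).
Proof.
have [[h _] _] := net N; apply: bm_bool; apply: measurable_fun_ltr => //.
by apply: measurable_sum => i; apply: mf_natr; apply: mf_natP.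
Qed.

Lemma bm_mix_queue N l : (0 < N)%N ->
  bm (fun z : Omega * Omega => `|queue_frac N l (mix S (Y N z.1) (Y N z.2)) - Z l T 0|).
Proof.
move=> N0; have mY := measurable_input (net N) T0.
have mm : measurable_fun setT (fun z : Omega * Omega => mix S (Y N z.1) (Y N z.2) : MI coord R).
  apply: measurable_MI => co; rewrite /mix; case: (S co).
    by apply: (mf_coord (h := fun z : Omega * Omega => Y N z.2)); exact: measurableT_comp mY measurable_snd.
  by apply: (mf_coord (h := fun z : Omega * Omega => Y N z.1)); exact: measurableT_comp mY measurable_fst.
apply: (bm_comp (f := fun y : MI coord R => `|queue_frac N l y - Z l T 0|) mm).
by apply: bm_norm; apply: bmB; [exact: bm_queue_frac|exact: bm_cst].
Qed.

Lemma queue_frac_cvg l : (0 < l)%N ->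
  (fun N => Ex P (fun w => `|queue_frac N l (Y N w) - Z l T 0|)) @ \oo --> (0 : R).
Proof.
move=> l0; apply/cvgrPdist_le => e e0.
(* With this accuracy the bound of [frac_bound] equals [e / 2]. *)
pose a : R := e / (2 * (136 * 2 ^+ l * Wmax)).
have D0 : 0 < 136 * 2 ^+ l * Wmax.
  apply: mulr_gt0; last exact: Wmax_gt0.
  by apply: mulr_gt0; [rewrite ltr0n|exact: exprn_gt0].
have a0 : 0 < a by rewrite divr_gt0 // mulr_gt0.
have ae2 : 136 * a * 2 ^+ l * Wmax = e / 2.
  by rewrite /a; field; rewrite !gt_eqF // exprn_gt0.
(* [B] dominates the trivial bounds, so levels from [L] on need no estimate. *)
pose B : R := 8 * Lam + 4.
have [L hL] : exists L, B <= a * 2 ^+ L.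
  exists (Num.truncn (B / a)).+1; set n := _.+1.
  rewrite mulrC -ler_pdivrMr //; apply: le_trans (ltW (truncnS_gt _)) _.
  by rewrite -natrX ler_nat ltnW // ltn_expl.
pose ep : R := (a / 2) / (2 * Lam + 9).
have C0 : 0 < 2 * Lam + 9 by move: Lam0; lra.
have ep0 : 0 < ep by rewrite divr_gt0 // divr_gt0.
have epE : ep * (2 * Lam + 9) = a / 2 by rewrite divfK // gt_eqF.
have sig0 u : 0 <= u <= T -> 0 <= total_modulus H lam Z L u.
  move=> /andP[u0 _]; apply: le_trans (le_total_modulus Z sa lam0 (_ : 0 < 1 <= L.+1)%N u0) => //.
  by apply: le_trans (flux_modulus_ge H Z lam0 1%N u0); rewrite addr_ge0 ?(hazard_ge0 sa) ?lam0.
have [m [t [t_0 t_m t_in t_le cell]]] :=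
  exists_grid T0 ep0 (total_modulus_integ sa lami hs L T0) sig0.
have m0 : 0 < 8 * m.+1%:R :> R by rewrite mulr_gt0 // ltr0n.
pose de : R := Num.min 1 ((a / 2) / (8 * m.+1%:R)).
have de0 : 0 < de by rewrite lt_min ltr01 divr_gt0 // divr_gt0.
have de1 : de <= 1 by rewrite ge_min lexx.
have de2 : 8 * m.+1%:R * de <= a / 2.
  by rewrite mulrC -ler_pdivlMr // ge_min lexx orbT.
have e16 : 0 < e / 16 by rewrite divr_gt0.
have [M [M0 hM]] := start_jobs_tight net init e16.
(* These count the failed requirements. Where one fails the error is still at most 2, so three kinds
   of failure, each of mean at most [e / 16], add at most [3 * e / 8] to the bound [e / 2]. *)
pose badA N w : R := \sum_(i < m.+1) (de < `|N%:R^-1 * (E N (t i) w)%:R - int 0 (t i) lam|)%R%:R.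
pose badR N w : R := \sum_(l' < L.+1) \sum_(i < m.+1)
  (de < `|residual_frac X0 Res N l'.+1 (t i) w - Z0 l'.+1 (t i)|)%R%:R.
pose badM N w : R := (M * N%:R < \sum_(i < N) (X0 N i w)%:R)%R%:R.
have bA N : bm (badA N) by apply: bm_sum => i _; exact: bm_arr.
have bR N : bm (badR N) by apply: bm_sum => l' _; apply: bm_sum => i _; exact: bm_res.
have bM N : bm (badM N) by exact: bm_tight.
have t0 i : (i < m.+1)%N -> 0 <= t i by move=> im; have /andP[] := t_in i im.
have limA : (fun N => Ex P (badA N)) @ \oo --> (0 : R).
  have -> : (fun N => Ex P (badA N)) = fun N => \sum_(i < m.+1)
      Ex P (fun w => (de < `|N%:R^-1 * (E N (t i) w)%:R - int 0 (t i) lam|)%R%:R).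
    by apply/funext => N; rewrite Ex_sum // => i _; exact: bm_arr.
  apply: (cvg_sum0 (F := fun i N =>
    Ex P (fun w => (de < `|N%:R^-1 * (E N (t i) w)%:R - int 0 (t i) lam|)%R%:R))) => i im.
  by apply: (arrivals_lln arr net) => //; exact: t0.
have limR : (fun N => Ex P (badR N)) @ \oo --> (0 : R).
  have -> : (fun N => Ex P (badR N)) = fun N => \sum_(l' < L.+1) \sum_(i < m.+1)
      Ex P (fun w => (de < `|residual_frac X0 Res N l'.+1 (t i) w - Z0 l'.+1 (t i)|)%R%:R).
    apply/funext => N; rewrite Ex_sum; last by move=> l' _; apply: bm_sum => i _; exact: bm_res.
    by apply: eq_bigr => l' _; rewrite Ex_sum // => i _; exact: bm_res.
  pose F l' i N := Ex P (fun w => (de < `|residual_frac X0 Res N l'.+1 (t i) w - Z0 l'.+1 (t i)|)%R%:R).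
  apply: (cvg_sum0 (F := fun l' N => \sum_(i < m.+1) F l' i N)) => l' _.
  apply: (cvg_sum0 (F := F l')) => i im.
  by apply: (residual_lln sa net Zlim) => //; exact: t0.
move/cvgrPdist_le: limA => /(_ _ e16) [N1 _ h1].
move/cvgrPdist_le: limR => /(_ _ e16) [N2 _ h2].
have [N3 _ h3] := hM.
pose F : R := M + Lam + 1.
have F0 : 0 < F by rewrite /F; move: Lam0; lra.
(* From this size on the noise [3 * sqrt (F * N) / N] is at most [a]. *)
pose N4 := (Num.truncn (9 * F / a ^+ 2)).+1.
exists (maxn (maxn N1 N2) (maxn N3 N4)) => // N /=.
rewrite !geq_max => /andP[/andP[n1 n2] /andP[n3 n4]].
have N0 : (0 < N)%N by apply: leq_trans n4.
have Np : (0 : R) < N%:R by rewrite ltr0n.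
have noise : 3 * Num.sqrt (F * N%:R) / N%:R <= a.
  rewrite ler_pdivrMr // -ler_pdivlMl //.
  rewrite -[leRHS]ger0_norm; last by rewrite mulr_ge0 ?invr_ge0 // mulr_ge0 // ltW.
  rewrite -sqrtr_sqr ler_wsqrtr // exprMn exprMn exprVn.
  have : 9 * F <= a ^+ 2 * N%:R.
    rewrite mulrC [leRHS]mulrC -ler_pdivrMr ?exprn_gt0 // [F * 9]mulrC.
    by apply: le_trans (ltW (truncnS_gt _)) _; rewrite ler_nat.
  move=> h; rewrite ler_pdivlMl ?exprn_gt0 // [_ ^+ 2 * (F * _)]mulrA expr2.
  have : 9 * F * N%:R <= a ^+ 2 * N%:R * N%:R by rewrite ler_pM2r.
  by rewrite !expr2; lra.
rewrite sub0r normrN ger0_norm ?Ex_ge0 //.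
have mY := measurable_input (net N) T0.
have bq : bm (fun y : MI coord R => `|queue_frac N l y - Z l T 0|).
  by apply: bm_norm; apply: bmB; [exact: bm_queue_frac|exact: bm_cst].
rewrite (Ex_resample (net N) N0 T0 SS bq).
have b2 : bm (fun w => e / 2 + 2 * (badA N w + badR N w + badM N w)).
  by apply: bmD; [exact: bm_cst|apply: bmZ; apply: bmD => //; exact: bmD].
apply: le_trans (le_Ex_ae (h := fun w => e / 2 + 2 * (badA N w + badR N w + badM N w)) _ b2 _) _.
- exact: (bm_Ex2 P P (bm_mix_queue l N0)).
- apply: filterS (ae_proper sa net N0) => w pw.
  have ge0A : 0 <= badA N w by apply: sumr_ge0.
  have ge0R : 0 <= badR N w by apply: sumr_ge0 => l' _; apply: sumr_ge0.
  have ge0M : 0 <= badM N w by [].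
  have le2 : Ex P (fun w' => `|queue_frac N l (mix S (Y N w) (Y N w')) - Z l T 0|) <= 2.
    apply: Ex_le_cst.
      have [mm [K hK]] := bm_mix_queue l N0.
      by split; [exact: measurableT_comp mm (measurable_pair1 w)|exists K => w'; exact: (hK (w, w'))].
    move=> w'; apply: le_trans (ler_normB _ _) _; have := Z_le1 hs l0 T0 (lexx 0).
    have /andP[q0 q1] := queue_frac01 N l (mix S (Y N w) (Y N w')); rewrite (ger0_norm q0); lra.
  have [goodA|] := boolP [forall i : 'I_m.+1, ~~ (de < `|N%:R^-1 * (E N (t i) w)%:R - int 0 (t i) lam|)]; last first.
    rewrite negb_forall => /existsP[i]; rewrite negbK => bad.
    suff : 1 <= badA N w by move: e0; lra.
    by rewrite /badA (bigD1 i) //= bad lerDl sumr_ge0.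
  have [goodR|] := boolP [forall l' : 'I_L.+1, forall i : 'I_m.+1,
      ~~ (de < `|residual_frac X0 Res N l'.+1 (t i) w - Z0 l'.+1 (t i)|)]; last first.
    rewrite negb_forall => /existsP[l']; rewrite negb_forall => /existsP[i]; rewrite negbK => bad.
    suff : 1 <= badR N w by move: e0; lra.
    rewrite /badR (bigD1 l') //= (bigD1 i) //= bad -addrA lerDl addr_ge0 ?sumr_ge0 //.
    by move=> j _; apply: sumr_ge0.
  have [tight|bad] := leP (\sum_(i < N) (X0 N i w)%:R) (M * N%:R); last first.
    suff : 1 <= badM N w by move: e0; lra.
    by rewrite /badM bad.
  apply: (@le_trans _ _ (e / 2)); last by rewrite lerDl mulr_ge0 // !addr_ge0.
  rewrite -ae2.
  apply: (@frac_bound N l a de ep M L m t w N0 pw l0 (ltW ep0) a0 de1 t_0 t_m t_in t_le cell) => //.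
  + by move=> i im; move/forallP: goodA => /(_ (Ordinal (im : i < m.+1)%N)); rewrite -leNgt.
  + move=> [|l'] i //= lL im; move/forallP: goodR => /(_ (Ordinal (lL : l' < L.+1)%N)).
    by move/forallP => /(_ (Ordinal (im : i < m.+1)%N)); rewrite -leNgt.
  + have : ep * (2 * Lam + de + 8) <= a / 2 by rewrite -epE ler_pM2l //; lra.
    lra.
  + have : ep * 1 <= a / 2 by rewrite -epE ler_pM2l //; move: Lam0; lra.
    have : 1 * de <= 8 * m.+1%:R * de.
      rewrite ler_pM2r //; have : (1 : R) <= m.+1%:R by rewrite ler1n.
      lra.
    lra.
  + by apply: le_trans hL; rewrite /B; lra.
  + by apply: le_trans hL; rewrite /B; move: Lam0; lra.
have bAR := bmD (bA N) (bR N); have bARM := bmD bAR (bM N).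
rewrite (ExD P (@bm_cst _ Omega R (e / 2)) (bmZ 2 bARM)) Ex_cst (ExZ P 2 bARM) (ExD P bAR (bM N)) (ExD P (bA N) (bR N)).
have := h1 N n1; have := h2 N n2; have := h3 N n3 => /=.
rewrite !sub0r !normrN -/(badM N) => u3 /(le_trans (ler_norm _)) u2 /(le_trans (ler_norm _)) u1.
by move: e0; lra.
Qed.

End FractionLimit.

(** * Measurability of the queue lengths *)

Section WorkDynamics.
Variable R : realType.

(* Only the remaining work of the head job matters: the ages drop out of the dynamics. *)
Definition remaining (s : seq R * R) : seq R := if s.1 is h :: q then (h - s.2) :: q else [::].

Fixpoint serve (dt : R) (q : seq R) : seq R :=
  if q is h :: q' then if dt < h then (h - dt) :: q' else serve (dt - h) q' else [::].

Lemma size_remaining s : size (remaining s) = size s.1.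
Proof. by case: s => -[|h q] e. Qed.

Lemma remaining0 (q : seq R) : remaining (q, 0) = q.
Proof. by case: q => //= h q; rewrite /remaining /= subr0. Qed.

Lemma remaining_adv dt q e : remaining (adv dt q e) = serve dt (remaining (q, e)).
Proof.
elim: q dt e => [|h q IH] dt e //=; case: ifP => _.
  by rewrite /remaining /= opprD addrA.
by rewrite IH remaining0.
Qed.

Lemma adv_nil (dt : R) (q : seq R) (e : R) : (adv dt q e).1 = [::] -> (adv dt q e).2 = 0.
Proof. by elim: q dt e => [|h q IH] dt e //=; case: ifP => // _; exact: IH. Qed.

Definition last_time (tau : nat -> R) n : R := if n is n'.+1 then tau n' else 0.

Section Run.
Variables (s0 : nat -> seq R) (tau v : nat -> R) (c1 c2 : nat -> nat) (b : nat -> bool).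

Fixpoint run n : nat -> seq R :=
  if n is n'.+1 then
    let s i := serve (tau n' - last_time tau n') (run n' i) in
    fun i => if i == pick2 (fun i => size (s i)) (c1 n') (c2 n') (b n')
      then rcons (s i) (v n') else s i
  else s0.

Definition run_length n (t : R) i : nat := size (serve (t - last_time tau n) (run n i)).

End Run.

(** The dynamics uses server labels only through equality and queue lengths, hence commutes with
    injective relabellings. With the identity it identifies the coordinate system with the network;
    with a permutation it serves exchangeability. *)
Lemma run_natural (N : nat) (sg : nat -> nat) s0 s0' tau tau' v v' c1 c1' c2 c2' b b' n :
  (forall i j, (i < N)%N -> (j < N)%N -> sg i = sg j -> i = j) ->
  (forall i, (i < N)%N -> s0' i = s0 (sg i)) ->
  (forall j, (j < n)%N -> tau' j = tau j) -> (forall j, v' j = v j) ->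
  (forall j, (c1' j < N)%N /\ sg (c1' j) = c1 j) ->
  (forall j, (c2' j < N)%N /\ sg (c2' j) = c2 j) -> (forall j, b' j = b j) ->
  forall i, (i < N)%N -> run s0' tau' v' c1' c2' b' n i = run s0 tau v c1 c2 b n (sg i).
Proof.
move=> inj h0 + hv h1 h2 hb; elim: n => [|n IH] ht i iN; first exact: h0.
have {}IH := IH (fun j jn => ht j (ltnW jn)).
have hl : last_time tau' n = last_time tau n by case: (n) ht => //= k ht; rewrite ht.
rewrite /= ht // hl hv hb.
have [k1 e1] := h1 n; have [k2 e2] := h2 n.
pose s' i := serve (tau n - last_time tau n) (run s0' tau' v' c1' c2' b' n i).
pose s i := serve (tau n - last_time tau n) (run s0 tau v c1 c2 b n i).
rewrite -/(s' i) -/(s (sg i)).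
have hs j : (j < N)%N -> s' j = s (sg j) by move=> jN; rewrite /s' /s IH.
have [pN pE] : (pick2 (fun i => size (s' i)) (c1' n) (c2' n) (b n) < N)%N /\
    sg (pick2 (fun i => size (s' i)) (c1' n) (c2' n) (b n)) =
    pick2 (fun i => size (s i)) (c1 n) (c2 n) (b n).
  by rewrite /pick2 !hs // e1 e2; do 3?case: ifP => _.
rewrite -pE hs //.
case: eqP => [->|ne]; first by rewrite eqxx.
by case: eqP => // /inj e; case: ne; exact: e.
Qed.

Lemma qlen_run x0 a0 res W Ec v c1 c2 b i (t : R) :
  qlen (init_state x0 a0 res W) Ec v c1 c2 b i t =
  run_length (fun i => if x0 i is 0%N then [::] else res i :: mkseq (W i) (x0 i).-1)
    (arr_time Ec) v c1 c2 b (Ec t) t i.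
Proof.
set s0 := init_state _ _ _ _; set r0 := fun i => _.
have key n : (forall i, remaining ((after s0 Ec v c1 c2 b n).1 i) = run r0 (arr_time Ec) v c1 c2 b n i)
    /\ (after s0 Ec v c1 c2 b n).2 = last_time (arr_time Ec) n.
  elim: n => [|n [IH1 IH2]].
    split=> // j; rewrite /= /s0 /init_state /r0; case: (x0 j) => //= k.
    by rewrite /remaining /= addrAC subrr add0r.
  rewrite /=; move: IH1 IH2; case: (after _ _ _ _ _ _ n) => s tl /= IH1 IH2; split=> // j.
  have sE k : size (adv_all (arr_time Ec n - tl) s k).1 =
      size (serve (arr_time Ec n - last_time (arr_time Ec) n) (run r0 (arr_time Ec) v c1 c2 b n k)).
    by rewrite -size_remaining /adv_all remaining_adv -IH1 IH2; case: (s k).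
  have rE : remaining (adv_all (arr_time Ec n - tl) s j) =
      serve (arr_time Ec n - last_time (arr_time Ec) n) (run r0 (arr_time Ec) v c1 c2 b n j).
    by rewrite /adv_all remaining_adv -IH1 IH2; case: (s j).
  rewrite /add_job /sq2_pick /pick2 !sE; case: ifP => _ //; rewrite -rE.
  have := @adv_nil (arr_time Ec n - tl) (s j).1 (s j).2; rewrite -/(adv_all _ s j).
  case: (adv_all _ s j) => -[|h q] e //= he.
  by rewrite /remaining /= he // subr0.
rewrite /qlen /state_at /run_length; have [k1 k2] := key (Ec t).
move: k1 k2; case: (after _ _ _ _ _ _ _) => s tl /= k1 k2.
by rewrite -size_remaining /adv_all remaining_adv -k1 k2; case: (s i).
Qed.

End WorkDynamics.

Section SeqMeasurable.
Context (R : realType) d (T : measurableType d).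

(** Instead of a sigma-algebra on lists, measurability is required of the length and of every entry,
    beyond the end with default 0. *)
Definition mseq (f : T -> seq R) : Prop :=
  measurable_fun setT (fun x => size (f x)) /\
  forall k, measurable_fun setT (fun x => nth 0 (f x) k).

Lemma mseq_if (c : T -> bool) f h : measurable_fun setT c -> mseq f -> mseq h ->
  mseq (fun x => if c x then f x else h x).
Proof.
move=> mc [f1 f2] [h1 h2]; split=> [|k].
  have -> : (fun x => size (if c x then f x else h x)) = fun x => if c x then size (f x) else size (h x).
    by apply/funext => x; case: (c x).
  exact: measurable_fun_ifT.
have -> : (fun x => nth 0 (if c x then f x else h x) k) = fun x => if c x then nth 0 (f x) k else nth 0 (h x) k.
  by apply/funext => x; case: (c x).
exact: measurable_fun_ifT.
Qed.

Lemma mseq_nil : mseq (fun=> [::]).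
Proof. by split=> [|k]; exact: measurable_cst. Qed.

Lemma mseq_cons (a : T -> R) f : measurable_fun setT a -> mseq f -> mseq (fun x => a x :: f x).
Proof.
move=> ma [f1 f2]; split=> [|[|k]] //=.
by apply: (measurableT_comp (f := succn)).
Qed.

Lemma mseq_rcons (a : T -> R) f : measurable_fun setT a -> mseq f -> mseq (fun x => rcons (f x) (a x)).
Proof.
move=> ma [f1 f2]; split=> [|k].
  under eq_fun do rewrite size_rcons.
  by apply: (measurableT_comp (f := succn)).
under eq_fun do rewrite nth_rcons.
apply: measurable_fun_ifT => //; first by apply: measurable_fun_ltn => //; exact: measurable_cst.
by apply: measurable_fun_ifT => //; apply: measurable_fun_eqn => //; exact: measurable_cst.
Qed.

Lemma mseq_mkseq (h : nat -> T -> R) n : (forall k, measurable_fun setT (h k)) ->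
  mseq (fun x => mkseq (h ^~ x) n).
Proof.
move=> mh; elim: n h mh => [|n IH] h mh; first exact: mseq_nil.
have -> : (fun x => mkseq (h ^~ x) n.+1) = fun x => h 0%N x :: mkseq (fun k => h k.+1 x) n.
  by apply/funext => x; rewrite /mkseq /= -[1%N]/(1 + 0)%N iotaDl -map_comp.
by apply: mseq_cons => //; exact: (IH (fun k => h k.+1)).
Qed.

(** It suffices to treat each fixed length, where the list is given by finitely many measurable
    reals. *)
Lemma mseq_resize (f : T -> seq R) (F : seq R -> T -> seq R) : mseq f ->
  (forall n, mseq (fun x => F (mkseq (nth 0 (f x)) n) x)) -> mseq (fun x => F (f x) x).
Proof.
move=> [f1 _] h; have e x : f x = mkseq (nth 0 (f x)) (size (f x)) by rewrite mkseq_nth.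
split=> [|k].
  rewrite (_ : (fun x => _) = fun x => size (F (mkseq (nth 0 (f x)) (size (f x))) x)); last first.
    by apply/funext => x; rewrite -e.
  by apply: (mf_index (f := fun n x => size (F (mkseq (nth 0 (f x)) n) x))) => // n; case: (h n).
rewrite (_ : (fun x => _) = fun x => nth 0 (F (mkseq (nth 0 (f x)) (size (f x))) x) k); last first.
  by apply/funext => x; rewrite -e.
by apply: (mf_index (f := fun n x => nth 0 (F (mkseq (nth 0 (f x)) n) x) k)) => // n; case: (h n).
Qed.

Lemma mseq_serve_mkseq (h : nat -> T -> R) n dt : measurable_fun setT dt ->
  (forall k, measurable_fun setT (h k)) -> mseq (fun x => serve (dt x) (mkseq (h ^~ x) n)).
Proof.
elim: n dt h => [|n IH] dt h mdt mh; first exact: mseq_nil.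
have -> : (fun x => serve (dt x) (mkseq (h ^~ x) n.+1)) = fun x => if dt x < h 0%N x
    then (h 0%N x - dt x) :: mkseq (fun k => h k.+1 x) n
    else serve (dt x - h 0%N x) (mkseq (fun k => h k.+1 x) n).
  by apply/funext => x; rewrite /mkseq /= -[1%N]/(1 + 0)%N iotaDl -map_comp.
apply: mseq_if; first exact: measurable_fun_ltr.
  apply: mseq_cons; first exact: measurable_funB.
  exact: (mseq_mkseq n (h := fun k => h k.+1)).
by apply: (IH _ (fun k => h k.+1)) => //; exact: measurable_funB.
Qed.

Lemma mseq_serve (dt : T -> R) f : measurable_fun setT dt -> mseq f ->
  mseq (fun x => serve (dt x) (f x)).
Proof.
move=> mdt mf; apply: (mseq_resize (F := fun q x => serve (dt x) q)) => // n.
by apply: (@mseq_serve_mkseq (fun k x => nth 0 (f x) k)) => //; case: mf.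
Qed.

Variables (s0 : T -> nat -> seq R) (tau v : nat -> T -> R) (c1 c2 : nat -> T -> nat)
  (b : nat -> T -> bool).
Hypotheses (ms0 : forall i, mseq (s0 ^~ i)) (mtau : forall j, measurable_fun setT (tau j))
  (mv : forall j, measurable_fun setT (v j)) (mc1 : forall j, measurable_fun setT (c1 j))
  (mc2 : forall j, measurable_fun setT (c2 j)) (mb : forall j, measurable_fun setT (b j)).

Let rn n x := run (s0 x) (tau ^~ x) (v ^~ x) (c1 ^~ x) (c2 ^~ x) (b ^~ x) n.

Let mlast n : measurable_fun setT (fun x => last_time (tau ^~ x) n).
Proof. by case: n => [|n] /=; [exact: measurable_cst|exact: mtau]. Qed.

Lemma mseq_run n i : mseq (fun x => rn n x i).
Proof.
elim: n i => [|n IH] i; first exact: ms0.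
pose s j x := serve (tau n x - last_time (tau ^~ x) n) (rn n x j).
have ms j : mseq (s j) by apply: mseq_serve => //; exact: measurable_funB.
have msize c : measurable_fun setT c -> measurable_fun setT (fun x => size (s (c x) x)).
  by move=> mc; apply: (mf_index (f := fun j x => size (s j x))) => // j; case: (ms j).
rewrite /rn /=; apply: (mseq_if (c := fun x => i == pick2 (fun j => size (s j x)) (c1 n x) (c2 n x) (b n x))).
- apply: measurable_fun_eqn; first exact: measurable_cst.
  rewrite /pick2; apply: measurable_fun_ifT => //; first by apply: measurable_fun_ltn; exact: msize.
  apply: measurable_fun_ifT => //; first by apply: measurable_fun_ltn; exact: msize.
  exact: measurable_fun_ifT.
- exact: (mseq_rcons (mv n) (ms i)).
- exact: ms.
Qed.

Lemma mf_run_length (n : T -> nat) (t : R) i : measurable_fun setT n ->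
  measurable_fun setT (fun x => run_length (s0 x) (tau ^~ x) (v ^~ x) (c1 ^~ x) (c2 ^~ x) (b ^~ x) (n x) t i).
Proof.
move=> mn; apply: (mf_index (f := fun k x => size (serve (t - last_time (tau ^~ x) k) (rn k x i)))) => // k.
have [] // : mseq (fun x => serve (t - last_time (tau ^~ x) k) (rn k x i)).
by apply: mseq_serve; [exact: measurable_funB|exact: mseq_run].
Qed.

End SeqMeasurable.

Section QueueDynamics.
Variable R : realType.

Lemma queue_qlen N t (y : coord -> R) (sg : nat -> nat) x0 a0 res W Ec v c1 c2 b i :
  (i < N)%N -> 0 <= t ->
  (forall j, 0 <= y (cT j)) -> (forall i j, (i <= j)%N -> y (cT i) <= y (cT j)) ->
  Ec t = arrivals y ->
  (forall j, (j < Ec t)%N -> y (cT j) = arr_time Ec j /\ y (cT j) <= t) ->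
  (forall i j, (i < N)%N -> (j < N)%N -> sg i = sg j -> i = j) ->
  (forall i, (i < N)%N -> Num.truncn (y (cX i)) = x0 (sg i)) ->
  (forall i, (i < N)%N -> (0 < x0 (sg i))%N -> pos (y (cR i)) = res (sg i)) ->
  (forall i k, (i < N)%N -> pos (y (cW i k)) = W (sg i) k) ->
  (forall j, pos (y (cV j)) = v j) ->
  (forall j, sg (clip N (Num.truncn (y (cC1 j)))) = c1 j) ->
  (forall j, sg (clip N (Num.truncn (y (cC2 j)))) = c2 j) ->
  (forall j, (0 < y (cB j)) = b j) ->
  queue N i t y = qlen (init_state x0 a0 res W) Ec v c1 c2 b (sg i) t.
Proof.
move=> iN t0 y0 ym En ht inj hX hR hW hV h1 h2 hB.
have N0 : (0 < N)%N by apply: leq_ltn_trans iN.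
rewrite /queue -En /outer_of /inner_of.
rewrite -(qlen_Q a0 (wf_outer_at (xs N y) N0 y0 ym) (@wf_inner_at R N (outer_at N (xs N y) y) (xs N y) y N0 erefl) iN t0 ht).
rewrite !qlen_run /run_length; congr (size (serve _ _)).
apply: (run_natural (N := N)) => // [j jN|j|j].
- by rewrite nth_mkseq // hX //; case x0j : (x0 (sg j)) => [|n] //=;
    rewrite hR ?x0j //; congr (_ :: _); apply: eq_map => k; rewrite hW.
- by split; [exact: clip_lt|exact: h1].
- by split; [exact: clip_lt|exact: h2].
Qed.

Lemma run_length_tau (s0 : nat -> seq R) tau tau' v c1 c2 b n t i :
  (forall j, (j < n)%N -> tau' j = tau j) ->
  run_length s0 tau' v c1 c2 b n t i = run_length s0 tau v c1 c2 b n t i.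
Proof.
move=> ht.
have hl m : (m <= n)%N -> last_time tau' m = last_time tau m by case: m => //= m mn; exact: ht.
have hr m : (m <= n)%N -> run s0 tau' v c1 c2 b m = run s0 tau v c1 c2 b m.
  elim: m => //= m IH mn; apply/funext => k; have mn' := ltnW mn.
  by rewrite (ht m mn) (hl m mn') (IH mn').
by rewrite /run_length hl // hr.
Qed.

End QueueDynamics.

Section Observed.
Context (R : realType) (d : measure_display) (Omega : measurableType d)
  (P : probability Omega R).
Variables (G lam : R -> R) (aN : nat -> R)
  (X0 : nat -> nat -> Omega -> nat) (A0 Res : nat -> nat -> Omega -> R)
  (W : nat -> nat -> nat -> Omega -> R) (E : nat -> R -> Omega -> nat)
  (V : nat -> nat -> Omega -> R) (C1 C2 : nat -> nat -> Omega -> nat)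
  (Bt : nat -> nat -> Omega -> bool) (N : nat) (T : R).
Hypotheses (net : sq2_network P X0 A0 Res W E V C1 C2 Bt G lam aN N) (T0 : 0 <= T).
Let Y w : MI coord R := input X0 Res W E V C1 C2 Bt N T w.
Let XqT i w := Xq X0 A0 Res W E V C1 C2 Bt N i T w.

Lemma input_arr_time w j : (j < E N T w)%N ->
  Y w (cT j) = arr_time (E N ^~ w) j /\ Y w (cT j) <= T.
Proof.
by move=> jE; rewrite /= jE; split=> //; exact: arr_time_le.
Qed.

Section Relabelled.
Variables (sg ro : nat -> nat -> nat).
Hypotheses (sgK : cancel (sg N) (ro N)) (roK : cancel (ro N) (sg N)) (sgN : forall i, (sg N i < N)%N = (i < N)%N).

(** Server [i] of the relabelled network is server [sg N i] of the original one, so sampled labels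
    have to be transformed by the inverse [ro]. *)
Lemma Xq_relabel w i : (i < N)%N -> proper X0 Res W V C1 C2 N w ->
  queue N i T (input (fun M i => X0 M (sg M i)) (fun M i => Res M (sg M i)) (fun M i => W M (sg M i))
    E V (fun M j w => ro M (C1 M j w)) (fun M j w => ro M (C2 M j w)) Bt N T w) = XqT (sg N i) w.
Proof.
move=> iN pw; have N0 : (0 < N)%N by apply: leq_ltn_trans iN.
have roN j : (ro N j < N)%N = (j < N)%N by rewrite -sgN roK.
rewrite /XqT /Xq; apply: (queue_qlen (sg := sg N)) => //.
- by move=> j; exact: input_tau_ge0.
- by move=> j k /=; exact: (input_tau_mono net T0 w).
- by rewrite /arrivals /= natrK.
- by move=> j; exact: input_arr_time.
- by move=> j k _ _ /(can_inj sgK).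
- by move=> j jN /=; rewrite jN natrK.
- move=> j jN x0 /=; rewrite jN x0 /pos; have [h _ _ _ _] := pw (sg N j) 0%N.
  by rewrite h // sgN.
- by move=> j k jN; rewrite /pos; have [_ /= -> _ _ _] := pw (sg N j) k.
- by move=> j; rewrite /pos; have [_ _ /= -> _ _] := pw j 0%N.
- move=> j /=; have [_ _ _ h _] := pw j j.
  by rewrite natrK /clip roN h roK.
- move=> j /=; have [_ _ _ _ h] := pw j j.
  by rewrite natrK /clip roN h roK.
- by move=> j /=; rewrite ltr0n; case: (Bt N j w).
Qed.

End Relabelled.

Lemma Xq_queue w i : (i < N)%N -> proper X0 Res W V C1 C2 N w ->
  XqT i w = queue N i T (Y w).
Proof. by move=> iN pw; rewrite -(Xq_relabel (sg := fun=> id) (ro := fun=> id)). Qed.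

Lemma mseq_index (D : measurableType d) (f : nat -> D -> seq R) (c : D -> nat) :
  (forall n, mseq (f n)) -> measurable_fun setT c -> mseq (fun x => f (c x) x).
Proof.
move=> mf mc; split=> [|k].
  by apply: (mf_index (f := fun n x => size (f n x))) => // n; case: (mf n).
by apply: (mf_index (f := fun n x => nth 0 (f n x) k)) => // n; case: (mf n).
Qed.

(** Almost sure equality with a measurable function would not suffice, since [P] need not be
    complete; the formula used here holds at every sample point. The arrival times are replaced by
    the coordinates [cT j], which are measurable and agree with them up to the horizon. *)
Lemma mf_Xq i : measurable_fun setT (XqT i).
Proof.
have [[mX [_ [mR [mW [mE [mV [mC mB]]]]]]] _] := net.
have mY := measurable_input net T0.
pose s0 w i : seq R := if X0 N i w is 0%N then [::] else Res N i w :: mkseq (fun k => W N i k w) (X0 N i w).-1.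
have -> : XqT i = fun w => run_length (s0 w) (fun j => Y w (cT j)) (V N ^~ w) (C1 N ^~ w) (C2 N ^~ w)
    (Bt N ^~ w) (E N T w) T i.
  apply/funext => w; rewrite /XqT /Xq qlen_run; symmetry; apply: run_length_tau => j jE.
  by have [] := input_arr_time jE.
apply: (mf_run_length (s0 := s0) (tau := fun j w => Y w (cT j)) (v := V N) (c1 := C1 N) (c2 := C2 N) (b := Bt N)).
- move=> j; pose f n w : seq R := if n is 0%N then [::] else Res N j w :: mkseq (fun k => W N j k w) n.-1.
  apply: (mseq_index (f := f) (c := X0 N j)); last exact: mf_natP.
  case=> [|n]; first exact: mseq_nil.
  by apply: mseq_cons => //; exact: (mseq_mkseq (h := fun k => W N j k)).
- by move=> j; exact: mf_coord mY _.
- by [].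
- by move=> j; apply: mf_natP => m; case: (mC j m).
- by move=> j; apply: mf_natP => m; case: (mC j m).
- by move=> j; exact: measurable_bool.
- exact: mf_natP.
Qed.

End Observed.

(** * Exchangeability of the servers *)

Section RelabelledNetwork.
Context (R : realType) (d : measure_display) (Omega : measurableType d)
  (P : probability Omega R).
Variables (G lam : R -> R) (aN : nat -> R)
  (X0 : nat -> nat -> Omega -> nat) (A0 Res : nat -> nat -> Omega -> R)
  (W : nat -> nat -> nat -> Omega -> R) (E : nat -> R -> Omega -> nat)
  (V : nat -> nat -> Omega -> R) (C1 C2 : nat -> nat -> Omega -> nat)
  (Bt : nat -> nat -> Omega -> bool) (N : nat).
Hypothesis net : sq2_network P X0 A0 Res W E V C1 C2 Bt G lam aN N.
Variables (sg ro : nat -> nat -> nat).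
Hypotheses (sgK : cancel (sg N) (ro N)) (roK : cancel (ro N) (sg N))
  (sgN : forall i, (sg N i < N)%N = (i < N)%N).
Let X0' M i := X0 M (sg M i).
Let A0' M i := A0 M (sg M i).
Let Res' M i := Res M (sg M i).
Let W' M i := W M (sg M i).
Let C1' M j w := ro M (C1 M j w).
Let C2' M j w := ro M (C2 M j w).

Let roN i : (ro N i < N)%N = (i < N)%N. Proof. by rewrite -sgN roK. Qed.

Lemma prod_relabel (p : pred nat) (F : nat -> R) :
  \prod_(i < N | p (sg N i)) F (sg N i) = \prod_(i < N | p i) F i.
Proof.
have h (i : 'I_N) : (sg N i < N)%N by rewrite sgN.
rewrite [RHS](reindex_inj (h := fun i => Ordinal (h i))) // => i j [] /(can_inj sgK) e.
exact: val_inj.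
Qed.

Lemma init_cyl_relabel S B J r : init_cyl X0' A0' Res' N S B J r =
  init_cyl X0 A0 Res N (S \o ro N) (B \o ro N) (J \o ro N) (r \o ro N).
Proof.
apply/seteqP; split=> w h i iN; last by have := h (sg N i); rewrite /= sgN sgK; exact.
by have := h (ro N i); rewrite /X0' /A0' /Res' roN roK; exact.
Qed.

Definition relabel_prim p : prim := if p is PW i k then PW (sg N i) k else p.

Lemma relabel_prim_inj : injective relabel_prim.
Proof.
by case=> [||i k|j|j|j|j] [||i' k'|j'|j'|j'|j'] //= [] // /(can_inj sgK) -> ->.
Qed.

Lemma relabel_prim_events p A : prim_events X0' A0' Res' W' E V C1' C2' Bt N p A ->
  prim_events X0 A0 Res W E V C1 C2 Bt N (relabel_prim p) A.
Proof.
case: p => //= [|j|j].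
- move=> [S [B [J [r [mB ->]]]]]; rewrite init_cyl_relabel.
  by exists (S \o ro N), (B \o ro N), (J \o ro N), (r \o ro N); split=> // i; exact: mB.
- by move=> [S ->]; exists (ro N @^-1` S).
- by move=> [S ->]; exists (ro N @^-1` S).
Qed.

(** A permutation preserves uniform samples and carries cylinders of the initial data to cylinders,
    so the relabelled primitives satisfy the same assumptions. *)
Lemma relabelled_network : sq2_network P X0' A0' Res' W' E V C1' C2' Bt G lam aN N.
Proof.
have [[mX [mA [mR [mW [mE [mV [mC mB]]]]]]] [cp [ind [pl [[lW lV lC lB] [rl ex]]]]]] := net.
have roE (c : Omega -> nat) i : [set w | ro N (c w) = i] = [set w | c w = sg N i].
  by apply/seteqP; split=> w /= => [<-|->]; rewrite ?roK ?sgK.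
have {}mC : forall j m, measurable [set w | C1' N j w = m] /\ measurable [set w | C2' N j w = m].
  by move=> j m; rewrite !roE; exact: mC.
split.
  exact: (conj (fun i m => mX _ m) (conj (fun i => mA _) (conj (fun i => mR _)
    (conj (fun i k => mW _ k) (conj mE (conj mV (conj mC mB))))))).
split; first exact: cp.
split; [|split; [exact: pl|split; [split|split]]] => //.
- move=> n idx A hi hA; apply: (ind n (relabel_prim \o idx)).
    by move=> k k' kn k'n /relabel_prim_inj; exact: hi.
  by move=> k kn; apply: relabel_prim_events; exact: hA.
- by move=> i k x; exact: lW.
- by move=> j i iN; rewrite !roE; apply: lC; rewrite sgN.
- move=> S B J r mBo r0; rewrite !init_cyl_relabel rl; last 2 first.
  + by move=> i; exact: mBo.
  + by move=> i; exact: r0.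
  apply: eq_integral => w _; congr (_ * _)%:E.
  rewrite -(prod_relabel (fun i => J (ro N i) && (0 < X0 N i w)%N)
    (fun i => (1 - G (A0 N i w + r (ro N i))) / (1 - G (A0 N i w)))).
  by apply: eq_big => [i|i _]; rewrite sgK.
- move=> s sN si S B mBo.
  rewrite (ex (sg N \o s)) //; [|by move=> i iN; rewrite /= sgN sN|].
    symmetry; apply: (ex (sg N)) => // [i|i j _ _ /(can_inj sgK)] //.
    by rewrite sgN.
  by move=> i j iN jN /(can_inj sgK); exact: si.
Qed.

End RelabelledNetwork.

Section InitialLaw.
Context (R : realType) (d : measure_display) (Omega : measurableType d)
  (P : probability Omega R).
Variables (G g lam : R -> R) (H : R) (aN : nat -> R).
Hypothesis sa : service_assumption G g H.

Definition start_weight (S : nat -> nat -> bool) (J : nat -> bool) (r : nat -> R)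
    (i n : nat) (a : R) : R :=
  (S i n)%:R * (if J i && (0 < n)%N then (1 - G (a + r i)) / (1 - G a) else 1).

Let Gp a : 0 < 1 - G a. Proof. by rewrite subr_gt0 (cdf_lt1 sa). Qed.

Lemma bm_start_weight d' (D : measurableType d') S J r i (c : D -> nat) (a : D -> R) :
  (forall i, 0 <= r i) -> measurable_fun setT c -> measurable_fun setT a ->
  bm (fun x => start_weight S J r i (c x) (a x)).
Proof.
move=> r0 mc ma; apply: bmM; first by apply: bm_bool; exact: (measurableT_comp (f := S i)).
have mi : measurable_fun setT (fun a : R => (1 - G a)^-1).
  apply: nondecreasing_measurable => // u v uv.
  by rewrite lef_pV2 ?posrE ?Gp // lerB // (cdf_mono sa).
apply: (bm_le (M := 1)).
  apply: measurable_fun_ifT => //.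
    apply: measurable_and; first exact: measurable_cst.
    by apply: measurable_fun_ltn => //; exact: measurable_cst.
  apply: measurable_funM; last exact: measurableT_comp mi ma.
  apply: measurable_funB => //; apply: measurableT_comp (measurable_cdf sa) _.
  exact: measurable_funD.
move=> x; case: ifP => _; last by rewrite normr1.
rewrite ger0_norm ?divr_ge0 ?(ltW (Gp _)) // ler_pdivrMr // mul1r lerB //.
by rewrite (cdf_mono sa) // lerDl.
Qed.

Section Residual.
Variables (X0 : nat -> nat -> Omega -> nat) (A0 Res : nat -> nat -> Omega -> R)
  (W : nat -> nat -> nat -> Omega -> R) (E : nat -> R -> Omega -> nat)
  (V : nat -> nat -> Omega -> R) (C1 C2 : nat -> nat -> Omega -> nat)
  (Bt : nat -> nat -> Omega -> bool).
Hypothesis net : forall N, sq2_network P X0 A0 Res W E V C1 C2 Bt G lam aN N.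
Variables (N : nat) (S : nat -> nat -> bool) (J : nat -> bool) (r : nat -> R).
Hypothesis N0 : (0 < N)%N.

Definition start_age i w : R := if (0 < X0 N i w)%N then A0 N i w else 0.

Definition start_cond i w : bool :=
  S i (X0 N i w) && (J i ==> (0 < X0 N i w)%N ==> (r i < Res N i w)).

Lemma mf_start_cond i : measurable_fun setT (start_cond i).
Proof.
have [[mX [_ [mR _]]] _] := net N.
have mX0 : measurable_fun setT (X0 N i) by exact: mf_natP.
apply: measurable_and; first by apply: (measurableT_comp (f := S i)).
case: (J i) => //=; have -> : (fun w => (0 < X0 N i w)%N ==> (r i < Res N i w)) =
   (fun w => if (0 < X0 N i w)%N then r i < Res N i w else true).
  by apply/funext => w; case: (0 < _)%N.
apply: measurable_fun_ifT => //; first by apply: measurable_fun_ltn => //; exact: measurable_cst.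
by apply: measurable_fun_ltr => //; exact: measurable_cst.
Qed.

Lemma mf_start_age i : measurable_fun setT (start_age i).
Proof.
have [[mX [mA _]] _] := net N; apply: measurable_fun_ifT => //.
by apply: measurable_fun_ltn => //; exact: mf_natP.
Qed.

End Residual.

Variables (X0 : nat -> nat -> Omega -> nat) (A0 Res : nat -> nat -> Omega -> R)
  (W : nat -> nat -> nat -> Omega -> R) (E : nat -> R -> Omega -> nat)
  (V : nat -> nat -> Omega -> R) (C1 C2 : nat -> nat -> Omega -> nat)
  (Bt : nat -> nat -> Omega -> bool).
Hypothesis net : forall N, sq2_network P X0 A0 Res W E V C1 C2 Bt G lam aN N.
Variables (N : nat) (S : nat -> nat -> bool) (J : nat -> bool).
Hypothesis N0 : (0 < N)%N.

(** The residual law concerns nonnegative thresholds; passing to the positive part of [r] changes a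
    null event only, residual services being positive. What remains depends on lengths and ages, to
    which exchangeability applies. *)
Lemma start_law (r : nat -> R) :
  Ex P (fun w => \prod_(i < N) (start_cond X0 Res N S J r i w)%:R) =
  Ex P (fun w => \prod_(i < N) start_weight S J (fun i => Num.max (r i) 0) i
    (X0 N i w) (start_age X0 A0 N i w)).
Proof.
have bc r' : bm (fun w => \prod_(i < N) (start_cond X0 Res N S J r' i w)%:R : R).
  by apply: bm_prod => i _; apply: bm_bool; exact: (mf_start_cond net).
set r' := fun i => Num.max (r i) 0.
have r'0 i : 0 <= r' i by rewrite /r' le_max lexx orbT.
transitivity (Ex P (fun w => \prod_(i < N) (start_cond X0 Res N S J r' i w)%:R)).
  apply: eq_Ex_ae => //; apply: filterS (ae_proper sa net N0) => w pw.
  apply: eq_bigr => i _; congr ((_ && (_ ==> _))%:R); rewrite /r' gt_max.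
  by case: posnP => //= x0; have [h _ _ _ _] := pw i 0%N; rewrite h ?andbT.
rewrite (residual_Ex net N S J r'0); apply: eq_Ex => w; apply: eq_bigr => i _.
by rewrite /start_weight /start_age; case: (0 < _)%N; rewrite ?andbF.
Qed.

(** Exchangeability is given on product events; [law_unique], with lengths and ages as coordinates,
    extends it to expectations. *)
Lemma start_exchange (s : nat -> nat) (r : nat -> R) : (forall i, 0 <= r i) ->
  (forall i, (i < N)%N -> (s i < N)%N) ->
  (forall i j, (i < N)%N -> (j < N)%N -> s i = s j -> i = j) ->
  Ex P (fun w => \prod_(i < N) start_weight S J r i (X0 N (s i) w) (start_age X0 A0 N (s i) w)) =
  Ex P (fun w => \prod_(i < N) start_weight S J r i (X0 N i w) (start_age X0 A0 N i w)).
Proof.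
move=> r0 sN si; have [[mX [mA _]] [_ [_ [_ [_ [_ ex]]]]]] := net N.
pose Y (s : nat -> nat) w : MI (bool * nat)%type R := fun c =>
  if (c.2 < N)%N then (if c.1 then (X0 N (s c.2) w)%:R else start_age X0 A0 N (s c.2) w) else 0.
have mY s' : measurable_fun setT (Y s').
  apply: measurable_MI => -[b i]; rewrite /Y /=; case: (i < N)%N; last exact: measurable_cst.
  by case: b; [apply: mf_natr; exact: mf_natP|exact: (mf_start_age net)].
pose f (y : MI (bool * nat)%type R) : R :=
  \prod_(i < N) start_weight S J r i (Num.truncn (y (true, i : nat))) (y (false, i : nat)).
have bf : bm f.
  apply: bm_prod => i _; apply: bm_start_weight => //; last exact: measurable_coord.
  by apply: mf_trunc; exact: measurable_coord.
have fY s' w : f (Y s' w) = \prod_(i < N) start_weight S J r i (X0 N (s' i) w) (start_age X0 A0 N (s' i) w).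
  by apply: eq_bigr => i _; rewrite /Y /= ltn_ord natrK.
under eq_Ex do rewrite -fY; under [RHS]eq_Ex do rewrite -(fY id).
apply: law_unique => // l u.
pose K : Prop := forall c, c \in l -> (N <= c.2)%N -> u c < 0.
pose A i (n : nat) : Prop := K /\ ((true, i) \in l -> u (true, i) < n%:R).
pose B i : set R := [set x | (false, i) \in l -> u (false, i) < x].
have mB i : measurable (B i).
  rewrite /B; case: ((false, i) \in l); last by rewrite [X in measurable X](_ : _ = setT) //; apply/seteqP; split.
  rewrite [X in measurable X](_ : _ = `]u (false, i), +oo[%classic) //.
  by apply/seteqP; split=> x /=; rewrite in_itv /= andbT; [apply|move=> ? _].
have eY s' : [set w | upper l u (Y s' w)] = [set w | forall i, (i < N)%N -> A i (X0 N (s' i) w) /\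
    B i (if (0 < X0 N (s' i) w)%N then A0 N (s' i) w else 0)].
  apply/seteqP; split=> w /= h.
    move=> i iN; split; first split.
    - by move=> c cl cN; have := h c cl; rewrite /Y ltnNge cN.
    - by move=> cl; have := h _ cl; rewrite /Y /= iN.
    - by move=> cl; have := h _ cl; rewrite /Y /= iN.
  move=> c cl; rewrite /Y; case: ltnP => cN; last by have [[k _] _] := h 0%N N0; exact: k.
  by move: c cl cN => [[] i] /= cl iN; have [[_ h1] h2] := h i iN; [exact: h1|exact: h2].
by rewrite !eY; exact: ex.
Qed.

End InitialLaw.

Section Laws.
Context (R : realType) (d : measure_display) (Omega : measurableType d)
  (P : probability Omega R).

Lemma prob_Ex (b : Omega -> bool) : measurable_fun setT b ->
  P [set w | b w] = (Ex P (fun w => (b w)%:R))%:E.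
Proof.
by move=> mb; rewrite Ex_bool // fineK // fin_num_measure //; exact: bool_measurable.
Qed.

Lemma prob_gt_cdf (f : Omega -> R) (r p : R) : measurable_fun setT f ->
  P [set w | f w <= r] = p%:E -> P [set w | r < f w] = (1 - p)%:E.
Proof.
move=> mf hp; have ml : measurable_fun setT (fun w => f w <= r) by exact: measurable_fun_ler.
have mg : measurable_fun setT (fun w => r < f w) by exact: measurable_fun_ltr.
rewrite prob_Ex //; congr EFin.
have -> : p = Ex P (fun w => (f w <= r)%R%:R) by rewrite Ex_bool // hp.
rewrite -[X in X - _](Ex_cst P) -ExB; [|exact: bm_cst|exact: bm_bool].
by apply: eq_Ex => w; rewrite ltNge; case: (_ <= _); rewrite ?subrr ?subr0.
Qed.

Lemma prob_uniform (N : nat) (c : Omega -> nat) (S : nat -> bool) : (0 < N)%N ->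
  (forall m, measurable [set w | c w = m]) ->
  (forall i, (i < N)%N -> P [set w | c w = i] = (N%:R^-1)%:E) ->
  P [set w | S (c w)] = (N%:R^-1 * \sum_(i < N) (S i)%:R)%:E.
Proof.
move=> N0 mc' hc; have mc : measurable_fun setT c by exact: mf_natP.
have mb (S' : nat -> bool) : measurable_fun setT (fun w => S' (c w)).
  exact: (measurableT_comp (f := S')).
have low (S' : nat -> bool) : Ex P (fun w => (S' (c w) && (c w < N)%N)%:R) =
    N%:R^-1 * \sum_(i < N) (S' i)%:R.
  rewrite mulr_sumr; transitivity (\sum_(i < N) Ex P (fun w => (S' i)%:R * (c w == i :> nat)%:R)).
    rewrite -Ex_sum; last by move=> i _; apply: bmZ; apply: bm_bool; exact: (mb (fun n => n == i)).
    apply: eq_Ex => w; case: (ltnP (c w) N) => cN; rewrite ?andbT ?andbF.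
      rewrite (bigD1 (Ordinal cN)) //= eqxx mulr1 big1 ?addr0 // => i.
      by rewrite -(inj_eq val_inj) /= eq_sym => /negbTE ->; rewrite mulr0.
    by rewrite big1 // => i _; rewrite gtn_eqF ?mulr0 // (leq_trans (ltn_ord i)).
  apply: eq_bigr => i _; rewrite ExZ; last by apply: bm_bool; exact: (mb (fun n => n == i)).
  rewrite Ex_bool; last exact: (mb (fun n => n == i)).
  rewrite mulrC; congr (_ * _).
  have -> : [set w | c w == i :> nat] = [set w | c w = i] by apply/seteqP; split=> w /= /eqP.
  by rewrite hc.
rewrite prob_Ex // -low; congr EFin; apply/eqP; rewrite eq_le; apply/andP; split; last first.
  apply: le_Ex => [||w]; [exact: bm_bool (mb (fun n => S n && (n < N)%N))|exact: bm_bool (mb S)|].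
  by case: (S _); case: (_ < _)%N.
have b1 := bm_bool R (mb (fun n => S n && (n < N)%N)).
have b2 := bm_bool R (mb (fun n => (n < N)%N)).
have -> : Ex P (fun w => (S (c w) && (c w < N)%N)%:R) =
    Ex P (fun w => (S (c w) && (c w < N)%N)%:R + (1 - (c w < N)%N%:R)).
  rewrite (ExD P b1 (bmB (@bm_cst _ Omega R 1) b2)) (ExB P (@bm_cst _ Omega R 1) b2) Ex_cst.
  have := low predT; rewrite /= => ->.
  by rewrite sumr_const card_ord mulVf ?subrr ?addr0 // pnatr_eq0 -lt0n.
apply: le_Ex => [||w]; [exact: bm_bool (mb S)|exact: bmD b1 (bmB (bm_cst _ _) b2)|].
by case: (S _); case: (_ < _)%N; rewrite ?subrr ?subr0 ?addr0 ?add0r ?ler01.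
Qed.

Section InitUpper.
Variables (N : nat) (t : R) (s : seq coord) (r : coord -> R).

(** Collects the bounds on lengths, on the residual 1 of an empty server, and the deterministic ones
    for servers outside the network. *)
Definition upper_start i (n : nat) : bool :=
  [&& all (fun c => match c with cX i | cR i => (N <= i)%N ==> (r c < if c is cX _ then 0 else 1)
      | _ => true end) s,
    (cX i \in s) ==> (r (cX i) < n%:R) & (cR i \in s) ==> (n == 0)%N ==> (r (cR i) < 1)].

Lemma prim_upper_init X0 Res W E V C1 C2 Bt : (0 < N)%N ->
  prim_upper X0 Res W E V C1 C2 Bt N t PInit s r =
  [set w : Omega | [forall i : 'I_N, start_cond X0 Res N upper_start (fun i => cR i \in s)
    (fun i => r (cR i)) i w]].
Proof.
move=> N0; apply/seteqP; split=> w /=.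
  move=> h; apply/forallP => -[i iN]; rewrite /start_cond /=; apply/andP; split; last first.
    by apply/implyP => cs; apply/implyP => x0; have := h _ cs erefl; rewrite /= iN x0.
  apply/and3P; split.
  - apply/allP => -[j|j|j||j k|j|j|j|j] //= cs; apply/implyP => Nj.
      by have := h _ cs erefl; rewrite /= ltnNge Nj.
    by have := h _ cs erefl; rewrite /= ltnNge Nj.
  - by apply/implyP => cs; have := h _ cs erefl; rewrite /= iN.
  - by apply/implyP => cs; apply/implyP => /eqP x0; have := h _ cs erefl; rewrite /= x0 andbF.
move=> /forallP h c cs pc.
have /andP[/and3P[/allP k _ _] _] := h (Ordinal N0).
case: c cs pc (k _ cs) => [i|i|j||j m|j|j|j|j] //= cs _; case: ltnP => iN //= _.
  by have /andP[/and3P[_ + _] _] := h (Ordinal iN); rewrite cs.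
have /andP[/and3P[_ _ +] +] := h (Ordinal iN); rewrite /= cs /=.
by case: (X0 N i w) => [|n] //= _.
Qed.

End InitUpper.

End Laws.

Section Exchange.
Context (R : realType) (d : measure_display) (Omega : measurableType d)
  (P : probability Omega R).
Variables (G g lam : R -> R) (H : R) (aN : nat -> R)
  (X0 : nat -> nat -> Omega -> nat) (A0 Res : nat -> nat -> Omega -> R)
  (W : nat -> nat -> nat -> Omega -> R) (E : nat -> R -> Omega -> nat)
  (V : nat -> nat -> Omega -> R) (C1 C2 : nat -> nat -> Omega -> nat)
  (Bt : nat -> nat -> Omega -> bool).
Hypotheses (sa : service_assumption G g H)
  (net : forall N, sq2_network P X0 A0 Res W E V C1 C2 Bt G lam aN N).
Variables (T : R) (T0 : 0 <= T).

Section Relabelled.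
Variables (sg ro : nat -> nat -> nat).
Hypotheses (sgK : forall N, cancel (sg N) (ro N)) (roK : forall N, cancel (ro N) (sg N))
  (sgN : forall N i, (sg N i < N)%N = (i < N)%N).
Let X0' M i := X0 M (sg M i).
Let A0' M i := A0 M (sg M i).
Let Res' M i := Res M (sg M i).
Let W' M i := W M (sg M i).
Let C1' M j w := ro M (C1 M j w).
Let C2' M j w := ro M (C2 M j w).
Let net' N : sq2_network P X0' A0' Res' W' E V C1' C2' Bt G lam aN N :=
  relabelled_network (net N) (@sgK N) (@roK N) (@sgN N).

(** Comparing the primitives one at a time is enough, since both inputs factor over them by
    [upper_prod]. *)
Lemma prim_upper_relabel N (p : prim) (s : seq coord) (r : coord -> R) : (0 < N)%N ->
  P (prim_upper X0' Res' W' E V C1' C2' Bt N T p s r) =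
  P (prim_upper X0 Res W E V C1 C2 Bt N T p s r).
Proof.
move=> N0.
have [[mX [mA [mR [mW [mE [mV [mC mB]]]]]]] [_ [_ [_ [[lW _ lC _] _]]]]] := net N.
have [[_ [_ [_ [mW' [_ [_ [mC' _]]]]]]] [_ [_ [_ [[lW' _ lC' _] _]]]]] := net' N.
case: p => [||i k|j|j|j|j].
- rewrite !prim_upper_init //.
  pose S := upper_start N s r; pose J i := cR i \in s; pose q i := r (cR i).
  have step x0 a0 re W0 U1 U2 : (forall N, sq2_network P x0 a0 re W0 E V U1 U2 Bt G lam aN N) ->
      P [set w | [forall i : 'I_N, start_cond x0 re N S J q i w]] =
      (Ex P (fun w => \prod_(i < N) start_weight G S J (fun i => Num.max (q i) 0) i
        (x0 N i w) (start_age x0 a0 N i w)))%:E.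
    move=> nt; rewrite -(start_law sa nt S J N0 q) prob_Ex.
      congr EFin; apply: eq_Ex => w.
      case: (boolP [forall i, _]) => [/forallP h|].
        by rewrite big1 // => i _; rewrite h.
      by rewrite negb_forall => /existsP[i ni]; rewrite (bigD1 i) //= (negbTE ni) mul0r.
    apply: measurable_bool; rewrite [X in measurable X](_ : _ =
        \bigcap_(i in [set i | (i < N)%N]) [set w | start_cond x0 re N S J q i w]).
      by apply: bigcap_measurableType => i _; apply: bool_measurable; exact: (mf_start_cond nt).
    apply/seteqP; split=> w /=; first by move=> /forallP h i /= iN; exact: (h (Ordinal iN)).
    by move=> h; apply/forallP => i; exact: (h i (ltn_ord i)).
  rewrite (step X0' A0' Res' W' C1' C2' net') (step _ _ _ _ _ _ net); congr EFin.
  apply: (start_exchange sa net S J N0) => [i|i|i j _ _ /(can_inj (@sgK N))] //.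
    by rewrite le_max lexx orbT.
  by rewrite sgN.
- congr (P _); apply/seteqP; split=> w h c cs pc; move: (h c cs pc);
    by case: c cs pc => [i|i|j||j m|j|j|j|j].
- have mi : measurable [set x | cW i k \in s -> r (cW i k) < x].
    case: (cW i k \in s); last by rewrite [X in measurable X](_ : _ = setT) //; apply/seteqP; split.
    rewrite [X in measurable X](_ : _ = `]r (cW i k), +oo[%classic) //.
    by apply/seteqP; split=> x /=; rewrite in_itv /= andbT; [apply|move=> ? _].
  have WE X Y Z W0 U1 U2 : prim_upper X Y W0 E V U1 U2 Bt N Z (PW i k) s r =
      [set w : Omega | cW i k \in s -> r (cW i k) < W0 N i k w].
    apply/seteqP; split=> w /= h; first by move=> cs; apply: (h _ cs).
    by move=> [?|?|?||? ?|?|?|?|?] cs //= [e1 e2]; subst; apply: h.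
  rewrite !WE; case: (cW i k \in s); last by congr (P _); apply/seteqP; split.
  have tE (f : Omega -> R) : [set w | is_true true -> r (cW i k) < f w] = [set w | r (cW i k) < f w].
    by apply/seteqP; split=> w /= => [|h _]; [apply|].
  by rewrite !tE (prob_gt_cdf (mW' i k) (lW' i k _)) (prob_gt_cdf (mW i k) (lW i k _)).
- congr (P _); apply/seteqP; split=> w h c cs pc; move: (h c cs pc);
    by case: c cs pc => [i|i|j'||j' m|j'|j'|j'|j'].
- have CE X Y Z W0 U1 U2 : prim_upper X Y W0 E V U1 U2 Bt N Z (PC1 j) s r =
      [set w : Omega | (cC1 j \in s) ==> (r (cC1 j) < (U1 N j w)%:R)].
    apply/seteqP; split=> w /= h; first by apply/implyP => cs; apply: (h _ cs).
    by move=> [?|?|?||? ?|?|?|?|?] cs //= [e1]; subst; exact: (implyP h).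
  rewrite !CE (prob_uniform (fun n => (cC1 j \in s) ==> (r (cC1 j) < n%:R)) N0
      (fun m => (mC' j m).1) (fun i iN => (lC' j i iN).1)).
  by rewrite (prob_uniform (fun n => (cC1 j \in s) ==> (r (cC1 j) < n%:R)) N0
      (fun m => (mC j m).1) (fun i iN => (lC j i iN).1)).
- have CE X Y Z W0 U1 U2 : prim_upper X Y W0 E V U1 U2 Bt N Z (PC2 j) s r =
      [set w : Omega | (cC2 j \in s) ==> (r (cC2 j) < (U2 N j w)%:R)].
    apply/seteqP; split=> w /= h; first by apply/implyP => cs; apply: (h _ cs).
    by move=> [?|?|?||? ?|?|?|?|?] cs //= [e1]; subst; exact: (implyP h).
  rewrite !CE (prob_uniform (fun n => (cC2 j \in s) ==> (r (cC2 j) < n%:R)) N0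
      (fun m => (mC' j m).2) (fun i iN => (lC' j i iN).2)).
  by rewrite (prob_uniform (fun n => (cC2 j \in s) ==> (r (cC2 j) < n%:R)) N0
      (fun m => (mC j m).2) (fun i iN => (lC j i iN).2)).
- congr (P _); apply/seteqP; split=> w h c cs pc; move: (h c cs pc);
    by case: c cs pc => [i|i|j'||j' m|j'|j'|j'|j'].
Qed.

Lemma Ex_relabel N (f : MI coord R -> R) : (0 < N)%N -> bm f ->
  Ex P (fun w => f (input X0' Res' W' E V C1' C2' Bt N T w)) =
  Ex P (fun w => f (input X0 Res W E V C1 C2 Bt N T w)).
Proof.
move=> N0; apply: law_unique; [exact: (measurable_input (net' N) T0)|exact: (measurable_input (net N) T0)|].
move=> s r; have us := undup_uniq (map prim_of s).
have hs c : c \in s -> prim_of c \in undup (map prim_of s) by rewrite mem_undup; exact: map_f.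
rewrite (upper_prod (net' N) N0 T0 r us hs) (upper_prod (net N) N0 T0 r us hs).
by apply: eq_bigr => p _; exact: prim_upper_relabel.
Qed.

End Relabelled.
End Exchange.

(** * From fractions of queues to finitely many given servers *)

Lemma relabelling_exists (N K : nat) (js : nat -> nat) : (K <= N)%N ->
  (forall k, (k < K)%N -> (js k < N)%N) ->
  (forall k k', (k < K)%N -> (k' < K)%N -> js k = js k' -> k = k') ->
  exists sg ro : nat -> nat, [/\ cancel sg ro, cancel ro sg,
    (forall i, (sg i < N)%N = (i < N)%N) & forall k, (k < K)%N -> sg k = js k].
Proof.
elim: K => [|K IH] KN jN ji; first by exists id, id; split.
have [||k k' kK k'K|sg [ro [sgK roK sgN sgE]]] := IH; first exact: ltnW.
- by move=> k kK; apply: jN; exact: ltnW.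
- by apply: ji; exact: ltnW.
(* A transposition puts the next value in place; injectivity of [sg] and [js] leaves the earlier
   values untouched. *)
pose swp x := if x == sg K then js K else if x == js K then sg K else x.
have swpK : involutive swp.
  move=> x; rewrite /swp; case: (eqVneq x (sg K)) => [->|xa].
    by case: (eqVneq (js K) (sg K)) => [->|_]; rewrite ?eqxx.
  case: (eqVneq x (js K)) => [->|xb]; first by rewrite eqxx.
  by rewrite (negbTE xa) (negbTE xb).
exists (swp \o sg), (ro \o swp); split.
- by move=> x; rewrite /= swpK sgK.
- by move=> x; rewrite /= roK swpK.
- move=> i; rewrite -(sgN i) /= /swp.
  have aN : (sg K < N)%N by rewrite sgN.
  have bN := jN K (ltnSn K).
  by case: eqP => [->|_]; [rewrite aN bN|case: eqP => [->|_] //; rewrite aN bN].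
- move=> k; rewrite ltnS leq_eqVlt => /orP[/eqP ->|kK] /=; first by rewrite /swp eqxx.
  rewrite /swp (can_eq sgK) ltn_eqF // sgE //; case: eqP => // /ji e.
  by have := kK; rewrite (e (leqW kK) (ltnSn K)) ltnn.
Qed.

Lemma prod_dist (R : realType) K (a b : 'I_K -> R) : (forall k, `|a k| <= 1) ->
  (forall k, `|b k| <= 1) -> `|\prod_k a k - \prod_k b k| <= \sum_k `|a k - b k|.
Proof.
move=> ha hb; have le1 I (s : seq I) (c : I -> R) : (forall k, `|c k| <= 1) -> `|\prod_(k <- s) c k| <= 1.
  move=> hc; rewrite normr_prod; elim: s => [|x s IH]; first by rewrite big_nil.
  by rewrite big_cons mulr_ile1 // prodr_ge0.
elim: (index_enum _) => [|k s IH]; first by rewrite !big_nil subrr normr0.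
rewrite !big_cons.
set A := \prod_(_ <- s) a _ in IH *; set B := \prod_(_ <- s) b _ in IH *.
have -> : a k * A - b k * B = (a k - b k) * A + b k * (A - B) by ring.
apply: le_trans (ler_normD _ _) _; rewrite !normrM lerD //.
  by rewrite ler_piMr // le1.
by apply: le_trans IH; rewrite ler_piMl.
Qed.

(** The number of injective maps is a product of [K] factors, each at least [N - K]. *)
Lemma injective_fraction (R : realType) (K N : nat) : (K <= N)%N -> (0 < N)%N ->
  ((N ^ K)%:R^-1 * (#|[pred f : {ffun 'I_K -> 'I_N} | ~~ injectiveb f]|)%:R : R) <=
  1 - (1 - K%:R * N%:R^-1) ^+ K.
Proof.
move=> KN N0.
have cE : (#|[pred f : {ffun 'I_K -> 'I_N} | ~~ injectiveb f]| = N ^ K - N ^_ K)%N.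
  have := card_inj_ffuns 'I_K 'I_N; rewrite !card_ord => <-.
  set A := (X in #|pred_of_set X|); have := cardC (mem A); rewrite card_ffun !card_ord => <-.
  by rewrite addKn; apply: eq_card => f; rewrite !inE.
have fl : ((N - K) ^ K <= N ^_ K)%N.
  rewrite ffact_prod -{2}(card_ord K) -prod_nat_const; apply: leq_prod => i _.
  by rewrite leq_sub2l // ltnW.
have fu : (N ^_ K <= N ^ K)%N.
  have -> : (N ^ K = \prod_(i < K) N)%N by rewrite prod_nat_const card_ord.
  rewrite ffact_prod; apply: leq_prod => i _; exact: leq_subr.
have NK : 0 < (N ^ K)%:R :> R by rewrite ltr0n expn_gt0 N0.
rewrite cE natrB // mulrBr mulVf ?gt_eqF // lerD2l lerN2.
have -> : 1 - K%:R * N%:R^-1 = (N - K)%:R * N%:R^-1 :> R.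
  by rewrite natrB // mulrBl divff // pnatr_eq0 -lt0n.
by rewrite exprMn exprVn -!natrX mulrC ler_pM2l ?invr_gt0 // ler_nat.
Qed.

Section ProductLimit.
Context (R : realType) (d : measure_display) (Omega : measurableType d)
  (P : probability Omega R).
Variables (G g lam : R -> R) (H : R) (aN : nat -> R)
  (X0 : nat -> nat -> Omega -> nat) (A0 Res : nat -> nat -> Omega -> R)
  (W : nat -> nat -> nat -> Omega -> R) (E : nat -> R -> Omega -> nat)
  (V : nat -> nat -> Omega -> R) (C1 C2 : nat -> nat -> Omega -> nat)
  (Bt : nat -> nat -> Omega -> bool) (Z0 : nat -> R -> R) (Z : nat -> R -> R -> R).
Hypotheses (sa : service_assumption G g H) (arr : arrival_assumption lam aN)
  (net : forall N, sq2_network P X0 A0 Res W E V C1 C2 Bt G lam aN N)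
  (init : init_assumption_a P X0 A0)
  (Zlim : {ae P, forall w, forall l r, (1 <= l)%N -> 0 <= r ->
      (fun N => Zbar0 X0 A0 G N l r w) @ \oo --> Z0 l r})
  (hs : hydro_sol lam (fun x => 1 - G x) Z0 Z).
Variables (T : R) (T0 : 0 <= T).
Let XqT N i w := Xq X0 A0 Res W E V C1 C2 Bt N i T w.
Let Y N w : MI coord R := input X0 Res W E V C1 C2 Bt N T w.

Lemma bm_Xq N l i : bm (fun w => (l <= XqT N i w)%N%:R : R).
Proof.
apply: bm_bool; apply: measurable_fun_leq; first exact: measurable_cst.
exact: (mf_Xq (net N) T0).
Qed.

Lemma Xq_exchange N K (ls js : nat -> nat) : (K <= N)%N ->
  (forall k, (k < K)%N -> (js k < N)%N) ->
  (forall k k', (k < K)%N -> (k' < K)%N -> js k = js k' -> k = k') ->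
  Ex P (fun w => \prod_(k < K) (ls k <= XqT N (js k) w)%N%:R) =
  Ex P (fun w => \prod_(k < K) (ls k <= XqT N k w)%N%:R).
Proof.
move=> KN jN ji; have [N0|N0] := posnP N.
  by move: KN; rewrite N0 leqn0 => /eqP ->; apply: eq_Ex => w; rewrite !big_ord0.
have [sg [ro [sgK roK sgN sgE]]] := relabelling_exists KN jN ji.
(* The network assumptions concern all sizes, so the relabelling acts at size [N] and is the
   identity elsewhere. *)
pose sgf M := if M == N then sg else id; pose rof M := if M == N then ro else id.
have sgfK M : cancel (sgf M) (rof M) by rewrite /sgf /rof; case: ifP.
have rofK M : cancel (rof M) (sgf M) by rewrite /sgf /rof; case: ifP.
have sgfN M i : (sgf M i < M)%N = (i < M)%N.
  by rewrite /sgf; case: eqP => // ->; rewrite sgN.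
pose f (y : MI coord R) : R := \prod_(k < K) (ls k <= queue N k T y)%N%:R.
have bf : bm f.
  apply: bm_prod => k _; apply: bm_bool; apply: measurable_fun_leq; first exact: measurable_cst.
  exact: mf_queue.
have kN (k : 'I_K) : (k < N)%N by rewrite (leq_trans (ltn_ord k)).
have e2 : Ex P (fun w => f (Y N w)) = Ex P (fun w => \prod_(k < K) (ls k <= XqT N k w)%N%:R).
  apply: eq_Ex_ae; first exact: bm_comp (measurable_input (net N) T0) bf.
    by apply: bm_prod => k _; exact: bm_Xq.
  apply: filterS (ae_proper sa net N0) => w pw; apply: eq_bigr => k _.
  by rewrite /XqT (Xq_queue (net N) T0).
rewrite -e2 -(Ex_relabel sa net T0 sgfK rofK sgfN N0 bf).
have nt := relabelled_network (net N) (@sgfK N) (@rofK N) (@sgfN N).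
apply: eq_Ex_ae; first by apply: bm_prod => k _; exact: bm_Xq.
  exact: bm_comp (measurable_input nt T0) bf.
apply: filterS (ae_proper sa net N0) => w pw; apply: eq_bigr => k _.
rewrite (Xq_relabel (net N) T0 (@sgfK N) (@rofK N) (@sgfN N) (kN k) pw).
by rewrite /sgf eqxx sgE.
Qed.

Let frac N l w : R := N%:R^-1 * \sum_(i < N) (l <= XqT N i w)%N%:R.

Let bfrac N l : bm (frac N l).
Proof. by apply: bmZ; apply: bm_sum => i _; exact: bm_Xq. Qed.

Let frac01 N l w : `|frac N l w| <= 1.
Proof.
have /andP[h1 h2] := @sum_bool_le R N (fun i => (l <= XqT N i w)%N).
rewrite /frac ger0_norm ?mulr_ge0 ?invr_ge0 //; have [->|N0] := posnP N.
  by rewrite invr0 mul0r ler01.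
by rewrite ler_pdivrMl ?ltr0n // mulr1.
Qed.

Lemma frac_cvg l : (0 < l)%N -> (fun N => Ex P (fun w => `|frac N l w - Z l T 0|)) @ \oo --> (0 : R).
Proof.
move=> l0; have h := queue_frac_cvg sa arr net init Zlim hs T0 (lexx 1024) l0.
apply: cvg_trans h; apply: near_eq_cvg; near=> N.
have N0 : (0 < N)%N by near: N; exists 1%N.
have bq : bm (fun w => queue_frac T N l (Y N w)) := bm_comp (measurable_input (net N) T0) (bm_queue_frac T N l).
apply: eq_Ex_ae; [exact: bm_norm (bmB bq (@bm_cst _ _ _ _))|exact: bm_norm (bmB (bfrac N l) (@bm_cst _ _ _ _))|].
apply: filterS (ae_proper sa net N0) => w pw; congr (`| _ * _ - _|); apply: eq_bigr => i _.
by rewrite /XqT (Xq_queue (net N) T0).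
Unshelve. all: by end_near. Qed.

(** A product of [K] averages is the average over all maps from [K] indices to servers. Injective
    maps contribute the value for the first [K] servers by exchangeability; the others differ from
    it by at most 1. *)
Lemma Ex_prod_frac N K (ls : nat -> nat) : (K <= N)%N -> (0 < N)%N ->
  `|Ex P (fun w => \prod_(k < K) frac N (ls k) w) -
    Ex P (fun w => \prod_(k < K) (ls k <= XqT N k w)%N%:R)| <= 1 - (1 - K%:R * N%:R^-1) ^+ K.
Proof.
move=> KN N0; set p := Ex P (fun w => \prod_(k < K) (_ <= XqT N k w)%N%:R).
pose e (f : {ffun 'I_K -> 'I_N}) := Ex P (fun w => \prod_(k < K) (ls k <= XqT N (f k) w)%N%:R).
have be f : bm (fun w => \prod_(k < K) (ls k <= XqT N (f k) w)%N%:R : R).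
  by apply: bm_prod => k _; exact: bm_Xq.
have NK : 0 < (N ^ K)%:R :> R by rewrite ltr0n expn_gt0 N0.
have e01 (f : nat -> nat) : 0 <= Ex P (fun w => \prod_(k < K) (ls k <= XqT N (f k) w)%N%:R) <= 1.
  apply/andP; split; first by apply: Ex_ge0 => w; apply: prodr_ge0.
  apply: Ex_le_cst => [|w]; first by apply: bm_prod => k _; exact: bm_Xq.
  by rewrite prodr_ile1 // => k _; case: (_ <= _)%N; rewrite ?ler01 ?lexx.
have -> : Ex P (fun w => \prod_(k < K) frac N (ls k) w) = (N ^ K)%:R^-1 * \sum_f e f.
  have -> : \sum_f e f = Ex P (fun w => \sum_(f : {ffun 'I_K -> 'I_N})
      \prod_(k < K) (ls k <= XqT N (f k) w)%N%:R).
    by rewrite Ex_sum // => f _; exact: (be (fun k => f k)).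
  rewrite -ExZ; last by apply: bm_sum => f _; exact: (be (fun k => f k)).
  apply: eq_Ex => w; rewrite big_split /= prodr_const card_ord exprVn natrX; congr (_ * _).
  by rewrite bigA_distr_bigA.
have -> : p = (N ^ K)%:R^-1 * \sum_(f : {ffun 'I_K -> 'I_N}) p.
  by rewrite sumr_const card_ffun !card_ord -[p *+ _]mulr_natl mulKf // gt_eqF.
rewrite -mulrBr -sumrB normrM ger0_norm ?invr_ge0 //.
apply: le_trans (injective_fraction R KN N0); rewrite ler_pM2l ?invr_gt0 //.
apply: le_trans (ler_norm_sum _ _ _) _; rewrite -sum1_card natr_sum [leRHS]big_mkcond.
apply: ler_sum => f _; rewrite inE; case: ifPn => [_|].
  (* [f] is extended by 0 to all natural numbers, which index the servers in the general bounds. *)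
  have /andP[h1 h2] := e01 (fun k => oapp (fun k => f k : nat) 0%N (insub k)).
  have /andP[h3 h4] := e01 id.
  have -> : e f = Ex P (fun w => \prod_(k < K) (ls k <= XqT N (oapp (fun k => f k : nat) 0%N (insub (val k))) w)%N%:R).
    by apply: eq_Ex => w; apply: eq_bigr => k _; rewrite valK.
  by rewrite ler_norml; move: h1 h2 h3 h4; rewrite -/p; lra.
rewrite negbK => /injectiveP fi.
have -> : e f = p; last by rewrite subrr normr0.
rewrite /p -(@Xq_exchange N K ls (fun k => oapp (fun k => f k : nat) 0%N (insub k)) KN).
- by apply: eq_Ex => w; apply: eq_bigr => k _; rewrite valK.
- by move=> k kK; rewrite insubT /= ltn_ord.
- move=> k k' kK k'K; rewrite !insubT /= => /val_inj /fi.
  by move/(congr1 val).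
Qed.

Lemma product_limit K (ls : nat -> nat) : (forall k, (k < K)%N -> (1 <= ls k)%N) ->
  (fun N => fine (P [set w | forall k, (k < K)%N -> (ls k <= XqT N k w)%N]))
    @ \oo --> \prod_(k < K) Z (ls k) T 0.
Proof.
move=> l1; pose p N := Ex P (fun w => \prod_(k < K) (ls k <= XqT N k w)%N%:R).
have -> : (fun N => fine (P [set w | forall k, (k < K)%N -> (ls k <= XqT N k w)%N])) = p.
  apply/funext => N; pose b w := [forall k : 'I_K, (ls k <= XqT N k w)%N].
  have bE : [set w | forall k, (k < K)%N -> (ls k <= XqT N k w)%N] = [set w | b w].
    apply/seteqP; split=> w /= h; first by apply/forallP => k; exact: h.
    by move=> k kK; exact: (forallP h (Ordinal kK)).
  have eb w : (b w)%:R = \prod_(k < K) (ls k <= XqT N k w)%N%:R :> R.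
    rewrite /b; case: (boolP [forall k : 'I_K, _]) => [/forallP h|].
      by rewrite big1 // => k _; rewrite h.
    by rewrite negb_forall => /existsP[k nk]; rewrite (bigD1 k) //= (negbTE nk) mul0r.
  rewrite /p; under eq_Ex do rewrite -eb; rewrite bE Ex_bool //.
  apply: measurable_bool; rewrite -bE [X in measurable X](_ : _ =
      \bigcap_(k in [set k | (k < K)%N]) [set w | (ls k <= XqT N k w)%N]).
    apply: bigcap_measurableType => k _; apply: bool_measurable.
    by apply: measurable_fun_leq; [exact: measurable_cst|exact: (mf_Xq (net N) T0)].
  by apply/seteqP; split=> w /= h k; exact: h.
have Z1 k : (k < K)%N -> `|Z (ls k) T 0| <= 1.
  by move=> kK; apply: (Z_le1 hs) => //; exact: l1.
(* The first summand pays for repeated servers, the second for replacing the fractions by their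
   limits. *)
pose err N : R := (1 - (1 - K%:R * N%:R^-1) ^+ K) +
  \sum_(k < K) Ex P (fun w => `|frac N (ls k) w - Z (ls k) T 0|).
have err0 : err @ \oo --> (0 : R).
  have i0 : (fun N => N%:R^-1 : R) @ \oo --> (0 : R).
    apply/gtr0_cvgV0; last exact: cvgr_idn.
    by exists 1%N => // n /=; rewrite ltr0n.
  have c1 : (fun N => 1 - (1 - K%:R * N%:R^-1) ^+ K : R) @ \oo --> (1 - (1 - K%:R * 0) ^+ K : R).
    apply: cvgB; first exact: cvg_cst.
    have c : (fun N => 1 - K%:R * N%:R^-1 : R) @ \oo --> (1 - K%:R * 0 : R).
      by apply: cvgB; [exact: cvg_cst|apply: cvgM => //; exact: cvg_cst].
    exact: (cvg_comp _ _ c (@exprn_continuous R K _)).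
  have c2 := cvg_sum0 (F := fun k N => Ex P (fun w => `|frac N (ls k) w - Z (ls k) T 0|))
    (fun k kK => frac_cvg (l1 k kK)).
  have := cvgD c1 c2; rewrite mulr0 subr0 expr1n subrr addr0; exact.
apply/cvgrPdist_le => ep ep0; near=> N.
have N0 : (0 < N)%N by near: N; exists 1%N.
have KN : (K <= N)%N by near: N; exists K.
apply: (@le_trans _ _ (err N)).
  rewrite distrC; set z := \prod_(_ < _) _.
  have -> : p N - z = - (Ex P (fun w => \prod_(k < K) frac N (ls k) w) - p N) +
      (Ex P (fun w => \prod_(k < K) frac N (ls k) w) - z) by ring.
  apply: le_trans (ler_normD _ _) _; rewrite normrN lerD ?Ex_prod_frac //.
  have bp : bm (fun w => \prod_(k < K) frac N (ls k) w) by apply: bm_prod => k _; exact: bfrac.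
  rewrite -{1}[z](Ex_cst P) -ExB //; last exact: bm_cst.
  apply: le_trans (Ex_norm P (bmB bp (bm_cst _ _))) _.
  rewrite -Ex_sum; last by move=> k _; exact: bm_norm (bmB (bfrac _ _) (bm_cst _ _)).
  apply: le_Ex => [||w]; first exact: bm_norm (bmB bp (bm_cst _ _)).
    by apply: bm_sum => k _; exact: bm_norm (bmB (bfrac _ _) (bm_cst _ _)).
  by apply: prod_dist => k; [exact: frac01|exact: Z1].
apply: le_trans (ler_norm _) _; near: N.
have /cvgrPdist_le/(_ ep ep0) := err0; apply: filterS => N.
by rewrite sub0r normrN.
Unshelve. all: by end_near. Qed.

End ProductLimit.

Theorem theorem4p3 (R : realType) (d : measure_display) (Omega : measurableType d)
  (P : probability Omega R)
  (G g : R -> R) (H : R) (lam : R -> R) (aN : nat -> R)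
  (X0 : nat -> nat -> Omega -> nat) (A0 Res : nat -> nat -> Omega -> R)
  (W : nat -> nat -> nat -> Omega -> R) (E : nat -> R -> Omega -> nat)
  (V : nat -> nat -> Omega -> R) (C1 C2 : nat -> nat -> Omega -> nat)
  (Bt : nat -> nat -> Omega -> bool)
  (Z0 : nat -> R -> R) (Z : nat -> R -> R -> R) :
  service_assumption G g H ->
  arrival_assumption lam aN ->
  (forall N, sq2_network P X0 A0 Res W E V C1 C2 Bt G lam aN N) ->
  init_assumption_a P X0 A0 ->
  (* Z0_l(r) = lim_N \bar Z^{(N)}_l(0, r) (almost surely, deterministic limit) *)
  {ae P, forall w, forall l r, (1 <= l)%N -> 0 <= r ->
      (fun N => Zbar0 X0 A0 G N l r w) @ \oo --> Z0 l r} ->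
  (* Z is the unique solution of the hydrodynamic PDE associated to (lam, Z0) *)
  hydro_sol lam (fun x => 1 - G x) Z0 Z ->
  (forall Z', hydro_sol lam (fun x => 1 - G x) Z0 Z' ->
     forall l t r, (1 <= l)%N -> 0 <= t -> 0 <= r -> Z' l t r = Z l t r) ->
  (forall l t, (1 <= l)%N -> 0 <= t ->
     (fun N => fine (P [set w | (l <= Xq X0 A0 Res W E V C1 C2 Bt N 0 t w)%N]))
       @ \oo --> Z l t 0)
  /\
  (forall t (K : nat) (ls : nat -> nat), 0 <= t -> (1 <= K)%N ->
     (forall k, (k < K)%N -> (1 <= ls k)%N) ->
     (fun N => fine (P [set w | forall k, (k < K)%N ->
                          (ls k <= Xq X0 A0 Res W E V C1 C2 Bt N k t w)%N]))
       @ \oo --> \prod_(k < K) Z (ls k) t 0).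
Proof.
move=> sa arr net init Zlim hs _.
have lim t K ls (t0 : 0 <= t) (hl : forall k, (k < K)%N -> (1 <= ls k)%N) :=
  product_limit sa arr net init Zlim hs t0 hl.
split=> [l t l0 t0|t K ls t0 _ hl]; last exact: lim.
have := lim t 1%N (fun=> l) t0 (fun _ _ => l0); rewrite big_ord1.
have e N : [set w | forall k, (k < 1)%N -> (l <= Xq X0 A0 Res W E V C1 C2 Bt N k t w)%N] =
    [set w | (l <= Xq X0 A0 Res W E V C1 C2 Bt N 0 t w)%N].
  by apply/seteqP; split=> w /= => [|h [|k]] //; apply.
by under eq_fun do rewrite e.
Qed.
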